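(* Let $(\mathbf X,\mathbf B)$ be a weak solution of the ISDE (defined in the context) on $(\Omega,\mathcal F,P,\{\mathcal F_t\})$. Assume that for every $m\in\mathbb N$: (i) (non-exit) $P\big(\lim_{n\to\infty}\varsigma_n(\mathbf X^m,\mathfrak X^{m*})=\infty\big)=1$. (ii) (local Lipschitz bound) $\mathfrak u(\mathfrak H[\mathbf a])\subset\mathfrak S_{\mathrm{sde}}$, and for each $n=(p,q,r)\in\mathbb N^3$ and $T\in\mathbb N$ there is a function $\widetilde F_{n,T}$ on $S^m\times\mathfrak S$ such that for each $f\in\{\sigma^m,b^m\}$, $P$-a.s., $$|f(\mathbf x,\mathfrak X_t^{m*})-f(\mathbf y,\mathfrak X_t^{m*})|\le|\mathbf x-\mathbf y|\,\widetilde F_{n,T}(\mathbf x,\mathfrak X_t^{m*})$$ for all $0\le t\le T$ and all $\mathbf x,\mathbf y$ with $(\mathbf x,\mathfrak X_t^{m*}),(\mathbf y,\mathfrak X_t^{m*})\in\mathfrak H[\mathbf a]_n^\circ$ and $(\mathbf x,\mathfrak X_t^{m*})\sim_n(\mathbf y,\mathfrak X_t^{m*})$. (iii) $\sigma^m$ is a constant function and, for each $n\in\mathbb N^3$ and $T\in\mathbb N$, for some exponent $\gamma>1$, $$E\Big[\int_0^T1_{\mathfrak H[\mathbf a]_n^\circ}(\mathbf X_t^m,\mathfrak X_t^{m*})\,\big|\widetilde F_{n,T}(\mathbf X_t^m,\mathfrak X_t^{m*})\big|^{\gamma}dt\Big]<\infty .$$ Then $(\mathbf X,\mathbf B)$ satisfies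 the IFC condition: for $P\circ\mathbf X_0^{-1}$-a.s. $\mathbf s$ and for all $m\in\mathbb N$, the finite-dimensional SDE with random environment (defined in the context) has a unique strong solution $F_{\mathbf s}^m(\mathbf B^m,\mathbf X^{m*})$ for $(\mathbf X,\mathbf B)$ under $P_{\mathbf s}=P(\,\cdot\,|\,\mathbf X_0=\mathbf s)$.
   Context: Configurations. Let $d\in\mathbb N$ and let $S\subset\mathbb R^d$ be a closed set whose interior is connected, is dense in $S$, and with $\partial S$ Lebesgue-null. $S_r=\{x\in S:|x|<r\}$, $\overline S_r=\{x\in S:|x|\le r\}$. $\mathfrak S$ is the configuration space: measures $\mathfrak s=\sum_i\delta_{s_i}$ on $S$ with $\mathfrak s(K)<\infty$ for all compact $K\subset S$, with the vague topology. $\mathfrak S_{\mathrm s}=\{\mathfrak s:\mathfrak s(\{x\})\le1\ \forall x\in S\}$, $\mathfrak S_{\mathrm i}=\{\mathfrak s:\mathfrak s(S)=\infty\}$, $\mathfrak S_{\mathrm{s,i}}=\mathfrak S_{\mathrm s}\cap\mathfrak S_{\mathrm i}$. $\mathfrak u((s_i)_i)=\sum_i\delta_{s_i}$ and $\mathfrak u(\mathbf x,\mathfrak s)=\mathfrak u(\mathbf x)+\mathfrak s$. A label is a measurable map $\mathfrak l:\mathfrak S_{\mathrm{s,i}}\to S^{\mathbb N}$ with $\mathfrak u\circ\mathfrak l=\mathrm{id}$. $W(A)=C([0,\infty);A)$. ISDE. Let $\mathfrak H\subset\mathfrak S_{\mathrm{sde}}\subset\mathfrak S_{\mathrm i}$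 be Borel, $\mathfrak S_{\mathrm{sde}}^{[1]}=\{(x,\mathfrak s)\in S\times\mathfrak S:\delta_x+\mathfrak s\in\mathfrak S_{\mathrm{sde}}\}$, $\mathbf S_{\mathrm{sde}}=\mathfrak u^{-1}(\mathfrak S_{\mathrm{sde}})\subset S^{\mathbb N}$, and $\sigma:\mathfrak S_{\mathrm{sde}}^{[1]}\to\mathbb R^{d^2}$, $b:\mathfrak S_{\mathrm{sde}}^{[1]}\to\mathbb R^d$ Borel. The ISDE is $$dX_t^i=\sigma(X_t^i,\mathfrak X_t^{i\diamondsuit})dB_t^i+b(X_t^i,\mathfrak X_t^{i\diamondsuit})dt\ (i\in\mathbb N),\quad\mathbf X\in W(\mathbf S_{\mathrm{sde}}),\quad\mathbf X_0\in\mathfrak l(\mathfrak H),$$ where $\mathfrak X_t=\sum_i\delta_{X_t^i}$, $\mathfrak X_t^{i\diamondsuit}=\sum_{j\ne i}\delta_{X_t^j}$. A weak solution is a pair $(\mathbf X,\mathbf B)$ on a filtered probability space such that $\mathbf X=(X^i)_{i\in\mathbb N}$ is adapted and continuous, $\mathbf B=(B^i)_{i\in\mathbb N}$ is an $(\mathbb R^d)^{\mathbb N}$-valued Brownian motion for the filtration with $\mathbf B_0=\mathbf 0$, for all $i,T$ $E\int_0^T|\sigma(X_t^i,\mathfrak X_t^{i\diamondsuit})|^2dt<\infty$ and $E\int_0^T|b(X_t^i,\mathfrak X_t^{i\diamondsuit})|dt<\infty$, and, a.s., $\mathbf X\in W(\mathbf S_{\mathrm{sde}})$, $\mathbf X_0\in\mathfrak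 l(\mathfrak H)$ and $X_t^i-X_0^i=\int_0^t\sigma(X_u^i,\mathfrak X_u^{i\diamondsuit})dB_u^i+\int_0^tb(X_u^i,\mathfrak X_u^{i\diamondsuit})du$ for all $t\ge0$ and $i\in\mathbb N$. Set $\mathbf X^m=(X^1,\dots,X^m)$, $\mathbf X^{m*}=(X^i)_{i>m}$, $\mathbf B^m=(B^1,\dots,B^m)$, $\mathfrak X_t^{m*}=\sum_{j>m}\delta_{X_t^j}$. Finite-dimensional SDE. For $\mathbf y=(y_1,\dots,y_m)$ put $\sigma^m(\mathbf y,\mathfrak s)=(\sigma(y_i,\sum_{j\ne i}\delta_{y_j}+\mathfrak s))_{i=1}^m$, $b^m(\mathbf y,\mathfrak s)=(b(y_i,\sum_{j\ne i}\delta_{y_j}+\mathfrak s))_{i=1}^m$. On $(\Omega,\mathcal F,P_{\mathbf s},\{\mathcal F_t\})$, the SDE with random environment is the equation for $\mathbf Y^m=(Y^{m,i})_{i=1}^m$ $$\mathbf Y_t^m-\mathbf Y_0^m=\int_0^t\sigma^m(\mathbf Y_u^m,\mathfrak X_u^{m*})d\mathbf B_u^m+\int_0^tb^m(\mathbf Y_u^m,\mathfrak X_u^{m*})du,\quad \mathfrak u(\mathbf Y_t^m)+\mathfrak X_t^{m*}\in\mathfrak S_{\mathrm{sde}}\ \forall t,\quad\mathbf Y_0^m=\mathbf s^m,$$ where $\mathbf s^m=(s_1,\dots,s_m)$ for $\mathbf s=(s_i)_i$; a weak solution is a triple $(\mathbf Y^m,\mathbf B^m,\mathbf X^{m*})$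 of $\{\mathcal F_t\}$-adapted continuous processes satisfying this. Strong solutions. Fix $o\in S$ and let $\mathbf X^{m\circ*}=(o,\dots,o,X^{m+1},X^{m+2},\dots)$ (first $m$ components constant paths $o$); write $F(\mathbf B^m,\mathbf X^{m*}):=F(\mathbf B^m,\mathbf X^{m\circ*})$. Let $W_{\mathbf 0}(\mathbb R^{dm})=\{\mathbf v\in W(\mathbb R^{dm}):\mathbf v_0=\mathbf 0\}$, $\widetilde P^m=P_{\mathbf s}\circ(\mathbf B^m,\mathbf X^{m\circ*})^{-1}$, let $\mathcal C^m$ be the $\widetilde P^m$-completion of the Borel $\sigma$-field of $W_{\mathbf 0}(\mathbb R^{dm})\times W((\mathbb R^{d})^{\mathbb N})$, $\mathcal C_t^m$ the $\widetilde P^m$-completion of $\sigma[(\mathbf v_s,\mathbf w_s):0\le s\le t]$, and $\mathcal B_t^m=\sigma[\mathbf w_s:0\le s\le t]$ on $W(\mathbb R^{dm})$. A weak solution $(\mathbf Y^m,\mathbf B^m,\mathbf X^{m*})$ is a strong solution if there is $F_{\mathbf s}^m:W_{\mathbf 0}(\mathbb R^{dm})\times W((\mathbb R^{d})^{\mathbb N})\to W(\mathbb R^{dm})$ which is $\mathcal C^m$-measurable, $\mathcal C_t^m/\mathcal B_t^m$-measurable for all $t$, with $\mathbf Y^m=F_{\mathbf s}^m(\mathbf B^m,\mathbf X^{m*})$ $P_{\mathbf s}$-a.s. The SDE has a unique strong solution $F^m_{\mathbf s}$ for $(\mathbf X,\mathbf B)$ under $P_{\mathbf s}$ if there is one function $F_{\mathbf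 s}^m$ with these properties such that $\hat{\mathbf Y}^m=F_{\mathbf s}^m(\mathbf B^m,\mathbf X^{m*})$ a.s. for every weak solution $(\hat{\mathbf Y}^m,\mathbf B^m,\mathbf X^{m*})$ on $(\Omega,\mathcal F,P_{\mathbf s},\{\mathcal F_t\})$. Tame sets (for each $m$). Fix $\mathbf a=\{a_q\}_{q\in\mathbb N}$, $a_q=\{a_q(R)\}_{R\in\mathbb N}$ natural numbers with $a_q(R)<a_q(R+1)$, $a_q(R)<a_{q+1}(R)$. For a sequence $c=\{c(R)\}$ set $\mathcal K[c]=\{\mathfrak s\in\mathfrak S:\mathfrak s(\overline S_R)\le c(R)\ \forall R\in\mathbb N\}$; let $a_q^+(R)=1+a_q(R+1)$. Let $\mathfrak S_{\mathrm{s,i}}^{[m]}=\{(\mathbf x,\mathfrak s)\in S^m\times\mathfrak S:\mathfrak u(\mathbf x)+\mathfrak s\in\mathfrak S_{\mathrm{s,i}}\}$. For $\mathfrak s=\sum_i\delta_{s_i}$, $S^m_{p,r}(\mathfrak s)=\{\mathbf x\in S_r^m:\inf_{j\ne k}|x_j-x_k|>2^{-p},\ \inf_{l,i}|x_l-s_i|>2^{-p}\}$, $\overline S^m_{p,r}(\mathfrak s)=\{\mathbf x\in\overline S_r^m:\min_{j\ne k}|x_j-x_k|\ge2^{-p},\ \inf_{l,i}|x_l-s_i|\ge2^{-p}\}$. For $n=(p,q,r)\in\mathbb N^3$, $\mathfrak H[\mathbf a]_n^\circ=\{(\mathbf x,\mathfrak s)\in\mathfrak S_{\mathrm{s,i}}^{[m]}:\mathbf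 x\in S^m_{p,r}(\mathfrak s),\mathfrak s\in\mathcal K[a_q^+]\}$, $\mathfrak H[\mathbf a]_n=\{(\mathbf x,\mathfrak s)\in\mathfrak S_{\mathrm{s,i}}^{[m]}:\mathbf x\in\overline S^m_{p,r}(\mathfrak s),\mathfrak s\in\mathcal K[a_q^+]\}$, and $\mathfrak H[\mathbf a]=\bigcup_r\bigcup_q\bigcup_p\mathfrak H[\mathbf a]_{p,q,r}^\circ$. Write $(\mathbf x,\mathfrak s)\sim_n(\mathbf y,\mathfrak s)$ if $\mathbf x,\mathbf y$ lie in the same connected component of $S^m_{p,r}(\mathfrak s)$ and $\mathfrak s\in\Pi_2(\mathfrak H[\mathbf a]_n)$, $\Pi_2(\mathbf x,\mathfrak s)=\mathfrak s$. For a path $(\mathbf u,\mathfrak v)$ in $S^m\times\mathfrak S$, $\varsigma_n(\mathbf u,\mathfrak v)=\inf\{t>0:(\mathbf u,\mathfrak v)_t\notin\mathfrak H[\mathbf a]_n^\circ\}$. $\lim_{n\to\infty}:=\lim_{r\to\infty}\lim_{q\to\infty}\lim_{p\to\infty}$. *)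

(* Defs.v *)
From HB Require Import structures.
From mathcomp Require Import all_boot all_order all_algebra.
From mathcomp Require Import all_classical all_reals all_analysis.

Set Implicit Arguments.
Unset Strict Implicit.
Unset Printing Implicit Defensive.

Import Order.TTheory GRing.Theory Num.Theory.
Import numFieldNormedType.Exports.

Local Open Scope classical_set_scope.
Local Open Scope ring_scope.

(* Indices: the particles, numbered 1, 2, ... in the mathematics, are numbered
   0, 1, ... here, so X^m consists of the X^i with i < m and X^{m*} of those
   with m <= i.  The parameters m, p, q, r, T range over positive integers;
   this is imposed by hypotheses. *)

Definition borel (T : ptopologicalType) := g_sigma_algebraType (@open T).

Section euclidean.
Context {R : realType}.

(* The library norm on matrices is the sup norm. *)
Definition enorm {m n : nat} (x : 'M[R]_(m, n)) : R :=
  Num.sqrt (\sum_i \sum_j x i j ^+ 2).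

Definition fam_norm {m k l : nat} (f : 'I_m -> 'M[R]_(k, l)) : R :=
  Num.sqrt (\sum_i enorm (f i) ^+ 2).

(* Null sets of d-dimensional Lebesgue measure, by coverings with boxes. *)
Definition lebesgue_null {d : nat} (N : set 'rV[R]_d) : Prop :=
  forall e : R, 0 < e -> exists lo hi : nat -> 'rV[R]_d,
    [/\ forall k i, lo k 0 i <= hi k 0 i,
        N `<=` \bigcup_k [set x | forall i, lo k 0 i <= x 0 i <= hi k 0 i] &
        (\sum_(0 <= k <oo) (\prod_i (hi k 0 i - lo k 0 i))%:E <= e%:E)%E].

Definition admissible_domain {d : nat} (S : set 'rV[R]_d) : Prop :=
  [/\ closed S, connected S°, S `<=` closure S° &
      lebesgue_null (closure S `\` S°)].

End euclidean.

Section configurations.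
Context {R : realType} {d : nat}.

Definition cfg : Type := {measure set (borel 'rV[R]_d) -> \bar R}.

HB.instance Definition _ := gen_eqMixin cfg.
HB.instance Definition _ := gen_choiceMixin cfg.
HB.instance Definition _ := isPointed.Build cfg (@mzero _ (borel 'rV[R]_d) R).

Definition seqE := {ptws nat -> 'rV[R]_d}.
HB.instance Definition _ := Topological.on seqE.
HB.instance Definition _ := isPointed.Build seqE (fun=> 0).

Definition delta (x : option 'rV[R]_d) : cfg :=
  if x is Some y then @dirac _ (borel 'rV[R]_d) y R
  else @mzero _ (borel 'rV[R]_d) R.

(* A finite or infinite family of points is a sequence of optional points. *)
Definition point_measure (x : nat -> option 'rV[R]_d) : cfg :=
  mseries (fun i => delta (x i)) 0.

(* The point measure of the x_j with P j. *)
Definition unlabel (P : pred nat) (x : seqE) : cfg :=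
  point_measure (fun j => if P j then Some (x j) else None).

Definition unlabelm {m : nat} (y : 'M[R]_(m, d)) : cfg :=
  point_measure (fun j => omap (fun i : 'I_m => row i y) (insub j)).

(* The sum of the delta_{y_j} with j <> i. *)
Definition unlabelm_but {m : nat} (y : 'M[R]_(m, d)) (i : 'I_m) : cfg :=
  point_measure (fun j => if j == i then None else
    omap (fun k : 'I_m => row k y) (insub j)).

Definition cfg_add (s t : cfg) : cfg := measure_add s t.

Definition firstm (m : nat) (x : seqE) : 'M[R]_(m, d) := \matrix_(i < m) x i.

Section domain.
Variable S : set 'rV[R]_d.

Definition config : set cfg :=
  [set s | (exists x : nat -> option 'rV[R]_d,
             (forall i y, x i = Some y -> S y) /\ s = point_measure x) /\
           (forall K : set 'rV[R]_d, compact K -> K `<=` S -> (s K < +oo)%E)].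

Definition config_simple : set cfg :=
  config `&` [set s : cfg | forall x, S x -> (s [set x] <= 1)%E].

Definition config_infinite : set cfg := config `&` [set s : cfg | s S = +oo%E].

Definition config_si : set cfg := config_simple `&` config_infinite.

Definition Cc : set ('rV[R]_d -> R) :=
  [set f | {within S, continuous f} /\
    exists K, [/\ compact K, K `<=` S & forall x, S x -> ~ K x -> f x = 0]].

Definition vague_eval (s : cfg) : {ptws set_type Cc -> R} :=
  fun f => (\int[s]_(x in S) (set_val f : borel 'rV[R]_d -> R) x)%R.

Definition vague_open : set (set cfg) :=
  [set config `&` U | U in @open (initial_topology vague_eval)].

(* The measurable subsets of config are the Borel sets of the vague topology. *)
Definition cfgM := g_sigma_algebraType vague_open.

(* For a set A of configurations, the pairs (x, s) in S^m * config with
   u(x) + s in A. *)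
Definition extend (m : nat) (A : set cfg) : set ('M[R]_(m, d) * cfg) :=
  [set p | [/\ forall i, S (row i p.1), config p.2 &
               A (cfg_add (unlabelm p.1) p.2)]].
Arguments extend : clear implicits.

Definition label (l : cfg -> seqE) : Prop :=
  measurable_fun (config_si : set cfgM) (l : cfgM -> borel seqE) /\
  forall s, config_si s -> (forall i, S (l s i)) /\ unlabel predT (l s) = s.

(* Coefficients are total functions, of which only the values on
   extend 1 A are used. *)
Definition borel_coef {k n : nat} (A : set cfg)
    (f : 'rV[R]_d -> cfg -> 'M[R]_(k, n)) : Prop :=
  measurable_fun (extend 1 A : set (borel 'rV[R]_d * cfgM))
    (fun p => f p.1 p.2 : borel 'M[R]_(k, n)).

Section tame.
Variable m : nat.

Definition atoms (s : cfg) : set 'rV[R]_d := [set z | s [set z] != 0%E].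

Definition pair_dists (x : 'M[R]_(m, d)) : set (\bar R) :=
  [set e | exists j k : 'I_m, j != k /\ e = (enorm (row j x - row k x))%:E].

Definition env_dists (x : 'M[R]_(m, d)) (s : cfg) : set (\bar R) :=
  [set e | exists (l : 'I_m) z, atoms s z /\ e = (enorm (row l x - z))%:E].

Definition Spr_open (p r : nat) (s : cfg) : set 'M[R]_(m, d) :=
  [set x | [/\ forall i, S (row i x) /\ enorm (row i x) < r%:R,
               ((2 ^- p)%:E < ereal_inf (pair_dists x))%E &
               ((2 ^- p)%:E < ereal_inf (env_dists x s))%E]].

Definition Spr_closed (p r : nat) (s : cfg) : set 'M[R]_(m, d) :=
  [set x | [/\ forall i, S (row i x) /\ enorm (row i x) <= r%:R,
               ((2 ^- p)%:E <= ereal_inf (pair_dists x))%E &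
               ((2 ^- p)%:E <= ereal_inf (env_dists x s))%E]].

Definition Kset (c : nat -> nat) : set cfg :=
  config `&` [set s : cfg | forall r : nat, (0 < r)%N ->
    (s (S `&` [set x : 'rV[R]_d | (enorm x <= r%:R)%R]) <= (c r)%:R%:E)%E].

Variable a : nat -> nat -> nat.

Definition aplus (q r : nat) : nat := (1 + a q r.+1)%N.

Definition Hopen (p q r : nat) : set ('M[R]_(m, d) * cfg) :=
  extend m config_si `&`
  [set xs | Spr_open p r xs.2 xs.1 /\ Kset (aplus q) xs.2].

Definition Hclosed (p q r : nat) : set ('M[R]_(m, d) * cfg) :=
  extend m config_si `&`
  [set xs | Spr_closed p r xs.2 xs.1 /\ Kset (aplus q) xs.2].

Definition Hall : set ('M[R]_(m, d) * cfg) :=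
  [set xs | exists p q r, [/\ (0 < p)%N, (0 < q)%N, (0 < r)%N &
                              Hopen p q r xs]].

(* The relation (x, s) ~_n (y, s). *)
Definition simn (p q r : nat) (s : cfg) (x y : 'M[R]_(m, d)) : Prop :=
  connected_component (Spr_open p r s) x y /\ (snd @` Hclosed p q r) s.

Definition exit_time (p q r : nat) (w : R -> 'M[R]_(m, d) * cfg) : \bar R :=
  ereal_inf [set t%:E | t in [set t | 0 < t /\ ~ Hopen p q r (w t)]].

(* The exit times increase with each of p, q, r, so that the limits exist. *)
Definition lim_exit_time (w : R -> 'M[R]_(m, d) * cfg) : \bar R :=
  limn (fun r => limn (fun q => limn (fun p => exit_time p q r w))).

End tame.
End domain.

Definition tame_seq (a : nat -> nat -> nat) : Prop :=
  forall q r : nat, (0 < q)%N -> (0 < r)%N ->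
    [/\ (0 < a q r)%N, (a q r < a q r.+1)%N & (a q r < a q.+1 r)%N].

(* f^m(y, s), for f a coefficient. *)
Definition coefm {k n m : nat} (f : 'rV[R]_d -> cfg -> 'M[R]_(k, n))
    (y : 'M[R]_(m, d)) (s : cfg) : 'I_m -> 'M[R]_(k, n) :=
  fun i => f (row i y) (cfg_add (unlabelm_but y i) s).

End configurations.
Arguments cfg R d : clear implicits.
Arguments seqE R d : clear implicits.

Section processes.
Context {R : realType} {dO : measure_display} {Omega : measurableType dO}.

(* Processes are functions of a real time, of which only the values at times
   t >= 0 are used; their paths are functions on [0, oo[. *)
Definition time : Type := set_type (`[0, +oo[%classic : set R).
HB.instance Definition _ := Topological.on time.

Definition is_filtration (F : R -> set (set Omega)) : Prop :=
  (forall t, 0 <= t -> sigma_algebra setT (F t) /\ F t `<=` measurable) /\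
  (forall s t, 0 <= s -> s <= t -> F s `<=` F t).

Definition path_of {A : Type} (Z : R -> Omega -> A) (w : Omega) : time -> A :=
  fun t => Z (set_val t) w.

Definition adapted {A : ptopologicalType} (F : R -> set (set Omega))
    (Z : R -> Omega -> A) : Prop :=
  forall t, 0 <= t -> forall U : set (borel A), measurable U ->
    F t (Z t @^-1` U).

Definition continuous_process {A : topologicalType} (Z : R -> Omega -> A) :=
  forall w, continuous (path_of Z w).

Definition brownian {d : nat} (P : set Omega -> \bar R)
    (F : R -> set (set Omega)) (B : R -> Omega -> seqE R d) : Prop :=
  [/\ adapted F B, continuous_process B,
      {ae P, forall w, forall i, B 0 w i = 0} &
      forall s t, 0 <= s -> s < t -> forall A, F s A ->
      forall (N : nat) (C : 'I_N -> 'I_d -> set R),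
        (forall i k, measurable (C i k)) ->
        P (A `&` [set w | forall i k,
                     C i k ((B t w i - B s w i) 0 k)]) =
        (P A * \prod_i \prod_k normal_prob 0 (Num.sqrt (t - s)) (C i k))%E].

(* Convergence to 0 in probability.  The outer measure spares measurability
   conditions; on measurable sets it is P. *)
Definition cvg0_in_prob (P : set Omega -> \bar R)
    (Z : nat -> Omega -> \bar R) : Prop :=
  forall e : R, 0 < e ->
    (fun n => mu_ext P [set w | (e%:E <= Z n w)%E]) @ \oo --> 0%E.

Section ito.
Context {d : nat}.

(* The process sum_j xi_j 1_{]t_j, t_{j+1}]}, j < n. *)
Record simple_process := SimpleProcess {
  sp_size : nat;
  sp_time : nat -> R;
  sp_val : nat -> Omega -> 'M[R]_d }.

Definition sp_adapted (G : R -> set (set Omega)) (h : simple_process) : Prop :=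
  [/\ 0 <= sp_time h 0,
      forall j, (j < sp_size h)%N -> sp_time h j <= sp_time h j.+1,
      forall j, (j < sp_size h)%N ->
        exists c : R, forall w, enorm (sp_val h j w) <= c &
      forall j, (j < sp_size h)%N -> forall U : set (borel 'M[R]_d),
        measurable U -> G (sp_time h j) (sp_val h j @^-1` U)].

Definition sp_eval (h : simple_process) (t : R) (w : Omega) : 'M[R]_d :=
  \sum_(j < sp_size h | sp_time h j < t <= sp_time h j.+1) sp_val h j w.

(* Vectors are rows, so that the column vector sigma dB is dB *m sigma^T. *)
Definition sp_int (h : simple_process) (B : R -> Omega -> 'rV[R]_d)
    (t : R) (w : Omega) : 'rV[R]_d :=
  \sum_(j < sp_size h)
    (B (Num.min t (sp_time h j.+1)) w - B (Num.min t (sp_time h j)) w)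
      *m (sp_val h j w)^T.

Definition joint_natural_filtration (H : R -> Omega -> 'M[R]_d)
    (B : R -> Omega -> 'rV[R]_d) (t : R) : set (set Omega) :=
  <<s [set A | exists2 s, 0 <= s <= t &
         (exists2 U : set (borel 'M[R]_d), measurable U & A = H s @^-1` U) \/
         (exists2 U : set (borel 'rV[R]_d), measurable U & A = B s @^-1` U)] >>.

(* I is the Ito integral of H (locally square integrable) with respect to B:
   the locally uniform limit in probability of the integrals of simple
   processes that converge to H in L^2([0, T], dt), in probability.
   The Ito integral does not depend on the filtration, as long as H is adapted
   and B is a Brownian motion for it; the smallest one is used because, for a
   conditional law P(. | X_0 = s), B need not be a Brownian motion for the
   given filtration F_t if that contains all the P-null sets: {X_0 = s} may be
   one of them. *)
Definition ito_integral (P : set Omega -> \bar R) (B : R -> Omega -> 'rV[R]_d)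
    (H : R -> Omega -> 'M[R]_d) (I : R -> Omega -> 'rV[R]_d) : Prop :=
  exists h : nat -> simple_process,
    (forall n, sp_adapted (joint_natural_filtration H B) (h n)) /\
    forall T : R, 0 <= T ->
      cvg0_in_prob P (fun n w =>
        \int[lebesgue_measure]_(t in `[0%R, T])
          ((enorm (sp_eval (h n) t w - H t w) ^+ 2)%R)%:E)%E /\
      cvg0_in_prob P (fun n w =>
        ereal_sup [set (enorm (sp_int (h n) B t w - I t w))%:E
                  | t in `[0, T]%classic]).

(* Z_t - Z_0 = int_0^t H dB + int_0^t K du for all t, almost surely, where the
   integrals make sense. *)
Definition ito_equation (P : set Omega -> \bar R)
    (Z B : R -> Omega -> 'rV[R]_d)
    (H : R -> Omega -> 'M[R]_d) (K : R -> Omega -> 'rV[R]_d) : Prop :=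
  {ae P, forall w, forall T : R, 0 <= T ->
     (\int[lebesgue_measure]_(t in `[0%R, T]) ((enorm (H t w) ^+ 2)%R)%:E < +oo)%E /\
     (forall k, lebesgue_measure.-integrable `[0, T]
        (fun t => (K t w 0 k)%:E))} /\
  exists I : R -> Omega -> 'rV[R]_d, ito_integral P B H I /\
    {ae P, forall w, forall t : R, 0 <= t ->
       Z t w - Z 0 w = I t w +
         \row_k (\int[lebesgue_measure]_(u in `[0, t]) K u w 0 k)%R}.

End ito.

Section equations.
Context {d : nat}.
Variables (sigma : 'rV[R]_d -> cfg R d -> 'M[R]_d)
          (b : 'rV[R]_d -> cfg R d -> 'rV[R]_d).
Variable Ssde : set (cfg R d).

Definition but (i : nat) : pred nat := fun j => j != i.
Definition from (m : nat) : pred nat := fun j => (m <= j)%N.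

(* The image of H under l is that of its elements in the domain of l. *)
Record isde_weak_solution (S : set 'rV[R]_d) (l : cfg R d -> seqE R d)
    (H : set (cfg R d)) (P : set Omega -> \bar R) (F : R -> set (set Omega))
    (X B : R -> Omega -> seqE R d) : Prop := {
  isde_adapted : adapted F X;
  isde_continuous : continuous_process X;
  isde_brownian : brownian P F B;
  isde_moments : forall (i : nat) (T : R), 0 < T ->
    (\int[P]_w \int[lebesgue_measure]_(t in `[0%R, T])
       ((enorm (sigma (X t w i) (unlabel (but i) (X t w))) ^+ 2)%R)%:E < +oo)%E /\
    (\int[P]_w \int[lebesgue_measure]_(t in `[0%R, T])
       (enorm (b (X t w i) (unlabel (but i) (X t w))))%:E < +oo)%E;
  isde_state : {ae P, forall w, forall t : R, 0 <= t ->
    (forall i, S (X t w i)) /\ Ssde (unlabel predT (X t w))};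
  isde_init : {ae P, forall w, (l @` (H `&` config_si S)) (X 0 w)};
  isde_equation : forall i : nat,
    ito_equation P (fun t w => X t w i) (fun t w => B t w i)
      (fun t w => sigma (X t w i) (unlabel (but i) (X t w)))
      (fun t w => b (X t w i) (unlabel (but i) (X t w))) }.

Section finite_dimensional.
Variables (P : set Omega -> \bar R) (F : R -> set (set Omega)).
Variables (X B : R -> Omega -> seqE R d) (m : nat) (s : seqE R d).

Definition env (t : R) (w : Omega) : cfg R d := unlabel (from m) (X t w).

(* (Y, B^m, X^{m*}) is a weak solution; B^m and X^{m*} are given. *)
Definition fsde_weak_solution (Y : R -> Omega -> 'M[R]_(m, d)) : Prop :=
  [/\ adapted F Y, continuous_process Y,
      forall i : 'I_m,
        ito_equation P (fun t w => row i (Y t w)) (fun t w => B t w i)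
          (fun t w => coefm sigma (Y t w) (env t w) i)
          (fun t w => coefm b (Y t w) (env t w) i),
      {ae P, forall w, forall t : R, 0 <= t ->
         Ssde (cfg_add (unlabelm (Y t w)) (env t w))} &
      {ae P, forall w, Y 0 w = firstm m s}].

Local Notation pathm := {compact-open, time -> 'M[R]_(m, d)}.
Local Notation paths := {compact-open, time -> seqE R d}.

Definition Wm : set pathm := [set v | continuous (v : time -> 'M[R]_(m, d))].

(* W_0(R^{dm}) * W((R^d)^N) *)
Definition W0W : set (pathm * paths) :=
  [set vw | [/\ continuous (vw.1 : time -> 'M[R]_(m, d)),
                (forall t : time, set_val t = 0 :> R -> vw.1 t = 0) &
                continuous (vw.2 : time -> seqE R d)]].

Definition borel_on {T : topologicalType} (D : set T) : set (set T) :=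
  <<s D, [set D `&` U | U in open] >>.

Definition past_Wm (t : time) : set (set pathm) :=
  <<s Wm, [set A | exists (u : time) (U : set (borel 'M[R]_(m, d))),
      [/\ (set_val u : R) <= set_val t, measurable U &
          A = Wm `&` [set v : pathm | U (v u)]]] >>.

Definition past_W0W (t : time) : set (set (pathm * paths)) :=
  <<s W0W, [set A | exists (u : time)
      (U : set (borel 'M[R]_(m, d) * borel (seqE R d))),
      [/\ (set_val u : R) <= set_val t, measurable U &
          A = W0W `&` [set vw : pathm * paths | U (vw.1 u, vw.2 u)]]] >>.

Variable o : 'rV[R]_d.

(* (B^m, X^{m o *}) *)
Definition input (w : Omega) : pathm * paths :=
  (fun t : time => firstm m (B (set_val t) w),
   fun t : time => fun j => if (j < m)%N then o else X (set_val t) w j).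

Definition input_law (A : set (pathm * paths)) : \bar R := P (input @^-1` A).

(* The sets of G modified by null sets of the law of the input (null Borel
   sets of the whole path space, also if G is a smaller sigma-field). *)
Definition completed (G : set (set (pathm * paths))) :
    set (set (pathm * paths)) :=
  [set A | A `<=` W0W /\ exists C N,
    [/\ G C, borel_on W0W N, input_law N = 0%E & A `+` C `<=` N]].

Definition strong_functional (Fs : pathm * paths -> pathm) : Prop :=
  [/\ forall vw, W0W vw -> Wm (Fs vw),
      forall U, borel_on Wm U ->
        completed (borel_on W0W) (W0W `&` Fs @^-1` U) &
      forall t U, past_Wm t U ->
        completed (past_W0W t) (W0W `&` Fs @^-1` U)].

Definition represents (Fs : pathm * paths -> pathm)
    (Y : R -> Omega -> 'M[R]_(m, d)) : Prop :=
  {ae P, forall w, path_of Y w = Fs (input w)}.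

Definition fsde_strong_solution (Fs : pathm * paths -> pathm)
    (Y : R -> Omega -> 'M[R]_(m, d)) : Prop :=
  [/\ fsde_weak_solution Y, strong_functional Fs & represents Fs Y].

Definition unique_strong_solution : Prop :=
  exists Fs : pathm * paths -> pathm,
    (exists Y, fsde_strong_solution Fs Y) /\
    (forall Y, fsde_weak_solution Y -> represents Fs Y).

End finite_dimensional.

(* Ps is a regular version of P( . | X_0 = s). *)
Definition regular_conditional {d' : measure_display}
    {A : measurableType d'} (P : set Omega -> \bar R) (X0 : Omega -> A)
    (Ps : R.-pker A ~> Omega) : Prop :=
  forall (E : set Omega) (C : set A), measurable E -> measurable C ->
    P (E `&` X0 @^-1` C) = (\int[P]_(w in X0 @^-1` C) Ps (X0 w) E)%E.

Definition IFC (P : set Omega -> \bar R) (F : R -> set (set Omega))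
    (X B : R -> Omega -> seqE R d) (o : 'rV[R]_d)
    (Ps : R.-pker (borel (seqE R d)) ~> Omega) : Prop :=
  {ae pushforward P (X 0 : Omega -> borel (seqE R d)),
    forall s, forall m : nat, (0 < m)%N ->
      unique_strong_solution (Ps s) F X B m s o}.

End equations.
End processes.

(* Main.v *)
Require Import Defs.
From HB Require Import structures.
From mathcomp Require Import all_boot all_order all_algebra.
From mathcomp Require Import all_classical all_reals all_analysis.
From mathcomp Require Import measurable_realfun lra ring.

Set Implicit Arguments.
Unset Strict Implicit.
Unset Printing Implicit Defensive.

Import Order.TTheory GRing.Theory Num.Theory.
Import numFieldNormedType.Exports.

Local Open Scope classical_set_scope.
Local Open Scope ring_scope.

(** As [sigma] is constant, the noise term of the finite-dimensional equation is
    a fixed linear image of the Brownian path. Two solutions with the same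
    driving path and the same environment therefore differ by a difference of
    drift integrals, and Gronwall's inequality, with the time-integrable
    Lipschitz weight along the tame sets that the solution does not leave,
    gives pathwise uniqueness. Thus X^m at time t is the only value compatible
    with a Borel condition on the paths of (B^m, X^{m*}) up to time t. Events
    about X^m are then projections of Borel sets, whose complements are
    projections too; inner approximation of projections by compact ones makes
    them measurable for the completed sigma-field of the input, hence X^m is a
    strong solution. The Brownian property and the equation pass to the
    conditional law P_s through countably many rational events. *)


(** Two obstacles shape the proof. The conditional law [P_s] is determined only up to null sets of
    [s], so only countably many statements can be carried over to it, and [B] need not be a Brownian
    motion for the given filtration under it. What is carried over is the independence of single
    increments between dyadic times from rational cylinder events. This suffices for the one
    stochastic fact in use: whatever simple processes define it, the Ito integral of a constant [c]
    is [(B_t - B_0) c^T]. An L2 bound with the crude constant [secmom] in place of the isometry, and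
    a cut-off by energy, prove it; afterwards every argument concerns single paths. The Lipschitz
    bound compares only points in one component of a tame set with the environment frozen at one
    time, and a competing solution is not known to stay tame. Gronwall's inequality is therefore
    applied locally, right after the last time at which the two solutions agree; closeness to the
    common position gives both tameness and connectedness. Compactness is available because a path
    is coded by bits [r < x(k/2^n)], a point in a product of two-point spaces. *)

(** * Sequences of bits: closed sets, their projections, generated events *)

Section separation.
Context {Ev : countType}.
Implicit Types (c : Ev -> bool) (K : set (Ev -> bool)).

(** Closedness in the product topology of [Ev -> bool], expressed by agreement on the first [N]
    coordinates in the order of [pickle]. *)
Definition seq_closed K := forall c,
  (forall N, exists2 c', K c' & forall e, (pickle e < N)%N -> c' e = c e) -> K c.

Lemma code_nbhs (c : {ptws Ev -> bool}) (N : nat) :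
  nbhs c [set c' : {ptws Ev -> bool} | forall e, (pickle e < N)%N -> c' e = c e].
Proof.
have H (k : 'I_N) : nbhs c [set c' : {ptws Ev -> bool} |
    if unpickle k is Some e then c' e = c e else True].
  case: (unpickle k) => [e|]; last exact: filterT.
  have /(_ [set c e]) := @proj_continuous Ev (fun _ => bool) e c.
  by apply; exact: discrete_set1.
have := @filter_forall _ 'I_N _ (nbhs c) (nbhs_filter c) H.
apply: (@filterS _ _ (nbhs_filter c)) => c' /= + e eN => /(_ (Ordinal eN)).
by rewrite /= pickleK.
Qed.

(** The projection of a closed set to the coordinates in [J] is closed, by compactness: elements
    that agree with [z] on longer and longer segments have a cluster point, which lies in [K] and
    agrees with [z] on all of [J]. *)
Lemma seq_closed_compact K (J : set Ev) (z : Ev -> bool) : seq_closed K ->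
  (forall N, exists2 c, K c & forall e, J e -> (pickle e < N)%N -> c e = z e) ->
  exists2 c, K c & forall e, J e -> c e = z e.
Proof.
move=> clK H.
have /choice [f Hf] : forall N, exists c, K c /\
    forall e, J e -> (pickle e < N)%N -> c e = z e.
  by move=> N; have [c Kc cz] := H N; exists c.
have cpt : compact [set: {ptws Ev -> bool}].
  have := @tychonoff Ev (fun _ => bool) (fun _ => setT) (fun _ => bool_compact).
  by congr compact; apply/seteqP; split.
have [c [_ clc]] := cpt ((f : nat -> {ptws Ev -> bool}) @ \oo) _ filterT.
(* The index can be taken at least [M], so that the constraint on [f N] covers the first [M]
   coordinates. *)
have F M : exists2 N, (M <= N)%N & forall e, (pickle e < M)%N -> f N e = c e.
  have [] := clc [set f N | N in [set N | (M <= N)%N]] _ _ (code_nbhs c M).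
    by exists M => // N /= MN; exists N.
  by move=> _ [[N MN <-]] /= hN; exists N.
exists c.
  by apply: clK => M; have [N _ hN] := F M; exists (f N) => //; case: (Hf N).
move=> e Je; have [N eN /(_ e)] := F (pickle e).+1.
rewrite ltnSn => <- //; by apply (Hf N).2.
Qed.

Definition code_sigma : set (set (Ev -> bool)) :=
  <<s [set [set c : Ev -> bool | c e] | e in [set: Ev]] >>.

Section generated.
Context {T : Type} {W : set T} {G : set (set T)}.
Hypothesis sG : sigma_algebra W G.

Let G0 : G set0. Proof. by case: sG. Qed.
Let GD (A : set T) : G A -> G (W `\` A). Proof. by case: sG => _ + _; exact. Qed.
Let GU (A : nat -> set T) : (forall n, G (A n)) -> G (\bigcup_n A n).
Proof. by case: sG => _ _; exact. Qed.
Let GW : G W. Proof. by have := GD G0; rewrite setD0. Qed.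
Let GU2 (A B : set T) : G A -> G B -> G (A `|` B).
Proof.
move=> gA gB; rewrite -bigcup2E; apply: GU => -[|[|n]]//=.
Qed.

Lemma sigma_algebra_bigcapW (A : nat -> set T) :
  (forall n, G (A n)) -> G (W `&` \bigcap_n A n).
Proof.
move=> gA; have := GD (GU (fun n => GD (gA n))).
congr G; apply/seteqP; split => x /=.
  move=> [Wx Hx]; split=> // n _; apply: contrapT => nA; apply: Hx.
  by exists n.
by move=> [Wx Hx]; split => // -[n _ [_]]; apply; exact: Hx.
Qed.

Let GI2 (A B : set T) : A `<=` W -> G A -> G B -> G (A `&` B).
Proof.
move=> AW gA gB; have := GD (GU2 (GD gA) (GD gB)).
congr G; apply/seteqP; split => x /=.
  move=> [Wx /not_orP[h1 h2]]; split; apply: contrapT => h; [apply: h1|apply: h2]; tauto.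
by move=> [Ax Bx]; split; [exact: AW|tauto].
Qed.

Variable k : T -> Ev -> bool.
Hypothesis kG : forall e, G (W `&` [set z | k z e]).

(** Induction on [N] by splitting on the value of the last bit: with that bit fixed, the predicate
    depends on one bit less. *)
Lemma finite_code_sigma (N : nat) (P : (Ev -> bool) -> Prop) :
  (forall c c', (forall e, (pickle e < N)%N -> c e = c' e) -> P c -> P c') ->
  G (W `&` [set z | P (k z)]).
Proof.
elim: N P => [|N IH] P HP.
  have [Pk|nPk] := pselect (P (fun _ => false)).
    suff -> : W `&` [set z | P (k z)] = W by [].
    apply/seteqP; split => [x []//|x Wx]; split => //=.
    by apply: HP Pk.
  suff -> : W `&` [set z | P (k z)] = set0 by [].
  apply/seteqP; split => // x [Wx /= /HP Px]; apply: nPk.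
  exact: Px.
(* The number [N] may code no event; then there is no bit to split on. *)
case E : (@pickle_inv Ev N) => [eN|]; last first.
  apply: IH => c c' cc'; apply: HP => e; rewrite ltnS leq_eqVlt.
  by case/orP=> [/eqP eqe|/cc'//]; move: E; rewrite -eqe pickleK_inv.
pose upd b c : Ev -> bool := fun e => if e == eN then b else c e.
have pE e : (pickle e == N) = (e == eN).
  apply/eqP/eqP => [h|->]; last by have /= := (@pickle_invK Ev N); rewrite E.
  by move: E; rewrite -h pickleK_inv => -[].
have Hupd b : G (W `&` [set z | P (upd b (k z))]).
  apply: (IH (fun c => P (upd b c))) => c c' cc'; apply: HP => e.
  rewrite ltnS leq_eqVlt pE /upd; case: eqP => //= _; exact: cc'.
have k1 := kG eN; have k0 := GD (kG eN).
have := GU2 (GI2 (@subIsetl _ _ _) (Hupd true) k1) (GI2 (@subIsetl _ _ _) (Hupd false) k0).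
congr G; apply/seteqP; split => x /=.
  have X b : k x eN = b -> P (upd b (k x)) -> P (k x).
    by move=> kb; apply: HP => e _; rewrite /upd; case: eqP => // ->.
  move=> [[[Wx Pu] [_ kx]]|[[Wx Pu] [_ kx]]]; split => //; first exact: X Pu.
  by apply: X Pu; apply/negP => kx'; apply: kx.
move=> [Wx Px].
have X b : k x eN = b -> P (upd b (k x)).
  by move=> kb; apply: HP Px => e _; rewrite /upd; case: eqP => // ->.
by case E' : (k x eN); [left|right]; (split; first by split=>//; exact: X);
  split => // -[].
Qed.

(** By compactness, having an extension in [K] amounts to having one at every finite stage; each
    stage involves finitely many bits of [z], hence belongs to [G]. *)
Lemma seq_closed_sigma K (J : set Ev) : seq_closed K ->
  G (W `&` [set z | exists2 c, K c & forall e, J e -> c e = k z e]).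
Proof.
move=> clK.
have -> : W `&` [set z | exists2 c, K c & forall e, J e -> c e = k z e] =
   W `&` \bigcap_N (W `&` [set z | exists2 c, K c &
      forall e, J e -> (pickle e < N)%N -> c e = k z e]).
  apply/seteqP; split => z /= [Wz].
    move=> [c Kc cz]; split => // N _; split => //; exists c => // e Je _; exact: cz.
  move=> H; split => //; apply: seq_closed_compact => // N.
  by case: (H N I).
apply: sigma_algebra_bigcapW => N.
apply: (@finite_code_sigma N (fun d => exists2 c, K c &
      forall e, J e -> (pickle e < N)%N -> c e = d e)) => d d' dd' [c Kc cd].
by exists c => // e Je eN; rewrite -dd'//; exact: cd.
Qed.

Lemma code_sigma_preimage (E : set (Ev -> bool)) : code_sigma E ->
  G (W `&` [set z | E (k z)]).
Proof.
move: E; apply: smallest_sub => [|_ [e _ <-]]; last exact: kG.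
split.
- by rewrite (_ : _ `&` _ = set0)//; apply/seteqP; split => // x [].
- move=> A gA; have := GD gA; congr G; apply/seteqP; split => x /=.
    by move=> [Wx h]; split => //; split => // Ax; exact: h.
  by move=> [Wx [_ h]]; split => // -[].
- move=> A gA; have := GU gA; congr G; apply/seteqP; split => x /=.
    by move=> [n _ [Wx An]]; split => //; exists n.
  by move=> [Wx [n _ An]]; exists n.
Qed.

End generated.
End separation.

(** * Inner regularity of laws on codes *)

Section closed.
Context {Ev : countType}.
Implicit Types K : set (Ev -> bool).

(** If [c] cannot be approximated by [K] at some stage [M], then all approximations at stages beyond
    [M] come from [K']. *)
Lemma seq_closedU K K' : seq_closed K -> seq_closed K' -> seq_closed (K `|` K').
Proof.
move=> clK clK' c H.
have [hK|/existsNP[M nM]] := pselect (forall N, exists2 c', K c' &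
   forall e, (pickle e < N)%N -> c' e = c e).
  by left; exact: clK.
right; apply: clK' => N.
have [c' [Kc'|Kc'] c'c] := H (maxn N M).
  exfalso; apply: nM; exists c' => // e eM; apply: c'c.
  by rewrite (leq_trans eM)// leq_maxr.
by exists c' => // e eM; apply: c'c; rewrite (leq_trans eM)// leq_maxl.
Qed.

Lemma seq_closed0 : seq_closed (set0 : set (Ev -> bool)).
Proof. by move=> c /(_ 0)[]. Qed.

Lemma seq_closed_bigcap (K : nat -> set (Ev -> bool)) :
  (forall n, seq_closed (K n)) -> seq_closed (\bigcap_n K n).
Proof.
move=> clK c H n _; apply: clK => N; have [c' Kc' h] := H N.
by exists c' => //; exact: Kc'.
Qed.

Lemma seq_closed_bit b (e : Ev) : seq_closed [set c | c e = b].
Proof.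
move=> c /(_ (pickle e).+1)[c' /= <-] /(_ e) ->//.
Qed.

End closed.

Section regularity.
Context {Ev : countType} {R : realType} {d : measure_display}
  {Omega : measurableType d}.
Variables (Q : probability Omega R) (k : Omega -> Ev -> bool).
Hypothesis mk : forall e, measurable [set w | k w e].

Let sM : sigma_algebra [set: Omega] (@measurable _ Omega).
Proof. exact: sigma_algebra_measurable. Qed.

Let mk' e : measurable ([set: Omega] `&` [set w | k w e]).
Proof. by rewrite setTI. Qed.

Lemma measurable_code_closed K : seq_closed K -> measurable (k @^-1` K).
Proof.
move=> clK; have := seq_closed_sigma sM mk' setT clK.
rewrite setTI; congr measurable; apply/seteqP; split => w /=.
  by move=> [c Kc ck]; suff <- : c = k w by []; apply/funext => e; exact: ck.
by move=> Kw; exists (k w).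
Qed.

Lemma measurable_code E : code_sigma E -> measurable (k @^-1` E).
Proof. by move=> /(code_sigma_preimage sM mk'); rewrite setTI. Qed.

(** The sets that are approximable from inside together with their complements form a sigma-algebra:
    symmetry gives complements; a countable union is approximated by finitely many of the inner
    sets, and its complement by the intersection of the inner sets of the complements. *)
Lemma code_inner_regular (A : set (Ev -> bool)) : code_sigma A ->
  forall e : R, 0 < e -> exists K K', [/\ seq_closed K, seq_closed K',
    K `<=` A, K' `<=` ~` A & (Q (k @^-1` (~` (K `|` K'))) <= e%:E)%E].
Proof.
move: A; apply: smallest_sub => [|_ [e _ <-] eps eps0]; last first.
  exists [set c | c e = true], [set c | c e = false]; split => //.
  - exact: seq_closed_bit.
  - exact: seq_closed_bit.
  - by move=> c /= ->.
  - rewrite (_ : _ @^-1` _ = set0) ?measure0 ?lee_fin ?ltW//.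
    by apply/seteqP; split => // w /= /not_orP[] /=; case: (k w e).
split.
- move=> e e0; exists set0, setT; split => //; first exact: seq_closed0.
    by move=> c _ [].
  rewrite setUT setCT preimage_set0 measure0 lee_fin ltW//.
- move=> A + e e0 => /(_ e e0)[K [K' [c1 c2 s1 s2 H]]].
  exists K', K; split => //; first by move=> c /s2.
    by move=> c /s1 Ac [_].
  by rewrite setUC.
move=> A HA e e0.
(* These errors sum to [e / 2]. The other half is spent on replacing the countable union of closed
   sets, which need not be closed, by a finite one. *)
have {}HA n : exists KK : set (Ev -> bool) * set (Ev -> bool),
   [/\ seq_closed KK.1, seq_closed KK.2, KK.1 `<=` A n, KK.2 `<=` ~` A n &
    (Q (k @^-1` (~` (KK.1 `|` KK.2))) <= (e / 2 / (2 ^ n.+1)%:R)%:E)%E].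
  have [|K [K' H]] := HA n (e / 2 / (2 ^ n.+1)%:R); last by exists (K, K').
  by rewrite !divr_gt0// ltr0n expn_gt0.
move/choice : HA => [f Hf].
pose U := \bigcup_n (f n).1.
pose UN N := \bigcup_(n < N) (f n).1.
have clUN N : seq_closed (UN N).
  rewrite /UN bigcup_mkord; elim/big_ind: _ => //; first exact: seq_closed0.
    exact: seq_closedU.
  by move=> i _; case: (Hf i).
have mUN N : measurable (k @^-1` UN N) by exact: measurable_code_closed.
have mf1 n : measurable (k @^-1` (f n).1) by apply: measurable_code_closed; case: (Hf n).
have mf2 n : measurable (k @^-1` (f n).2) by apply: measurable_code_closed; case: (Hf n).
have mU : measurable (k @^-1` U) by rewrite preimage_bigcup; exact: bigcup_measurable.
have cvgU : Q (k @^-1` U `\` k @^-1` UN N) @[N --> \oo] --> 0%E.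
  have -> : 0%E = Q (\bigcap_N (k @^-1` U `\` k @^-1` UN N)).
    rewrite (_ : \bigcap_N _ = set0) ?measure0//; apply/seteqP; split => // w.
    move=> /= h; have [[n _ fn] _] := h 0 I; have [_] := h n.+1 I; apply.
    by exists n => /=.
  apply: nonincreasing_cvg_mu => //.
  - by rewrite (le_lt_trans (probability_le1 _ _)) ?ltry//; exact: measurableD.
  - by move=> n; exact: measurableD.
  - by apply: bigcap_measurable => //= n _; exact: measurableD.
  - move=> n m nm; apply/subsetPset; apply: setDS => w /=.
    move=> -[i /= im]; exists i => //=.
    exact: leq_trans nm.
have [N HN] : exists N, (Q (k @^-1` U `\` k @^-1` UN N) <= (e / 2)%:E)%E.
  have /fine_cvgP[_ /cvgrPdist_le /(_ (e / 2)) []] := cvgU.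
    by rewrite divr_gt0.
  move=> N _ /(_ N) /=; rewrite leqnn sub0r normrN => /(_ isT) h.
  exists N; rewrite -(@fineK _ (Q _)) ?fin_num_measure ?lee_fin//; last exact: measurableD.
  exact: le_trans (ler_norm _) h.
exists (UN N), (\bigcap_n (f n).2); split => //.
- by apply: seq_closed_bigcap => n; case: (Hf n).
- move=> c [n _ fn]; exists n => //.
  by case: (Hf n) => _ _ + _ _; exact.
- move=> c h [n _ An]; case: (Hf n) => _ _ _ /(_ c (h n I)) + _; exact.
have sub : k @^-1` (~` (UN N `|` \bigcap_n (f n).2)) `<=`
    (k @^-1` U `\` k @^-1` UN N) `|`
    \bigcup_n (k @^-1` (~` ((f n).1 `|` (f n).2))).
  move=> w /= /not_orP[nU /existsNP[n /not_implyP[_ nf]]].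
  have [Uw|nUw] := pselect (U (k w)); first by left.
  by right; exists n => //= -[f1|//]; apply: nUw; exists n.
have m1 n : measurable (k @^-1` (~` ((f n).1 `|` (f n).2))).
  rewrite -preimage_setC preimage_setU; apply: measurableC; exact: measurableU.
have m2 : measurable (k @^-1` U `\` k @^-1` UN N) by exact: measurableD.
have m3 : measurable (\bigcup_n (k @^-1` (~` ((f n).1 `|` (f n).2)))).
  exact: bigcup_measurable.
apply: (@le_trans _ _ ((e / 2)%:E + (e / 2)%:E)%E); last first.
  by rewrite -EFinD -splitr.
apply: le_trans (le_measure _ _ _ sub) _; rewrite ?inE//.
- rewrite -preimage_setC; apply: measurableC; rewrite preimage_setU preimage_bigcap.
  by apply: measurableU => //; exact: bigcap_measurable.
- exact: measurableU.
apply: le_trans (measureU2 _ _ _) _ => //.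
apply: leeD => //.
apply: le_trans (measure_sigma_subadditive Q _ m3 (@subset_refl _ _)) _ => //.
apply: le_trans (lee_nneseries _ _) (@epsilon_trick0 R (e / 2) xpredT _) => //.
- by move=> n _; case: (Hf n).
- by rewrite ltW// divr_gt0.
Qed.

End regularity.

(** * Factorization of an event through partial information *)

Section separation.
Context {Ev : countType} {R : realType} {d : measure_display}
  {Omega : measurableType d}.
Variables (Q : probability Omega R) (k : Omega -> Ev -> bool).
Hypothesis mk : forall e, measurable [set w | k w e].
Context {T : Type} {W : set T} {G : set (set T)}.
Hypothesis sG : sigma_algebra W G.
Variables (Z : Omega -> T) (kZ : T -> Ev -> bool) (J : set Ev).
Hypothesis kG : forall e, J e -> G (W `&` [set z | kZ z e]).
Variables (Gam E : set (Ev -> bool)) (L : set Omega).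
Hypothesis sGam : code_sigma Gam.
Hypothesis sE : code_sigma E.
Hypothesis Lae : {ae Q, forall w, L w}.
Hypothesis LP : forall w, L w ->
  [/\ W (Z w), Gam (k w) & forall e, J e -> kZ (Z w) e = k w e].
Hypothesis Gam_uniq : forall w, L w -> forall c c', Gam c -> Gam c' ->
  (forall e, J e -> c e = k w e) -> (forall e, J e -> c' e = k w e) -> E c -> E c'.

(* The sets [K n] are compact, so that their projections to the bits in [J]
   are again compact, hence measurable; the union of the projections contains
   almost all of [E] and, by [Gam_uniq], nothing else. *)
Lemma factor_through : exists2 C, G C & {ae Q, forall w, C (Z w) <-> E (k w)}.
Proof.
have sGE : code_sigma (Gam `&` E).
  by apply: (@measurableI _ (g_sigma_algebraType [set [set c : Ev -> bool | c e] | e in [set: Ev]])).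
have {}HK n : exists KK : set (Ev -> bool) * set (Ev -> bool),
   [/\ seq_closed KK.1, seq_closed KK.2, KK.1 `<=` Gam `&` E, KK.2 `<=` ~` (Gam `&` E) &
    (Q (k @^-1` (~` (KK.1 `|` KK.2))) <= (n.+1%:R^-1)%:E)%E].
  have [|K [K' H]] := code_inner_regular Q mk sGE (e := n.+1%:R^-1); last by exists (K, K').
  by rewrite invr_gt0 ltr0n.
move/choice : HK => [f Hf].
pose C := \bigcup_n (W `&` [set z | exists2 c, (f n).1 c & forall e, J e -> c e = kZ z e]).
exists C.
  case: (sG) => _ _; apply => n.
  (* Bits outside [J] are replaced by false, as only those in [J] are known to be events of [G]. *)
  pose kJ z e := `[< J e >] && kZ z e.
  have kJG e : G (W `&` [set z | kJ z e]).
    have [Je|nJe] := pselect (J e).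
      have := kG Je; congr G; congr (_ `&` _); apply/seteqP.
      by split => z; rewrite /= /kJ (asboolT Je).
    rewrite (_ : _ `&` _ = set0); first by case: sG.
    by apply/seteqP; split => // z [_]; rewrite /= /kJ (asboolF nJe).
  have clf : seq_closed (f n).1 by case: (Hf n).
  have := seq_closed_sigma sG kJG J clf.
  by congr G; congr (_ `&` _); apply/seteqP; split => z /= [c fc cz];
    exists c => // e Je; rewrite cz// /kJ (asboolT Je).
(* The outcomes that no pair of closed sets decides; their probability is at most [1/(n+1)] for
   every [n]. *)
pose N := \bigcap_n (k @^-1` (~` ((f n).1 `|` (f n).2))).
have mN n : measurable (k @^-1` (~` ((f n).1 `|` (f n).2))).
  case: (Hf n) => cl1 cl2 _ _ _.
  rewrite -preimage_setC preimage_setU; apply: measurableC.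
  by apply: measurableU; exact: (measurable_code_closed mk).
have N0 : Q.-negligible N.
  exists N; split => //; first exact: bigcap_measurable.
  apply/eqP; rewrite eq_le measure_ge0 andbT; apply/lee_addgt0Pr => e e0.
  rewrite add0e; have [n ne] : exists n, n.+1%:R^-1 <= e.
    have [n _ /(_ n (leqnn n)) /ltW] := near_infty_natSinv_lt (PosNum e0).
    by exists n.
  case: (Hf n) => _ _ _ _ Hn; apply: le_trans (le_trans Hn _); last by rewrite lee_fin.
  apply: le_measure; rewrite ?inE//; first exact: bigcap_measurable.
  by move=> w /(_ n I).
have {}N0 : {ae Q, forall w, ~ N w}.
  by case: N0 => A [mA A0 NA]; exists A; split => // w /= /contrapT /NA.
apply: filterS2 Lae N0 => w Lw nNw; have [WZ Gw Jw] := LP Lw; split.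
  move=> [n _ [_ [c fc cz]]]; case: (Hf n) => _ _ /(_ c fc)[Gc Ec] _ _.
  apply: (Gam_uniq Lw Gc Gw) => // e Je.
  by rewrite cz// Jw.
move=> Ew; have /existsNP[n /not_implyP[_ /contrapT[]]] := nNw; last first.
  by move=> f2; case: (Hf n) => _ _ _ /(_ _ f2 (conj Gw Ew)).
move=> fk; exists n => //; split=> //; exists (k w) => // e Je.
by rewrite Jw.
Qed.
End separation.

(** * Coding of paths by rational bits at dyadic times *)

Section decoding.
Context {R : realType} {I : countType}.

Definition event : Type := (nat * nat * I * rat)%type.
HB.instance Definition _ := Countable.on event.

Definition code := g_sigma_algebraType [set [set c : event -> bool | c e] | e in [set: event]].
HB.instance Definition _ := Measurable.on code.

(* The value coded by the bits [c (n, k, i, r)], [r] rational: these bits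
   stand for [r < x_i(k / 2^n)]. *)
Definition decode (c : code) (n k : nat) (i : I) : \bar R :=
  esups (fun j => if @unpickle rat j is Some r
                  then (if c (n, k, i, r) then (ratr r)%:E else -oo%E) else -oo%E) 0.

Definition dyadic (n : nat) (u : R) : R := (Num.truncn (u * 2 ^+ n))%:R / 2 ^+ n.

(** An upper limit along the dyadic approximations from below makes sense for every code and is
    jointly measurable in time and code; on the code of a continuous path it returns the path. *)
Definition decoded (c : code) (u : R) (i : I) : R :=
  fine (limn_esup (fun n => decode c n (Num.truncn (u * 2 ^+ n)) i)).

Lemma measurable_bit (e : event) : measurable [set c : code | c e].
Proof. by apply: sub_sigma_algebra; exists e. Qed.

Lemma measurable_decode n k i : measurable_fun setT (fun c : code => decode c n k i).
Proof.
apply: measurable_fun_esups => j; case: unpickle => [r|]; last exact: measurable_cst.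
apply: measurable_fun_ifT => //; apply: (measurable_fun_bool true).
by rewrite setTI; exact: measurable_bit.
Qed.

Lemma measurable_truncn_eq (n k : nat) : measurable [set u : R | Num.truncn (u * 2 ^+ n) = k].
Proof.
have -> : [set u : R | Num.truncn (u * 2 ^+ n) = k] =
    (fun u : R => u * 2 ^+ n) @^-1` [set v | Num.truncn v = k] by [].
rewrite -[X in measurable X]setTI; apply: (_ : measurable_fun setT (fun u : R => u * 2 ^+ n)) => //.
  exact: mulrr_measurable.
have le j : measurable [set v : R | (Num.truncn v <= j)%N].
  rewrite (_ : [set v | _] = [set` `]-oo, j.+1%:R[]); first exact: measurable_itv.
  by apply/seteqP; split => v /=; rewrite in_itv /= truncn_le_nat.
case: k => [|k].
  have -> : [set v : R | Num.truncn v = 0%N] = [set v : R | (Num.truncn v <= 0)%N].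
    by apply/seteqP; split => v /=; [move=> ->|rewrite leqn0 => /eqP].
  exact: le.
have -> : [set v : R | Num.truncn v = k.+1] =
   [set v : R | (Num.truncn v <= k.+1)%N] `\` [set v : R | (Num.truncn v <= k)%N].
  apply/seteqP; split => v /=; first by move=> ->; rewrite ltnn.
  by move=> [h1 /negP]; rewrite -ltnNge => h2; apply/eqP; rewrite eqn_leq h1.
by apply: measurableD; exact: le.
Qed.

(** The time enters each approximation only through the integer [Num.truncn (u * 2 ^+ n)], so a
    preimage splits into countably many measurable rectangles. *)
Lemma measurable_decoded i :
  measurable_fun [set: R * code] (fun p => decoded p.2 p.1 i).
Proof.
have fm : measurable_fun [set: \bar R] (fine : \bar R -> R) by exact: fine_measurable.
apply: (measurableT_comp fm); apply: measurable_fun_limn_esup => n.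
move=> _ Y mY; rewrite setTI.
have -> : (fun p : R * code => decode p.2 n (Num.truncn (p.1 * 2 ^+ n)) i) @^-1` Y =
  \bigcup_k ([set u : R | Num.truncn (u * 2 ^+ n) = k] `*` ((fun c => decode c n k i) @^-1` Y)).
  apply/seteqP; split => [[u c] /= Yuc|[u c] /= [k _ [/= -> Yc]]]//.
  by exists (Num.truncn (u * 2 ^+ n)).
apply: bigcup_measurable => k _; apply: measurableX; first exact: measurable_truncn_eq.
by rewrite -[X in measurable X]setTI; exact: measurable_decode.
Qed.

Section encoding.
Context {T : Type} (x : T -> R -> I -> R).

Definition encode (w : T) : event -> bool :=
  fun e => let '(n, k, i, r) := e in ratr r < x w (k%:R / 2 ^+ n) i.

(** A real number is the supremum of the rationals below it; indices that code no rational
    contribute [-oo]. *)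
Lemma decode_encode w n k i : decode (encode w) n k i = (x w (k%:R / 2 ^+ n) i)%:E.
Proof.
rewrite /decode /esups /sdrop; set v := x w _ i.
apply/eqP; rewrite eq_le; apply/andP; split.
  apply: ge_ereal_sup => _ [j _ <-]; case: unpickle => [r|]; last by rewrite leNye.
  by rewrite /encode -/v; case: ifPn => [h|_]; rewrite ?leNye// lee_fin ltW.
apply/lee_subgt0Pr => e e0.
have [q] : exists q : rat, ratr q \in `]v - e, v[.
  by apply: rat_in_itvoo; rewrite ltrBlDr ltrDl.
rewrite in_itv /= => /andP[q1 q2]; apply: (@le_trans _ _ (ratr q)%:E).
  by rewrite -EFinB lee_fin ltW.
by apply: ereal_sup_ubound; exists (pickle q) => //=; rewrite pickleK -/v q2.
Qed.

Lemma dyadic_le n u : 0 <= u -> 0 <= dyadic n u <= u.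
Proof.
move=> u0; rewrite /dyadic; have e0 : 0 < 2 ^+ n :> R by rewrite exprn_gt0.
apply/andP; split; first by rewrite divr_ge0// ltW.
rewrite ler_pdivrMr//.
have /andP[] := @truncn_itv R (u * 2 ^+ n) (mulr_ge0 u0 (ltW e0)); by [].
Qed.

Lemma dyadic_gt n u : 0 <= u -> u - 2^-1 ^+ n < dyadic n u.
Proof.
move=> u0; rewrite /dyadic; have e0 : 0 < 2 ^+ n :> R by rewrite exprn_gt0.
have /andP[_] := @truncn_itv R (u * 2 ^+ n) (mulr_ge0 u0 (ltW e0)).
rewrite -ltr_pdivlMr// => /lt_le_trans h; rewrite ltrBlDr; apply: h.
by rewrite -natr1 mulrDl mul1r exprVn.
Qed.

Lemma cvg_half : 2^-1 ^+ n @[n --> \oo] --> (0 : R).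
Proof. by apply: cvg_expr; rewrite ger0_norm ?invf_lt1 ?ltr1n. Qed.

Lemma cvg_dyadic u : 0 <= u -> dyadic n u @[n --> \oo] --> u.
Proof.
move=> u0; apply/cvgrPdist_lt => e e_gt0.
have /cvgrPdist_lt/(_ e e_gt0) := cvg_half.
apply: filterS => n; rewrite sub0r normrN => h.
have /andP[_ h1] := dyadic_le n u0; have h2 := dyadic_gt n u0.
rewrite ger0_norm ?subr_ge0//; rewrite ger0_norm in h; last by rewrite exprn_ge0.
by lra.
Qed.

Lemma decoded_encode w u i : 0 <= u ->
  x w (dyadic n u) i @[n --> \oo] --> x w u i -> decoded (encode w) u i = x w u i.
Proof.
move=> u0 cvx; rewrite /decoded.
under eq_fun do rewrite decode_encode.
have [|_ ->//] := @cvg_limn_einf_sup R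
  (fun n => (x w (dyadic n u) i)%:E) (x w u i)%:E.
by apply: cvg_EFin => //; near=> n.
Unshelve. all: end_near. Qed.

End encoding.
End decoding.
Arguments code : clear implicits.

(** * Measurability into matrices and sequences *)

Section borel_matrix.
Context {R : realType}.

(** An open set of matrices is a countable union of boxes with rational centre and radius, and a box
    is a finite condition on the entries. *)
Lemma measurable_fun_borel_matrix {dT} {T : measurableType dT} (D : set T) m n
    (f : T -> 'M[R]_(m, n)) :
  (forall i j, measurable_fun D (fun w => f w i j)) ->
  measurable_fun D (f : T -> borel 'M[R]_(m, n)).
Proof.
move=> mf mD; suff h : measurable_fun D (f : T -> borel 'M[R]_(m, n)) by exact: h.
apply: measurability; first by [].
move=> _ [U oU <-].
pose box (qr : 'M[rat]_(m, n) * rat) : set 'M[R]_(m, n) :=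
  [set x | forall i j, `|x i j - ratr (qr.1 i j)| < ratr qr.2].
have mbox (qr : 'M[rat]_(m, n) * rat) : measurable (D `&` f @^-1` (box qr)).
  have -> : D `&` f @^-1` box qr = D `&` \bigcap_(ij in [set: 'I_m * 'I_n])
     (D `&` (fun w => `|f w ij.1 ij.2 - ratr (qr.1 ij.1 ij.2)|) @^-1` `]-oo, ratr qr.2[ ).
    apply/seteqP; split => w /= [Dw].
      by move=> h; split => // -[i j] _ /=; split => //; rewrite in_itv /=; exact: h.
    by move=> h; split => // i j; have [_ /=] := h (i, j) I; rewrite in_itv.
  apply: measurableI => //; apply: fin_bigcap_measurable => [|[i j] _ /=]; first by have := @finite_finset ('I_m * 'I_n)%type setT.
  apply: (_ : measurable_fun D _) => //.
  apply: measurableT_comp => //; apply: measurable_funB => //; exact: mf.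
have -> : D `&` f @^-1` U = \bigcup_(qr in [set: 'M[rat]_(m, n) * rat])
    (if `[< box qr `<=` U >] then D `&` f @^-1` box qr else set0).
  apply/seteqP; split => w /=; last first.
    by move=> [qr _]; case: ifPn => // /asboolP qO [Dw /qO].
  move=> [Dw Uw].
  have [e e0 eO] : exists2 e : R, 0 < e & ball (f w) e `<=` U.
    have := oU; rewrite openE => /(_ _ Uw); rewrite /interior /= => /nbhs_ballP.
    by move=> [e e0 h]; exists e.
  (* The centre is within [r] of [f w] and the box has radius [r], so it lies in the ball of radius
     [e]. *)
  have [r] : exists r : rat, ratr r \in `]0, e / 2[ by apply: rat_in_itvoo; lra.
  rewrite in_itv /= => /andP[r0 r1].
  have /choice[q Hq] : forall ij : 'I_m * 'I_n, exists q : rat,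
      `|f w ij.1 ij.2 - ratr q| < ratr r.
    move=> [i j] /=; have [q] : exists q : rat, ratr q \in `](f w i j - ratr r), (f w i j)[.
      by apply: rat_in_itvoo; lra.
    by rewrite in_itv /= => /andP[q0 q1]; exists q; rewrite ltr_norml; apply/andP; split; lra.
  exists (\matrix_(i, j) q (i, j), r) => //; rewrite asboolT; last first.
    move=> x Hx; apply: eO; split => // i j; rewrite /ball /=.
    have := Hx i j; have := Hq (i, j); rewrite /= mxE => h1 h2.
    by rewrite -(subrK (ratr (q (i, j))) (f w i j)) -addrA (le_lt_trans (ler_normD _ _))//
      (distrC (ratr _)); lra.
  by split => //= i j; rewrite mxE; exact: (Hq (i, j)).
apply: countable_bigcupT_measurable; first exact: countableP.
by move=> qr; case: ifPn => // _; exact: mbox.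
Qed.

Lemma measurable_entry m n i j :
  measurable_fun [set: borel 'M[R]_(m, n)] (fun x : borel 'M[R]_(m, n) => (x : 'M[R]_(m, n)) i j).
Proof.
apply: (measurability _ (RGenOInfty.measurableE R)).
move=> _ [_ [r ->] <-]; rewrite setTI; apply: sub_sigma_algebra => /=.
have /continuousP := @coord_continuous R m n i j.
by apply; exact: itv_open_ends_open.
Qed.

Lemma measurable_open_matrix {dT} {T : measurableType dT} (D : set T) m n
    (f : T -> 'M[R]_(m, n)) (O : set 'M[R]_(m, n)) : measurable D ->
  (forall i j, measurable_fun D (fun w => f w i j)) -> open O ->
  measurable (D `&` f @^-1` O).
Proof.
move=> mD /measurable_fun_borel_matrix /(_ mD O) + oO; apply.
exact: sub_sigma_algebra.
Qed.

End borel_matrix.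

Section sequences.
Context {R : realType} {d : nat}.

Definition coord_sets : set (set (seqE R d)) :=
  [set A | exists i k (U : set R), measurable U /\ A = (fun x : seqE R d => x i 0 k) @^-1` U].

(** The product sigma-field: measurability into it is checked coordinate by coordinate, while
    coordinates are also Borel functions on [seqE R d]. *)
Definition seqM := g_sigma_algebraType coord_sets.
HB.instance Definition _ := Measurable.on seqM.

Lemma measurable_coord i k : measurable_fun [set: seqM] (fun x : seqM => (x : seqE R d) i 0 k).
Proof. by move=> _ U mU; rewrite setTI; apply: sub_sigma_algebra; exists i, k, U. Qed.

Lemma measurable_fun_seqM {dT} {T : measurableType dT} (D : set T) (f : T -> seqE R d) :
  (forall i k, measurable_fun D (fun w => f w i 0 k)) ->
  measurable_fun D (f : T -> seqM).
Proof.
move=> mf mD; suff h : measurable_fun D (f : T -> seqM) by exact: h.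
apply: measurability; first by [].
move=> _ [_ [i [k [U [mU ->]]]] <-].
exact: mf.
Qed.

Lemma measurable_seq_coord i k : measurable_fun [set: borel (seqE R d)]
  (fun x : borel (seqE R d) => (x : seqE R d) i 0 k).
Proof.
apply: (measurability _ (RGenOInfty.measurableE R)).
move=> _ [_ [r ->] <-]; rewrite setTI; apply: sub_sigma_algebra => /=.
have h : continuous (fun x : seqE R d => x i 0 k).
  move=> x; apply: (@continuous_comp _ _ _ (fun x : seqE R d => x i) (fun y => y 0 k)).
    exact: (@proj_continuous nat (fun _ => 'rV[R]_d) i x).
  exact: coord_continuous.
by move/continuousP : h; apply; exact: itv_open_ends_open.
Qed.

End sequences.
Arguments seqM R d : clear implicits.

(** * Euclidean norm, and configurations as labelled sequences *)

Section euclidean.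
Context {R : realType}.

Lemma enorm_ge0 m n (x : 'M[R]_(m, n)) : 0 <= enorm x.
Proof. exact: sqrtr_ge0. Qed.

Lemma le_enorm m n (x : 'M[R]_(m, n)) i j : `|x i j| <= enorm x.
Proof.
rewrite /enorm -sqrtr_sqr ler_wsqrtr// (bigD1 i)//= (bigD1 j)//=.
rewrite -addrA lerDl addr_ge0//; first by apply: sumr_ge0 => ? _; rewrite sqr_ge0.
by do 2!apply: sumr_ge0 => ? _; rewrite sqr_ge0.
Qed.

Lemma continuous_enorm m n : continuous (fun x : 'M[R]_(m, n) => enorm x).
Proof.
move=> x; apply: (@continuous_comp _ _ _ (fun x : 'M[R]_(m, n) => \sum_i \sum_j x i j ^+ 2)); last exact: sqrt_continuous.
have fx := nbhs_filter x.
apply: (@cvg_big _ _ _ _ _ add_continuous) => i _.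
apply: (@cvg_big _ _ _ _ _ add_continuous) => j _.
apply: (cvg_comp (fun x : 'M[R]_(m, n) => x i j) (fun r => r ^+ 2)).
  exact: coord_continuous.
exact: exprn_continuous.
Qed.

End euclidean.

Section configurations.
Context {R : realType} {d : nat}.
Implicit Types (x : seqE R d) (P : pred nat) (s : cfg R d).

Lemma cfg_ext (s t : cfg R d) : (forall A, s A = t A) -> s = t.
Proof. by move=> st; apply: eq_measure; apply/funext => A; exact: st. Qed.

Lemma cfg_addE (s t : cfg R d) A : cfg_add s t A = (s A + t A)%E.
Proof. exact: measure_addE. Qed.

Definition mass P x (A : set 'rV[R]_d) (i : nat) : \bar R :=
  if P i then (\1_A (x i))%:E else 0%E.

Lemma mass_ge0 P x A i : (0 <= mass P x A i)%E.
Proof. by rewrite /mass; case: ifP => // _; rewrite lee_fin. Qed.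

Lemma unlabelE P x (A : set 'rV[R]_d) : unlabel P x A = (\sum_(0 <= i <oo) mass P x A i)%E.
Proof.
rewrite /unlabel /point_measure /=; apply: eq_eseriesr => i _.
by rewrite /mass; case: ifP.
Qed.

Lemma unlabel_split P Q x :
  unlabel P x = cfg_add (unlabel (fun i => P i && Q i) x) (unlabel (fun i => P i && ~~ Q i) x).
Proof.
apply: cfg_ext => A; rewrite cfg_addE !unlabelE -nneseriesD; try by move=> *; exact: mass_ge0.
by apply: eq_eseriesr => i _; rewrite /mass; case: (P i); case: (Q i); rewrite /= ?adde0 ?add0e.
Qed.

Lemma eq_unlabel P Q x y : (forall i, P i = Q i) -> (forall i, P i -> x i = y i) ->
  unlabel P x = unlabel Q y.
Proof.
move=> PQ xy; rewrite /unlabel; congr point_measure; apply/funext => j.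
by rewrite -PQ; case: ifP => // /xy ->.
Qed.

Lemma row_firstm m x i : row i (firstm m x) = x i.
Proof. by rewrite /firstm; apply/rowP => k; rewrite !mxE. Qed.

Lemma unlabelm_firstm m x : unlabelm (firstm m x) = unlabel (fun i => i < m)%N x.
Proof.
rewrite /unlabelm /unlabel; congr point_measure; apply/funext => j.
by case: insubP => [i -> <-|/negbTE -> //]; rewrite /= row_firstm.
Qed.

Lemma unlabelm_but_firstm m x i :
  unlabelm_but (firstm m x) i = unlabel (fun j => (j < m)%N && (j != i)) x.
Proof.
rewrite /unlabelm_but /unlabel; congr point_measure; apply/funext => j.
case: eqP => [_|_]; first by rewrite andbF.
by rewrite andbT; case: insubP => [k -> <-|/negbTE -> //]; rewrite /= row_firstm.
Qed.

(** Lets conditions on the pair of first particles and environment be read as conditions on the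
    whole labelled sequence. *)
Lemma cfg_add_env m x : cfg_add (unlabelm (firstm m x)) (unlabel (from m) x) = unlabel predT x.
Proof.
rewrite unlabelm_firstm [RHS](@unlabel_split _ (fun i => i < m)%N).
by congr cfg_add; apply: eq_unlabel => // i; rewrite /from /= leqNgt.
Qed.

Lemma cfg_add_env_but m x (i : 'I_m) :
  cfg_add (unlabelm_but (firstm m x) i) (unlabel (from m) x) = unlabel (but i) x.
Proof.
rewrite unlabelm_but_firstm [RHS](@unlabel_split _ (fun i => i < m)%N).
congr cfg_add; apply: eq_unlabel => // j; rewrite /from /but /=; first by rewrite andbC.
rewrite -leqNgt; case: (leqP m j) => mj; rewrite ?andbF// andbT; apply/esym/eqP => ji.
by move: mj; rewrite ji leqNgt ltn_ord.
Qed.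

Lemma borel_open (T : ptopologicalType) (U : set T) : open U -> measurable (U : set (borel T)).
Proof. exact: sub_sigma_algebra. Qed.

Lemma borel_closed (T : ptopologicalType) (U : set T) : closed U -> measurable (U : set (borel T)).
Proof.
move=> cU; rewrite -(setCK U); apply: measurableC; apply: borel_open.
exact: closed_openC.
Qed.

Definition eball (n : nat) : set 'rV[R]_d := [set y | enorm y <= n%:R].

Lemma closed_eball n : closed (eball n).
Proof.
have -> : eball n = enorm @^-1` [set r | r <= n%:R] by [].
by move/continuous_closedP : (@continuous_enorm R 1 d); apply; exact: closed_le.
Qed.

Lemma eball_S n m : (n <= m)%N -> eball n `<=` eball m.
Proof. by move=> nm y /= /le_trans; apply; rewrite ler_nat. Qed.

Section domain.
Variable S : set 'rV[R]_d.
Hypothesis clS : closed S.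
Hypothesis d_gt0 : (0 < d)%N.

Lemma compact_eball n : compact (S `&` eball n).
Proof.
apply: bounded_closed_compact; last exact: closedI clS (@closed_eball n).
exists n%:R; split => // M nM y [_ yn] /=.
rewrite [leLHS]mx_normrE; apply/bigmax_leP; split; first by rewrite (le_trans _ (ltW nM)).
by move=> [i j] _; rewrite (le_trans (le_enorm _ _ _))// (le_trans yn)// ltW.
Qed.

Lemma compact_eball_sub K : compact K -> exists n, K `<=` eball n.
Proof.
move=> cK; have : compact [set enorm y | y in K].
  apply: continuous_compact => //; apply: continuous_subspaceT.
  exact: continuous_enorm.
move=> /compact_bounded[M [_ HM]]; exists (Num.truncn (M + 1)).+1 => y Ky /=.
have : (`|enorm y| <= M + 1)%R by apply: HM; [rewrite ltrDl|exists y].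
by rewrite ger0_norm ?enorm_ge0// => /le_trans; apply; apply: ltW; exact: truncnS_gt.
Qed.

(** Membership in [config] reduced to countably many conditions on the labels; a compact set lies in
    some ball of integer radius. *)
Definition goodcfg P : set (seqE R d) :=
  [set x | (forall i, P i -> S (x i)) /\ forall n, (unlabel P x (S `&` eball n) < +oo)%E].

Let mS : measurable (S : set (borel 'rV[R]_d)). Proof. exact: borel_closed. Qed.

Let mSn n : measurable (S `&` eball n : set (borel 'rV[R]_d)).
Proof. by apply: borel_closed; apply: closedI => //; exact: closed_eball. Qed.

Lemma point_measure_support (y : nat -> option 'rV[R]_d) :
  (forall i z, y i = Some z -> S z) -> point_measure y (~` S) = 0%E.
Proof.
move=> yS; rewrite /point_measure /=; apply: eseries0 => i _ _ /=.
case E : (y i) => [z|] //=; rewrite diracE memNset//= => /(_ (yS _ _ E)) //.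
Qed.

Lemma unlabel_ge x P (A : set 'rV[R]_d) i : P i -> A (x i) -> (1 <= unlabel P x A)%E.
Proof.
move=> Pi Ai; rewrite unlabelE.
rewrite (@nneseriesD1 _ _ i) //; last by move=> j _; exact: mass_ge0.
rewrite {1}/mass Pi indicE mem_set// leeDl//.
by apply: nneseries_ge0 => j _ _; exact: mass_ge0.
Qed.

Lemma config_unlabel P x : config S (unlabel P x) <-> goodcfg P x.
Proof.
split.
  move=> [[y [yS E]] fin]; split => [i Pi|n]; last first.
    by apply: fin => //; exact: compact_eball.
  (* A label outside [S] would give mass at least 1 to the complement of [S], which a point measure
     on [S] does not charge. *)
  apply: contrapT => nS; have := @unlabel_ge x P (~` S) i Pi nS.
  by rewrite E point_measure_support// leNgt lte01.
move=> [xS fin]; split.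
  exists (fun j => if P j then Some (x j) else None); split => // i y.
  by case: ifP => // Pi [<-]; exact: xS.
move=> K cK KS; have [n Kn] := compact_eball_sub cK.
apply: le_lt_trans (fin n); apply: le_measure; rewrite ?inE.
- by apply: borel_closed; apply: compact_closed => //; exact: norm_hausdorff.
- exact: mSn.
- by move=> y Ky; split; [exact: KS|exact: Kn].
Qed.

Lemma goodcfg_sub (P Q : pred nat) x : (forall i, P i -> Q i) -> goodcfg Q x -> goodcfg P x.
Proof.
move=> PQ [xS fin]; split => [i /PQ|n]; first exact: xS.
apply: le_lt_trans (fin n); rewrite !unlabelE; apply: lee_nneseries => i *; first exact: mass_ge0.
by rewrite /mass; case: ifP => [/PQ -> //|_]; exact: mass_ge0.
Qed.

(** Infinitely many labels in [A] would make the partial sums exceed every integer. *)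
Lemma unlabel_fin P x A : (unlabel P x A < +oo)%E ->
  exists N, forall i, (N <= i)%N -> P i -> ~ A (x i).
Proof.
rewrite unlabelE => fin; apply: contrapT => /forallNP H.
suff : (forall k : nat, k%:R%:E <= \sum_(0 <= i <oo) mass P x A i)%E.
  move=> /(_ (Num.truncn (fine (\sum_(0 <= i <oo) mass P x A i))).+1).
  apply/negP; rewrite -ltNge -[ltLHS]fineK ?lte_fin ?truncnS_gt//.
  rewrite ge0_fin_numE//; apply: nneseries_ge0 => i _ _; exact: mass_ge0.
have key : forall k : nat, exists N, (k%:R%:E <= \sum_(0 <= i < N) mass P x A i)%E.
  elim=> [|k [N HN]]; first by exists 0; rewrite big_geq.
  have /existsNP[i /not_implyP[Ni /not_implyP[Pi /contrapT Ai]]] := H N.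
  exists i.+1; rewrite big_nat_recr//= {2}/mass Pi indicE mem_set//.
  rewrite -natr1 EFinD leeD// (le_trans HN)//; apply: lee_sum_nneg_natr => //.
  by move=> j _ _; exact: mass_ge0.
move=> k; have [N HN] := key k; apply: (le_trans HN).
by apply: nneseries_lim_ge => j _ _; exact: mass_ge0.
Qed.

End domain.
End configurations.

(** * The vague topology and measurability of the unlabelling map *)

(** The basic sets around [g] generate a filter that converges to [g] in every coordinate, hence for
    pointwise convergence; so it contains [U]. *)
Lemma ptws_open_basic {R : realType} {T : choiceType} (U : set {ptws T -> R})
    (g : {ptws T -> R}) : open U -> U g ->
  exists (F : seq T) (e : R), 0 < e /\
    forall g', (forall f, f \in F -> `|g' f - g f| < e) -> U g'.
Proof.
move=> oU Ug.
pose B (Fe : seq T * R) : set {ptws T -> R} :=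
  [set g' | forall f, f \in Fe.1 -> `|g' f - g f| < Fe.2].
pose Fl := filter_from [set Fe : seq T * R | 0 < Fe.2] B.
have FFl : Filter Fl.
  apply: filter_from_filter; first by exists ([::], 1) => /=.
  move=> [F e] [F' e'] /= e0 e'0; exists (F ++ F', Num.min e e').
    by rewrite /= lt_min e0.
  move=> g' /= Hg'; split => f fF; have := Hg' f; rewrite mem_cat fF ?orbT => /(_ isT);
    by rewrite lt_min => /andP[].
have Flg : {ptws, Fl --> g}.
  rewrite cvg_sup => f.
  rewrite cvg_image; last by rewrite eqEsubset; split=> v // _; exists (cst v).
  move=> W /= /nbhs_ballP[e /= e0 eW]; exists ((fun g' : T -> R => g' f) @^-1` W).
    exists ([:: f], e) => //= g' /(_ f); rewrite inE eqxx => /(_ isT) h.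
    by apply: eW; rewrite /ball /= distrC.
  by rewrite eqEsubset; split => [j [? + <-//]|j Wj]; exists (fun _ => j).
have : Fl U by apply: Flg; rewrite nbhsE /=; exists U.
by move=> [[F e] e0 BU]; exists F, e.
Qed.

Lemma ptws_basic_open {R : realType} {T : choiceType} (F : seq T) (g : T -> R) (e : R) :
  open [set g' : {ptws T -> R} | forall f, f \in F -> `|g' f - g f| < e].
Proof.
elim: F => [|f F IH].
  by rewrite (_ : [set _ | _] = setT); [exact: openT|apply/seteqP; split].
rewrite (_ : [set _ | _] = [set g' : {ptws T -> R} | `|g' f - g f| < e] `&`
   [set g' : {ptws T -> R} | forall f, f \in F -> `|g' f - g f| < e]).
  apply: openI => //.
  apply: (@open_comp {ptws T -> R} R (fun g' => g' f) [set y | `|y - g f| < e]).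
    by move=> g' _; exact: (@proj_continuous T (fun _ => R) f).
  rewrite (_ : [set y | _] = ball (g f) e); first exact: ball_open.
  by apply/seteqP; split => y; rewrite /ball /= distrC.
apply/seteqP; split => g' /=.
  move=> h; split; first by apply: h; rewrite inE eqxx.
  by move=> f' fF; apply: h; rewrite inE fF orbT.
by move=> [h1 h2] f'; rewrite inE => /orP[/eqP ->//|/h2].
Qed.

Lemma integral_support {dT} {T : measurableType dT} {R : realType}
    (mu : {measure set T -> \bar R}) (D B : set T) (g : T -> \bar R) :
  (forall x, D x -> ~ B x -> g x = 0%E) ->
  (\int[mu]_(x in D) g x = \int[mu]_(x in D `&` B) g x)%E.
Proof.
move=> g0; rewrite (integral_mkcond D) (integral_mkcond (D `&` B)); congr integral.
apply/funext => x; rewrite /patch in_setI; case: ifPn => //; rewrite inE => Dx.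
by case: ifPn => //; rewrite notin_setE => /(g0 _ Dx).
Qed.

Section vague.
Context {R : realType} {d : nat}.
Variable S : set 'rV[R]_d.
Hypothesis clS : closed S.
Hypothesis d_gt0 : (0 < d)%N.
Local Notation E := (borel 'rV[R]_d).

Let mS : measurable (S : set E). Proof. exact: borel_closed. Qed.

Let mSn n : measurable (S `&` eball n : set E).
Proof. by apply: borel_closed; apply: closedI => //; exact: closed_eball. Qed.

Lemma Cc_measurable f : Cc S f -> measurable_fun (S : set E) (f : E -> R).
Proof.
move=> [cf _] _; apply: (_ : measurable_fun (S : set E) (f : E -> R)) => //.
apply: (measurability _ (RGenOInfty.measurableE R)).
move=> _ [_ [r ->] <-]; move/continuousP : cf => /(_ `]r, +oo[%classic).
rewrite open_subspaceP => -[|V oV VE]; first exact: itv_open_ends_open.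
rewrite setIC -VE; apply: measurableI => //; exact: borel_open.
Qed.

Lemma Cc_bounded f : Cc S f -> exists n (M : R), [/\ 0 <= M,
  (forall x, S x -> `|f x| <= M) & (forall x, S x -> ~ eball n x -> f x = 0)].
Proof.
move=> [cf [K [cK KS f0]]]; have [n Kn] := compact_eball_sub cK.
have : compact (f @` K).
  by apply: continuous_compact => //; exact: continuous_subspaceW cf.
move=> /compact_bounded[M [_ HM]]; exists n, (`|M| + 1); split.
- by rewrite addr_ge0.
- move=> x Sx; have [Kx|nKx] := pselect (K x); last first.
    by rewrite f0// normr0 addr_ge0.
  apply: HM; last by exists x.
  by rewrite (le_lt_trans (ler_norm M))// ltrDl.
- by move=> x Sx nx; apply: f0 => // /Kn.
Qed.

(** A test function is bounded and vanishes outside a ball, to which [s] gives finite mass. *)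
Lemma Cc_integrable (s : cfg R d) f : config S s -> Cc S f ->
  s.-integrable (S : set E) (EFin \o (f : E -> R)).
Proof.
move=> [_ fin] Cf; have mf := Cc_measurable Cf.
have [n [M [M0 fM f0]]] := Cc_bounded Cf.
apply/integrableP; split; first exact/measurable_EFinP.
rewrite (@integral_support _ _ _ s _ (eball n)); last by move=> x Sx nx /=; rewrite f0// normr0.
apply: le_lt_trans (@integral_le_bound _ _ _ s (S `&` eball n : set E) (EFin \o f) M%:E _ _ _ _) _ => //.
- by apply/measurable_EFinP; apply: measurable_funS mf => // x [].
- by apply: aeW => x [Sx _]; rewrite lee_fin; exact: fM.
- rewrite lte_mul_pinfty ?lee_fin//; apply: fin; last by move=> x [].
  exact: compact_eball.
Qed.

Lemma vague_evalD (s t : cfg R d) (f : set_type (Cc S)) : config S s -> config S t ->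
  vague_eval (cfg_add s t) f = vague_eval s f + vague_eval t f.
Proof.
move=> cs ct; have Cf : Cc S (set_val f) := set_mem (valP f).
have is_ := Cc_integrable cs Cf; have it := Cc_integrable ct Cf.
rewrite /vague_eval /Rintegral (integral_measure_add mS is_ it).
by rewrite fineD//; apply: integrable_fin_num.
Qed.

(** Test functions supported in a ball do not see the configuration outside it; this localization
    reduces the vague topology to finitely many particles. *)
Lemma vague_eval_local (s t : cfg R d) (f : set_type (Cc S)) n :
  (forall x, S x -> ~ eball n x -> set_val f x = 0) ->
  (forall A : set E, measurable A -> A `<=` S `&` eball n -> s A = t A) ->
  vague_eval s f = vague_eval t f.
Proof.
move=> f0 st; rewrite /vague_eval /Rintegral; congr fine.
rewrite (@integral_support _ _ _ s _ (eball n)) => [|x Sx nx]; last by rewrite f0.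
rewrite (@integral_support _ _ _ t _ (eball n)) => [|x Sx nx]; last by rewrite f0.
exact: eq_measure_integral.
Qed.

Lemma vague_eval_dirac (y : 'rV[R]_d) (f : set_type (Cc S)) : S y ->
  vague_eval (delta (Some y) : cfg R d) f = set_val f y.
Proof.
move=> Sy; have Cf : Cc S (set_val f) := set_mem (valP f).
rewrite /vague_eval /Rintegral /= integral_dirac//; last first.
  by apply/measurable_EFinP; exact: Cc_measurable.
by rewrite diracE mem_set// mul1e.
Qed.

End vague.

Section vague.
Context {R : realType} {d : nat}.
Variable S : set 'rV[R]_d.
Hypothesis clS : closed S.
Local Notation E := (borel 'rV[R]_d).
Implicit Types (F : seq (set_type (Cc S))) (P : pred nat).

Let mS : measurable (S : set E). Proof. exact: borel_closed. Qed.

Let mSn n : measurable (S `&` eball n : set E).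
Proof. by apply: borel_closed; apply: closedI => //; exact: closed_eball. Qed.

Definition vague_nbhd F (e : R) (s : cfg R d) : set (cfg R d) :=
  config S `&` [set s' | forall f, f \in F -> `|vague_eval s' f - vague_eval s f| < e].

Lemma vague_open_basic V s : vague_open S V -> V s ->
  exists F e, 0 < e /\ vague_nbhd F e s `<=` V.
Proof.
move=> [U [V' oV' <-] <-] [_ V's].
have [F [e [e0 H]]] := ptws_open_basic oV' V's.
by exists F, e; split => // s' [cs' h]; split => //; exact: H.
Qed.

Lemma vague_nbhd_open F e s : vague_open S (vague_nbhd F e s).
Proof.
eexists; last reflexivity; eexists; first exact: (ptws_basic_open F (vague_eval s) e).
by [].
Qed.

Lemma Cc_common_support F : exists n, forall f, f \in F ->
  forall x, S x -> ~ eball n x -> set_val f x = 0.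
Proof.
elim: F => [|f F [n Hn]]; first by exists 0.
have [n' [M [_ _ Hf]]] := Cc_bounded (set_mem (valP f)).
exists (maxn n n') => g; rewrite inE => /orP[/eqP ->|gF] x Sx nx.
  by apply: Hf => // h; apply: nx; apply: eball_S h; exact: leq_maxr.
by apply: (Hn g) => // h; apply: nx; apply: eball_S h; exact: leq_maxl.
Qed.

(* The configurations that have a neighbourhood in [V] given by functions
   supported in the ball of radius [n]; these sets exhaust [V], and depend on
   the restriction of a configuration to that ball only. *)
Definition vague_core (V : set (cfg R d)) n : set (cfg R d) :=
  [set s | exists F e, [/\ 0 < e,
     forall f, f \in F -> forall x, S x -> ~ eball n x -> set_val f x = 0 &
     vague_nbhd F e s `<=` V]].

Lemma vague_coreP V s : vague_open S V -> config S s -> V s <-> exists n, vague_core V n s.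
Proof.
move=> oV cs; split => [Vs|[n [F [e [e0 _]]]]].
  have [F [e [e0 FV]]] := vague_open_basic oV Vs.
  by have [n Hn] := Cc_common_support F; exists n, F, e.
by apply; split => // f _; rewrite subrr normr0.
Qed.

Lemma vague_core_local V n (s t : cfg R d) :
  (forall A : set E, measurable A -> A `<=` S `&` eball n -> s A = t A) ->
  vague_core V n s -> vague_core V n t.
Proof.
move=> st [F [e [e0 F0 FV]]]; exists F, e; split => // s' [cs' h]; apply: FV.
split => // f fF; rewrite (vague_eval_local (F0 _ fF) st); exact: h.
Qed.

Lemma unlabel1 P (x : seqE R d) N (A : set E) :
  unlabel (fun i => P i && (i == N)) x A =
  (delta (if P N then Some (x N) else None) : cfg R d) A.
Proof.
rewrite unlabelE (@nneseriesD1 _ _ N) //; last by move=> *; exact: mass_ge0.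
rewrite eseries0 ?adde0.
  by rewrite /mass eqxx andbT; case: ifP.
by move=> i _ /= iN; rewrite /mass (negbTE iN) andbF.
Qed.

Lemma unlabel_ltS P N (x : seqE R d) :
  unlabel (fun i => P i && (i < N.+1)%N) x =
  cfg_add (unlabel (fun i => P i && (i < N)%N) x) (unlabel (fun i => P i && (i == N)) x).
Proof.
rewrite [LHS](@unlabel_split _ _ _ (fun i => i < N)%N); congr cfg_add;
  apply: eq_unlabel => // i; rewrite ltnS -andbA; congr andb.
  by apply/andP/idP => [[]//|h]; split => //; exact: ltnW.
by rewrite -leqNgt -eqn_leq.
Qed.

Lemma goodcfg_lt P N (x : seqE R d) : (forall i, P i -> S (x i)) ->
  goodcfg S (fun i => P i && (i < N)%N) x.
Proof.
move=> xS; split => [i /andP[/xS]//|n].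
elim: N => [|N IH].
  rewrite unlabelE eseries0 ?ltry// => i _ _.
  by rewrite /mass ltn0 andbF.
rewrite unlabel_ltS cfg_addE lte_add_pinfty// unlabel1.
by case: ifP => _ /=; rewrite ?diracE ?ltry// /mzero ltry.
Qed.

Lemma vague_eval_lt P N (x : seqE R d) (f : set_type (Cc S)) :
  (forall i, P i -> S (x i)) ->
  vague_eval (unlabel (fun i => P i && (i < N)%N) x) f =
  \sum_(i < N | P i) set_val f (x i).
Proof.
move=> xS; elim: N => [|N IH].
  rewrite big_ord0 /vague_eval /Rintegral.
  rewrite (@eq_measure_integral _ _ _ _ (@mzero _ E R)) ?integral_measure_zero//.
  move=> A mA _; rewrite unlabelE eseries0// => i _ _.
  by rewrite /mass ltn0 andbF.
rewrite unlabel_ltS vague_evalD//; last 2 first.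
- by apply/config_unlabel => //; exact: goodcfg_lt.
- apply/config_unlabel => //.
  by apply: (goodcfg_sub (Q := fun i => P i && (i < N.+1)%N)); [move=> i /andP[-> /eqP ->] /=|exact: goodcfg_lt].
rewrite IH big_mkcond [RHS]big_mkcond/= big_ord_recr/=; congr (_ + _).
transitivity (vague_eval (delta (if P N then Some (x N) else None) : cfg R d) f).
  rewrite /vague_eval /Rintegral; congr fine; apply: eq_measure_integral => A mA _.
  exact: unlabel1.
case: ifP => [PN|_]; first by rewrite vague_eval_dirac//; exact: xS.
by rewrite /vague_eval /Rintegral /= integral_measure_zero.
Qed.

Lemma measurable_proj i : measurable_fun [set: seqM R d] (fun x : seqM R d => (x : seqE R d) i : E).
Proof.
apply: measurable_fun_borel_matrix => j k; rewrite (ord1 j).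
exact: measurable_coord.
Qed.

Lemma measurable_unlabel_set P (A : set E) : measurable A ->
  measurable_fun [set: seqM R d] (fun x : seqM R d => unlabel P x A).
Proof.
move=> mA; under eq_fun do rewrite unlabelE.
apply: ge0_emeasurable_sum => i; first by move=> *; exact: mass_ge0.
move=> _; rewrite /mass; case: (P i) => //.
apply/measurable_EFinP; apply: (measurableT_comp (measurable_indic mA)).
exact: measurable_proj.
Qed.

Lemma measurable_goodcfg P : measurable (goodcfg S P : set (seqM R d)).
Proof.
have -> : goodcfg S P = \bigcap_i [set x : seqM R d | P i -> S ((x : seqE R d) i)] `&`
   \bigcap_n [set x : seqM R d | (unlabel P x (S `&` eball n) < +oo)%E].
  apply/seteqP; split => x [h1 h2]; first by split => i _ /=; [exact: h1|exact: h2].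
  by split => i; [exact: (h1 i I)|exact: (h2 i I)].
apply: measurableI; apply: bigcapT_measurable => i.
  case: (P i); last by rewrite (_ : [set _ | _] = setT)//; apply/seteqP; split.
  rewrite (_ : [set _ | _] = (fun x : seqM R d => (x : seqE R d) i : E) @^-1` S).
    by rewrite -[X in measurable X]setTI; exact: measurable_proj.
  by apply/seteqP; split => x /= => [/(_ isT)|].
rewrite -[X in measurable X]setTI; apply: emeasurable_fun_infty_o => //.
exact: measurable_unlabel_set.
Qed.

Lemma measurable_firstm m : measurable_fun [set: seqM R d]
  (fun x : seqM R d => firstm m x : borel 'M[R]_(m, d)).
Proof.
apply: measurable_fun_borel_matrix => i k; under eq_fun do rewrite /firstm mxE.
exact: measurable_coord.
Qed.

(* The finite partial configurations depend continuously on their points. *)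
Lemma measurable_core_lt P N V n : vague_open S V ->
  measurable ([set x : seqM R d | forall i, P i -> S ((x : seqE R d) i)] `&`
    [set x | vague_core V n (unlabel (fun i => P i && (i < N)%N) x)]).
Proof.
move=> oV; set D := [set x | _].
have mD : measurable D.
  have -> : D = \bigcap_i [set x : seqM R d | P i -> S ((x : seqE R d) i)].
    by apply/seteqP; split => x h i; [move=> _; exact: h|exact: (h i I)].
  apply: bigcapT_measurable => i.
  case: (P i); last by rewrite (_ : [set _ | _] = setT)//; apply/seteqP; split.
  rewrite (_ : [set _ | _] = (fun x : seqM R d => (x : seqE R d) i : E) @^-1` S).
    by rewrite -[X in measurable X]setTI; exact: measurable_proj.
  by apply/seteqP; split => x /= => [/(_ isT)|].
pose W := [set y : 'M[R]_(N, d) | forall x, D x -> firstm N x = y ->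
   vague_core V n (unlabel (fun i => P i && (i < N)%N) x)].
pose Good := [set y : 'M[R]_(N, d) | forall x, D x -> firstm N x = y ->
   vague_core V n (unlabel (fun i => P i && (i < N)%N) x)].
(* Within [D] the condition is open in the first [N] positions: it is the trace of the interior of
   [Good]. *)
have -> : D `&` [set x | vague_core V n (unlabel (fun i => P i && (i < N)%N) x)] =
    D `&` (fun x : seqM R d => firstm N x) @^-1` Good°.
  apply/seteqP; split => x [Dx]; last first.
    by move=> /interior_subset /(_ x Dx erefl).
  move=> [F [e [e0 F0 FV]]]; split => //; rewrite /= /interior /=.
  (* The truncation has at most [N] particles, and moving each changes a test value by less than
     [eta]; the total change stays below [e / 2]. *)
  pose eta := e / 2 / N.+1%:R.
  have eta0 : 0 < eta by rewrite !divr_gt0.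
  have near_f (f : set_type (Cc S)) (i : 'I_N) : \forall y \near nbhs (firstm N x),
     P i -> S (row i y) -> `|set_val f (row i y) - set_val f (x i)| < eta.
    have [Pi|nPi] := boolP (P i); last by near=> y.
    have [cf _] := set_mem (valP f).
    have /cvgrPdist_lt /(_ eta eta0) cfx := cf (x i).
    have : within S (nbhs (x i)) [set y | `|set_val f (x i) - set_val f y| < eta].
      by rewrite nbhs_subspace_in; [exact: cfx|exact: Dx].
    rewrite /within /= => /nbhs_ballP[r /= r0 rH]; apply/nbhs_ballP; exists r => // y [_ By] _ Sy.
    rewrite distrC; apply: rH => //; split => // j k; rewrite (ord1 j) mxE.
    by have := By i k; rewrite mxE.
  have near_F : \forall y \near nbhs (firstm N x), forall f, f \in F ->
     forall i : 'I_N, P i -> S (row i y) -> `|set_val f (row i y) - set_val f (x i)| < eta.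
    elim: (F) => [|f F' IH]; first by near=> y.
    have := @filter_forall _ 'I_N _ _ (nbhs_filter (firstm N x)) (near_f f); apply: filterS2 IH => y h1 h2 g.
    by rewrite inE => /orP[/eqP ->//|/h1].
  apply: filterS near_F => y Hy x' Dx' x'y.
  exists F, (e / 2); split => //; first by rewrite divr_gt0.
  move=> s [cs Hs]; apply: FV; split => // f fF.
  rewrite -(subrK (vague_eval (unlabel (fun i => P i && (i < N)%N) x') f) (vague_eval s f)).
  rewrite -addrA (le_lt_trans (ler_normD _ _))// (splitr e) ltrD ?Hs//.
  rewrite !vague_eval_lt// -sumrB (le_lt_trans (ler_norm_sum _ _ _))//.
  apply: (@le_lt_trans _ _ (\sum_(i < N | P i) eta)).
    apply: ler_sum => i Pi; rewrite -(row_firstm x' i) x'y ltW//; apply: Hy => //.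
    by rewrite -x'y row_firstm; exact: Dx'.
  rewrite sumr_const /eta -[X in X < _]mulr_natr -mulrA gtr_pMr ?divr_gt0//.
  rewrite mulrC ltr_pdivrMr// mul1r ltr_nat ltnS (leq_trans (max_card _))//.
  by rewrite card_ord.
apply: measurableI => //; rewrite -[X in measurable X]setTI.
apply: measurable_firstm => //; apply: borel_open; exact: open_interior.
Unshelve. all: end_near.
Qed.

(** Inside a ball a locally finite configuration has finitely many labels, so it lies in a vaguely
    open set exactly when, for some radius, all long enough truncations lie in the core. *)
Lemma measurable_unlabel P :
  measurable_fun (goodcfg S P : set (seqM R d)) (fun x : seqM R d => unlabel P x : cfgM S).
Proof.
apply: measurability; first by [].
move=> _ [V oV <-].
have -> : goodcfg S P `&` (fun x : seqM R d => unlabel P x) @^-1` V =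
  goodcfg S P `&` \bigcup_n \bigcup_M \bigcap_(N in [set N | (M <= N)%N])
   ([set x : seqM R d | forall i, P i -> S ((x : seqE R d) i)] `&`
    [set x | vague_core V n (unlabel (fun i => P i && (i < N)%N) x)]).
  have loc x n : goodcfg S P x -> exists M, forall N, (M <= N)%N ->
      forall A : set E, measurable A -> A `<=` S `&` eball n ->
       unlabel P x A = unlabel (fun i => P i && (i < N)%N) x A.
    move=> [xS fin]; have [M HM] := unlabel_fin (fin n); exists M => N MN A _ AS.
    rewrite !unlabelE; apply: eq_eseriesr => i _; rewrite /mass.
    case: (ltnP i N) => iN; rewrite ?andbT// andbF; case: ifP => // Pi.
    rewrite indicE memNset// => /AS; apply: HM => //; exact: leq_trans iN.
  apply/seteqP; split => x [gx].
    rewrite /= => /(vague_coreP oV ((config_unlabel clS P x).2 gx))[n Vx].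
    split => //; exists n => //; have [M HM] := loc x n gx; exists M => // N /= MN.
    split; first by case: gx.
    exact: vague_core_local (HM N MN) Vx.
  move=> [n _ [M' _ H]]; split => //=.
  apply/(vague_coreP oV ((config_unlabel clS P x).2 gx)); exists n.
  have [M HM] := loc x n gx; have [|_] := H (maxn M M'); first exact: leq_maxr.
  apply: vague_core_local => A mA AS; apply/esym; apply: HM => //; exact: leq_maxl.
apply: measurableI; first exact: measurable_goodcfg.
apply: bigcupT_measurable => n; apply: bigcupT_measurable => M.
apply: bigcap_measurable => [|N _]; first by exists M => /=.
exact: measurable_core_lt.
Qed.

End vague.

(** Replacing both functions by the constant [point] outside [D] makes them measurable on the whole
    space. *)
Lemma measurable_fun_pair_on {dT d1 d2} {T : measurableType dT} {T1 : measurableType d1}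
    {T2 : measurableType d2} (D : set T) (f : T -> T1) (g : T -> T2) :
  measurable_fun D f -> measurable_fun D g -> measurable_fun D (fun x => (f x, g x)).
Proof.
move=> mf mg mD Y mY.
pose f' x := if x \in D then f x else point.
pose g' x := if x \in D then g x else point.
have mif dd (U : measurableType dd) (h : T -> U) : measurable_fun D h ->
    measurable_fun [set: T] (fun x => if x \in D then h x else point).
  move=> mh _ Z mZ; rewrite setTI.
  rewrite (_ : _ @^-1` _ = (D `&` h @^-1` Z) `|` (if `[< Z point >] then ~` D else set0)).
    apply: measurableU; first exact: mh.
    by case: ifP => // _; exact: measurableC.
  apply/seteqP; split => x /=.
    case: ifPn => [|]; first by rewrite inE; left.
    by rewrite notin_setE => nD Zp; right; rewrite asboolT.
  move=> [[Dx Zx]|]; first by rewrite mem_set.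
  by case: asboolP => // Zp nD; rewrite memNset.
have := measurable_fun_pair (mif _ _ f mf) (mif _ _ g mg) measurableT mY.
rewrite setTI => /(measurableI _ _ mD); congr measurable.
by apply/seteqP; split => x /= [Dx]; rewrite mem_set.
Qed.

(** * Adding one particle to a configuration *)

Section vague_add.
Context {R : realType} {d : nat}.
Variable S : set 'rV[R]_d.
Hypothesis clS : closed S.
Local Notation E := (borel 'rV[R]_d).

Lemma vague_open_bigcup I (D : set I) (V : I -> set (cfg R d)) :
  (forall i, D i -> vague_open S (V i)) -> vague_open S (\bigcup_(i in D) V i).
Proof.
move=> oV.
have /choice[U HU] : forall i, exists U : set (initial_topology (@vague_eval R d S)), open U /\ (D i -> V i = config S `&` U).
  move=> i; have [Di|nDi] := pselect (D i); last by exists setT; split => //; exact: openT.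
  by have [U oU <-] := oV _ Di; exists U.
exists (\bigcup_(i in D) U i); first by apply: bigcup_open => i _; case: (HU i).
rewrite setI_bigcupr; apply: eq_bigcupr => i Di.
by case: (HU i) => _ /(_ Di).
Qed.

Lemma vague_openM (V : set (cfg R d)) : vague_open S V -> measurable (V : set (cfgM S)).
Proof. exact: sub_sigma_algebra. Qed.

Lemma measurable_config : measurable (config S : set (cfgM S)).
Proof.
apply: vague_openM; exists setT; last by rewrite setIT.
exact: openT.
Qed.

Lemma firstm1 (y : 'rV[R]_d) : firstm 1 (fun=> y) = y.
Proof. by apply/matrixP => i j; rewrite mxE (ord1 i). Qed.

Lemma vague_eval_unlabelm1 (y : 'rV[R]_d) (f : set_type (Cc S)) : S y ->
  vague_eval (unlabelm y : cfg R d) f = set_val f y.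
Proof.
move=> Sy; rewrite -[in LHS](firstm1 y) unlabelm_firstm.
rewrite (@eq_unlabel _ _ _ (fun i => predT i && (i < 1)%N) _ (fun=> y))//.
by rewrite vague_eval_lt// big_mkcond big_ord1.
Qed.

Lemma config_unlabelm m (y : 'M[R]_(m, d)) : (forall i, S (row i y)) -> config S (unlabelm y).
Proof.
move=> Sy.
pose x : seqE R d := fun j => if insub j is Some i then row (i : 'I_m) y else 0.
have <- : firstm m x = y.
  by apply/matrixP => i k; rewrite mxE /x valK mxE.
rewrite unlabelm_firstm.
rewrite (@eq_unlabel _ _ _ (fun i => (i < m)%N && (i < m)%N) _ x)//; last by move=> i; rewrite andbb.
apply/config_unlabel => //; apply: goodcfg_lt => i im.
by rewrite /x; case: insubP => [k _ _|]; [exact: Sy|rewrite im].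
Qed.

Lemma unlabelm1E (y : 'rV[R]_d) A : (unlabelm y : cfg R d) A = (\1_A y)%:E.
Proof.
rewrite -[in LHS](firstm1 y) unlabelm_firstm.
rewrite (@eq_unlabel _ _ _ (fun i => predT i && (i == 0)%N) _ (fun=> y))//; last first.
  by case.
by rewrite unlabel1 /= diracE indicE.
Qed.

(** The new particle is put in front of an enumeration of [s]. *)
Lemma config_add1 (u : 'rV[R]_d) (s : cfg R d) : S u -> config S s ->
  config S (cfg_add (unlabelm u) s).
Proof.
move=> Su [[y [yS yE]] fy]; split; last first.
  by move=> K cK KS; rewrite cfg_addE unlabelm1E lte_add_pinfty// ?ltry ?fy.
exists (fun j => if j is k.+1 then y k else Some u); split.
  by case=> [|j] v; [case=> <-|exact: yS].
apply: cfg_ext => A; rewrite cfg_addE yE unlabelm1E /point_measure /= /mseries.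
rewrite [RHS]nneseries_recl//=.
rewrite diracE indicE -(@nneseries_addn _ _ 1)/=; last by move=> k; exact: measure_ge0.
by congr (_ + _)%E; apply: eq_eseriesr => k _; rewrite addn1.
Qed.

Lemma extend1P (A : set (cfg R d)) (p : 'rV[R]_d * cfg R d) :
  extend S A p <-> [/\ S p.1, config S p.2 & A (cfg_add (unlabelm p.1) p.2)].
Proof.
have rE i : row i p.1 = p.1 by apply/rowP => k; rewrite mxE (ord1 i).
split=> -[h1 h2 h3]; split => //; first by rewrite -(rE ord0).
by move=> i; rewrite rE.
Qed.

Let D0 : set (E * cfgM S) := (S : set E) `*` (config S : set (cfgM S)).

Let mD0 : measurable D0.
Proof. by apply: measurableX; [exact: borel_closed|exact: measurable_config]. Qed.

(** For each rational box the second factor is the union of all vaguely open sets that work with it;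
    the preimage of an open set is then a countable union of rectangles. *)
Lemma measurable_cfg_add1 : measurable_fun D0 (fun p => cfg_add (unlabelm p.1) p.2 : cfgM S).
Proof.
apply: measurability; first by [].
move=> _ [V oV <-].
pose box (qr : 'rV[rat]_d * rat) : set 'rV[R]_d :=
  [set x | forall i j, `|x i j - ratr (qr.1 i j)| < ratr qr.2].
pose VB qr := \bigcup_(V' in [set V' | vague_open S V' /\ forall x s, S x -> box qr x -> V' s ->
   V (cfg_add (unlabelm x) s)]) V'.
have obox qr : open (box qr).
  rewrite openE => y Hy.
  apply: (@filter_forall _ 'I_1 (fun i => [set x : 'rV[R]_d | forall j, `|x i j - ratr (qr.1 i j)| < ratr qr.2]) _ (nbhs_filter y)) => i.
  apply: (@filter_forall _ 'I_d (fun j => [set x : 'rV[R]_d | `|x i j - ratr (qr.1 i j)| < ratr qr.2]) _ (nbhs_filter y)) => j.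
  have := @coord_continuous R 1 d i j y [set v | `|v - ratr (qr.1 i j)| < ratr qr.2].
  apply; rewrite (_ : [set v | _] = ball (ratr (qr.1 i j) : R) (ratr qr.2)).
    by apply: open_nbhs_nbhs; split; [exact: ball_open|rewrite /ball /= distrC; exact: Hy].
  by apply/seteqP; split => v; rewrite /ball /= distrC.
have -> : D0 `&` (fun p => cfg_add (unlabelm p.1) p.2) @^-1` V =
  \bigcup_(qr in [set: 'rV[rat]_d * rat])
     (((S `&` box qr) : set E) `*` (VB qr : set (cfgM S))).
  apply/seteqP; split => -[x s] /=; last first.
    move=> [qr _ [/= [Sx bx] [V' [oV' HV'] V's]]]; split; last exact: HV' V's.
    by split => //=; case: oV' => U _ UV'; move: V's; rewrite -UV' => -[].
  move=> [[/= Sx cs] Vxs].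
  have [F [e [e0 FV]]] := vague_open_basic oV Vxs.
  have near_F : \forall y \near nbhs x, forall f, f \in F -> S y ->
      `|set_val f y - set_val f x| < e / 2.
    elim: (F) => [|f F' IH]; first by near=> y.
    have [cf _] := set_mem (valP f).
    have e20 : 0 < e / 2 by rewrite divr_gt0.
    have /cvgrPdist_lt /(_ (e / 2) e20) cfx := cf x.
    have : within S (nbhs x) [set y | `|set_val f x - set_val f y| < e / 2].
      by rewrite nbhs_subspace_in; [exact: cfx|exact: Sx].
    apply: filterS2 IH => y h1 h2 g; rewrite inE => /orP[/eqP -> Sy|/h1//].
    by rewrite distrC; exact: h2.
  have [qr bx bF] : exists2 qr, box qr x & forall y, box qr y -> forall f, f \in F -> S y ->
      `|set_val f y - set_val f x| < e / 2.
    have [r r0 rH] := (@nbhs_ballP _ _ _ _).1 near_F.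
    have [q] : exists q : rat, ratr q \in `]0, r / 2[.
      by apply: rat_in_itvoo; rewrite divr_gt0.
    rewrite in_itv /= => /andP[q0 q1].
    have /choice[c Hc] : forall j : 'I_d, exists c : rat, `|x 0 j - ratr c| < ratr q.
      move=> j; have [c] : exists c : rat, ratr c \in `](x 0 j - ratr q), (x 0 j)[.
        by apply: rat_in_itvoo; lra.
      by rewrite in_itv /= => /andP[c0 c1]; exists c; rewrite ltr_norml; apply/andP; split; lra.
    exists (\row_j c j, q); first by move=> i j; rewrite (ord1 i) mxE; exact: Hc.
    move=> y Hy; apply: rH; split => // i j; rewrite (ord1 i) /ball /=.
    have := Hy 0 j; have := Hc j; rewrite /= mxE => h1 h2.
    by rewrite -(subrK (ratr (c j)) (x 0 j)) -addrA (le_lt_trans (ler_normD _ _))//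
      (distrC (ratr _)); lra.
  exists qr => //; split => //=.
  (* Half of the tolerance goes to the configuration, the other half to the added particle. *)
  exists (vague_nbhd F (e / 2) s); last first.
    by split => // f _; rewrite subrr normr0 divr_gt0.
  split; first exact: vague_nbhd_open.
  move=> y t Sy By [ct Ht]; apply: FV; split.
    exact: config_add1.
  have cu z : S z -> config S (unlabelm z : cfg R d).
    move=> Sz; apply: config_unlabelm => i.
    by rewrite (_ : row i z = z)//; apply/rowP => k; rewrite mxE (ord1 i).
  move=> f fF; rewrite !vague_evalD//; [|exact: cu|exact: cu].
  rewrite !vague_eval_unlabelm1//.
  rewrite opprD addrACA (le_lt_trans (ler_normD _ _))// (splitr e) ltrD//.
    exact: bF.
  exact: Ht.
apply: countable_bigcupT_measurable; first exact: countableP.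
move=> qr; apply: measurableX.
  by apply: measurableI; [exact: borel_closed|exact: borel_open].
by apply: vague_openM; apply: vague_open_bigcup => V' [].
Unshelve. all: end_near.
Qed.

Lemma measurable_extend1 (A : set (cfg R d)) : measurable (A : set (cfgM S)) ->
  measurable (extend S A : set (E * cfgM S)).
Proof.
move=> mA; have := measurable_cfg_add1 mD0 mA; congr measurable.
by apply/seteqP; split => p; rewrite extend1P; [move=> [[]]|move=> []].
Qed.

End vague_add.

(** * Tame sets as measurable conditions on labelled sequences *)

(** A strict bound on an infimum over infinitely many distances is not the conjunction of the strict
    bounds; the margin [1/(k+1)] turns it into a countable union of countable intersections. *)
Lemma ereal_inf_gtP {R : realType} (A : set (\bar R)) (c : R) :
  (c%:E < ereal_inf A)%E <->
  exists k : nat, forall e, A e -> ((c + k.+1%:R^-1)%:E <= e)%E.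
Proof.
split; last first.
  move=> [k Hk]; apply: (@lt_le_trans _ _ (c + k.+1%:R^-1)%:E).
    by rewrite lte_fin ltrDl invr_gt0.
  exact: le_ereal_inf_tmp.
case El : (ereal_inf A) => [l| |]//.
  rewrite lte_fin => cl; have lc : 0 < l - c by rewrite subr_gt0.
  have [k _ /(_ k (leqnn k)) /= kl] := near_infty_natSinv_lt (PosNum lc).
  exists k => e Ae; apply: (@le_trans _ _ l%:E); last by rewrite -El; exact: ereal_inf_lbound.
  by rewrite lee_fin -lerBrDl ltW.
by move=> _; exists 0 => e Ae; rewrite (@le_trans _ _ +oo%E) ?leey// -El; exact: ereal_inf_lbound.
Qed.

Section tame.
Context {R : realType} {d : nat}.
Variable S : set 'rV[R]_d.
Hypothesis clS : closed S.
Local Notation E := (borel 'rV[R]_d).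
Variable a : nat -> nat -> nat.

Lemma unlabel_eq0 (P : pred nat) (x : seqE R d) (A : set 'rV[R]_d) : (forall i, P i -> ~ A (x i)) -> unlabel P x A = 0%E.
Proof.
move=> nA; rewrite unlabelE eseries0// => i _ _; rewrite /mass; case: ifP => // /nA h.
by rewrite indicE memNset.
Qed.

Lemma atoms_unlabel (P : pred nat) (x : seqE R d) z : atoms (unlabel P x) z <-> exists2 j, P j & z = x j.
Proof.
split; rewrite /atoms /=; last first.
  move=> [j Pj ->]; rewrite gt_eqF// (@lt_le_trans _ _ 1%E)// (@unlabel_ge _ _ _ _ _ j)//.
move=> /eqP h; apply: contrapT => nz; apply: h; apply: unlabel_eq0 => i Pi /= xz.
by apply: nz; exists i.
Qed.

Lemma config_infinite_unlabel (x : seqE R d) : goodcfg S predT x ->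
  config_infinite S (unlabel predT x).
Proof.
move=> gx; split; first exact/config_unlabel.
apply: contrapT => /eqP; rewrite -ltey => /unlabel_fin[N /(_ N (leqnn N) isT)].
by apply; case: gx => + _; exact.
Qed.

(** The atoms are the labels themselves, so simplicity is tested at the countably many points [x i];
    a sequence of labels in [S] always has infinite mass. *)
Lemma config_si_unlabel (x : seqE R d) : config_si S (unlabel predT x) <->
  goodcfg S predT x /\ forall i, (unlabel predT x [set x i] <= 1)%E.
Proof.
split.
  move=> [[/(config_unlabel clS) gx H] _]; split => // i; apply: H.
  by case: gx => + _; exact.
move=> [gx H]; split; last exact: config_infinite_unlabel.
split; first exact/config_unlabel.
move=> z Sz; have [|] := pselect (atoms (unlabel predT x) z).
  by move=> /atoms_unlabel[j _ ->]; exact: H.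
by move=> /negP/negPn/eqP ->.
Qed.

Section hop.
Variable m : nat.

Definition hop p q r : set (seqE R d) :=
  [set x | Hopen S a p q r (firstm m x, unlabel (from m) x)].

Lemma goodcfg_env (x : seqE R d) : (forall i : 'I_m, S (row i (firstm m x))) ->
  config S (unlabel (from m) x) -> goodcfg S predT x.
Proof.
move=> Sx /(config_unlabel clS)[xS fin]; split => [i _|n].
  case: (ltnP i m) => im; last exact: xS.
  by have := Sx (Ordinal im); rewrite row_firstm.
rewrite -(cfg_add_env m) cfg_addE lte_add_pinfty//.
have : config S (unlabelm (firstm m x)) by exact: config_unlabelm.
by case=> _; apply; [exact: compact_eball|move=> y []].
Qed.

(** A form in which each clause is a countable combination of measurable conditions on
    coordinates. *)
Lemma hopP p q r x : hop p q r x <->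
  [/\ goodcfg S predT x /\ (forall i, unlabel predT x [set x i] <= 1)%E,
      forall i : 'I_m, enorm (x i) < r%:R,
      exists k : nat, forall i j : 'I_m, i != j -> 2 ^- p + k.+1%:R^-1 <= enorm (x i - x j),
      exists k : nat, forall (i : 'I_m) j, (m <= j)%N -> 2 ^- p + k.+1%:R^-1 <= enorm (x i - x j) &
      forall r', (0 < r')%N -> (unlabel (from m) x (S `&` eball r') <= (aplus a q r')%:R%:E)%E].
Proof.
rewrite /hop /Hopen /extend /Spr_open /Kset /=; rewrite cfg_add_env.
split.
  move=> [[h1 h2 /config_si_unlabel h3] [[h4 /ereal_inf_gtP[k Hk] /ereal_inf_gtP[k' Hk']] [_ h5]]].
  split => //.
  - by move=> i; have [_] := h4 i; rewrite row_firstm.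
  - by exists k => i j ij; rewrite -lee_fin; apply: Hk; exists i, j; rewrite !row_firstm.
  - exists k' => i j mj; rewrite -lee_fin; apply: Hk'; exists i, (x j); rewrite !row_firstm.
    by split => //; apply/atoms_unlabel; exists j.
move=> [[gx h3] h4 [k Hk] [k' Hk'] h5].
have cE : config S (unlabel (from m) x).
  by apply/config_unlabel => //; apply: goodcfg_sub gx.
split; split => //.
- by move=> i; rewrite row_firstm; case: gx => + _; exact.
- exact/config_si_unlabel.
split => //.
- by move=> i; rewrite row_firstm; split; [case: gx => + _; exact|exact: h4].
- by apply/ereal_inf_gtP; exists k => _ [i [j [ij ->]]]; rewrite lee_fin !row_firstm; exact: Hk.
- apply/ereal_inf_gtP; exists k' => _ [i [z [/atoms_unlabel[j mj ->] ->]]].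
  by rewrite lee_fin !row_firstm; exact: Hk'.
Qed.

Lemma measurable_dist_ge (c : R) i j :
  measurable [set x : seqM R d | c <= enorm ((x : seqE R d) i - (x : seqE R d) j)].
Proof.
have -> : [set x : seqM R d | c <= enorm ((x : seqE R d) i - (x : seqE R d) j)] =
  ~` (setT `&` (fun x : seqM R d => (x : seqE R d) i - (x : seqE R d) j) @^-1` [set y | enorm y < c]).
  apply/seteqP; split => x /=; first by move=> h [_]; rewrite /preimage /= ltNge h.
  by move=> h; rewrite leNgt; apply/negP => h'; apply: h.
apply: measurableC; apply: measurable_open_matrix => //.
  move=> i' k; rewrite (ord1 i').
  rewrite (_ : (fun w : seqM R d => _) =
     (fun x : seqM R d => (x : seqE R d) i 0 k - (x : seqE R d) j 0 k)).
    by apply: measurable_funB; exact: measurable_coord.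
  by apply/funext => x; rewrite !mxE.
have -> : [set y : 'rV[R]_d | enorm y < c] = enorm @^-1` [set t | t < c] by [].
apply: open_comp; [by move=> y _; exact: continuous_enorm|exact: open_lt].
Qed.

Lemma measurable_norm_lt (c : R) i :
  measurable [set x : seqM R d | enorm ((x : seqE R d) i) < c].
Proof.
have mU : measurable ([set y | enorm y < c] : set E).
  apply: borel_open.
  have -> : [set y : 'rV[R]_d | enorm y < c] = enorm @^-1` [set t | t < c] by [].
  apply: open_comp; [by move=> y _; exact: continuous_enorm|exact: open_lt].
by have := @measurable_proj R d i measurableT _ mU; rewrite setTI.
Qed.

Lemma measurable_multiplicity i :
  measurable_fun [set: seqM R d] (fun x : seqM R d => unlabel predT x [set (x : seqE R d) i]).
Proof.
under eq_fun do rewrite unlabelE.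
apply: ge0_emeasurable_sum => j; first by move=> *; exact: mass_ge0.
move=> _; rewrite /mass /=; apply/measurable_EFinP.
have -> : (fun x : seqM R d => \1_[set (x : seqE R d) i] ((x : seqE R d) j)) =
  \1_[set x : seqM R d | (x : seqE R d) j = (x : seqE R d) i] :> (_ -> R).
  by apply/funext => x; rewrite !indicE; congr (_%:R); apply: congr1; apply/idP/idP; rewrite !inE.
apply: measurable_indic.
have -> : [set x : seqM R d | (x : seqE R d) j = (x : seqE R d) i] =
  \bigcap_(k in [set: 'I_d]) [set x : seqM R d | (x : seqE R d) j 0 k - (x : seqE R d) i 0 k = 0].
  apply/seteqP; split => x /=; first by move=> xji k _ /=; rewrite xji subrr.
  by move=> h; apply/rowP => k; apply/eqP; rewrite -subr_eq0; apply/eqP; exact: h.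
apply: fin_bigcap_measurable; first exact: finite_finset.
move=> k _.
have := measurable_funB (@measurable_coord R d j k) (@measurable_coord R d i k).
by move=> /(_ measurableT _ (measurable_set1 0)); rewrite setTI.
Qed.

Lemma measurable_hop p q r : measurable (hop p q r : set (seqM R d)).
Proof.
have -> : hop p q r = (goodcfg S predT `&` \bigcap_i [set x : seqM R d | unlabel predT x [set (x : seqE R d) i] <= 1]%E) `&`
  (\bigcap_(i in [set: 'I_m]) [set x : seqM R d | enorm ((x : seqE R d) i) < r%:R]) `&`
  (\bigcup_k \bigcap_(ij in [set ij : 'I_m * 'I_m | ij.1 != ij.2])
    [set x : seqM R d | 2 ^- p + k.+1%:R^-1 <= enorm ((x : seqE R d) ij.1 - (x : seqE R d) ij.2)]) `&`
  (\bigcup_k \bigcap_(i in [set: 'I_m]) \bigcap_(j in [set j | (m <= j)%N])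
    [set x : seqM R d | 2 ^- p + k.+1%:R^-1 <= enorm ((x : seqE R d) i - (x : seqE R d) j)]) `&`
  \bigcap_(r' in [set r' | (0 < r')%N])
    [set x : seqM R d | unlabel (from m) x (S `&` eball r') <= (aplus a q r')%:R%:E]%E.
  apply/seteqP; split => x.
    move=> /hopP[[gx h1] h2 [k Hk] [k' Hk'] h5].
    split; last by move=> r' r0; exact: h5.
    split; last by exists k' => // i _ j mj; exact: Hk'.
    split; last by exists k => // -[i j] /=; exact: Hk.
    by split; [split => // i _; exact: h1|move=> i _; exact: h2].
  move=> [[[[[gx h1] h2] [k _ Hk]] [k' _ Hk']] h5]; apply/hopP; split => //.
  - by split => // i; exact: h1.
  - by move=> i; exact: h2.
  - by exists k => i j ij; exact: (Hk (i, j)).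
  - by exists k' => i j mj; exact: (Hk' i I j).
have leM f (c : \bar R) : measurable_fun [set: seqM R d] f -> measurable [set x : seqM R d | (f x <= c)%E].
  by move=> mf; rewrite -[X in measurable X]setTI; exact: emeasurable_fun_infty_c.
apply: measurableI; [apply: measurableI; [apply: measurableI; [apply: measurableI|]|]|].
- apply: measurableI; first exact: measurable_goodcfg.
  by apply: bigcapT_measurable => i; apply: leM; exact: measurable_multiplicity.
- apply: fin_bigcap_measurable => [|i _]; [exact: finite_finset|exact: measurable_norm_lt].
- apply: bigcupT_measurable => k; apply: fin_bigcap_measurable => [|i _]; first exact: finite_finset.
  exact: measurable_dist_ge.
- apply: bigcupT_measurable => k; apply: fin_bigcap_measurable => [|i _]; first exact: finite_finset.
  apply: bigcap_measurable => [|j _]; first by exists m => /=.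
  exact: measurable_dist_ge.
- apply: bigcap_measurable => [|r' _]; first by exists 1.
  apply: leM; apply: measurable_unlabel_set.
  by apply: borel_closed; apply: closedI => //; exact: closed_eball.
Qed.

Definition hall : set (seqE R d) :=
  [set x | exists p q r, [/\ (0 < p)%N, (0 < q)%N, (0 < r)%N & hop p q r x]].

Lemma measurable_hall : measurable (hall : set (seqM R d)).
Proof.
have -> : hall = \bigcup_p \bigcup_q \bigcup_r (hop p.+1 q.+1 r.+1).
  apply/seteqP; split => x.
    by move=> [[|p] [[|q] [[|r] [//]]]] _ _ _ h; exists p => //; exists q => //; exists r.
  by move=> [p _ [q _ [r _ h]]]; exists p.+1, q.+1, r.+1.
by do 3![apply: bigcupT_measurable => ?]; exact: measurable_hop.
Qed.

Lemma hall_goodcfg x : hall x -> goodcfg S predT x.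
Proof. by move=> [p [q [r [_ _ _ /hopP[[]]]]]]. Qed.

End hop.

(** [b] is Borel only where particle and rest add up to an element of [Ssde]; on [hall] this holds
    because tame pairs are mapped into [Ssde]. *)
Lemma measurable_coefficient m (Ssde : set (cfg R d)) (b : 'rV[R]_d -> cfg R d -> 'rV[R]_d)
  (i : 'I_m) (k : 'I_d) :
  measurable (Ssde : set (cfgM S)) -> borel_coef S Ssde b ->
  (forall xs : 'M[R]_(m, d) * cfg R d, Hall S a xs -> Ssde (cfg_add (unlabelm xs.1) xs.2)) ->
  measurable_fun (hall m : set (seqM R d))
    (fun x : seqM R d => b ((x : seqE R d) i) (unlabel (but i) x) 0 k).
Proof.
move=> mSsde mb hS.
have mE := measurable_extend1 clS mSsde.
have sub x : hall m x -> extend S Ssde ((x : seqE R d) i, unlabel (but i) x).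
  move=> hx; have gx := hall_goodcfg hx; apply/extend1P; split => /=.
  - by case: gx => + _; exact.
  - by apply/config_unlabel => //; apply: goodcfg_sub gx.
  rewrite (_ : cfg_add _ _ = unlabel predT x).
    rewrite -(cfg_add_env m); apply: (hS (firstm m x, unlabel (from m) x)).
    by case: hx => p [q [r [p0 q0 r0 hx]]]; exists p, q, r.
  apply: cfg_ext => A; rewrite cfg_addE unlabelm1E !unlabelE.
  rewrite [RHS](@nneseriesD1 _ _ i)//; last by move=> *; exact: mass_ge0.
  by congr (_ + _)%E; rewrite [RHS]eseries_mkcond; apply: eq_eseriesr => j _; rewrite /mass /but /=.
have mpair : measurable_fun (hall m : set (seqM R d))
   (fun x : seqM R d => ((x : seqE R d) i : E, unlabel (but i) x : cfgM S)).
  apply: measurable_fun_pair_on; first by apply: measurable_funTS; exact: measurable_proj.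
  apply: (measurable_funS (measurable_goodcfg clS (but i))); last exact: measurable_unlabel.
  by move=> x hx; exact: goodcfg_sub (hall_goodcfg hx).
have mbk : measurable_fun (extend S Ssde : set (E * cfgM S)) (fun p => b p.1 p.2 0 k : R).
  by apply: (measurableT_comp (@measurable_entry R 1 d 0 k)); exact: mb.
apply: (measurable_comp mE _ mbk mpair).
by move=> _ [x hx <-]; exact: sub.
Qed.

Lemma measurable_bound m p q r (f : 'M[R]_(m, d) -> cfg R d -> R) :
  measurable_fun
       [set xs : borel 'M[R]_(m, d) * cfgM S |
          (forall i, S (row i (xs.1 : 'M[R]_(m, d)))) /\ config S xs.2]
       (fun xs => f xs.1 xs.2) ->
  measurable_fun (hop m p q r : set (seqM R d))
    (fun x : seqM R d => f (firstm m x) (unlabel (from m) x)).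
Proof.
move=> mf; set D := [set xs | _] in mf.
have mD : measurable D.
  have -> : D = (\bigcap_(i in [set: 'I_m]) [set y : borel 'M[R]_(m, d) | S (row i (y : 'M[R]_(m, d)))]) `*` (config S : set (cfgM S)).
    by apply/seteqP; split => -[y s] /= [h1 h2]; split => //= i; first (by move=> _; exact: h1); exact: h1.
  apply: measurableX; last exact: measurable_config.
  apply: fin_bigcap_measurable => [|i _]; first exact: finite_finset.
  rewrite -[X in measurable X]setTI; apply: (_ : measurable_fun setT (fun y : borel 'M[R]_(m, d) => row i (y : 'M[R]_(m, d)) : E)) => //.
    apply: measurable_fun_borel_matrix => i' k; under eq_fun do rewrite mxE.
    exact: measurable_entry.
  exact: borel_closed.
have hg x : hop m p q r x -> goodcfg S predT x by move=> /hopP[[]].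
apply: (measurable_comp mD _ mf (f := fun xs : borel 'M[R]_(m, d) * cfgM S => f xs.1 xs.2) (g := fun x : seqM R d => (firstm m x, unlabel (from m) x))).
  move=> _ [x /hg gx <-]; split => /=.
    by move=> i; rewrite row_firstm; case: gx => + _; exact.
  by apply/config_unlabel => //; exact: goodcfg_sub gx.
apply: measurable_fun_pair_on; first by apply: measurable_funTS; exact: measurable_firstm.
apply: (measurable_funS (measurable_goodcfg clS (from m))); last exact: measurable_unlabel.
by move=> x /hg; exact: goodcfg_sub.
Qed.

End tame.

(** * Gaussian moments and independent increments *)

Section normal_moments.
Context {R : realType}.
Local Notation mu := (@lebesgue_measure R).

Lemma normal_pdf_sym (s x : R) : s != 0 -> normal_pdf 0 s (- x) = normal_pdf 0 s x.
Proof. by move=> s0; rewrite !normal_pdfE// /normal_fun !subr0 sqrrN. Qed.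

Lemma normal_prob_sym (s : R) (D : set R) : s != 0 -> measurable D ->
  normal_prob 0 s (-%R @^-1` D) = normal_prob 0 s D.
Proof.
move=> s0 mD; rewrite /normal_prob.
have mN : measurable_fun setT (-%R : measurableTypeR R -> measurableTypeR R) by exact: oppr_measurable.
transitivity (\int[pushforward mu (-%R : R -> measurableTypeR R)]_(x in D) (normal_pdf 0 s x)%:E)%E; last first.
  by apply: eq_measure_integral => A mA _; exact: lebesgue_measureN.
rewrite (ge0_integral_pushforward mN)//; last 2 first.
- by apply/measurable_EFinP; apply: measurable_funTS; exact: measurable_normal_pdf.
- by move=> x _; rewrite lee_fin normal_pdf_ge0.
by apply: eq_integral => x _ /=; rewrite normal_pdf_sym.
Qed.

(** The second moment of a normal law enters only through an upper bound; this constant comes from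
    the comparison of densities in [sqr_normal_pdf]. *)
Definition secmom : R := 4 * Num.sqrt 2.

Lemma secmom_ge0 : 0 <= secmom.
Proof. by rewrite mulr_ge0. Qed.

(** With [y = x^2 / (4 s^2)] the density of variance [s^2] is a multiple of
    [expR (- y) * expR (- y)], that of variance [2 s^2] a multiple of [expR (- y)], and
    [y * expR (- y) <= 1]. The factor 4 comes from [y], the square root of 2 from the ratio of the
    peaks. *)
Lemma sqr_normal_pdf (s x : R) : 0 < s ->
  x ^+ 2 * normal_pdf 0 s x <= secmom * s ^+ 2 * normal_pdf 0 (Num.sqrt 2 * s) x.
Proof.
move=> s0; have s2 : 0 < Num.sqrt 2 * s by rewrite mulr_gt0// sqrtr_gt0.
rewrite !normal_pdfE ?gt_eqF// /normal_peak /normal_fun !subr0.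
have -> : (Num.sqrt 2 * s) ^+ 2 = 2 * s ^+ 2 by rewrite exprMn sqr_sqrtr.
have -> : 2 * s ^+ 2 * pi *+ 2 = 2 * (s ^+ 2 * pi *+ 2) by rewrite -mulrA mulrnAr.
rewrite sqrtrM//; set A := Num.sqrt (s ^+ 2 * pi *+ 2).
have A0 : 0 < A by rewrite sqrtr_gt0 pmulrn_lgt0// mulr_gt0 ?pi_gt0 ?exprn_gt0.
pose y := x ^+ 2 / (4 * s ^+ 2).
have sn : s != 0 by rewrite gt_eqF.
have -> : - x ^+ 2 / (s ^+ 2 *+ 2) = - y + - y by rewrite /y; field.
have -> : - x ^+ 2 / (2 * s ^+ 2 *+ 2) = - y by rewrite /y; field.
have xE : x ^+ 2 = 4 * s ^+ 2 * y by rewrite /y; field.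
rewrite expRD xE /secmom.
have q2 : Num.sqrt 2 != 0 :> R by rewrite gt_eqF// sqrtr_gt0.
have -> : 4 * Num.sqrt 2 * s ^+ 2 * ((Num.sqrt 2 * A)^-1 * expR (- y)) =
   4 * s ^+ 2 * A^-1 * expR (- y).
  by field; rewrite q2 gt_eqF.
rewrite [leLHS](_ : _ = 4 * s ^+ 2 * A^-1 * expR (- y) * (y * expR (- y))); last by ring.
rewrite ler_piMr//.
  by rewrite !mulr_ge0 ?expR_ge0 ?invr_ge0 ?sqr_ge0// ltW.
rewrite expRN ler_pdivrMr ?expR_gt0// mul1r (le_trans _ (expR_ge1Dx _))//.
by rewrite lerDr.
Qed.

(** The truncation at [M] makes the integrand integrable, as the change of variables demands; the
    bound does not depend on [M]. *)
Lemma normal_truncated_moment (s M : R) : 0 < s -> 0 <= M ->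
  (\int[normal_prob 0 s]_x (Num.min (x ^+ 2) M)%:E <= (secmom * s ^+ 2)%:E)%E.
Proof.
move=> s0 M0; pose f x := (Num.min (x ^+ 2) M)%:E.
have mf : measurable_fun [set: R] (fun x : R => Num.min (x ^+ 2) M).
  by apply: measurable_minr => //; exact: exprn_measurable.
have f0 x : 0 <= Num.min (x ^+ 2) M by rewrite le_min sqr_ge0 ?ler0n.
have intf : (normal_prob 0 s).-integrable setT f.
  apply: measurable_bounded_integrable => //.
    by rewrite (le_lt_trans (probability_le1 _ _)) ?ltry.
  exists M; split; [exact: num_real|move=> N MN x _ /=]; rewrite ger0_norm//.
  by rewrite ge_min (ltW MN) orbT.
have dom : normal_prob 0 s `<< mu by exact: normal_prob_dominates.
have -> : (\int[normal_prob 0 s]_x f x = \int[mu]_x (f x * (normal_pdf 0 s x)%:E))%E.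
  rewrite -(Radon_Nikodym_change_of_variables dom)//=.
  apply: ae_eq_integral => //.
  - apply: emeasurable_funM; first exact/measurable_EFinP.
    apply: (measurable_int mu); apply: Radon_Nikodym_integrable; exact: dom.
  - apply: emeasurable_funM; apply/measurable_EFinP => //; exact: measurable_normal_pdf.
  - apply: ae_eqe_mul2l => /=.
    rewrite Radon_NikodymE/=; case: cid => /= h [h1 h2 h3].
    apply: integral_ae_eq => //=.
    + by apply/measurable_EFinP; exact: measurable_normal_pdf.
    + by move=> E _ mE; rewrite -h3.
apply: (@le_trans _ _ (\int[mu]_x ((secmom * s ^+ 2)%:E * (normal_pdf 0 (Num.sqrt 2 * s) x)%:E)))%E.
  apply: ge0_le_integral => //.
  - by move=> x _; rewrite mule_ge0 ?lee_fin ?normal_pdf_ge0.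
  - apply: emeasurable_funM; apply/measurable_EFinP => //; exact: measurable_normal_pdf.
  - by apply: emeasurable_funM => //; apply/measurable_EFinP; exact: measurable_normal_pdf.
  - move=> x _; rewrite -!EFinM lee_fin; apply: le_trans (sqr_normal_pdf _ s0).
    by rewrite ler_wpM2r ?normal_pdf_ge0// ge_min lexx.
rewrite ge0_integralZl//; last 3 first.
- by apply/measurable_EFinP; exact: measurable_normal_pdf.
- by move=> x _; rewrite lee_fin normal_pdf_ge0.
- by rewrite lee_fin mulr_ge0 ?secmom_ge0 ?sqr_ge0.
by rewrite integral_normal_pdf mule1.
Qed.

End normal_moments.

Section independent_increment.
Context {R : realType} {d : measure_display} {Omega : measurableType d}.
Variables (Q : probability Omega R) (f Z : Omega -> R) (s : R).
Hypothesis s0 : 0 < s.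
Hypothesis mf : measurable_fun setT f.
Hypothesis mZ : measurable_fun setT Z.
Hypothesis indep : forall C D, measurable C -> measurable D ->
  Q (f @^-1` C `&` Z @^-1` D) = (Q (f @^-1` C) * normal_prob 0 s D)%E.

(** The identity carries [normal_prob], a measure on [measurableTypeR R], over to [R], where product
    laws with [f] are formed. *)
Let idR : {mfun measurableTypeR R >-> R} :=
  mfun_Sub (mem_set (@measurable_id _ (measurableTypeR R) setT : measurable_fun setT (fun x : measurableTypeR R => x : R))).

Let N : probability R R := distribution (normal_prob 0 s : probability (measurableTypeR R) R) idR.

Let NE D : N D = normal_prob 0 s D. Proof. by []. Qed.

Let F : {mfun Omega >-> R} := mfun_Sub (mem_set mf).

Let mpair (e : R) : measurable_fun setT
  (fun w => (f w, e * Z w) : R * R).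
Proof.
apply: measurable_fun_pair => //; apply: measurable_funM => //.
Qed.

Let G (e : R) : {mfun Omega >-> (R * R)%type} :=
  mfun_Sub (mem_set (mpair e)).

Let law1 X : measurable X ->
  (distribution Q F \x N)%E X = distribution Q (G 1) X.
Proof.
move=> mX; apply: product_measure_unique => // C D mC mD.
transitivity (Q (f @^-1` C `&` Z @^-1` D)); last exact: indep.
congr (Q _).
by apply/seteqP; split => w /=; rewrite mul1r.
Qed.

Let lawN X : measurable X ->
  (distribution Q F \x N)%E X = distribution Q (G (-1)) X.
Proof.
move=> mX; apply: product_measure_unique => // C D mC mD.
have mND : measurable (-%R @^-1` D : set R).
  by rewrite -[X in measurable X]setTI; exact: oppr_measurable.
transitivity (Q (f @^-1` C `&` Z @^-1` (-%R @^-1` D))).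
  by congr (Q _); apply/seteqP; split => w /=; rewrite mulN1r.
by rewrite indep// normal_prob_sym// gt_eqF.
Qed.

(** Fubini for the product law with [Z^2] truncated at [n], then monotone convergence. *)
Lemma indep_sqr : (\int[Q]_w (`|f w| * Z w ^+ 2)%:E <=
  (secmom * s ^+ 2)%:E * \int[Q]_w (`|f w|)%:E)%E.
Proof.
have mabs : measurable_fun [set: R] (fun x : R => `|x|) by exact: normr_measurable.
have mabsf : measurable_fun setT (fun w => (`|f w|)%:E).
  by apply/measurable_EFinP; apply: measurableT_comp.
pose g (n : nat) (z : R * R) := (`|z.1| * Num.min (z.2 ^+ 2) n%:R)%:E.
have mmin n : measurable_fun [set: R] (fun x : R => Num.min (x ^+ 2) n%:R).
  by apply: measurable_minr => //; exact: exprn_measurable.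
have mg n : measurable_fun setT (g n).
  apply/measurable_EFinP; apply: measurable_funM.
    by apply: (measurableT_comp mabs); exact: measurable_fst.
  by apply: (measurableT_comp (mmin n)); exact: measurable_snd.
have min0 n (x : R) : 0 <= Num.min (x ^+ 2) n%:R by rewrite le_min sqr_ge0 ?ler0n.
have g0 n z : (0 <= g n z)%E by rewrite lee_fin mulr_ge0.
have bound n : (\int[Q]_w (`|f w| * Num.min (Z w ^+ 2) n%:R)%:E <=
  (secmom * s ^+ 2)%:E * \int[Q]_w (`|f w|)%:E)%E.
  have -> : (\int[Q]_w (`|f w| * Num.min (Z w ^+ 2) n%:R)%:E = \int[distribution Q (G 1)]_z g n z)%E.
    rewrite ge0_integral_distribution//; apply: eq_integral => w _ /=.
    by rewrite /g /= mul1r.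
  rewrite (@eq_measure_integral _ _ _ _ (distribution Q F \x N)%E); last by move=> A mA _; exact/esym/law1.
  rewrite fubini_tonelli1//.
  apply: (@le_trans _ _ (\int[distribution Q F]_x ((secmom * s ^+ 2)%:E * (`|x|)%:E)))%E.
    apply: ge0_le_integral => //.
    - by move=> x _; apply: integral_ge0.
    - exact: measurable_fun_fubini_tonelli_F.
    - by apply: emeasurable_funM => //; apply/measurable_EFinP.
    - move=> x _; have mm : measurable_fun setT (fun y : R => (Num.min (y ^+ 2) n%:R)%:E).
        by apply/measurable_EFinP; exact: mmin.
      have -> : fubini_F N (g n) x = ((`|x|)%:E * \int[N]_y (Num.min (y ^+ 2) n%:R)%:E)%E.
        by rewrite -ge0_integralZl// => y _; rewrite lee_fin.
      rewrite muleC; apply: lee_wpmul2r; first by rewrite lee_fin.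
      rewrite ge0_integral_distribution//.
        exact: normal_truncated_moment.
      by move=> y; rewrite lee_fin.
  have mE : measurable_fun setT (fun x : R => (`|x|)%:E) by apply/measurable_EFinP.
  have K0 : (0 <= (secmom * s ^+ 2)%:E)%E by rewrite lee_fin mulr_ge0 ?secmom_ge0 ?sqr_ge0.
  by rewrite ge0_integralZl// ge0_integral_distribution.
have mgn n : measurable_fun setT (fun w => (`|f w| * Num.min (Z w ^+ 2) n%:R)%:E).
  apply/measurable_EFinP; apply: measurable_funM; first exact: (measurableT_comp mabs).
  exact: (measurableT_comp (mmin n)).
have -> : (\int[Q]_w (`|f w| * Z w ^+ 2)%:E =
   \int[Q]_w limn (fun n => (`|f w| * Num.min (Z w ^+ 2) n%:R)%:E))%E.
  apply: eq_integral => w _; apply/esym/cvg_lim => //.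
  apply: cvg_near_cst; exists (Num.truncn (Z w ^+ 2)).+1 => // n /= nZ.
  rewrite min_l// ltW// (lt_le_trans (truncnS_gt _))// ler_nat.
  exact: nZ.
rewrite monotone_convergence//.
- apply: lime_le; last by near=> n; exact: bound.
  apply: ereal_nondecreasing_is_cvgn => n k nk; apply: ge0_le_integral => //.
  + by move=> w _; rewrite lee_fin mulr_ge0.
  + by move=> w _; rewrite lee_fin ler_wpM2l// le_min ge_min lexx/= ge_min ler_nat nk orbT.
- by move=> n w _; rewrite lee_fin mulr_ge0.
- move=> w _ n k nk; rewrite lee_fin ler_wpM2l// le_min ge_min lexx/= ge_min ler_nat nk orbT//.
Unshelve. all: end_near. Qed.

(** By symmetry of the normal law, [(f, Z)] and [(f, - Z)] have the same law, so the mean of [f * Z]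
    equals its opposite. Integrability comes from [|Z| <= 1 + Z^2] and [indep_sqr]. *)
Lemma indep_mean : Q.-integrable setT (EFin \o f) ->
  Q.-integrable setT (EFin \o (fun w => f w * Z w)) /\ (\int[Q]_w (f w * Z w)%:E = 0)%E.
Proof.
move=> intf.
have mabs : measurable_fun [set: R] (fun x : R => `|x|) by exact: normr_measurable.
have mabsf : measurable_fun setT (fun w => (`|f w|)%:E).
  by apply/measurable_EFinP; apply: measurableT_comp.
have mprod e : measurable_fun setT (fun w => f w * (e * Z w)).
  by apply: measurable_funM => //; apply: measurable_funM.
have msq : measurable_fun setT (fun w => (`|f w| * Z w ^+ 2)%:E).
  apply/measurable_EFinP; apply: measurable_funM; first exact: (measurableT_comp mabs).
  exact: measurable_funX.
have intfZ e : `|e| = 1 -> Q.-integrable setT (EFin \o (fun w => f w * (e * Z w))).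
  move=> e1; apply/integrableP; split; first exact/measurable_EFinP.
  apply: (@le_lt_trans _ _ (\int[Q]_w ((`|f w|)%:E + (`|f w| * Z w ^+ 2)%:E)))%E.
    apply: ge0_le_integral => //.
    - by apply: measurableT_comp => //; exact/measurable_EFinP.
    - exact: emeasurable_funD.
    - move=> w _; rewrite /= lee_fin normrM normrM e1 mul1r -[X in _ <= X + _]mulr1 -mulrDr ler_wpM2l//.
      rewrite -[Z w ^+ 2]real_normK ?num_real//; set z := `|Z w|.
      have z0 : 0 <= z by exact: normr_ge0.
      by have := sqr_ge0 (z - 1); nra.
  rewrite ge0_integralD//; last first.
    by move=> w _; rewrite lee_fin mulr_ge0// sqr_ge0.
  have fin : (\int[Q]_w (`|f w|)%:E < +oo)%E by case/integrableP : intf.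
  rewrite lte_add_pinfty//; apply: le_lt_trans indep_sqr _.
  by rewrite lte_mul_pinfty// lee_fin mulr_ge0 ?secmom_ge0 ?sqr_ge0.
have int1 : Q.-integrable setT (EFin \o (fun w => f w * Z w)).
  have := intfZ 1 (normr1 _); apply: eq_integrable => // w _ /=.
  by rewrite mul1r.
split => //.
pose h (z : R * R) := (z.1 * z.2)%:E.
have mh : measurable_fun setT h.
  by apply/measurable_EFinP; apply: measurable_funM; [exact: measurable_fst|exact: measurable_snd].
have E e : `|e| = 1 -> (\int[distribution Q (G e)]_z h z = \int[Q]_w (f w * (e * Z w))%:E)%E.
  by move=> e1; rewrite integral_distribution//; exact: intfZ.
have : (\int[Q]_w (f w * (1 * Z w))%:E = \int[Q]_w (f w * (- 1 * Z w))%:E)%E.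
  rewrite -(E 1) ?normr1// -(E (-1)) ?normrN ?normr1//.
  by apply: eq_measure_integral => A mA _; exact: etrans (esym (law1 mA)) (lawN mA).
have -> : (\int[Q]_w (f w * (1 * Z w))%:E = \int[Q]_w (f w * Z w)%:E)%E.
  by apply: eq_integral => w _; rewrite mul1r.
have -> : (\int[Q]_w (f w * (- 1 * Z w))%:E = - \int[Q]_w (f w * Z w)%:E)%E.
  rewrite -integralN//; last exact: integrable_add_def.
  by apply: eq_integral => w _; rewrite mulN1r mulrN.
have := integrable_fin_num measurableT int1 => /fineK.
set x := fine _ => /= <-; rewrite -EFinN => -[xx].
by congr (_%:E); lra.
Qed.

End independent_increment.

(** * L2 bounds and tail estimates for sums over increments *)

Section sub_sigma_algebra.
Context {d : measure_display} {Omega : measurableType d} {R : realType}.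

Definition measurable_wrt (G : set (set Omega)) (f : Omega -> R) : Prop :=
  measurable_fun [set: g_sigma_algebraType G] (f : g_sigma_algebraType G -> R).

Lemma measurable_wrtP G f : sigma_algebra setT G ->
  measurable_wrt G f <-> forall C : set R, measurable C -> G (f @^-1` C).
Proof.
move=> sG; have GE : <<s G >> = G by exact: sigma_algebra_id.
split=> [mf C mC|H _ C mC].
  by have := mf measurableT C mC; rewrite setTI /measurable /= GE.
by rewrite setTI /measurable /= GE; exact: H.
Qed.

Lemma measurable_wrtS (G G' : set (set Omega)) f : G `<=` G' -> measurable_wrt G f -> measurable_wrt G' f.
Proof.
move=> GG' mf _ C mC; have := mf measurableT C mC.
by apply: sub_smallest2r.
Qed.

Lemma measurable_wrtW (G : set (set Omega)) f : G `<=` measurable -> measurable_wrt G f ->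
  measurable_fun [set: Omega] f.
Proof.
move=> GM mf _ C mC; have := mf measurableT C mC.
apply: smallest_sub => //; exact: sigma_algebra_measurable.
Qed.

End sub_sigma_algebra.

Lemma integral_cst_prob {d} {T : measurableType d} {R : realType} (Q : probability T R) (r : \bar R) :
  (\int[Q]_w cst r w = r)%E.
Proof.
rewrite integral_cst// -[RHS]mule1; congr (_ * _)%E.
exact: probability_setT.
Qed.

Definition is_dyadic {R : realType} (u : R) := exists n k : nat, u = k%:R / 2 ^+ n.

Section isometry.
Context {R : realType} {d : measure_display} {Omega : measurableType d}.
Variables (Q : probability Omega R) (G : R -> set (set Omega)) (beta : R -> Omega -> R).
Hypothesis GM : forall t : R, 0 <= t -> sigma_algebra setT (G t) /\ G t `<=` measurable.
Hypothesis Gmono : forall s t : R, 0 <= s -> s <= t -> G s `<=` G t.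
Hypothesis Gbeta : forall t : R, 0 <= t -> measurable_wrt (G t) (beta t).
Hypothesis beta_indep : forall u t : R, 0 <= u -> u < t -> is_dyadic u -> is_dyadic t ->
  forall A D, G u A -> measurable D ->
  Q (A `&` (fun w => beta t w - beta u w) @^-1` D) = (Q A * normal_prob 0 (Num.sqrt (t - u)) D)%E.

Let mG (t : R) (f : Omega -> R) : 0 <= t -> measurable_wrt (G t) f -> measurable_fun [set: Omega] f.
Proof. by move=> t0; apply: measurable_wrtW; case: (GM t0). Qed.

Let mbeta (t : R) : 0 <= t -> measurable_fun [set: Omega] (beta t).
Proof. by move=> t0; exact: (mG t0 (Gbeta t0)). Qed.

Definition step_sum (g : nat -> Omega -> R) (tau : nat -> R) (N : nat) (w : Omega) : R :=
  \sum_(j < N) g j w * (beta (tau j.+1) w - beta (tau j) w).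

Lemma step_sum_measurable g (tau : nat -> R) N : (forall j, (j <= N)%N -> 0 <= tau j) ->
  (forall j, (j < N)%N -> tau j <= tau j.+1) ->
  (forall j, (j < N)%N -> measurable_wrt (G (tau j)) (g j)) ->
  measurable_wrt (G (tau N)) (step_sum g tau N).
Proof.
elim: N => [|N IH] tau0 tauS mg.
  rewrite (_ : step_sum _ _ _ = cst 0); first exact: measurable_cst.
  by apply/funext => w; rewrite /step_sum big_ord0.
rewrite (_ : step_sum _ _ _ = fun w => step_sum g tau N w + g N w * (beta (tau N.+1) w - beta (tau N) w)); last first.
  by apply/funext => w; rewrite /step_sum big_ord_recr.
have tN : tau N <= tau N.+1 by exact: tauS.
have t0 : 0 <= tau N by exact: tau0.
have GS := Gmono t0 tN.
apply: measurable_funD.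
  apply: (measurable_wrtS GS); apply: IH => j jN; [exact: tau0 (leqW jN)|exact: tauS (ltnW _)|exact: mg (ltnW _)].
apply: measurable_funM; first by apply: (measurable_wrtS GS); exact: mg.
apply: measurable_funB; first by apply: Gbeta; exact: tau0.
by apply: (measurable_wrtS GS); exact: Gbeta.
Qed.

(** Induction on [N]: in the square of the sum plus its last term, the cross term has mean 0 by
    [indep_mean] and the last square is bounded by [indep_sqr]. Times are dyadic because a
    conditional law offers independence for countably many pairs of times only. *)
Lemma isometry_dyadic g (tau : nat -> R) N (c : R) :
  (forall j, (j <= N)%N -> 0 <= tau j) -> (forall j, (j <= N)%N -> is_dyadic (tau j)) ->
  (forall j, (j < N)%N -> tau j <= tau j.+1) ->
  (forall j, (j < N)%N -> measurable_wrt (G (tau j)) (g j)) ->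
  (forall j w, (j < N)%N -> `|g j w| <= c) ->
  (\int[Q]_w ((step_sum g tau N w) ^+ 2)%:E <=
   \sum_(j < N) (secmom * (tau j.+1 - tau j))%:E * \int[Q]_w ((g j w) ^+ 2)%:E)%E.
Proof.
move=> tau0 taud tauS mg gc.
elim: N tau0 taud tauS mg gc => [|N IH] tau0 taud tauS mg gc.
  rewrite big_ord0 (_ : (fun w => _) = cst 0%E) ?integral0//.
  by apply/funext => w; rewrite /step_sum big_ord0 expr0n.
have {}IH : (\int[Q]_w ((step_sum g tau N w) ^+ 2)%:E <=
   \sum_(j < N) (secmom * (tau j.+1 - tau j))%:E * \int[Q]_w ((g j w) ^+ 2)%:E)%E.
  by apply: IH => j; [move=> jN; exact: tau0 (leqW jN)|move=> jN; exact: taud (leqW jN)|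
    move=> jN; exact: tauS (ltnW _)|move=> jN; exact: mg (ltnW _)|move=> w jN; exact: gc (ltnW _)].
rewrite big_ord_recr /=.
have SE w : step_sum g tau N.+1 w = step_sum g tau N w + g N w * (beta (tau N.+1) w - beta (tau N) w).
  by rewrite /step_sum big_ord_recr.
have tN0 : 0 <= tau N by exact: tau0.
have tNS : tau N <= tau N.+1 by exact: tauS.
have tN1 : 0 <= tau N.+1 by exact: tau0.
(* Independence concerns strictly increasing times; an empty step contributes nothing. *)
have [tE|tneq] := eqVneq (tau N) (tau N.+1).
  rewrite -tE subrr mulr0 mul0e adde0; apply: le_trans IH.
  by rewrite le_eqVlt; apply/orP; left; apply/eqP; apply: eq_integral => w _; rewrite SE -tE subrr mulr0 addr0.
have tlt : tau N < tau N.+1 by rewrite lt_neqAle tneq.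
have sub0 : 0 < tau N.+1 - tau N by rewrite subr_gt0.
have s0 : 0 < Num.sqrt (tau N.+1 - tau N) by rewrite sqrtr_gt0.
set Z := fun w => beta (tau N.+1) w - beta (tau N) w.
have mZ : measurable_fun [set: Omega] Z by apply: measurable_funB; exact: mbeta.
have [sGN GMN] := GM tN0.
have ind (f : Omega -> R) : measurable_wrt (G (tau N)) f -> forall C D, measurable C -> measurable D ->
   Q (f @^-1` C `&` Z @^-1` D) = (Q (f @^-1` C) * normal_prob 0 (Num.sqrt (tau N.+1 - tau N)) D)%E.
  move=> /(measurable_wrtP _ sGN) mf C D mC mD; apply: beta_indep => //.
  - exact: taud.
  - exact: taud.
  - exact: mf.
have mS : measurable_wrt (G (tau N)) (step_sum g tau N).
  by apply: step_sum_measurable => j jN; [exact: tau0 (leqW jN)|exact: tauS (ltnW _)|exact: mg (ltnW _)].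
have mgN : measurable_wrt (G (tau N)) (g N) by exact: mg.
have mSg : measurable_wrt (G (tau N)) (fun w => step_sum g tau N w * g N w) by exact: measurable_funM.
have mg2 : measurable_wrt (G (tau N)) (fun w => g N w ^+ 2) by exact: measurable_funX.
have c0 : 0 <= c by apply: le_trans (gc N point _) => //; exact: normr_ge0.
have fing j : (j < N.+1)%N -> (\int[Q]_w ((g j w) ^+ 2)%:E <= (c ^+ 2)%:E)%E.
  move=> jN; have tj : 0 <= tau j by exact: tau0 (ltnW _).
  apply: (@le_trans _ _ (\int[Q]_w (cst (c ^+ 2)%:E w))%E).
    apply: ge0_le_integral => //.
    - by move=> w _; rewrite lee_fin sqr_ge0.
    - by apply/measurable_EFinP; apply: measurable_funX; apply: (mG tj); exact: mg.
    - by move=> w _; rewrite lee_fin -[leLHS]real_normK ?num_real// ler_sqr ?nnegrE// gc.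
  by rewrite integral_cst_prob.
have finS : (\int[Q]_w ((step_sum g tau N w) ^+ 2)%:E < +oo)%E.
  apply: le_lt_trans IH _; apply: lte_sum_pinfty => j _.
  rewrite lte_mul_pinfty//; first by rewrite lee_fin mulr_ge0 ?secmom_ge0// subr_ge0 tauS// ltnW// ltnS.
  by apply: le_lt_trans (fing j _) _; rewrite ?ltry// ltnW// ltnS.
have mS' := mG tN0 mS; have mgN' := mG tN0 mgN; have mSg' := mG tN0 mSg; have mg2' := mG tN0 mg2.
(* From [|z * y| <= c + c * z^2] when [|y| <= c]. *)
have intSg : Q.-integrable setT (EFin \o (fun w => step_sum g tau N w * g N w)).
  apply/integrableP; split; first exact/measurable_EFinP.
  apply: (@le_lt_trans _ _ (\int[Q]_w ((cst c%:E w) + c%:E * ((step_sum g tau N w) ^+ 2)%:E)))%E.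
    apply: ge0_le_integral => //.
    - by apply: measurableT_comp => //; exact/measurable_EFinP.
    - apply: emeasurable_funD => //; apply: emeasurable_funM => //.
      by apply/measurable_EFinP; exact: measurable_funX.
    - move=> w _; rewrite /= lee_fin normrM.
      set z := step_sum _ _ _ _; have := gc N w (ltnSn N); set y := g N w => yc.
      have z0 : 0 <= `|z| := normr_ge0 _; rewrite -[z ^+ 2]real_normK ?num_real//.
      have y0 : 0 <= `|y| := normr_ge0 _; have := sqr_ge0 (`|z| - 1).
      nra.
  have mS2 : measurable_fun setT (fun w => ((step_sum g tau N w) ^+ 2)%:E).
    by apply/measurable_EFinP; exact: measurable_funX.
  have S20 w : setT w -> (0 <= ((step_sum g tau N w) ^+ 2)%:E)%E by rewrite lee_fin sqr_ge0.
  have mcS : measurable_fun setT (fun w => c%:E * ((step_sum g tau N w) ^+ 2)%:E)%E.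
    exact: emeasurable_funM.
  have cS0 w : setT w -> (0 <= c%:E * ((step_sum g tau N w) ^+ 2)%:E)%E.
    by move=> _; rewrite mule_ge0// lee_fin// sqr_ge0.
  rewrite ge0_integralD// integral_cst_prob lte_add_pinfty ?ltry//.
  by rewrite ge0_integralZl// lte_mul_pinfty.
have [intSgZ SgZ0] := indep_mean s0 mSg' mZ (ind _ mSg) intSg.
have sqle := indep_sqr s0 mg2' mZ (ind _ mg2).
have sqE : Num.sqrt (tau N.+1 - tau N) ^+ 2 = tau N.+1 - tau N by rewrite sqr_sqrtr// ltW.
rewrite sqE in sqle.
have absg2 : (\int[Q]_w (`|g N w ^+ 2|)%:E = \int[Q]_w (g N w ^+ 2)%:E)%E.
  by apply: eq_integral => w _; rewrite ger0_norm// sqr_ge0.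
rewrite absg2 in sqle.
have mS2 : measurable_fun setT (fun w => ((step_sum g tau N w) ^+ 2)%:E).
  by apply/measurable_EFinP; exact: measurable_funX.
have mg2Z : measurable_fun setT (fun w => (`|g N w ^+ 2| * Z w ^+ 2)%:E).
  apply/measurable_EFinP; apply: measurable_funM; last exact: measurable_funX.
  by apply: measurableT_comp.
have intS2 : Q.-integrable setT (fun w => ((step_sum g tau N w) ^+ 2)%:E).
  apply/integrableP; split => //; apply: le_lt_trans finS.
  by apply: ge0_le_integral => //; [apply: measurableT_comp|move=> w _; rewrite gee0_abs// lee_fin sqr_ge0].
have intg2Z : Q.-integrable setT (fun w => (`|g N w ^+ 2| * Z w ^+ 2)%:E).
  apply/integrableP; split => //.
  apply: (@le_lt_trans _ _ (\int[Q]_w (`|g N w ^+ 2| * Z w ^+ 2)%:E)%E).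
    apply: ge0_le_integral => //; first exact: measurableT_comp.
    by move=> w _; rewrite gee0_abs// lee_fin mulr_ge0// sqr_ge0.
  apply: le_lt_trans sqle _; rewrite lte_mul_pinfty//.
    by rewrite lee_fin mulr_ge0 ?secmom_ge0// ltW.
  by apply: le_lt_trans (fing N _) _; rewrite ?ltry.
have -> : (\int[Q]_w ((step_sum g tau N.+1 w) ^+ 2)%:E =
  \int[Q]_w (((step_sum g tau N w) ^+ 2)%:E + (2%:E * (step_sum g tau N w * g N w * Z w)%:E + (`|g N w ^+ 2| * Z w ^+ 2)%:E)))%E.
  apply: eq_integral => w _; rewrite -EFinM -!EFinD; congr (_%:E); rewrite SE -/(Z w) ger0_norm ?sqr_ge0//.
  by ring.
have int2 : Q.-integrable setT (fun w => (2%:E * (step_sum g tau N w * g N w * Z w)%:E)%E).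
  exact: integrableZl.
rewrite integralD//; last exact: integrableD.
rewrite integralD// integralZl// SgZ0 mule0 add0e.
exact: leeD.
Qed.

End isometry.

(** Approximation from the right: what is known at time [u] is still known at [dyadic_up n u]. *)
Definition dyadic_up {R : realType} (n : nat) (u : R) : R := (Num.truncn (u * 2 ^+ n)).+1%:R / 2 ^+ n.

Lemma dyadic_upE {R : realType} n (u : R) : dyadic_up n u = dyadic n u + 2^-1 ^+ n.
Proof. by rewrite /dyadic_up /dyadic -natr1 mulrDl mul1r exprVn. Qed.

Lemma le_dyadic_up {R : realType} n (u : R) : 0 <= u -> u <= dyadic_up n u.
Proof. by move=> u0; rewrite dyadic_upE; have := dyadic_gt n u0; lra. Qed.

Lemma dyadic_up_homo {R : realType} n (u v : R) : 0 <= u -> u <= v -> dyadic_up n u <= dyadic_up n v.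
Proof.
move=> u0 uv; have e0 : 0 < 2 ^+ n :> R by rewrite exprn_gt0.
rewrite ler_pM2r ?invr_gt0// ler_nat ltnS truncn_ge_nat; last by rewrite mulr_ge0// ?(le_trans u0)// ltW.
apply: (@le_trans _ _ (u * 2 ^+ n)); first by rewrite truncn_le mulr_ge0// ltW.
by rewrite ler_pM2r.
Qed.

Lemma cvg_dyadic_up {R : realType} (u : R) : 0 <= u -> dyadic_up n u @[n --> \oo] --> u.
Proof.
move=> u0; have H := cvgD (cvg_dyadic u0) (@cvg_half R); rewrite addr0 in H.
have -> : (fun n => dyadic_up n u) = (fun n => dyadic n u + 2^-1 ^+ n).
  by apply/funext => n; rewrite dyadic_upE.
exact: H.
Qed.

Lemma limn_einf_le_cvg {R : realType} (u v : nat -> \bar R) l :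
  (forall n, (u n <= v n)%E) -> v n @[n --> \oo] --> l -> (limn_einf u <= l)%E.
Proof.
move=> uv vl; rewrite -(cvg_lim _ vl)// limn_einf_lim; apply: lee_lim.
- exact: is_cvg_einfs.
- by apply/cvg_ex; exists l.
- near=> n; apply: le_trans (uv n); apply: ereal_inf_lbound.
  by exists n => /=.
Unshelve. all: end_near. Qed.

(** The second conjunct of [H] carries the induction: while the full sum is at most [delta] it
    bounds the kept sum, and a term that makes it larger is not kept. *)
Lemma truncated_sum_le {R : realType} (a : nat -> R) (N : nat) (delta : R) : 0 <= delta ->
  (forall j, 0 <= a j) ->
  \sum_(j < N) a j * (\sum_(i < j.+1) a i <= delta)%R%:R <= delta.
Proof.
move=> d0 a0; suff H : \sum_(j < N) a j * (\sum_(i < j.+1) a i <= delta)%R%:R <= delta /\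
   \sum_(j < N) a j * (\sum_(i < j.+1) a i <= delta)%R%:R <= \sum_(j < N) a j by case: H.
elim: N => [|N [IH1 IH2]]; first by rewrite !big_ord0.
rewrite big_ord_recr [X in _ /\ _ <= X]big_ord_recr /=.
have [h|_] := boolP (\sum_(i < N.+1) a i <= delta).
  rewrite mulr1; split; last by rewrite lerD2r.
  by apply: le_trans h; rewrite [leRHS]big_ord_recr/= lerD2r.
by rewrite mulr0 addr0; split => //; rewrite (le_trans IH2)// lerDl.
Qed.

Section stochastic_sums.
Context {R : realType} {d : measure_display} {Omega : measurableType d}.
Variables (Q : probability Omega R) (G : R -> set (set Omega)) (beta : R -> Omega -> R).
Hypothesis GM : forall t : R, 0 <= t -> sigma_algebra setT (G t) /\ G t `<=` measurable.
Hypothesis Gmono : forall s t : R, 0 <= s -> s <= t -> G s `<=` G t.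
Hypothesis Gbeta : forall t : R, 0 <= t -> measurable_wrt (G t) (beta t).
Hypothesis beta_indep : forall u t : R, 0 <= u -> u < t -> is_dyadic u -> is_dyadic t ->
  forall A D, G u A -> measurable D ->
  Q (A `&` (fun w => beta t w - beta u w) @^-1` D) = (Q A * normal_prob 0 (Num.sqrt (t - u)) D)%E.
Hypothesis beta_cont : forall w (v : nat -> R) (u : R), 0 <= u -> (forall n, 0 <= v n) ->
  v n @[n --> \oo] --> u -> beta (v n) w @[n --> \oo] --> beta u w.

Let mG (t : R) (f : Omega -> R) : 0 <= t -> measurable_wrt (G t) f -> measurable_fun [set: Omega] f.
Proof. by move=> t0; apply: measurable_wrtW; case: (GM t0). Qed.

Variables (g : nat -> Omega -> R) (tau : nat -> R) (N : nat) (c : R).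
Hypothesis tau0 : forall j, (j <= N)%N -> 0 <= tau j.
Hypothesis tauS : forall j, (j < N)%N -> tau j <= tau j.+1.
Hypothesis mg : forall j, (j < N)%N -> measurable_wrt (G (tau j)) (g j).
Hypothesis gc : forall j w, (j < N)%N -> `|g j w| <= c.

Let mstep : measurable_fun setT (step_sum beta g tau N).
Proof.
apply: (mG (tau0 (leqnn N))).
exact: (step_sum_measurable Gmono Gbeta tau0 tauS mg).
Qed.

(** Arbitrary times are approached from the right by dyadic ones, with the same coefficients;
    continuity of [beta] and Fatou's lemma give the limit. *)
Lemma step_sum_bound (delta : R) : 0 <= delta ->
  (forall w, \sum_(j < N) g j w ^+ 2 * (tau j.+1 - tau j) <= delta) ->
  (\int[Q]_w ((step_sum beta g tau N w) ^+ 2)%:E <= (secmom * delta)%:E)%E.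
Proof.
move=> d0 gd.
pose I j := \int[Q]_w (g j w ^+ 2).
have mgj j : (j < N)%N -> measurable_fun setT (fun w => (g j w ^+ 2)%:E).
  move=> jN; apply/measurable_EFinP; apply: measurable_funX.
  exact: (mG (tau0 (ltnW jN)) (mg jN)).
have intg j : (j < N)%N -> Q.-integrable setT (fun w => (g j w ^+ 2)%:E).
  move=> jN; apply/integrableP; split; first exact: mgj.
  apply: (@le_lt_trans _ _ (\int[Q]_w (cst (c ^+ 2)%:E w))%E); last by rewrite integral_cst_prob ltry.
  apply: ge0_le_integral => //; first by apply: measurableT_comp => //; exact: mgj.
  move=> w _; rewrite /= lee_fin ger0_norm ?sqr_ge0// -[leLHS]real_normK ?num_real// ler_sqr ?nnegrE// ?gc//.
  exact: le_trans (normr_ge0 _) (gc w jN).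
have IE j : (j < N)%N -> (\int[Q]_w (g j w ^+ 2)%:E = (I j)%:E)%E.
  by move=> jN; rewrite /I /Rintegral fineK//; apply: integrable_fin_num => //; exact: intg.
pose taun n j := dyadic_up n (tau j).
have taun_ge n j : (j <= N)%N -> tau j <= taun n j by move=> jN; apply: le_dyadic_up; exact: tau0.
have step_n n : (\int[Q]_w ((step_sum beta g (taun n) N w) ^+ 2)%:E <=
    (\sum_(j < N) secmom * (taun n j.+1 - taun n j) * I j)%:E)%E.
  rewrite -sumEFin; apply: le_trans (isometry_dyadic GM Gmono Gbeta beta_indep _ _ _ _ gc) _.
  - by move=> j jN; apply: le_trans (taun_ge n j jN); exact: tau0.
  - by move=> j jN; exists n, (Num.truncn (tau j * 2 ^+ n)).+1.
  - by move=> j jN; apply: dyadic_up_homo; [exact: tau0 (ltnW jN)|exact: tauS].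
  - move=> j jN; apply: (measurable_wrtS _ (mg jN)); apply: Gmono; first exact: tau0 (ltnW jN).
    exact: taun_ge (ltnW jN).
  - by apply: lee_sum => j _; rewrite IE// -EFinM.
have cvS w : (step_sum beta g (taun n) N w) ^+ 2 @[n --> \oo] --> (step_sum beta g tau N w) ^+ 2.
  apply: (cvg_comp (fun n => step_sum beta g (taun n) N w) (fun r => r ^+ 2)); last exact: exprn_continuous.
  apply: (@cvg_big _ _ _ _ _ add_continuous) => j _; apply: cvgM; first exact: cvg_cst.
  have up0 i n : (i <= N)%N -> 0 <= taun n i by move=> iN; apply: le_trans (taun_ge n i iN); exact: tau0.
  apply: cvgB; apply: beta_cont.
  - exact: tau0.
  - by move=> n; exact: up0.
  - by apply: cvg_dyadic_up; exact: tau0.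
  - by apply: tau0; exact: ltnW.
  - by move=> n; apply: up0; exact: ltnW.
  - by apply: cvg_dyadic_up; apply: tau0; exact: ltnW.
have mstepn n : measurable_fun setT (fun w => ((step_sum beta g (taun n) N w) ^+ 2)%:E).
  apply/measurable_EFinP; apply: measurable_funX.
  have tN0 : 0 <= taun n N by apply: le_trans (taun_ge n N (leqnn N)); exact: tau0.
  apply: (mG tN0); apply: (step_sum_measurable Gmono Gbeta).
  - by move=> j jN; apply: le_trans (taun_ge n j jN); exact: tau0.
  - by move=> j jN; apply: dyadic_up_homo; [exact: tau0 (ltnW jN)|exact: tauS].
  - move=> j jN; apply: (measurable_wrtS _ (mg jN)); apply: Gmono; first exact: tau0 (ltnW jN).
    exact: taun_ge (ltnW jN).
have -> : (\int[Q]_w ((step_sum beta g tau N w) ^+ 2)%:E =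
   \int[Q]_w limn_einf (fun n => ((step_sum beta g (taun n) N w) ^+ 2)%:E))%E.
  apply: eq_integral => w _; apply/esym.
  have [|-> _//] := @cvg_limn_einf_sup R (fun n => ((step_sum beta g (taun n) N w) ^+ 2)%:E) ((step_sum beta g tau N w) ^+ 2)%:E.
  by apply: cvg_EFin; [near=> n|exact: cvS].
apply: le_trans (fatou _ _ _ _) _ => //; first by move=> n w _; rewrite lee_fin sqr_ge0.
apply: (@le_trans _ _ (\sum_(j < N) secmom * (tau j.+1 - tau j) * I j)%:E).
  apply: (limn_einf_le_cvg step_n); apply: cvg_EFin; first by near=> n.
  apply: (@cvg_big _ _ _ _ _ add_continuous) => j _; apply: cvgM; last exact: cvg_cst.
  apply: cvgM; first exact: cvg_cst.
  by apply: cvgB; apply: cvg_dyadic_up; apply: tau0; [|exact: ltnW].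
rewrite lee_fin; under eq_bigr do rewrite -mulrA.
rewrite -mulr_sumr ler_wpM2l ?secmom_ge0// -lee_fin -sumEFin.
under eq_bigr do rewrite EFinM -IE//.
have dt0 (j : 'I_N) : 0 <= tau j.+1 - tau j by rewrite subr_ge0; exact: tauS.
have E1 (j : 'I_N) : ((tau j.+1 - tau j)%:E * \int[Q]_w (g j w ^+ 2)%:E =
    \int[Q]_w ((tau j.+1 - tau j)%:E * (g j w ^+ 2)%:E))%E.
  rewrite ge0_integralZl_EFin//; last exact: mgj.
  by move=> w _; rewrite lee_fin sqr_ge0.
rewrite (eq_bigr _ (fun j _ => E1 j)).
rewrite -ge0_integral_sum//; last 2 first.
- by move=> j; apply: emeasurable_funM => //; exact: mgj.
- by move=> j w _; apply: mule_ge0; rewrite lee_fin ?dt0 ?sqr_ge0.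
apply: (@le_trans _ _ (\int[Q]_w (cst delta%:E w))%E); last by rewrite integral_cst_prob.
apply: ge0_le_integral => //.
- by move=> w _; apply: sume_ge0 => j _; apply: mule_ge0; rewrite lee_fin ?dt0 ?sqr_ge0.
- by apply: emeasurable_sum => j; apply: emeasurable_funM => //; exact: mgj.
- move=> w _; under eq_bigr do rewrite -EFinM; rewrite sumEFin lee_fin.
  by apply: le_trans (gd w); apply: ler_sum => j _; rewrite mulrC.
Unshelve. all: end_near. Qed.

End stochastic_sums.

Section step_tail.
Context {R : realType} {d : measure_display} {Omega : measurableType d}.
Variables (Q : probability Omega R) (G : R -> set (set Omega)) (beta : R -> Omega -> R).
Hypothesis GM : forall t : R, 0 <= t -> sigma_algebra setT (G t) /\ G t `<=` measurable.
Hypothesis Gmono : forall s t : R, 0 <= s -> s <= t -> G s `<=` G t.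
Hypothesis Gbeta : forall t : R, 0 <= t -> measurable_wrt (G t) (beta t).
Hypothesis beta_indep : forall u t : R, 0 <= u -> u < t -> is_dyadic u -> is_dyadic t ->
  forall A D, G u A -> measurable D ->
  Q (A `&` (fun w => beta t w - beta u w) @^-1` D) = (Q A * normal_prob 0 (Num.sqrt (t - u)) D)%E.
Hypothesis beta_cont : forall w (v : nat -> R) (u : R), 0 <= u -> (forall n, 0 <= v n) ->
  v n @[n --> \oo] --> u -> beta (v n) w @[n --> \oo] --> beta u w.
Variables (g : nat -> Omega -> R) (tau : nat -> R) (N : nat) (c : R).
Hypothesis tau0 : forall j, (j <= N)%N -> 0 <= tau j.
Hypothesis tauS : forall j, (j < N)%N -> tau j <= tau j.+1.
Hypothesis mg : forall j, (j < N)%N -> measurable_wrt (G (tau j)) (g j).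
Hypothesis gc : forall j w, (j < N)%N -> `|g j w| <= c.

Let mG (t : R) (f : Omega -> R) : 0 <= t -> measurable_wrt (G t) f -> measurable_fun [set: Omega] f.
Proof. by move=> t0; apply: measurable_wrtW; case: (GM t0). Qed.

Let energy k w := \sum_(i < k) g i w ^+ 2 * (tau i.+1 - tau i).

Let tau_le i j : (i <= j)%N -> (j <= N)%N -> tau i <= tau j.
Proof.
elim: j => [|j IH]; first by rewrite leqn0 => /eqP ->.
rewrite leq_eqVlt => /orP[/eqP -> //|ij] jN.
by apply: le_trans (tauS jN); apply: IH => //; exact: ltnW.
Qed.

Let menergy j k : (j < N)%N -> (k <= j.+1)%N -> measurable_wrt (G (tau j)) (energy k).
Proof.
move=> jN kj; apply: measurable_sum => i.
case: (ltnP i k) => ik; last by have := ltn_ord i; rewrite ltnNge ik.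
have ij : (i <= j)%N by rewrite -ltnS (leq_trans ik).
apply: measurable_funM; last exact: measurable_cst.
apply: measurable_funX; apply: (@measurable_wrtS _ _ _ (G (tau i))); last exact: mg (leq_ltn_trans ij jN).
by apply: Gmono; [exact: tau0 (ltnW (leq_ltn_trans ij jN))|exact: tau_le (ltnW jN)].
Qed.

(** The energy will be small only in probability, so the coefficients are cut off once it exceeds
    [delta]. The cut sum obeys Chebyshev's inequality with [step_sum_bound], and differs from the
    original only where the total energy exceeds [delta]. *)
Lemma step_sum_tail (delta e : R) : 0 <= delta -> 0 < e ->
  (Q [set w | (e <= `|step_sum beta g tau N w|)%R] <=
   Q [set w | (delta < \sum_(j < N) g j w ^+ 2 * (tau j.+1 - tau j))%R] + (secmom * delta / e ^+ 2)%:E)%E.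
Proof.
move=> d0 e0.
(* The energy including step [j] is already known at time [tau j]: it involves [g j] but no
   increment after [tau j]. *)
pose A j := [set w | energy j.+1 w <= delta].
pose g' j w := g j w * \1_(A j) w.
have mg' j : (j < N)%N -> measurable_wrt (G (tau j)) (g' j).
  move=> jN; apply: measurable_funM; first exact: mg.
  apply: measurable_indic; rewrite -[X in measurable X]setTI.
  have := menergy jN (leqnn _) measurableT (measurable_itv `]-oo, delta]).
  by congr measurable; apply/seteqP; split => w /=; rewrite in_itv.
have g'c j w : (j < N)%N -> `|g' j w| <= c.
  move=> jN; rewrite /g' indicE; case: (_ \in _); rewrite ?mulr1 ?mulr0 ?normr0; first exact: gc.
  exact: le_trans (normr_ge0 _) (gc w jN).
have g'd w : \sum_(j < N) g' j w ^+ 2 * (tau j.+1 - tau j) <= delta.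
  have := @truncated_sum_le R (fun j => if (j < N)%N then g j w ^+ 2 * (tau j.+1 - tau j) else 0) N delta d0.
  have a0 j : 0 <= (if (j < N)%N then g j w ^+ 2 * (tau j.+1 - tau j) else 0).
    by case: ifP => // jN; rewrite mulr_ge0 ?sqr_ge0// subr_ge0 tauS.
  move=> /(_ a0); apply: le_trans; apply: ler_sum => j _; rewrite ltn_ord /g' indicE exprMn.
  have -> : (w \in A j) = (\sum_(i < j.+1) (if (i < N)%N then g i w ^+ 2 * (tau i.+1 - tau i) else 0) <= delta).
    have E : energy j.+1 w = \sum_(i < j.+1) (if (i < N)%N then g i w ^+ 2 * (tau i.+1 - tau i) else 0).
      by apply: eq_bigr => i _; rewrite (leq_trans (ltn_ord i)).
    by apply/idP/idP; rewrite ?inE /A /= E// => h; rewrite inE /= E.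
  by case: (_ <= delta); rewrite ?expr1n ?expr0n /= ?mulr1 ?mulr0 ?mul0r ?mul1r.
have mst (f : nat -> Omega -> R) : (forall j, (j < N)%N -> measurable_wrt (G (tau j)) (f j)) ->
   measurable_fun setT (step_sum beta f tau N).
  by move=> mf; apply: (mG (tau0 (leqnn N))); exact: (step_sum_measurable Gmono Gbeta tau0 tauS mf).
have B := step_sum_bound GM Gmono Gbeta beta_indep beta_cont tau0 tauS mg' g'c d0 g'd.
have e20 : 0 < e ^+ 2 by rewrite exprn_gt0.
have mset (f : Omega -> R) (r : R) : measurable_fun setT f -> measurable [set w | r <= `|f w : R|].
  move=> mf; rewrite -[X in measurable X]setTI.
  have mabs : measurable_fun setT (fun w => `|f w|) by apply: measurableT_comp.
  have := mabs measurableT _ (measurable_itv `[r, +oo[).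
  by congr measurable; apply/seteqP; split => w /=; rewrite in_itv /= andbT.
have menN : measurable [set w | delta < energy N w].
  have -> : [set w | delta < energy N w] = setT `&` energy N @^-1` `]delta, +oo[.
    by apply/seteqP; split => w /=; rewrite in_itv /= andbT; [|case].
  (* The total energy is known one step before [tau N]; for [N = 0] there is no such step. *)
  case EN : N => [|n].
    apply: (_ : measurable_fun setT (energy 0)) => //.
    by rewrite (_ : energy 0 = cst 0); [exact: measurable_cst|apply/funext => w; rewrite /energy big_ord0].
  apply: (_ : measurable_fun setT (energy n.+1)) => //.
  have nN : (n < N)%N by rewrite EN.
  by apply: (mG (tau0 (ltnW nN))); exact: menergy.
have mS' : measurable [set w | e <= `|step_sum beta g' tau N w|] by apply: mset; exact: mst.
apply: (@le_trans _ _ (Q ([set w | delta < energy N w] `|` [set w | e <= `|step_sum beta g' tau N w|]))).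
  apply: le_measure; rewrite ?inE; [by apply: mset; exact: mst|exact: measurableU|].
  move=> w /= ew; case: (ltP delta (energy N w)) => h; [by left|right].
  rewrite (_ : step_sum beta g' tau N w = step_sum beta g tau N w)//.
  apply: eq_bigr => j _; congr (_ * _); rewrite /g' indicE mem_set ?mulr1// /A /=.
  apply: le_trans h; rewrite /energy (big_ord_widen N (fun i => g i w ^+ 2 * (tau i.+1 - tau i)))//.
  rewrite [leLHS]big_mkcond; apply: ler_sum => i _; case: ifP => // _.
  by rewrite mulr_ge0 ?sqr_ge0// subr_ge0 tauS.
apply: le_trans (measureU2 _ _ _) _ => //; apply: leeD => //.
have H := @le_integral_abse _ _ _ Q setT measurableT (fun w => ((step_sum beta g' tau N w) ^+ 2)%:E) (e ^+ 2) _ e20.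
have mS2 : measurable_fun setT (fun w => ((step_sum beta g' tau N w) ^+ 2)%:E).
  by apply/measurable_EFinP; apply: measurable_funX; exact: mst.
have {}H := H mS2.
rewrite -(@lee_pmul2l _ (e ^+ 2)%:E) ?lte_fin//.
have -> : ((e ^+ 2)%:E * (secmom * delta / e ^+ 2)%:E = (secmom * delta)%:E)%E.
  by rewrite -EFinM mulrC divfK// gt_eqF.
apply: le_trans B; apply: le_trans (le_trans H _).
  apply: lee_wpmul2l; first by rewrite lee_fin ltW.
  apply: le_measure; rewrite ?inE//.
    rewrite setTI; have := mset (fun w => (step_sum beta g' tau N w) ^+ 2) (e ^+ 2).
    by apply; apply: measurable_funX; exact: mst.
  move=> w /= ew; split => //; rewrite lee_fin ger0_norm ?sqr_ge0//.
  by rewrite -[leRHS]real_normK ?num_real// ler_sqr ?nnegrE// ltW.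
by apply: ge0_le_integral => //; [exact: measurableT_comp|move=> w _; rewrite gee0_abs// lee_fin sqr_ge0].
Qed.

End step_tail.

(** * The Ito integral of a constant *)

Lemma step_integral {R : realType} (f : R -> \bar R) (a tau : nat -> R) (N : nat) :
  (forall u, (0 <= f u)%E) ->
  (forall j, (j < N)%N -> tau j <= tau j.+1) ->
  (forall j u, (j < N)%N -> tau j < u <= tau j.+1 -> f u = (a j)%:E) ->
  measurable_fun `]tau 0, tau N] f /\ tau 0 <= tau N /\
  (\int[lebesgue_measure]_(u in `]tau 0%N, tau N]) f u = (\sum_(j < N) a j * (tau j.+1 - tau j))%:E)%E.
Proof.
move=> f0 + fa; elim: N fa => [|N IH] fa tauS.
  by rewrite set_itvoc0 big_ord0 integral_set0; split => //; exact: measurable_fun_set0.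
have [|j jN|mf [t0N intE]] := IH.
- by move=> j u jN; apply: fa; exact: ltnW.
- by apply: tauS; exact: ltnW.
have tN := tauS N (ltnSn N).
have UE : `]tau 0%N, tau N.+1]%classic = `]tau 0%N, tau N] `|` `]tau N, tau N.+1] :> set R.
  by rewrite -itv_bndbnd_setU.
have feq : {in `]tau N, tau N.+1]%classic, f =1 cst (a N)%:E}.
  by move=> u; rewrite inE /= in_itv /=; exact: fa.
have mf2 : measurable_fun `]tau N, tau N.+1] f.
  by apply: (eq_measurable_fun (cst (a N)%:E)) => // u uI; rewrite feq.
have mfU : measurable_fun (`]tau 0%N, tau N] `|` `]tau N, tau N.+1]) f by apply/measurable_funU.
rewrite UE; split => //; split; first exact: le_trans t0N tN.
rewrite ge0_integral_setU//; last first.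
  apply/disj_setPS => u [] /=; rewrite !in_itv /= => /andP[_ h1] /andP[h2 _].
  by move: (le_lt_trans h1 h2); rewrite ltxx.
rewrite big_ord_recr /= EFinD intE; congr (_ + _)%E.
rewrite (eq_integral (cst (a N)%:E)) // integral_cst//=.
rewrite lebesgue_measure_itv/= lte_fin; case: ltP => h; first by rewrite -EFinD -EFinM.
have -> : tau N.+1 = tau N by apply/eqP; rewrite eq_le h.
by rewrite mule0 subrr mulr0.
Qed.

Section outer.
Context {R : realType} {d : measure_display} {Omega : measurableType d} (Q : probability Omega R).

Lemma mu_ext_cover (A : set Omega) (e : R) : (mu_ext Q A < e%:E)%E ->
  exists B, [/\ measurable B, A `<=` B & (Q B <= e%:E)%E].
Proof.
rewrite /mu_ext => /ereal_inf_lt[_ [F [mF AF] <-] lt].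
exists (\bigcup_k F k); split => //; first exact: bigcupT_measurable.
apply: le_trans (ltW lt).
by apply: measure_sigma_subadditive => //; exact: bigcupT_measurable.
Qed.

Lemma cvg0_cover (Z : nat -> Omega -> \bar R) (e eta : R) : cvg0_in_prob Q Z -> 0 < e -> 0 < eta ->
  \forall n \near \oo, exists B, [/\ measurable B, [set w | (e%:E <= Z n w)%E] `<=` B & (Q B <= eta%:E)%E].
Proof.
move=> H e0 eta0; have /fine_cvgP[fin /cvgrPdist_lt /(_ eta eta0)] := H e e0.
apply: filterS2 fin => n fin; rewrite sub0r normrN /= => h.
apply: mu_ext_cover; rewrite -(fineK fin) lte_fin.
exact: le_lt_trans (ler_norm _) h.
Qed.

Lemma negligible_small (A : set Omega) :
  (forall eta : R, 0 < eta -> exists B, [/\ measurable B, A `<=` B & (Q B <= eta%:E)%E]) ->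
  Q.-negligible A.
Proof.
move=> H; have /choice[B HB] : forall n : nat, exists B, [/\ measurable B, A `<=` B & (Q B <= (n.+1%:R^-1)%:E)%E].
  by move=> n; apply: H; rewrite invr_gt0.
have mB : measurable (\bigcap_n B n) by apply: bigcapT_measurable => n; case: (HB n).
exists (\bigcap_n B n); split => //; last by move=> w Aw n _; case: (HB n) => _ + _; exact.
apply/eqP; rewrite eq_le measure_ge0 andbT; apply/lee_addgt0Pr => e e0; rewrite add0e.
have [n _ /(_ n (leqnn n)) /= ne] := near_infty_natSinv_lt (PosNum e0).
case: (HB n) => mBn _ Bn; apply: (@le_trans _ _ (Q (B n))); last first.
  by apply: le_trans Bn _; rewrite lee_fin ltW.
by apply: le_measure; rewrite ?inE// => w; apply.
Qed.

(** Probabilities tending to 0 for sets that need not be measurable, expressed by measurable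
    covers. *)
Definition prob_small (A : nat -> set Omega) : Prop := forall eta : R, 0 < eta ->
  \forall n \near \oo, exists B, [/\ measurable B, A n `<=` B & (Q B <= eta%:E)%E].

Lemma prob_smallS (A A' : nat -> set Omega) : (forall n, A n `<=` A' n) -> prob_small A' -> prob_small A.
Proof.
move=> AA' H eta /H; apply: filterS => n [B [mB A'B QB]]; exists B; split => //.
exact: subset_trans (AA' n) A'B.
Qed.

Lemma prob_smallU (A A' : nat -> set Omega) : prob_small A -> prob_small A' ->
  prob_small (fun n => A n `|` A' n).
Proof.
move=> H H' eta eta0; have e2 : 0 < eta / 2 by rewrite divr_gt0.
apply: filterS2 (H _ e2) (H' _ e2) => n [B [mB AB QB]] [B' [mB' AB' QB']].
exists (B `|` B'); split; [exact: measurableU|exact: setUSS|].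
apply: le_trans (measureU2 _ mB mB') _; rewrite [eta]splitr EFinD; exact: leeD.
Qed.

Lemma prob_small_bigcup {n : nat} (A : 'I_n -> nat -> set Omega) : (forall k, prob_small (A k)) ->
  prob_small (fun j => [set w | exists k, A k j w]).
Proof.
elim: n A => [|n IH] A H.
  move=> eta eta0; near=> j; exists set0; split => //; first by move=> w [[]].
  by rewrite measure0 lee_fin ltW.
apply: (@prob_smallS _ (fun j => A ord0 j `|` [set w | exists k, A (lift ord0 k) j w])); last first.
  by apply: prob_smallU => //; apply: IH => k.
move=> j w [k]; case: (unliftP ord0 k) => [k' ->|->] h; last by left.
by right; exists k'.
Unshelve. all: by end_near. Qed.

Lemma prob_small_negligible (A : set Omega) : prob_small (fun=> A) -> Q.-negligible A.
Proof.
move=> H; apply: negligible_small => eta /H h.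
by have [n] := filter_ex h.
Qed.

Lemma prob_small_null (A : set Omega) : measurable A -> Q A = 0%E -> prob_small (fun=> A).
Proof.
move=> mA A0 eta eta0; near=> n; exists A; split => //.
by rewrite A0 lee_fin ltW.
Unshelve. all: by end_near. Qed.

End outer.

Section ito_constant.
Context {R : realType} {d : nat} {dO : measure_display} {Omega : measurableType dO}.
Variables (Q : probability Omega R) (W : R -> Omega -> 'rV[R]_d) (G0 : R -> set (set Omega)).
Hypothesis G0M : forall t : R, 0 <= t -> sigma_algebra setT (G0 t) /\ G0 t `<=` measurable.
Hypothesis G0mono : forall s t : R, 0 <= s -> s <= t -> G0 s `<=` G0 t.
Hypothesis G0W : forall t : R, 0 <= t -> forall k, measurable_wrt (G0 t) (fun w => W t w 0 k).
Hypothesis W_indep : forall u t : R, 0 <= u -> u < t -> is_dyadic u -> is_dyadic t ->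
  forall k A D, G0 u A -> measurable D ->
  Q (A `&` (fun w => W t w 0 k - W u w 0 k) @^-1` D) = (Q A * normal_prob 0 (Num.sqrt (t - u)) D)%E.
Hypothesis W_cont : forall w (v : nat -> R) (u : R) k, 0 <= u -> (forall n, 0 <= v n) ->
  v n @[n --> \oo] --> u -> W (v n) w 0 k @[n --> \oo] --> W u w 0 k.
Variables (H : R -> Omega -> 'M[R]_d) (c : 'M[R]_d) (N : set Omega).
Hypothesis mN : measurable N.
Hypothesis N0 : Q N = 0%E.
Hypothesis HN : forall w t, ~ N w -> 0 <= t -> H t w = c.

(** [H] equals [c] at all times off the null set [N], and may be arbitrary on it; the filtration
    generated by [W] and [H] is compared with that of [W] by ignoring [N]. Measurability is demanded
    separately because of what happens on [N]. *)
Definition mod_null (u : R) : set (set Omega) :=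
  [set A | measurable A /\ exists A', G0 u A' /\ A `\` N = A' `\` N].

Lemma mod_null_sigma t : 0 <= t -> sigma_algebra setT (mod_null t) /\ mod_null t `<=` measurable.
Proof.
move=> t0; have [[s1 s2 s3] _] := G0M t0; split; last by move=> A [].
split.
- by split => //; exists set0.
- move=> A [mA [A' [GA' AA']]]; split; first exact: measurableD.
  exists (setT `\` A'); split; first exact: s2.
  apply/seteqP; split => w [[_ nA] nN]; split => //; split => // A'w; apply: nA.
    by have [] : (A `\` N) w by rewrite AA'.
  by have [] : (A' `\` N) w by rewrite -AA'.
- move=> A HA; split; first by apply: bigcupT_measurable => n; case: (HA n).
  have /choice[A' HA'] : forall n, exists A', G0 t A' /\ A n `\` N = A' `\` N by move=> n; case: (HA n).
  exists (\bigcup_n A' n); split; first by apply: s3 => n; case: (HA' n).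
  by rewrite !setD_bigcupl; apply: eq_bigcupr => n _; case: (HA' n).
Qed.

Lemma G0_mod_null t : 0 <= t -> G0 t `<=` mod_null t.
Proof. by move=> t0 A GA; split; [exact: (G0M t0).2|exists A]. Qed.

Lemma mod_null_mono s t : 0 <= s -> s <= t -> mod_null s `<=` mod_null t.
Proof.
move=> s0 st A [mA [A' [GA' AA']]]; split => //; exists A'; split => //.
exact: G0mono GA'.
Qed.

Lemma mod_null_indep u t k A D : 0 <= u -> u < t -> is_dyadic u -> is_dyadic t ->
  mod_null u A -> measurable D ->
  Q (A `&` (fun w => W t w 0 k - W u w 0 k) @^-1` D) = (Q A * normal_prob 0 (Num.sqrt (t - u)) D)%E.
Proof.
move=> u0 ut du dt [mA [A' [GA' AA']]] mD.
have mA' : measurable A' by exact: (G0M u0).2.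
have t0 : 0 <= t by exact: le_trans (ltW ut).
have mW v : 0 <= v -> measurable_fun setT (fun w => W v w 0 k).
  by move=> v0; apply: measurable_wrtW (G0W v0 k); exact: (G0M v0).2.
have mDD : measurable ((fun w => W t w 0 k - W u w 0 k) @^-1` D).
  rewrite -[X in measurable X]setTI; apply: (_ : measurable_fun setT (fun w => W t w 0 k - W u w 0 k)) => //.
  by apply: measurable_funB; exact: mW.
have QE B B' : measurable B -> measurable B' -> B `\` N = B' `\` N -> Q B = Q B'.
  move=> mB mB' E.
  have QD C : measurable C -> Q C = Q (C `\` N).
    move=> mC; rewrite -[in LHS](setDUK (@subIsetl _ C N)) (_ : C `\` (C `&` N) = C `\` N); last first.
      by apply/seteqP; split => w [Cw]; [move=> h; split => // Nw; exact: h|move=> h; split => // -[]].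
    have mCN : measurable (C `&` N) by exact: measurableI.
    have mCD : measurable (C `\` N) by exact: measurableD.
    have Q0 : Q (C `&` N) = 0%E.
      apply/eqP; rewrite eq_le measure_ge0 andbT -N0; apply: le_measure; rewrite ?inE//.
    have dis : (C `&` N) `&` (C `\` N) = set0.
      by rewrite -subset0 => w [[_ Nw] [_ nN]].
    by rewrite measureU// [X in (X + _)%E]Q0 add0e.
  by rewrite QD// E -QD.
rewrite (QE _ (A' `&` (fun w => W t w 0 k - W u w 0 k) @^-1` D)) ?(QE _ _ mA mA' AA')//.
- exact: W_indep.
- exact: measurableI.
- exact: measurableI.
- by rewrite ![_ `&` _ @^-1` D]setIC -!setIDA AA'.
Qed.

(** Off [N] an event on [H s] is everything or nothing, according to whether [c] satisfies it. *)
Lemma joint_mod_null u A : 0 <= u -> joint_natural_filtration H W u A ->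
  exists A', G0 u A' /\ A `\` N = A' `\` N.
Proof.
move=> u0; have [[s1 s2 s3] sM] := G0M u0; move: A; apply: smallest_sub.
  split.
  - by exists set0.
  - move=> A [A' [GA' AA']].
    exists (setT `\` A'); split; first exact: s2.
    apply/seteqP; split => w [[_ nA] nN]; split => //; split => // A'w; apply: nA.
      by have [] : (A `\` N) w by rewrite AA'.
    by have [] : (A' `\` N) w by rewrite -AA'.
  - move=> A /choice[A' HA'].
    exists (\bigcup_n A' n); split; first by apply: s3 => n; case: (HA' n).
    by rewrite !setD_bigcupl; apply: eq_bigcupr => n _; case: (HA' n).
move=> A [s /andP[s0 su] [[U mU ->]|[U mU ->]]].
  exists (if `[< U c >] then setT else set0); split.
    by case: ifP => // _; have := s2 _ s1; rewrite setD0.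
  apply/seteqP; split => w [h nN]; split => //; move: h; rewrite /preimage /= HN//.
    by move=> Uc; rewrite asboolT.
  by case: asboolP.
exists (W s @^-1` U); split => //.
have mW : measurable_fun [set: g_sigma_algebraType (G0 s)] (W s : g_sigma_algebraType (G0 s) -> borel 'rV[R]_d).
  apply: measurable_fun_borel_matrix => i k; rewrite (ord1 i).
  exact: G0W.
have := mW measurableT U mU; rewrite setTI => h.
apply: (G0mono s0 su); have <- : <<s G0 s >> = G0 s by apply: sigma_algebra_id; case: (G0M s0).
exact: h.
Qed.

(** An event of the joint filtration need not be measurable on [N]; being all or nothing there
    restores measurability. *)
Lemma mod_null_patch u A A' (b : Prop) : 0 <= u -> G0 u A' -> A `\` N = A' `\` N ->
  (forall w, N w -> A w <-> b) -> mod_null u A.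
Proof.
move=> u0 GA' AA' Ab; have mA' : measurable A' by exact: (G0M u0).2.
split; last by exists A'.
have -> : A = (A' `\` N) `|` (N `&` (if `[< b >] then setT else set0)).
  rewrite -AA'; apply/seteqP; split => w.
    by move=> Aw; case: (pselect (N w)) => Nw; [right; split => //; rewrite asboolT//; apply/(Ab w Nw)|left].
  move=> [[]//|[Nw]]; case: asboolP => // hb _; exact/(Ab w Nw).
apply: measurableU; first exact: measurableD.
by apply: measurableI => //; case: ifP.
Qed.

Section grid.
Variables (h : @simple_process R dO Omega d) (t : R).
Hypotheses (ha : sp_adapted (joint_natural_filtration H W) h) (t0 : 0 <= t).
Let n := sp_size h.

(** The times of [h] cut at [t], preceded by 0 and followed by [t], so that the cells fill [[0, t]]:
    in the added first and last cells [h] vanishes but its error against [c] counts. The first cell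
    shifts all indices by one. *)
Definition grid (k : nat) : R :=
  if k is j.+1 then (if (j <= n)%N then Num.min t (sp_time h j) else t) else 0.

Definition grid_val (k : nat) (w : Omega) : 'M[R]_d :=
  if k is j.+1 then (if (j < n)%N && (sp_time h j <= t) then sp_val h j w else 0) else 0.

(** The value 0 on [N] makes the error measurable: the values of [h] are adapted to a filtration
    that also contains [H], which is arbitrary on [N]. *)
Definition grid_err (k : nat) (w : Omega) : 'M[R]_d := if `[< N w >] then 0 else grid_val k w - c.

Lemma sp_time_le i j : (i <= j)%N -> (j <= n)%N -> sp_time h i <= sp_time h j.
Proof.
have [_ tS _ _] := ha.
elim: j => [|j IH]; first by rewrite leqn0 => /eqP ->.
rewrite leq_eqVlt => /orP[/eqP -> //|ij] jN.
by apply: le_trans (tS _ jN); apply: IH => //; exact: ltnW.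
Qed.

Lemma sp_time_ge0 j : (j <= n)%N -> 0 <= sp_time h j.
Proof. by have [h0 _ _ _] := ha; move=> jn; exact: le_trans (sp_time_le (leq0n j) jn). Qed.

Lemma grid_ge0 k : 0 <= grid k.
Proof. by case: k => //= j; case: ifP => // jn; rewrite le_min t0 sp_time_ge0. Qed.

Lemma gridS k : grid k <= grid k.+1.
Proof.
case: k => [|k]; first exact: (grid_ge0 1).
rewrite /=; case: (ltnP k n) => kn.
  by rewrite ltnW// le_min ge_min lexx /= ge_min (sp_time_le (leqnSn k) kn) orbT.
by case: ifP => // _; rewrite ge_min lexx.
Qed.

Lemma grid_last : grid n.+2 = t.
Proof. by rewrite /= ltnn. Qed.

Lemma sp_eval_grid k u w : grid k < u <= grid k.+1 -> sp_eval h u w = grid_val k w.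
Proof.
have [_ tS _ _] := ha; rewrite /sp_eval -/n; case: k => [|k] /=.
  rewrite le_min => /andP[u0 /andP[ut ut0]]; rewrite big1// => i /andP[iu _].
  have := lt_le_trans iu ut0; rewrite ltNge sp_time_le//; exact: ltnW.
case: (ltnP k n) => kn; last first.
  move=> /andP[ku ut]; rewrite big1// => i /andP[_ ui].
  have kn' : (k <= n)%N.
    by move: ku; case: ifP => // _; rewrite ltNge ut.
  have kE : k = n by apply/eqP; rewrite eqn_leq kn'.
  move: ku; rewrite kE leqnn gt_min => /orP[|nu]; first by rewrite ltNge ut.
  by have := lt_le_trans nu ui; rewrite ltNge sp_time_le.
rewrite (ltnW kn) gt_min le_min => /andP[+ /andP[ut uk]].
rewrite ltNge ut /= => ku; rewrite (le_trans (ltW ku) ut)/=.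
rewrite (bigD1 (Ordinal kn)) /= ?ku ?uk// big1 ?addr0// => i /andP[/andP[iu ui]] /eqP ik.
case: (ltngtP i k) => h'.
- by have := lt_le_trans ku ui; rewrite ltNge sp_time_le// ltnW.
- by have := lt_le_trans iu uk; rewrite ltNge sp_time_le// ltnW.
- by exfalso; apply: ik; apply: val_inj.
Qed.

(** Each matrix entry gives one scalar sum against one coordinate of [W]; the terms with [c]
    telescope to [W t - W 0]. *)
Lemma grid_sum_int w : ~ N w -> forall a,
  (sp_int h W t w - (W t w - W 0 w) *m c^T) 0 a =
  \sum_k step_sum (fun u w => W u w 0 k) (fun j w => grid_err j w a k) grid n.+2 w.
Proof.
move=> nN a; rewrite exchange_big /=.
have E j : \sum_k grid_err j w a k * (W (grid j.+1) w 0 k - W (grid j) w 0 k) =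
   ((W (grid j.+1) w - W (grid j) w) *m (grid_val j w)^T - (W (grid j.+1) w - W (grid j) w) *m c^T) 0 a.
  rewrite /grid_err asboolF// !mxE -sumrB; apply: eq_bigr => k _; rewrite !mxE; ring.
rewrite (eq_bigr _ (fun (j : 'I_n.+2) _ => E j)) -summxE; congr (fun_of_matrix _ 0 a).
rewrite sumrB -mulmx_suml; congr (_ - _); last congr (_ *m _).
  rewrite big_ord_recl /= trmx0 mulmx0 add0r big_ord_recr /= ltnn /= trmx0 mulmx0 addr0.
  rewrite /sp_int; apply: eq_bigr => j _; rewrite /bump /= ltn_ord (ltnW (ltn_ord j)) /=.
  case: (lerP (sp_time h j) t) => jt //.
  rewrite trmx0 mulmx0 (min_idPl _) ?subrr ?mul0mx//.
  apply: le_trans (ltW jt) _; exact: (sp_time_le (leqnSn j) (ltn_ord j)).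
rewrite -[X in _ - X]/(W (grid 0) w) -{1}grid_last.
by rewrite -(big_mkord predT (fun j => W (grid j.+1) w - W (grid j) w)) telescope_sumr.
Qed.

Lemma grid_err_bound : exists C : R, forall j w a k, `|grid_err j w a k| <= C.
Proof.
have [_ _ hb _] := ha.
have /choice[cb Hcb] : forall j, exists cj : R, (j < n)%N -> forall w, enorm (sp_val h j w) <= cj.
  move=> j; case: (ltnP j n) => jn; last by exists 0.
  by have [b Hb] := hb j jn; exists b.
exists (\sum_(j < n) `|cb j| + enorm c) => j w a k.
have C0 : 0 <= \sum_(j < n) `|cb j| by apply: sumr_ge0.
rewrite /grid_err; case: asboolP => _; first by rewrite mxE normr0 addr_ge0 ?enorm_ge0.
rewrite !mxE (le_trans (ler_normB _ _))// lerD ?le_enorm//.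
case: j => [|j] /=; first by rewrite mxE normr0.
case: (ltnP j n) => jn /=; last by rewrite mxE normr0.
case: ifP => _; last by rewrite mxE normr0.
rewrite (le_trans (le_enorm _ _ _))// (le_trans (Hcb j jn w))// (le_trans (ler_norm _))//.
by rewrite (bigD1 (Ordinal jn)) //= lerDl sumr_ge0.
Qed.

Lemma grid_err_adapted j a k : measurable_wrt (mod_null (grid j)) (fun w => grid_err j w a k).
Proof.
have [_ _ _ hm] := ha; have sG := (mod_null_sigma (grid_ge0 j)).1.
apply/measurable_wrtP => // C mC.
have [[s1 s2 s3] _] := G0M (grid_ge0 j).
have NC A' : G0 (grid j) A' -> (forall w, ~ N w -> C (grid_val j w a k - c a k) <-> A' w) ->
   mod_null (grid j) ((fun w => grid_err j w a k) @^-1` C).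
  move=> GA' AE; apply: (mod_null_patch (b := C 0) (grid_ge0 j) GA').
    apply/seteqP; split => w [Cw nN]; split => //; move: Cw;
    rewrite /preimage /= /grid_err asboolF// !mxE => h1; exact/(AE w nN).
  by move=> w Nw; rewrite /preimage /= /grid_err asboolT// mxE.
have const (x : 'M[R]_d) : (forall w, grid_val j w = x) -> mod_null (grid j) ((fun w => grid_err j w a k) @^-1` C).
  move=> E; case: (pselect (C (x a k - c a k))) => h1.
    by apply: (NC setT) => [|w _]; [have := s2 _ s1; rewrite setD0|rewrite E].
  by apply: (NC set0) => // w _; rewrite E.
case: j NC const {sG s1 s2 s3} => [|j] NC const; first exact: (const 0).
case: (boolP ((j < n)%N && (sp_time h j <= t))) => [/andP[jn jt]|nj]; last first.
  by apply: (const 0) => w /=; rewrite (negPf nj).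
have E : grid j.+1 = sp_time h j by rewrite /= (ltnW jn); exact: min_idPr.
have mU : measurable ([set M : 'M[R]_d | C (M a k - c a k)] : set (borel 'M[R]_d)).
  rewrite -[X in measurable X]setTI.
  have mf : measurable_fun [set: borel 'M[R]_d] (fun M : borel 'M[R]_d => (M : 'M[R]_d) a k - c a k).
    by apply: measurable_funB; [exact: measurable_entry|exact: measurable_cst].
  exact: mf.
have [A' [GA' AA']] := joint_mod_null (sp_time_ge0 (ltnW jn)) (hm j jn _ mU).
apply: (NC A'); first by rewrite E.
move=> w nN; rewrite /grid_val jn jt /=; split => h1.
  by have [] : (A' `\` N) w by rewrite -AA'.
by have [] : ((sp_val h j @^-1` [set M : 'M[R]_d | C (M a k - c a k)]) `\` N) w by rewrite AA'.
Qed.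

Lemma grid_energy w a k : ~ N w -> ((\sum_(j < n.+2) grid_err j w a k ^+ 2 * (grid j.+1 - grid j))%:E <=
  \int[lebesgue_measure]_(u in `[0%R, t]) ((enorm (sp_eval h u w - H u w) ^+ 2)%R)%:E)%E.
Proof.
move=> nN.
pose f u := ((enorm (sp_eval h u w - c) ^+ 2)%:E : \bar R).
have [|||mf [_ If]] := @step_integral R f (fun j => enorm (grid_err j w) ^+ 2) grid n.+2.
- by move=> u; rewrite lee_fin sqr_ge0.
- by move=> j _; exact: gridS.
- by move=> j u _ ju; rewrite /f (sp_eval_grid w ju) /grid_err asboolF.
rewrite grid_last /= in mf If.
have -> : (\int[lebesgue_measure]_(u in `[0%R, t]) ((enorm (sp_eval h u w - H u w) ^+ 2)%R)%:E = \int[lebesgue_measure]_(u in `[0%R, t]) f u)%E.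
  by apply: eq_integral => u; rewrite inE /= in_itv /= => /andP[u0 _]; rewrite HN.
apply: (@le_trans _ _ (\int[lebesgue_measure]_(u in `]0%R, t]) f u)%E).
  rewrite If lee_fin; apply: ler_sum => j _; apply: ler_wpM2r; first by rewrite subr_ge0 gridS.
  by rewrite -[leLHS]real_normK ?num_real// ler_sqr ?nnegrE ?enorm_ge0// le_enorm.
apply: ge0_subset_integral => //=.
- by apply/(emeasurable_fun_itv_obnd_cbndP _ _ _).
- by move=> u _; rewrite lee_fin sqr_ge0.
- by apply: subset_itvr; rewrite bnd_simp.
Qed.

End grid.

Lemma enorm_lt_entry {m m' : nat} (x : 'M[R]_(m, m')) e i j : enorm x < e -> `|x i j| < e.
Proof. exact/le_lt_trans/le_enorm. Qed.

(** The elementary integrals of the [h n] converge to [I], and by [step_sum_tail] also to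
    [(W t - W 0) *m c^T], because the energies of the errors tend to 0 in probability. *)
Lemma ito_constant I : ito_integral Q W H I -> forall t, 0 <= t ->
  Q.-negligible [set w | I t w <> (W t w - W 0 w) *m c^T].
Proof.
move=> [h [ha hI]] t t0; have [h1 h2] := hI t t0.
have key a (e : R) : 0 < e -> prob_small Q (fun=> [set w | e <= `|I t w 0 a - ((W t w - W 0 w) *m c^T) 0 a|]).
  move=> e0.
  have e2 : 0 < e / 2 by rewrite divr_gt0.
  (* There are [d] scalar sums; if each is below [e'], their total is below [e / 2]. *)
  pose e' := e / 2 / d.+1%:R; have e'0 : 0 < e' by rewrite divr_gt0.
  pose St n k w := step_sum (fun u w => W u w 0 k) (fun j w => grid_err (h n) t j w a k) (grid (h n) t) (sp_size (h n)).+2 w.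
  apply: (@prob_smallS _ _ _ Q _ (fun n => ([set w | ((e / 2)%:E <= ereal_sup [set (enorm (sp_int (h n) W t w - I t w))%:E
                  | t in `[0%R, t]%classic])%E] `|` [set w | exists k, e' <= `|St n k w|]) `|` N)).
    move=> n w /= ew; case: (pselect (N w)) => nN; [by right|left].
    apply/or_asboolP; rewrite -implyNb; apply/implyP => /asboolPn => h1w; apply/asboolP.
    apply: contrapT => h2w.
    have {}h1w : `|sp_int (h n) W t w 0 a - I t w 0 a| < e / 2.
      have := @enorm_lt_entry _ _ (sp_int (h n) W t w - I t w) (e / 2) 0 a.
      rewrite !mxE; apply; rewrite ltNge; apply/negP => h3; apply: h1w.
      apply: le_trans (_ : ((e/2)%:E <= (enorm (sp_int (h n) W t w - I t w))%:E)%E) _; first by rewrite lee_fin.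
      by apply: ereal_sup_ubound => /=; exists t => //=; rewrite in_itv /= t0 lexx.
    have {}h2w : `|sp_int (h n) W t w 0 a - ((W t w - W 0 w) *m c^T) 0 a| < e / 2.
      have := @grid_sum_int (h n) t (ha n) w nN a; rewrite [in LHS]mxE ?mxE => ->.
      apply: (@le_lt_trans _ _ (\sum_(k < d) e')).
        apply: le_trans (ler_norm_sum _ _ _) _; apply: ler_sum => k _; apply/ltW.
        by rewrite ltNge; apply/negP => h3; apply: h2w; exists k.
      rewrite sumr_const card_ord -(mulr_natr e') /e' mulrC mulrA ltr_pdivrMr//.
      by rewrite mulrC ltr_pM2l// ltr_nat.
    have : e < e by rewrite [ltRHS]splitr (le_lt_trans ew)//
      (_ : _ - _ = (sp_int (h n) W t w 0 a - ((W t w - W 0 w) *m c^T) 0 a) - (sp_int (h n) W t w 0 a - I t w 0 a)) ?(le_lt_trans (ler_normB _ _)) ?ltrD//; ring.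
    by rewrite ltxx.
  apply: prob_smallU; last exact: prob_small_null.
  apply: prob_smallU; first by move=> eta; exact: cvg0_cover.
  apply: prob_small_bigcup => k eta eta0.
  (* Makes the Chebyshev term [secmom * delta / e'^2] at most [eta / 2]; the other half bounds the
     probability of an energy above [delta]. *)
  pose delta := eta / 2 * e' ^+ 2 / (`|secmom| + 1).
  have sm0 : 0 < `|@secmom R| + 1 by rewrite ltr_wpDl.
  have delta0 : 0 < delta by rewrite divr_gt0// mulr_gt0 ?exprn_gt0// divr_gt0.
  have eta2 : 0 < eta / 2 by rewrite divr_gt0.
  apply: filterS (cvg0_cover h1 delta0 eta2) => n [B [mB EB QB]].
  have [C HC] := grid_err_bound t (ha n).
  have GM := mod_null_sigma.
  have := @step_sum_tail R _ Omega Q mod_null (fun u w => W u w 0 k) GM mod_null_mono.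
  have Gbeta u : 0 <= u -> measurable_wrt (mod_null u) (fun w => W u w 0 k).
    by move=> u0; apply: measurable_wrtS (G0W u0 k); exact: G0_mod_null.
  have Ind u v : 0 <= u -> u < v -> is_dyadic u -> is_dyadic v -> forall A D, mod_null u A -> measurable D ->
    Q (A `&` (fun w => W v w 0 k - W u w 0 k) @^-1` D) = (Q A * normal_prob 0 (Num.sqrt (v - u)) D)%E.
    by move=> u0 uv du dv A D; exact: mod_null_indep.
  have Wc w (v : nat -> R) (u : R) : 0 <= u -> (forall n, 0 <= v n) -> v n @[n --> \oo] --> u ->
    W (v n) w 0 k @[n --> \oo] --> W u w 0 k by move=> u0 v0; exact: W_cont.
  move=> /(_ Gbeta Ind Wc (fun j w => grid_err (h n) t j w a k) (grid (h n) t) (sp_size (h n)).+2 C).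
  have g0 j : (j <= (sp_size (h n)).+2)%N -> 0 <= grid (h n) t j by move=> _; exact: grid_ge0.
  have gS j : (j < (sp_size (h n)).+2)%N -> grid (h n) t j <= grid (h n) t j.+1 by move=> _; exact: gridS.
  have gm j : (j < (sp_size (h n)).+2)%N -> measurable_wrt (mod_null (grid (h n) t j)) (fun w => grid_err (h n) t j w a k).
    by move=> _; exact: grid_err_adapted.
  have gC j w : (j < (sp_size (h n)).+2)%N -> `|grid_err (h n) t j w a k| <= C by [].
  move=> /(_ g0 gS gm gC delta e' (ltW delta0) e'0) tail.
  exists [set w | e' <= `|St n k w|]; split => //.
    have mst := step_sum_measurable mod_null_mono Gbeta g0 gS gm.
    have : measurable_fun setT (St n k).
      by apply: measurable_wrtW mst; exact: (GM _ (g0 _ (leqnn _))).2.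
    move=> mS; rewrite -[X in measurable X]setTI.
    have mabs : measurable_fun setT (fun w => `|St n k w|) by apply: measurableT_comp.
    have := mabs measurableT _ (measurable_itv `[e', +oo[).
    by congr measurable; apply/seteqP; split => w /=; rewrite in_itv /= andbT.
  apply: le_trans tail _; rewrite [eta in leRHS]splitr EFinD; apply: leeD; last first.
    rewrite lee_fin /delta ler_pdivrMr ?exprn_gt0// mulrA ler_pdivrMr// mulrC ler_pM2l//.
      by rewrite (le_trans (ler_norm _))// lerDl.
    by rewrite mulr_gt0// exprn_gt0.
  apply: le_trans QB; rewrite -[leRHS]adde0 -N0.
  apply: le_trans (measureU2 _ mB mN); apply: le_measure; rewrite ?inE; [|exact: measurableU|].
    have mg j : (j < (sp_size (h n)).+2)%N -> measurable_fun setT (fun w => grid_err (h n) t j w a k).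
      by move=> jN; apply: measurable_wrtW (gm j jN); exact: (GM _ (g0 _ (ltnW jN))).2.
    have mE : measurable_fun setT (fun w => \sum_(j < (sp_size (h n)).+2) grid_err (h n) t j w a k ^+ 2 * (grid (h n) t j.+1 - grid (h n) t j)).
      apply: measurable_sum => j; apply: measurable_funM; last exact: measurable_cst.
      by apply: measurable_funX; apply: mg.
    rewrite -[X in measurable X]setTI.
    have := mE measurableT _ (measurable_itv `]delta, +oo[).
    by congr measurable; apply/seteqP; split => w /=; rewrite in_itv /= andbT.
  move=> w /= dw; case: (pselect (N w)) => nN; [by right|left]; apply: EB => /=.
  apply: le_trans (grid_energy (ha n) t0 a k nN); by rewrite lee_fin ltW.
apply: (@negligibleS _ _ _ Q (\bigcup_n [set w | exists a, n.+1%:R^-1 <= `|I t w 0 a - ((W t w - W 0 w) *m c^T) 0 a|])).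
  move=> w /= nE; apply: contrapT => nU; apply: nE; apply/rowP => a.
  apply/eqP; rewrite -subr_eq0 -normr_eq0 eq_le normr_ge0 andbT; apply/ler_addgt0Pr => e e0; rewrite add0r.
  have [n _ /(_ n (leqnn n)) /= ne] := near_infty_natSinv_lt (PosNum e0).
  apply: contrapT => /negP; rewrite -ltNge => h3; apply: nU; exists n => //; exists a => /=.
  by rewrite (le_trans (ltW ne))// ltW.
apply: negligible_bigcup => n; apply: prob_small_negligible.
by apply: prob_small_bigcup => a; apply: key; rewrite invr_gt0.
Qed.

End ito_constant.


(** * Monotone class arguments from countable families *)

Section independence.
Context {R : realType} {d : measure_display} {Omega : measurableType d} (Q : probability Omega R).

Lemma indep_dynkin (B : set Omega) : measurable B ->
  dynkin [set A | measurable A /\ Q (A `&` B) = (Q A * Q B)%E].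
Proof.
move=> mB; split => /=.
- by split => //; rewrite setTI probability_setT mul1e.
- move=> A [mA QA]; split; first exact: measurableC.
  have fA : Q A \is a fin_num by exact: fin_num_measure.
  have fB : Q B \is a fin_num by exact: fin_num_measure.
  rewrite probability_setC// muleBl ?fin_num_adde_defr// mul1e -QA.
  have fAB : Q (A `&` B) \is a fin_num by apply: fin_num_measure; exact: measurableI.
  rewrite (setIC A) in fAB *; rewrite setIC -setDE.
  by rewrite (measureDI Q mB mA) addeK.
- move=> F tF mF; split; first by apply: bigcupT_measurable => n; case: (mF n).
  rewrite setI_bigcupl measure_semi_bigcup//; last 3 first.
  + by move=> n; apply: measurableI => //; case: (mF n).
  + by under eq_fun do rewrite setIC; exact: trivIset_setIl.
  + by apply: bigcupT_measurable => n; apply: measurableI => //; case: (mF n).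
  rewrite measure_semi_bigcup//; last 2 first.
  + by move=> n; case: (mF n).
  + by apply: bigcupT_measurable => n; case: (mF n).
  have fB : Q B \is a fin_num by exact: fin_num_measure.
  rewrite muleC -(fineK fB) -nneseriesZl//.
  by apply: eq_eseriesr => n _; rewrite (fineK fB) muleC; case: (mF n).
Qed.

Lemma indep_generated (G : set (set Omega)) (B : set Omega) : measurable B -> setI_closed G ->
  (forall A, G A -> measurable A /\ Q (A `&` B) = (Q A * Q B)%E) ->
  forall A, <<s G >> A -> Q (A `&` B) = (Q A * Q B)%E.
Proof.
move=> mB GI HG A; rewrite -setI_closed_g_dynkin_g_sigma_algebra// => GA.
suff : [set A | measurable A /\ Q (A `&` B) = (Q A * Q B)%E] A by case.
by apply: (smallest_sub (indep_dynkin mB) _ GA).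
Qed.

(** A countable family, closed under intersection, that generates the Borel sets: the passage to a
    conditional law costs one null set for each condition, hence allows countably many. *)
Definition rat_rays : set (set R) := [set `]ratr q, +oo[%classic | q in [set: rat]].

Lemma rat_rays_setI : setI_closed rat_rays.
Proof.
move=> _ _ [q _ <-] [q' _ <-]; exists (Num.max q q') => //.
apply/seteqP; split => x /=; rewrite !in_itv/= !andbT.
  case: (leP q q') => qq' h; split => //; apply: le_lt_trans h; rewrite ler_rat//; exact: ltW.
by move=> [h h']; case: (leP q q').
Qed.

Lemma rat_rays_gen : (measurable : set (set R)) `<=` <<s rat_rays >>.
Proof.
move=> D mD; have {mD} : (@RGenOInfty.G R).-sigma.-measurable D by rewrite -RGenOInfty.measurableE.
move: D; apply: smallest_sub; first exact: smallest_sigma_algebra.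
move=> _ [x ->].
have -> : `]x, +oo[%classic = \bigcup_(q in [set q : rat | x < ratr q]) `]ratr q, +oo[%classic.
  apply/seteqP; split => y /=; rewrite in_itv /= andbT.
    by move=> /rat_in_itvoo[q]; rewrite in_itv /= => /andP[xq qy]; exists q => //=; rewrite in_itv /= qy.
  by move=> [q /= xq]; rewrite in_itv /= andbT; exact: lt_trans.
pose T := g_sigma_algebraType rat_rays.
suff : measurable (\bigcup_(q in [set q : rat | x < ratr q]) (`]ratr q, +oo[%classic : set T)) by [].
rewrite bigcup_mkcond; apply: countable_bigcupT_measurable => // q.
case: ifP => // _; apply: sub_sigma_algebra; by exists q.
Qed.

Lemma normal_prob_gen (s : R) (Z : Omega -> R) : measurable_fun setT Z ->
  (forall q : rat, Q (Z @^-1` `]ratr q, +oo[) = normal_prob 0 s `]ratr q, +oo[%classic) ->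
  forall D, measurable D -> Q (Z @^-1` D) = normal_prob 0 s D.
Proof.
move=> mZ HZ D mD.
have mp (C : set R) : measurable C -> measurable (Z @^-1` C) by move=> mC; rewrite -[X in measurable X]setTI; exact: mZ.
suff : [set C : set R | measurable C /\ Q (Z @^-1` C) = normal_prob 0 s C] D by case.
have := rat_rays_gen mD; rewrite -(setI_closed_g_dynkin_g_sigma_algebra rat_rays_setI).
apply: smallest_sub; last by move=> _ [q _ <-]; split.
split => /=.
- by split => //; rewrite preimage_setT probability_setT [RHS]probability_setT.
- move=> C [mC QC]; split; first exact: measurableC.
  rewrite -preimage_setC probability_setC; last exact: mp.
  by rewrite [RHS](@probability_setC _ _ _ (normal_prob 0 s) C mC) QC.
- move=> C tC mC; split; first by apply: bigcupT_measurable => n; case: (mC n).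
  rewrite preimage_bigcup measure_semi_bigcup//; last 3 first.
  + by move=> n; apply: mp; case: (mC n).
  + by apply/trivIsetP => i j _ _ ij; rewrite -preimage_setI; move/trivIsetP: tC => ->//; rewrite preimage_set0.
  + by apply: bigcupT_measurable => n; apply: mp; case: (mC n).
  rewrite [RHS](@measure_semi_bigcup _ _ _ (normal_prob 0 s) C)//; last 2 first.
  + by move=> n; case: (mC n).
  + by apply: bigcupT_measurable => n; case: (mC n).
  by apply: eq_eseriesr => n _; case: (mC n).
Qed.

End independence.

(** * Passage to the conditional laws *)

Section conditioning.
Context {R : realType} {d d' : measure_display} {Omega : measurableType d} {A : measurableType d'}.
Variables (P : probability Omega R) (X0 : Omega -> A) (Ps : R.-pker A ~> Omega).
Hypothesis mX0 : measurable_fun setT X0.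
Hypothesis PsP : regular_conditional P X0 Ps.

(** Almost everywhere for the law of [X0], with the exceptional set taken in [A] and its probability
    computed on [Omega]. *)
Definition law_ae (L : A -> Prop) : Prop :=
  exists C, [/\ measurable C, P (X0 @^-1` C) = 0%E & forall s, ~ C s -> L s].

Lemma law_aeP L : law_ae L -> {ae pushforward P X0, forall s, L s}.
Proof.
by move=> [C [mC PC CL]]; exists C; split => // s /= nL; apply: contrapT => /CL.
Qed.

Let mpre C : measurable C -> measurable (X0 @^-1` C).
Proof. by move=> mC; rewrite -[X in measurable X]setTI; exact: mX0. Qed.

Lemma law_aeS (L L' : A -> Prop) : (forall s, L s -> L' s) -> law_ae L -> law_ae L'.
Proof. by move=> LL' [C [mC PC CL]]; exists C; split => // s /CL /LL'. Qed.

Lemma law_aeT (L : A -> Prop) : (forall s, L s) -> law_ae L.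
Proof. by move=> HL; exists set0; split => //; rewrite preimage_set0 measure0. Qed.

Lemma law_ae_forall {I : countType} (L : I -> A -> Prop) : (forall i, law_ae (L i)) ->
  law_ae (fun s => forall i, L i s).
Proof.
move=> /choice[C HC]; pose D n := if @unpickle I n is Some i then C i else set0.
have mD n : measurable (D n) by rewrite /D; case: unpickle => // i; case: (HC i).
exists (\bigcup_n D n); split; first exact: bigcupT_measurable.
  rewrite preimage_bigcup; apply/negligibleP; first by apply: bigcupT_measurable => n; exact: mpre.
  apply: negligible_bigcup => n; apply/negligibleP; first exact: mpre.
  by rewrite /D; case: unpickle => [i|]; [case: (HC i)|rewrite preimage_set0 measure0].
move=> s nD i; have [_ _] := HC i; apply => Cs; apply: nD.
by exists (pickle i) => //; rewrite /D pickleK.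
Qed.

Lemma law_ae_and (L L' : A -> Prop) : law_ae L -> law_ae L' -> law_ae (fun s => L s /\ L' s).
Proof.
move=> HL HL'; apply: (@law_aeS (fun s => forall b : bool, if b then L s else L' s)).
  by move=> s h; split; [exact: (h true)|exact: (h false)].
by apply: law_ae_forall => -[].
Qed.

Let mker E : measurable E -> measurable_fun setT (fun s => Ps s E).
Proof. exact: measurable_kernel. Qed.

Let mkerX E : measurable E -> measurable_fun setT (fun w => Ps (X0 w) E).
Proof. by move=> mE; exact: (measurableT_comp (mker mE) mX0). Qed.

(** On [D] the function [g - f] is positive but has integral 0, so it vanishes almost everywhere
    there. *)
Lemma null_of_integral (D : set Omega) (f g : Omega -> \bar R) : measurable D ->
  measurable_fun setT f -> measurable_fun setT g ->
  (forall w, 0 <= f w <= 1)%E -> (forall w, 0 <= g w <= 1)%E ->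
  (\int[P]_(w in D) f w = \int[P]_(w in D) g w)%E ->
  (forall w, D w -> (f w < g w)%E) -> P D = 0%E.
Proof.
move=> mD mf mg f01 g01 fg lt.
have intg h : measurable_fun setT h -> (forall w, 0 <= h w <= 1)%E -> P.-integrable D h.
  move=> mh h01; apply: (@le_integrable _ _ _ P D mD _ (cst 1%E)) => //.
  - exact: measurable_funTS.
  - move=> w _; have /andP[h0 h1] := h01 w.
    by rewrite gee0_abs// gee0_abs.
  - by apply: finite_measure_integrable_cst.
have If := intg _ mf f01; have Ig := intg _ mg g01.
have I0 : (\int[P]_(w in D) (g w - f w) = 0)%E.
  rewrite integralB// fg subee//; exact: integrable_fin_num.
have : (\int[P]_(w in D) `|g w - f w| = 0)%E.
  rewrite -[RHS]I0; apply: eq_integral => w; rewrite inE => /lt h.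
  by rewrite gee0_abs// sube_ge0 ?ltW//; have /andP[f0 f1] := f01 w; rewrite fin_numElt (lt_le_trans _ f0)//= (le_lt_trans f1)// ltry.
move=> /(ae_eq_integral_abs P mD); case.
  by apply: emeasurable_funB; exact: measurable_funTS.
move=> N [mN PN sub]; apply/eqP; rewrite eq_le measure_ge0 andbT -PN.
apply: le_measure; rewrite ?inE// => w Dw; apply: sub => /= h.
have := lt w Dw; have /andP[f0 f1] := f01 w; have /andP[g0 g1] := g01 w.
have ff : f w \is a fin_num by rewrite fin_numElt (lt_le_trans _ f0)//= (le_lt_trans f1)// ltry.
have gf : g w \is a fin_num by rewrite fin_numElt (lt_le_trans _ g0)//= (le_lt_trans g1)// ltry.
have /eqP := h Dw; rewrite sube_eq// ?fin_num_adde_defr//.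
by rewrite add0e => /eqP ->; rewrite ltxx.
Qed.

(** The set where one function is below the other is an event of [X0], on which [null_of_integral]
    applies; once in each direction. *)
Lemma law_ae_eq (f g : A -> \bar R) : measurable_fun setT f -> measurable_fun setT g ->
  (forall s, 0 <= f s <= 1)%E -> (forall s, 0 <= g s <= 1)%E ->
  (forall C, measurable C -> \int[P]_(w in X0 @^-1` C) f (X0 w) = \int[P]_(w in X0 @^-1` C) g (X0 w))%E ->
  law_ae (fun s => f s = g s).
Proof.
move=> mf mg f01 g01 fg.
have key (h k : A -> \bar R) : measurable_fun setT h -> measurable_fun setT k ->
  (forall s, 0 <= h s <= 1)%E -> (forall s, 0 <= k s <= 1)%E ->
  (forall C, measurable C -> \int[P]_(w in X0 @^-1` C) h (X0 w) = \int[P]_(w in X0 @^-1` C) k (X0 w))%E ->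
  law_ae (fun s => (k s <= h s)%E).
  move=> mh mk h01 k01 hk; exists [set s | (h s < k s)%E].
  have mC : measurable [set s | (h s < k s)%E].
    by rewrite -[X in measurable X]setTI; exact: emeasurable_fun_lt.
  split => //; last by move=> s /negP; rewrite -leNgt.
  apply: (@null_of_integral _ (h \o X0) (k \o X0)) => //.
  - exact: mpre.
  - exact: measurableT_comp mX0.
  - exact: measurableT_comp mX0.
  - by move=> w; exact: h01.
  - by move=> w; exact: k01.
  - exact: hk.
apply: law_aeS (law_ae_and (key g f mg mf g01 f01 _) (key f g mf mg f01 g01 fg)); last first.
  by move=> C mC; rewrite fg.
by move=> s [h h']; apply/eqP; rewrite eq_le h h'.
Qed.

Lemma Ps01 s E : measurable E -> (0 <= Ps s E <= 1)%E.
Proof.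
move=> mE; rewrite measure_ge0 /= -(@prob_kernel _ _ _ _ _ Ps s).
by apply: le_measure; rewrite ?inE.
Qed.

(** [B] has probability [r] and is independent of [E] jointly with [X0]; testing on the events of
    [X0] transfers the independence to almost every [Ps s]. *)
Lemma law_ae_indep (E B : set Omega) (r : R) : measurable E -> measurable B -> 0 <= r <= 1 ->
  (forall C, measurable C -> P ((E `&` B) `&` X0 @^-1` C) = (P (E `&` X0 @^-1` C) * r%:E)%E) ->
  law_ae (fun s => Ps s (E `&` B) = (Ps s E * r%:E)%E).
Proof.
move=> mE mB /andP[r0 r1] H; have mEB : measurable (E `&` B) by exact: measurableI.
apply: law_ae_eq.
- exact: mker.
- by apply: emeasurable_funM; [exact: mker|exact: measurable_cst].
- by move=> s; exact: Ps01.
- move=> s; have /andP[h0 h1] := Ps01 s mE.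
  rewrite mule_ge0//= ?lee_fin// -[leRHS]mule1; apply: lee_pmul => //; by rewrite lee_fin.
- move=> C mC; rewrite -PsP// H// PsP// -ge0_integralZr//.
  + exact: mpre.
  + by apply: measurable_funTS; exact: mkerX.
Qed.

Lemma law_ae_null N : measurable N -> P N = 0%E -> law_ae (fun s => Ps s N = 0%E).
Proof.
move=> mN N0; apply: (@law_ae_eq _ (cst 0%E)) => //.
- exact: mker.
- by move=> s; exact: Ps01.
- by move=> s; rewrite /= lexx lee01.
- move=> C mC; rewrite -PsP// integral0.
  apply/eqP; rewrite eq_le measure_ge0 andbT -N0; apply: le_measure; rewrite ?inE//.
  by apply: measurableI => //; exact: mpre.
Qed.

Lemma law_ae_ae (L : Omega -> Prop) : {ae P, forall w, L w} ->
  law_ae (fun s => {ae Ps s, forall w, L w}).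
Proof.
move=> [N [mN N0 LN]]; apply: law_aeS (law_ae_null mN N0) => s Ns.
by exists N.
Qed.

(** Integrated over starting points in [C], the mass that the kernel puts outside [C] is the
    probability that [X0] lies both in [C] and outside it. *)
Lemma law_ae_start C : measurable C -> law_ae (fun s => C s -> Ps s (X0 @^-1` (~` C)) = 0%E).
Proof.
move=> mC; have mC' := measurableC mC.
have := @law_ae_eq (fun s => Ps s (X0 @^-1` (~` C)) * (\1_C s)%:E)%E (cst 0%E).
have m1 : measurable_fun setT (fun s => Ps s (X0 @^-1` (~` C)) * (\1_C s)%:E)%E.
  apply: emeasurable_funM; first exact: mker (mpre mC').
  exact/measurable_EFinP/measurable_indic.
have h01 s : (0 <= Ps s (X0 @^-1` (~` C)) * (\1_C s)%:E <= 1)%E.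
  have := Ps01 s (mpre mC'); rewrite indicE; case: (_ \in _); rewrite ?mule1// mule0 lexx/=.
  by rewrite lee01.
move=> /(_ m1 (measurable_cst _) h01).
have c01 (s : A) : (0 <= cst (0 : \bar R) s <= 1)%E by rewrite lexx lee01.
move=> /(_ c01) H; apply: law_aeS (H _) => [s + Cs|C' mD].
  by rewrite indicE mem_set// mule1.
rewrite integral0.
transitivity (\int[P]_(w in X0 @^-1` (C' `&` C)) Ps (X0 w) (X0 @^-1` (~` C)))%E.
  rewrite preimage_setI integral_mkcondr; apply: eq_integral => w _.
  rewrite /patch /= indicE (_ : (w \in X0 @^-1` C) = (X0 w \in C)); last first.
    by apply/idP/idP; rewrite !inE.
  by case: ifP => _; rewrite ?mule1 ?mule0.
rewrite -PsP//; [|exact: mpre|exact: measurableI].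
rewrite (_ : _ `&` _ = set0) ?measure0// -subset0 => w /= [h [_ h']].
exact: h h'.
Qed.

End conditioning.


(** * The past of the noise, generated by rational cylinders *)

Section past.
Context {R : realType} {d : nat} {dO : measure_display} {Omega : measurableType dO}.
Variable W : R -> Omega -> 'rV[R]_d.

Definition dyad (e : nat * nat) : R := e.2%:R / 2 ^+ e.1.

Lemma dyad_ge0 e : 0 <= dyad e.
Proof. by rewrite divr_ge0// exprn_ge0. Qed.

(** Conditions of the list at dyadic times after [u] are void, so that for every [u] the same
    countable set of lists indexes a generating family closed under intersection. *)
Definition past_cyl (L : seq (nat * nat * 'I_d * rat)) (u : R) : set Omega :=
  [set w | forall e, e \in L -> dyad e.1.1 <= u -> ratr e.2 < W (dyad e.1.1) w 0 e.1.2].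

Definition past (u : R) : set (set Omega) := <<s [set past_cyl L u | L in setT] >>.

Lemma past_cyl_cat L L' u : past_cyl (L ++ L') u = past_cyl L u `&` past_cyl L' u.
Proof.
apply/seteqP; split => w /=.
  by move=> h; split => e eL; apply: h; rewrite mem_cat eL ?orbT.
by move=> [h h'] e; rewrite mem_cat => /orP[]; [exact: h|exact: h'].
Qed.

Lemma past_cyl_setI u : setI_closed [set past_cyl L u | L in setT].
Proof. by move=> _ _ [L _ <-] [L' _ <-]; exists (L ++ L') => //; rewrite past_cyl_cat. Qed.

Lemma past_cyl_nil u : past_cyl [::] u = setT.
Proof. by apply/seteqP; split => w. Qed.

Lemma past_cyl_cons e L u : past_cyl (e :: L) u = past_cyl [:: e] u `&` past_cyl L u.
Proof. by rewrite -past_cyl_cat. Qed.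

Lemma past_cyl1 e u : past_cyl [:: e] u =
  if dyad e.1.1 <= u then (fun w => W (dyad e.1.1) w 0 e.1.2) @^-1` `]ratr e.2, +oo[ else setT.
Proof.
case: ifP => eu; apply/seteqP; split => w //=.
- by move=> /(_ e); rewrite inE in_itv /= andbT; apply.
- by rewrite in_itv/= andbT => h e'; rewrite inE => /eqP ->.
- by move=> _ e'; rewrite inE => /eqP ->; rewrite eu.
Qed.

Lemma past_cyl_in (G : set (set Omega)) L u : sigma_algebra setT G ->
  (forall v k, 0 <= v -> v <= u -> measurable_wrt G (fun w => W v w 0 k)) -> G (past_cyl L u).
Proof.
move=> sG HW; have GT : G setT by have [s1 s2 _] := sG; have := s2 _ s1; rewrite setD0.
have GI A A' : G A -> G A' -> G (A `&` A').
  move=> GA GA'; have E : <<s G >> = G by exact: sigma_algebra_id.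
  rewrite -E; have := @measurableI _ (g_sigma_algebraType G) A A'.
  by rewrite /measurable /= E; apply.
elim: L => [|e L IH]; first by rewrite past_cyl_nil.
rewrite past_cyl_cons; apply: GI => //; rewrite past_cyl1; case: ifP => // eu.
by have /(measurable_wrtP _ sG) := HW _ e.1.2 (dyad_ge0 e.1.1) eu; apply.
Qed.

Lemma past_sub (G : set (set Omega)) u : sigma_algebra setT G ->
  (forall v k, 0 <= v -> v <= u -> measurable_wrt G (fun w => W v w 0 k)) -> past u `<=` G.
Proof.
move=> sG HW; apply: smallest_sub => // _ [L _ <-]; exact: past_cyl_in.
Qed.

Lemma past_sigma u : sigma_algebra setT (past u).
Proof. exact: smallest_sigma_algebra. Qed.

Hypothesis W_cont : forall w (v : nat -> R) (u : R) k, 0 <= u -> (forall n, 0 <= v n) ->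
  v n @[n --> \oo] --> u -> W (v n) w 0 k @[n --> \oo] --> W u w 0 k.

Lemma past_dyadic u e : dyad e <= u -> forall k, measurable_wrt (past u) (fun w => W (dyad e) w 0 k).
Proof.
move=> eu k; apply/(measurable_wrtP _ (past_sigma u)) => C /rat_rays_gen.
pose f w := W (dyad e) w 0 k.
suff : <<s rat_rays >> `<=` [set C : set R | past u (f @^-1` C)] by apply.
apply: smallest_sub.
  have [s1 s2 s3] := past_sigma u; split => /=.
  - by rewrite preimage_set0.
  - by move=> D HD; exact: (s2 _ HD).
  - by move=> D HD; rewrite preimage_bigcup; exact: s3.
move=> _ [q _ <-]; apply: sub_sigma_algebra; exists [:: (e, k, q)] => //.
by rewrite past_cyl1 /= eu.
Qed.

(** By continuity [W u] is a limit of values at dyadic times at most [u]. *)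
Lemma past_W u : 0 <= u -> forall k, measurable_wrt (past u) (fun w => W u w 0 k).
Proof.
move=> u0 k.
apply: (@measurable_fun_cvg _ (g_sigma_algebraType (past u)) R setT (fun n w => W (dyadic n u) w 0 k)).
- move=> n; have /andP[_ h] := dyadic_le n u0.
  exact: (@past_dyadic u (n, _) h k).
- move=> w _; apply: W_cont => //; last exact: cvg_dyadic.
  by move=> n; have /andP[] := dyadic_le n u0.
Qed.

Lemma past_mono u v : 0 <= u -> u <= v -> past u `<=` past v.
Proof.
move=> u0 uv; apply: past_sub; first exact: past_sigma.
move=> x k x0 xu; apply: measurable_wrtS (past_W x0 k).
move=> A; apply: smallest_sub; first exact: past_sigma.
move=> _ [L _ <-]; apply: sub_sigma_algebra.
(* Conditions void at time [x] must be removed, as they may be active at the later time. *)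
exists [seq e <- L | dyad e.1.1 <= x] => //.
apply/seteqP; split => w /= h e.
  by move=> eL ex; apply: h; rewrite ?mem_filter ?ex// (le_trans ex)// (le_trans xu).
by rewrite mem_filter => /andP[ex eL] _; exact: h.
Qed.

Lemma past_measurable u : 0 <= u -> (forall v k, 0 <= v -> measurable_fun setT (fun w => W v w 0 k)) ->
  past u `<=` measurable.
Proof.
move=> u0 mW; apply: past_sub; first exact: sigma_algebra_measurable.
move=> v k v0 vu; apply/measurable_wrtP; first exact: sigma_algebra_measurable.
by move=> C mC; rewrite -[X in measurable X]setTI; exact: mW.
Qed.

(** Two monotone class arguments: from cylinders to the whole past with a rational ray fixed, then
    from rational rays to Borel sets with the past event fixed. The empty cylinder gives the law of
    the increment. *)
Lemma past_indep (Q : probability Omega R) :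
  (forall v k, 0 <= v -> measurable_fun setT (fun w => W v w 0 k)) ->
  (forall e e' k L q, dyad e < dyad e' ->
    Q (past_cyl L (dyad e) `&` (fun w => W (dyad e') w 0 k - W (dyad e) w 0 k) @^-1` `]ratr q, +oo[) =
    (Q (past_cyl L (dyad e)) * normal_prob 0 (Num.sqrt (dyad e' - dyad e)) `]ratr q, +oo[%classic)%E) ->
  forall u t : R, 0 <= u -> u < t -> is_dyadic u -> is_dyadic t ->
  forall k A D, past u A -> measurable D ->
  Q (A `&` (fun w => W t w 0 k - W u w 0 k) @^-1` D) = (Q A * normal_prob 0 (Num.sqrt (t - u)) D)%E.
Proof.
move=> mW HQ u t u0 ut [n [j uE]] [n' [j' tE]] k A D pA mD.
have {}uE : u = dyad (n, j) by []. have {}tE : t = dyad (n', j') by [].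
have {}HQ L q := HQ (n, j) (n', j') k L q; rewrite -uE -tE in HQ.
pose Z w := W t w 0 k - W u w 0 k.
have mZ : measurable_fun setT Z.
  by apply: measurable_funB; apply: mW => //; exact: le_trans (ltW ut).
have mp C : measurable C -> measurable (Z @^-1` C) by move=> mC; rewrite -[X in measurable X]setTI; exact: mZ.
have QZ C : measurable C -> Q (Z @^-1` C) = normal_prob 0 (Num.sqrt (t - u)) C.
  apply: normal_prob_gen => // q; have := HQ [::] q ut.
  by rewrite past_cyl_nil setTI => ->; rewrite probability_setT mul1e.
rewrite -QZ//.
have mray (q : rat) : measurable (`]ratr q, +oo[%classic : set R) by exact: measurable_itv.
have mpast A' : past u A' -> measurable A' by exact: past_measurable.
have step q : Q (A `&` Z @^-1` `]ratr q, +oo[) = (Q A * Q (Z @^-1` `]ratr q, +oo[))%E.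
  apply: (indep_generated (mp _ (mray q)) (@past_cyl_setI u)) pA => _ [L _ <-].
  split; last by rewrite HQ// QZ.
  by apply: mpast; apply: sub_sigma_algebra; exists L.
have mA := mpast _ pA.
have GI : setI_closed [set Z @^-1` C | C in rat_rays].
  move=> _ _ [C HC <-] [C' HC' <-]; exists (C `&` C'); first exact: rat_rays_setI.
  by rewrite preimage_setI.
have gen : <<s [set Z @^-1` C | C in rat_rays] >> (Z @^-1` D).
  have := rat_rays_gen mD; suff : <<s rat_rays >> `<=` [set C : set R | <<s [set Z @^-1` C | C in rat_rays] >> (Z @^-1` C)] by apply.
  have [s1 s2 s3] := @smallest_sigma_algebra _ setT [set Z @^-1` C | C in rat_rays].
  apply: smallest_sub.
    split => /=.
    - by rewrite preimage_set0.
    - by move=> C HD; exact: (s2 _ HD).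
    - by move=> C HC; rewrite preimage_bigcup; exact: s3.
  by move=> C HC; apply: sub_sigma_algebra; exists C.
rewrite setIC muleC; apply: (indep_generated mA GI) gen => _ [_ [q _ <-] <-].
split; first exact: mp.
by rewrite setIC step muleC.
Qed.

End past.

(** * A local Gronwall inequality *)

Section gronwall.
Context {R : realType}.
Local Notation mu := (@lebesgue_measure R).

Lemma integrable_sub_itv (f : R -> R) (a b a' b' : R) : mu.-integrable `[a, b] (EFin \o f) ->
  a <= a' -> b' <= b -> mu.-integrable `[a', b'] (EFin \o f).
Proof.
move=> If aa' bb'; apply: integrableS If => //.
by apply: subset_itv; rewrite bnd_simp.
Qed.

(** Where the integral of [f] is at most [1/(2C)], each [|D j|] is at most [max phi / (2C)]; summing
    over fewer than [C] indices gives [max phi <= max phi / 2]. A local statement fits its use, as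
    the bound on [g] will be known only shortly after a time of agreement. *)
Lemma local_gronwall {I : finType} (D g : I -> R -> R) (f : R -> R) (a b : R) : a < b ->
  (forall j, mu.-integrable `[a, b] (EFin \o g j)) -> mu.-integrable `[a, b] (EFin \o f) ->
  (forall u, 0 <= f u) ->
  (forall j u, a <= u <= b -> D j u = \int[mu]_(v in `[a, u]) g j v) ->
  {ae mu, forall u, a <= u <= b -> forall j, `|g j u| <= (\sum_i `|D i u|) * f u} ->
  exists2 c, a < c <= b & forall u j, a <= u <= c -> D j u = 0.
Proof.
move=> ab Ig If f0 DE gle.
pose C : R := #|I|%:R + 1.
have C0 : 0 < C by rewrite ltr_wpDl.
have e0 : 0 < (2 * C)^-1 by rewrite invr_gt0 mulr_gt0.
have [d /= d0 dH] := @parameterized_integral_near_left R a b (2 * C)^-1 f ab e0 If.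
pose c := Num.min b (a + d / 2).
have ac : a < c by rewrite lt_min ab /= ltrDl divr_gt0.
have cb : c <= b by rewrite ge_min lexx.
have intf u : a <= u <= c -> \int[mu]_(v in `[a, u]) f v <= (2 * C)^-1.
  move=> /andP[au uc]; apply/ltW/(le_lt_trans (ler_norm _)); apply: dH => //=.
  rewrite distrC ger0_norm ?subr_ge0// ltrBlDl (le_lt_trans uc)//.
  by rewrite gt_min ltrD2l ltr_pdivrMr// ltr_pMr// ltr1n orbT.
exists c; first by rewrite ac.
pose phi u := \sum_i `|D i u|.
have cphi : {within `[a, c], continuous phi}.
  move=> x; apply: (@cvg_big _ _ _ _ _ add_continuous) => i _; apply: cvg_norm.
  have h : {within `[a, c], continuous (D i)}.
    apply: (@subspace_eq_continuous _ _ _ (fun u => \int[mu]_(v in `[a, u]) g i v)).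
      by move=> u; rewrite inE /= in_itv /= => /andP[au uc]; apply/esym/DE; rewrite au (le_trans uc).
    apply: parameterized_integral_continuous; first exact: ltW.
    exact: integrable_sub_itv (Ig i) (lexx _) cb.
  exact: h.
have [x0 xI xmax] := EVT_max (ltW ac) cphi.
have phi0 u : 0 <= phi u by apply: sumr_ge0.
have main u j : a <= u <= c -> `|D j u| <= phi x0 * (2 * C)^-1.
  move=> /andP[au uc]; have ub := le_trans uc cb.
  have Igu := integrable_sub_itv (Ig j) (lexx a) ub.
  have Ifu := integrable_sub_itv If (lexx a) ub.
  have aub : a <= u <= b by rewrite au.
  rewrite DE//; apply: le_trans (le_normr_Rintegral _ Igu) _ => //.
  apply: (@le_trans _ _ (\int[mu]_(v in `[a, u]) (phi x0 * f v))); last first.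
    rewrite RintegralZl//; apply: ler_wpM2l => //.
    by apply: intf; rewrite au.
  have Ipf : mu.-integrable `[a, u] (EFin \o (fun v => phi x0 * f v)).
    apply: (@eq_integrable _ _ _ mu _ _ (fun v => (phi x0)%:E * (EFin \o f) v)%E) => //.
    exact: integrableZl.
  apply: fine_le.
  - apply: integrable_fin_num => //; exact: integrable_norm.
  - exact: integrable_fin_num.
  apply: ae_ge0_le_integral => //.
  - exact: (measurable_int _ (integrable_norm Igu)).
  - by move=> v _; rewrite lee_fin mulr_ge0.
  - exact: (measurable_int _ Ipf).
  have [N [mN N0 sub]] := gle; exists N; split => // v /= nv; apply: sub => /= {}gle; apply: nv.
  rewrite in_itv /= => /andP[av vu].
  rewrite lee_fin (le_trans (gle _ _))//; first by rewrite av (le_trans vu ub).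
  by apply: ler_wpM2r => //; apply: xmax; rewrite in_itv /= av (le_trans vu uc).
have phix0 : phi x0 = 0.
  apply/eqP; rewrite eq_le phi0 andbT.
  have : phi x0 <= phi x0 / 2.
    have {1}-> : phi x0 = \sum_i `|D i x0| by [].
    apply: (@le_trans _ _ (\sum_(i : I) (phi x0 * (2 * C)^-1))).
      by apply: ler_sum => i _; apply: main; rewrite in_itv in xI.
    rewrite sumr_const -(mulr_natr (_ * _)) -mulrA ler_wpM2l//.
    rewrite invfM -mulrA ger_pMr ?invr_gt0//.
    by rewrite mulrC ler_pdivrMr// mul1r lerDl.
  by rewrite ler_pdivlMr//; have := phi0 x0; lra.
move=> u j uI; apply/eqP; rewrite -normr_eq0 eq_le normr_ge0 andbT.
by have := main u j uI; rewrite phix0 mul0r.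
Qed.

Lemma Rintegral_itv_split (f : R -> R) (a b c : R) : a <= b -> b <= c ->
  mu.-integrable `[a, c] (EFin \o f) ->
  \int[mu]_(v in `[a, c]) f v = \int[mu]_(v in `[a, b]) f v + \int[mu]_(v in `[b, c]) f v.
Proof.
move=> ab bc If.
have := @Rintegral_itvB R f (BLeft a) (BRight c) b If; rewrite !bnd_simp => /(_ ab bc) h.
have -> : \int[mu]_(v in `[b, c]) f v = \int[mu]_(x0 in `]b, c]) f x0.
  rewrite Rintegral_itv_obnd_cbnd//.
  apply: integrableS If => //; by apply: subset_itv; rewrite bnd_simp.
by rewrite -h addrC subrK.
Qed.

End gronwall.


(** * Norm inequalities and one-sided limits *)

Section euclidean_norm.
Context {R : realType}.

(** The Cauchy-Schwarz inequality, by expanding the sum of the squares of [x i * Y - y i * X];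
    vanishing norms are treated apart because the expansion is divided by [2 * (X * Y)]. *)
Lemma sum_le_mul_sqrt {I : finType} (x y : I -> R) :
  \sum_i x i * y i <= Num.sqrt (\sum_i x i ^+ 2) * Num.sqrt (\sum_i y i ^+ 2).
Proof.
have s0 (z : I -> R) : 0 <= \sum_i z i ^+ 2 by apply: sumr_ge0 => i _; rewrite sqr_ge0.
have z0 (z : I -> R) : Num.sqrt (\sum_i z i ^+ 2) = 0 -> forall i, z i = 0.
  move=> /eqP; rewrite sqrtr_eq0 => h i; apply/eqP; rewrite -sqrf_eq0 eq_le sqr_ge0 andbT.
  by apply: le_trans h; rewrite (bigD1 i)//= lerDl sumr_ge0// => j _; rewrite sqr_ge0.
set X := Num.sqrt (\sum_i x i ^+ 2); set Y := Num.sqrt (\sum_i y i ^+ 2).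
have [X0|X0] := eqVneq X 0; first by rewrite X0 mul0r big1// => i _; rewrite (z0 x X0) mul0r.
have [Y0|Y0] := eqVneq Y 0; first by rewrite Y0 mulr0 big1// => i _; rewrite (z0 y Y0) mulr0.
have Xp : 0 < X by rewrite lt_def X0 sqrtr_ge0.
have Yp : 0 < Y by rewrite lt_def Y0 sqrtr_ge0.
have X2 : \sum_i x i ^+ 2 = X ^+ 2 by rewrite sqr_sqrtr.
have Y2 : \sum_i y i ^+ 2 = Y ^+ 2 by rewrite sqr_sqrtr.
have h : 0 <= \sum_i (x i * Y - y i * X) ^+ 2 by apply: sumr_ge0 => i _; rewrite sqr_ge0.
have E : \sum_i (x i * Y - y i * X) ^+ 2 = 2 * (X * Y) * (X * Y - \sum_i x i * y i).
  rewrite (eq_bigr (fun i => x i ^+ 2 * Y ^+ 2 + y i ^+ 2 * X ^+ 2 - 2 * (X * Y) * (x i * y i))).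
    by rewrite sumrB big_split /= -!mulr_suml X2 Y2 -mulr_sumr; ring.
  by move=> i _; ring.
by move: h; rewrite E pmulr_rge0 ?subr_ge0// !mulr_gt0.
Qed.

Lemma enorm_pair {m n : nat} (x : 'M[R]_(m, n)) :
  enorm x = Num.sqrt (\sum_(p : 'I_m * 'I_n) x p.1 p.2 ^+ 2).
Proof. by rewrite /enorm pair_bigA. Qed.

Lemma ler_enormD {m n : nat} (x y : 'M[R]_(m, n)) : enorm (x + y) <= enorm x + enorm y.
Proof.
rewrite -(@ler_sqr R) ?nnegrE ?addr_ge0 ?enorm_ge0//.
have s0 (z : 'M[R]_(m, n)) : 0 <= \sum_(p : 'I_m * 'I_n) z p.1 p.2 ^+ 2.
  by apply: sumr_ge0 => i _; rewrite sqr_ge0.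
have := @sum_le_mul_sqrt _ (fun p => x p.1 p.2) (fun p => y p.1 p.2).
rewrite !enorm_pair sqrrD !sqr_sqrtr// => h.
rewrite (eq_bigr (fun p : 'I_m * 'I_n => x p.1 p.2 ^+ 2 + (x p.1 p.2 * y p.1 p.2) *+ 2 + y p.1 p.2 ^+ 2)); last first.
  by move=> p _; rewrite mxE sqrrD.
by rewrite big_split big_split /= lerD2r lerD2l sumrMnl lerMn2r h orbT.
Qed.

Lemma enormN {m n : nat} (x : 'M[R]_(m, n)) : enorm (- x) = enorm x.
Proof. by rewrite !enorm_pair; congr Num.sqrt; apply: eq_bigr => p _; rewrite mxE sqrrN. Qed.

Lemma enormB {m n : nat} (x y : 'M[R]_(m, n)) : enorm (x - y) = enorm (y - x).
Proof. by rewrite -enormN opprB. Qed.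

Lemma enorm_perturb {m n : nat} (x y x' y' : 'M[R]_(m, n)) :
  enorm (x - y) <= enorm (x' - y') + (enorm (x' - x) + enorm (y' - y)).
Proof.
have -> : x - y = (x' - y') + ((x - x') + (y' - y)).
  by apply/matrixP => i j; rewrite !mxE; ring.
apply: le_trans (ler_enormD _ _) _; rewrite lerD2l (enormB x').
exact: ler_enormD.
Qed.

Lemma enorm_le_sum {m n : nat} (x : 'M[R]_(m, n)) :
  enorm x <= \sum_(p : 'I_m * 'I_n) `|x p.1 p.2|.
Proof.
rewrite enorm_pair -[leRHS]ger0_norm ?sumr_ge0// -sqrtr_sqr ler_wsqrtr//.
rewrite expr2 mulr_suml; apply: ler_sum => p _; rewrite -real_normK ?num_real// expr2.
by apply: ler_wpM2l => //; rewrite (bigD1 p) //= lerDl sumr_ge0.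
Qed.

Lemma le_fam_norm {m k l : nat} (f : 'I_m -> 'M[R]_(k, l)) i : enorm (f i) <= fam_norm f.
Proof.
rewrite /fam_norm -[leLHS]ger0_norm ?enorm_ge0// -sqrtr_sqr ler_wsqrtr//.
by rewrite (bigD1 i)//= lerDl sumr_ge0// => j _; rewrite sqr_ge0.
Qed.

Lemma cvg_matrix {T : Type} {F : set_system T} {FF : Filter F} {m n : nat}
  (f : T -> 'M[R]_(m, n)) (M : 'M[R]_(m, n)) :
  (forall i j, f x i j @[x --> F] --> M i j) -> f x @[x --> F] --> M.
Proof.
move=> H; apply/cvgrPdist_lt => e e0.
have : \forall x \near F, forall p : 'I_m * 'I_n, `|M p.1 p.2 - f x p.1 p.2| < e.
  apply: filter_forall => p; have /cvgrPdist_lt := H p.1 p.2; exact.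
apply: filterS => x h; rewrite [ltLHS]mx_normrE; apply: bigmax_lt => // p _.
by rewrite !mxE; exact: h.
Qed.

Lemma within_continuous_matrix {A : set R} {m n : nat} (f : R -> 'M[R]_(m, n)) :
  (forall i j, {within A, continuous (fun x => f x i j)}) -> {within A, continuous f}.
Proof. by move=> H x; apply: cvg_matrix => i j; exact: H. Qed.

Lemma within_right {V : pseudoMetricNormedZmodType R} (f : R -> V) (a b c : R) :
  {within `[a, b], continuous f} -> a <= c -> c < b -> f x @[x --> c^'+] --> f c.
Proof.
move=> cf ac cb; have [h1 h2 h3] := (continuous_within_itvP f (le_lt_trans ac cb)).1 cf.
move: ac; rewrite le_eqVlt => /predU1P[<- //|ac].
by apply: cvg_at_right_filter; apply: h1; rewrite in_itv /= ac.
Qed.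

Lemma within_left {V : pseudoMetricNormedZmodType R} (f : R -> V) (a b c : R) :
  {within `[a, b], continuous f} -> a < c -> c <= b -> f x @[x --> c^'-] --> f c.
Proof.
move=> cf ac cb; have [h1 h2 h3] := (continuous_within_itvP f (lt_le_trans ac cb)).1 cf.
move: cb; rewrite le_eqVlt => /predU1P[-> //|cb].
by apply: cvg_at_left_filter; apply: h1; rewrite in_itv /= ac.
Qed.

End euclidean_norm.

(** * Pathwise uniqueness along tame sets *)

Section uniqueness.
Context {R : realType} {d : nat}.
Local Notation mu := (@lebesgue_measure R).
Variable S : set 'rV[R]_d.
Hypothesis clS : closed S.
Variables (a : nat -> nat -> nat) (m : nat).

(** Moving each of the first [m] particles by at most [2^-(p+2)] shrinks a distance by at most
    [2^-(p+1)], half of [2^-p], so the bound [2^-(p+1)] holds with the same margin; norms grow by at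
    most 1. Simplicity at the moved particles follows from the new distances. *)
Lemma hop_near p q r (x x' : seqE R d) : hop S a m p q r x ->
  (forall j, (m <= j)%N -> x' j = x j) -> (forall i : 'I_m, S (x' i)) ->
  (forall i : 'I_m, enorm (x' i - x i) <= 2 ^- p.+2) -> hop S a m p.+1 q r.+1 x'.
Proof.
move=> /hopP-/(_ clS)[[gx simple] norm [k Hk] [k' Hk'] mass_le] env Sx' near.
have e2 : 2 ^- p = 2 ^- p.+1 + 2 ^- p.+1 :> R by rewrite exprS invfM; lra.
have e4 : 2 ^- p.+1 = 2 ^- p.+2 + 2 ^- p.+2 :> R by rewrite [in RHS]exprS invfM; lra.
have ep : 0 < 2 ^- p.+1 :> R by rewrite invr_gt0 exprn_gt0.
have el1 : 2 ^- p.+2 <= 1 :> R by rewrite invf_le1 ?exprn_gt0// exprn_ege1// ler1n.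
move: e2 e4 ep el1 near Hk Hk'.
set q1 := 2 ^- p; set q2 := 2 ^- p.+1; set q4 := 2 ^- p.+2 => e2 e4 ep el1 near Hk Hk'.
have envE : unlabel (from m) x' = unlabel (from m) x by apply: eq_unlabel => // j; exact: env.
have arith (kk u v n1 n2 : R) : q1 + kk <= u -> n1 <= q4 -> n2 <= q4 -> u <= v + (n1 + n2) -> q2 + kk <= v by lra.
have pairs : exists k, forall i j : 'I_m, i != j -> q2 + k.+1%:R^-1 <= enorm (x' i - x' j).
  exists k => i j ij.
  exact: arith (Hk i j ij) (near i) (near j) (enorm_perturb _ _ _ _).
have envs : exists k, forall (i : 'I_m) j, (m <= j)%N -> q2 + k.+1%:R^-1 <= enorm (x' i - x' j).
  exists k' => i j mj; have q40 : enorm (x' j - x j) <= q4.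
    rewrite (env j mj) subrr enorm_pair big1 ?sqrtr0; first by lra.
    by move=> q' _; rewrite mxE expr0n.
  exact: arith (Hk' i j mj) (near i) q40 (enorm_perturb _ _ _ _).
have far (i : 'I_m) j : i != j :> nat -> x' i <> x' j.
  move=> ij E; have z : enorm (x' i - x' j) = 0.
    by rewrite E subrr enorm_pair big1 ?sqrtr0// => q' _; rewrite mxE expr0n.
  case: (ltnP j m) => jm.
    have [k1 /(_ i (Ordinal jm) ij)] := pairs; rewrite /= z.
    by apply/negP; rewrite -ltNge addr_gt0// invr_gt0.
  have [k1 /(_ i j jm)] := envs; rewrite z.
  by apply/negP; rewrite -ltNge addr_gt0// invr_gt0.
apply/hopP => //; split => //.
- split.
    apply: (@goodcfg_env _ _ _ clS m); first by move=> i; rewrite row_firstm.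
    by rewrite envE; apply/config_unlabel => //; apply: goodcfg_sub gx.
  move=> i; rewrite (@unlabel_split _ _ predT (fun j => j < m)%N) cfg_addE.
  case: (ltnP i m) => im.
    rewrite [X in (_ + X)%E](_ : _ = 0%E); last first.
      apply: unlabel_eq0 => j /=; rewrite -leqNgt => jm /= /esym.
      by apply: (far (Ordinal im)) => /=; rewrite neq_ltn (leq_trans im jm).
    rewrite adde0 (@unlabel_split _ _ _ (pred1 i)) cfg_addE.
    rewrite [X in (_ + X)%E](_ : _ = 0%E); last first.
      apply: unlabel_eq0 => j /= /andP[jm ji] /= /esym.
      by apply: (far (Ordinal im)) => /=; rewrite eq_sym.
    rewrite adde0 unlabelE (@nneseriesD1 _ _ i)//; last by move=> *; exact: mass_ge0.
    rewrite eseries0 ?adde0.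
      by rewrite /mass /= im eqxx /= indicE; case: (_ \in _).
    by move=> j _ /= ji; rewrite /mass /= (negPf ji) andbF.
  rewrite [X in (X + _)%E](_ : _ = 0%E); last first.
    by apply: unlabel_eq0 => j /= jm; apply: (far (Ordinal jm)) => /=; rewrite neq_ltn (leq_trans jm im).
  rewrite add0e env//; apply: le_trans (simple i); rewrite !unlabelE.
  apply: lee_nneseries => j *; first exact: mass_ge0.
  rewrite /mass /=; case: ltnP => //= jm; last by rewrite env.
- move=> i; have := norm i; have := near i.
  have := ler_enormD (x i) (x' i - x i); rewrite addrC subrK -natr1; lra.
- by move=> r' r'0; rewrite envE; exact: mass_le.
Qed.

Lemma hop_simn p q r (x x' z : seqE R d) (C : set 'M[R]_(m, d)) : hop S a m p q r z ->
  connected C -> C (firstm m x) -> C (firstm m x') ->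
  unlabel (from m) x = unlabel (from m) z ->
  (forall y, C y -> exists2 x'', firstm m x'' = y & hop S a m p q r x'' /\ unlabel (from m) x'' = unlabel (from m) z) ->
  simn S a p q r (unlabel (from m) x) (firstm m x) (firstm m x').
Proof.
move=> hz cC Cx Cx' xz Chop; rewrite xz; split.
  exists C => //; split => // y /Chop[x'' <- [h e]].
  by case: h => _ [+ _]; rewrite /= e.
exists (firstm m z, unlabel (from m) z) => //; case: hz => h1 [[h2 h3 h4] h5]; split => //; split => //.
by split; [move=> i; have [Si ni] := h2 i; split => //; exact: ltW|exact: ltW|exact: ltW].
Qed.

Variables (b : 'rV[R]_d -> cfg R d -> 'rV[R]_d) (Ft : 'M[R]_(m, d) -> cfg R d -> R).

Definition drift (x : seqE R d) (i : nat) (k : 'I_d) : R := b (x i) (unlabel (but i) x) 0 k.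

(** Set to 0 off the tame set, where the moment condition says nothing. *)
Definition lip_weight p q r (x : seqE R d) : R :=
  if `[< hop S a m p q r x >] then `|Ft (firstm m x) (unlabel (from m) x)| else 0.

(** Continuation from the last time [T] up to which the paths agree. Only [x] is tame a priori; just
    after [T] both paths are close to their common position, so [x'] is tame at the level [p.+1],
    [q], [r.+1] and connected to [x] through that position, and the Lipschitz bound of that level
    applies. The drifts [g1], [g2] are prescribed on the tame set only, to cover both the true drift
    and its extension by 0. *)
Lemma pathwise_unique p q r (t0 : R) (x x' : R -> seqE R d) (beta g1 g2 : R -> 'I_m -> 'I_d -> R) :
  (0 < q)%N ->
  (forall (u : R) i k, 0 <= u <= t0 -> hall S a m (x u) -> g1 u i k = drift (x u) i k) ->
  (forall (u : R) i k, 0 <= u <= t0 -> hall S a m (x' u) -> g2 u i k = drift (x' u) i k) ->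
  {ae mu, forall u : R, 0 <= u <= t0 -> hop S a m p q r (x u)} ->
  (forall (u : R) j, 0 <= u <= t0 -> (m <= j)%N -> x' u j = x u j) ->
  (forall (u : R) (i : 'I_m), 0 <= u <= t0 -> S (x u i) /\ S (x' u i)) ->
  (forall (i : 'I_m) k, {within `[0, t0], continuous (fun u => x u i 0 k)}) ->
  (forall (i : 'I_m) k, {within `[0, t0], continuous (fun u => x' u i 0 k)}) ->
  (forall (u : R) y y', 0 <= u <= t0 -> Hopen S a p.+1 q r.+1 (y, unlabel (from m) (x u)) ->
     Hopen S a p.+1 q r.+1 (y', unlabel (from m) (x u)) ->
     simn S a p.+1 q r.+1 (unlabel (from m) (x u)) y y' ->
     fam_norm (fun i : 'I_m => coefm b y (unlabel (from m) (x u)) i - coefm b y' (unlabel (from m) (x u)) i)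
       <= enorm (y - y') * Ft y (unlabel (from m) (x u))) ->
  mu.-integrable `[0, t0] (EFin \o (fun u => lip_weight p.+1 q r.+1 (x u))) ->
  (forall (i : 'I_m) k, mu.-integrable `[0, t0] (EFin \o (fun u => g1 u i k)) /\
     mu.-integrable `[0, t0] (EFin \o (fun u => g2 u i k))) ->
  (forall (u : R) (i : 'I_m) k, 0 <= u <= t0 -> x u i 0 k = beta u i k + \int[mu]_(v in `[0, u]) g1 v i k /\
     x' u i 0 k = beta u i k + \int[mu]_(v in `[0, u]) g2 v i k) ->
  forall (u : R) (i : 'I_m), 0 <= u <= t0 -> x u i = x' u i.
Proof.
move=> q0 Eg1 Eg2 Hx env Sx cx cx' lip Iw Id eqx.
pose D (j : 'I_m * 'I_d) u := x u j.1 0 j.2 - x' u j.1 0 j.2.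
pose g (j : 'I_m * 'I_d) u := g1 u j.1 j.2 - g2 u j.1 j.2.
have Ig j : mu.-integrable `[0, t0] (EFin \o g j).
  have [I1 I2] := Id j.1 j.2; rewrite (_ : EFin \o g j = ((EFin \o (fun u => g1 u j.1 j.2)) \- (EFin \o (fun u => g2 u j.1 j.2)))%E); last first.
    by apply/funext => u /=; rewrite EFinB.
  exact: integrableB.
have DE j u : 0 <= u <= t0 -> D j u = \int[mu]_(v in `[0, u]) g j v.
  move=> u0; have [E E'] := eqx u j.1 j.2 u0; have [I1 I2] := Id j.1 j.2.
  have /andP[_ ut] := u0.
  rewrite /D E E' opprD addrACA subrr add0r /g RintegralB//.
    exact: integrable_sub_itv I1 (lexx _) ut.
  exact: integrable_sub_itv I2 (lexx _) ut.
have cD j : {within `[0, t0], continuous (D j)}.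
  by move=> u; apply: cvgB; [exact: cx|exact: cx'].
suff D0 u : 0 <= u <= t0 -> forall j, D j u = 0.
  move=> u i u0; apply/rowP => k; apply/eqP; rewrite -subr_eq0.
  exact/eqP/(D0 u u0 (i, k)).
move=> ut j.
pose A := [set v | 0 <= v <= t0 /\ forall v', 0 <= v' <= v -> forall j, D j v' = 0].
apply: contrapT => Du; have /andP[u0 ut0] := ut.
have t00 : 0 <= t0 by exact: le_trans ut0.
have A0 : A 0.
  split; first by rewrite lexx t00.
  move=> v' /andP[h1 h2]; have -> : v' = 0 by apply/eqP; rewrite eq_le h1 h2.
  by move=> j'; rewrite DE ?lexx// set_itv1 Rintegral_set1.
have Au v : A v -> v <= u.
  move=> [/andP[v0 vt] Av]; rewrite leNgt; apply/negP => uv; apply: Du.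
  by apply: Av; rewrite u0 ltW.
have supA : has_sup A by split; [exists 0|exists u => v /Au].
pose T := sup A.
have T0 : 0 <= T by exact: sup_upper_bound.
have Tu : T <= u by apply: ge_sup => //; exists 0.
have Tt : T <= t0 by exact: le_trans ut0.
have Tlt v j' : 0 <= v -> v < T -> D j' v = 0.
  move=> v0; rewrite -subr_gt0 => Tv; have [v' [Av' Hv']] := sup_adherent Tv supA.
  by rewrite -/T subKr => /ltW vv'; apply: Hv'; rewrite v0 vv'.
have DT j' : D j' T = 0.
  move: T0; rewrite le_eqVlt => /predU1P[T0|T0].
    by have [_ /(_ 0)] := A0; rewrite -T0 lexx => /(_ isT).
  have lim1 : D j' v @[v --> T^'-] --> D j' T by exact: within_left (cD j') T0 Tt.
  have lim2 : D j' v @[v --> T^'-] --> (0 : R).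
    apply: cvg_near_cst; near=> v; apply: Tlt; last by near: v; exact: nbhs_left_lt.
    by near: v; exact: nbhs_left_ge.
  by rewrite (cvg_unique _ lim1 lim2).
have {}Tu : T < u.
  by rewrite lt_neqAle Tu andbT; apply/negP => /eqP E; apply: Du; rewrite -E.
have Tt0 : T < t0 := lt_le_trans Tu ut0.
have xT (i : 'I_m) : x T i = x' T i.
  by apply/rowP => k; apply/eqP; rewrite -subr_eq0; exact/eqP/(DT (i, k)).
(* Two deviations of [2^-(p+3)] from the common position add up to [2^-(p+2)], the distance allowed
   by [hop_near]. *)
have ep : 0 < 2 ^- p.+3 :> R by rewrite invr_gt0 exprn_gt0.
have cM (z : R -> seqE R d) : (forall (i : 'I_m) k, {within `[0, t0], continuous (fun u => z u i 0 k)}) ->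
  {within `[0, t0], continuous (fun u => firstm m (z u))}.
  move=> cz; apply: within_continuous_matrix => i k.
  by rewrite (_ : (fun u => _) = (fun u => z u i 0 k)) //; apply/funext => v; rewrite mxE.
have close (z : R -> seqE R d) : (forall (i : 'I_m) k, {within `[0, t0], continuous (fun u => z u i 0 k)}) ->
  \forall v \near T^'+, forall i : 'I_m, enorm (z v i - z T i) < 2 ^- p.+3.
  move=> cz; apply: filter_forall => i.
  have h : z v i - z T i @[v --> T^'+] --> (0 : 'rV[R]_d).
    rewrite -(subrr (z T i)); apply: cvgB; last exact: cvg_cst.
    apply: cvg_matrix => i' k; rewrite (ord1 i').
    exact: within_right (cz i k) T0 Tt0.
  have h2 : enorm (z v i - z T i) @[v --> T^'+] --> (0 : R).
    have <- : enorm (0 : 'rV[R]_d) = 0 by rewrite enorm_pair big1 ?sqrtr0// => q' _; rewrite mxE expr0n.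
    exact: (continuous_cvg _ (@continuous_enorm R 1 d 0) h).
  move/cvgrPdist_lt : h2 => /(_ _ ep); apply: filterS => v.
  by rewrite sub0r normrN ger0_norm ?enorm_ge0.
have [T1 /andP[TT1 T1t] near1] : exists2 T1, T < T1 <= t0 & forall v (i : 'I_m), T <= v <= T1 ->
   enorm (x v i - x T i) < 2 ^- p.+3 /\ enorm (x' v i - x' T i) < 2 ^- p.+3.
  have [e /= e0 He] := filterI (close _ cx) (close _ cx').
  exists (Num.min t0 (T + e / 2)).
    by rewrite lt_min Tt0 ltrDl divr_gt0//= ge_min lexx.
  move=> v i /andP[]; rewrite le_eqVlt => /predU1P[<- _|Tv].
    rewrite !subrr; have -> : enorm (0 : 'rV[R]_d) = 0 by rewrite enorm_pair big1 ?sqrtr0// => q' _; rewrite mxE expr0n.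
    by split.
  rewrite le_min => /andP[_ ve]; have [|h1 h2] := He v _ Tv; last by split; [exact: h1|exact: h2].
  rewrite /= distrC gtr0_norm ?subr_gt0// ltrBlDl (le_lt_trans ve)// ltrD2l.
  by rewrite ltr_pdivrMr// ltr_pMr// ltr1n.
have T1u v : T <= v <= T1 -> 0 <= v <= t0.
  by move=> /andP[h1 h2]; rewrite (le_trans T0 h1) (le_trans h2 T1t).
have e3 : 2 ^- p.+3 + 2 ^- p.+3 = 2 ^- p.+2 :> R by rewrite [in RHS]exprS; rewrite [2 ^+ p.+3]exprS invfM [2 ^+ p.+2]exprS; lra.
have tri (z y w : seqE R d) i : enorm (z i - w i) < 2 ^- p.+3 -> enorm (y i - w i) < 2 ^- p.+3 ->
    enorm (z i - y i) <= 2 ^- p.+2.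
  move=> h1 h2; have -> : z i - y i = (z i - w i) + (w i - y i) by rewrite addrA subrK.
  by apply: le_trans (ler_enormD _ _) _; rewrite (enormB (w i)) -e3 lerD// ltW.
have near v v' (i : 'I_m) : T <= v <= T1 -> T <= v' <= T1 ->
   enorm (x v i - x v' i) <= 2 ^- p.+2 /\ enorm (x' v i - x v' i) <= 2 ^- p.+2.
  move=> h h'; have [a1 b1] := near1 v i h; have [a2 b2] := near1 v' i h'.
  rewrite -xT in b1 b2; split; exact: (tri _ _ (x T)).
(* The component is that of the environment at a single time [u']; positions at other times [v] are
   therefore combined with this frozen environment. *)
pose glue (z z' : seqE R d) : seqE R d := fun j => if (j < m)%N then z j else z' j.
have gluef z z' : firstm m (glue z z') = firstm m z.
  by apply/matrixP => i k; rewrite !mxE /glue ltn_ord.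
have gluee z z' : unlabel (from m) (glue z z') = unlabel (from m) z'.
  by apply: eq_unlabel => // j0; rewrite /from /glue ltnNge => ->.
have gluehop u' v (z : R -> seqE R d) : z = x \/ z = x' -> T <= u' <= T1 -> T <= v <= T1 -> hop S a m p q r (x u') ->
   hop S a m p.+1 q r.+1 (glue (z v) (x u')).
  move=> zx hu hv h; apply: hop_near h _ _ _.
  - by move=> j'; rewrite /glue ltnNge => ->.
  - by move=> i; rewrite /glue ltn_ord; case: zx => ->; case: (Sx v i (T1u _ hv)).
  - by move=> i; rewrite /glue ltn_ord; have [n1 n2] := near v u' i hv hu; case: zx => ->.
have gle : {ae mu, forall u, T <= u <= T1 -> forall j, `|g j u| <= (\sum_i `|D i u|) * lip_weight p.+1 q r.+1 (x u)}.
  have [N [mN N0 sub]] := Hx; exists N; split => // u' /= nu; apply: sub => /= hu; apply: nu => hu' j'.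
  have {hu} := hu (T1u _ hu') => hu.
  have TT1' : T <= T <= T1 by rewrite lexx ltW.
  have hx1 : hop S a m p.+1 q r.+1 (x u').
    have := gluehop u' u' x (or_introl erefl) hu' hu' hu; rewrite (_ : glue _ _ = x u')//.
    by apply/funext => j''; rewrite /glue; case: ifP.
  have hx1' : hop S a m p.+1 q r.+1 (x' u').
    have := gluehop u' u' x' (or_intror erefl) hu' hu' hu; rewrite (_ : glue _ _ = x' u')//.
    apply/funext => j''; rewrite /glue; case: ltnP => // mj.
    by rewrite env// T1u.
  have ee : unlabel (from m) (x' u') = unlabel (from m) (x u').
    by apply: eq_unlabel => // j'' mj; rewrite env// T1u.
  have /andP[Tu' uT1] := hu'.
  have sub1 : `[T, u'] `<=` `[0, t0].
    by apply: subset_itv; rewrite bnd_simp// (le_trans uT1).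
  have simxx' : simn S a p.+1 q r.+1 (unlabel (from m) (x u')) (firstm m (x u')) (firstm m (x' u')).
    (* Both pieces of path start from the same point at time [T], so their union is connected. *)
    pose C := ((fun v => firstm m (x v)) @` `[T, u']) `|` ((fun v => firstm m (x' v)) @` `[T, u']).
    apply: (@hop_simn _ _ _ _ _ (x u') C) => //.
    - apply: connectedU.
      + exists (firstm m (x T)); split; first by exists T => //=; rewrite in_itv /= lexx.
        exists T; first by rewrite /= in_itv /= lexx.
        by apply/matrixP => i k; rewrite !mxE xT.
      + apply: connected_continuous_connected; first exact: segment_connected.
        exact: continuous_subspaceW sub1 (cM _ cx).
      + apply: connected_continuous_connected; first exact: segment_connected.
        exact: continuous_subspaceW sub1 (cM _ cx').
    - by left; exists u' => //=; rewrite in_itv /= lexx Tu'.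
    - by right; exists u' => //=; rewrite in_itv /= lexx Tu'.
    - move=> y [] [v /=]; rewrite in_itv /= => /andP[Tv vu] <-.
        exists (glue (x v) (x u')); first exact: gluef.
        by split; [apply: gluehop => //; [left|rewrite Tv (le_trans vu)]|exact: gluee].
      exists (glue (x' v) (x u')); first exact: gluef.
      by split; [apply: gluehop => //; [right|rewrite Tv (le_trans vu)]|exact: gluee].
  have := lip u' (firstm m (x u')) (firstm m (x' u')) (T1u _ hu') hx1 _ simxx'.
  rewrite -[in Hopen _ _ _ _ _ (firstm m (x' u'), _)]ee => /(_ hx1') {}lip.
  have gfam : `|g j' u'| <= fam_norm (fun i : 'I_m => coefm b (firstm m (x u')) (unlabel (from m) (x u')) i
     - coefm b (firstm m (x' u')) (unlabel (from m) (x u')) i).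
    apply: le_trans (le_fam_norm _ j'.1); apply: le_trans (le_enorm _ 0 j'.2).
    have E1 : coefm b (firstm m (x u')) (unlabel (from m) (x u')) j'.1 = b (x u' j'.1) (unlabel (but j'.1) (x u')).
      by rewrite /coefm cfg_add_env_but row_firstm.
    have E2 : coefm b (firstm m (x' u')) (unlabel (from m) (x u')) j'.1 = b (x' u' j'.1) (unlabel (but j'.1) (x' u')).
      by rewrite -ee /coefm cfg_add_env_but row_firstm.
    have hallx z : hop S a m p.+1 q r.+1 z -> hall S a m z by move=> hz; exists p.+1, q, r.+1.
    rewrite /g (Eg1 _ _ _ (T1u _ hu') (hallx _ hx1)) (Eg2 _ _ _ (T1u _ hu') (hallx _ hx1')).
    by rewrite /= E1 E2 !mxE.
  apply: le_trans gfam _; apply: le_trans lip _; rewrite /lip_weight asboolT//.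
  apply: (@le_trans _ _ (enorm (firstm m (x u') - firstm m (x' u')) * `|Ft (firstm m (x u')) (unlabel (from m) (x u'))|)).
    by apply: ler_wpM2l; [exact: enorm_ge0|exact: ler_norm].
  apply: ler_wpM2r => //; apply: le_trans (enorm_le_sum _) _.
  by apply: ler_sum => i _; rewrite /D !mxE.
have DE' j' v : T <= v <= T1 -> D j' v = \int[mu]_(w in `[T, v]) g j' w.
  move=> hv; have /andP[Tv vT1] := hv; have hv' := T1u _ hv; have /andP[v0 vt] := hv'.
  rewrite DE// (Rintegral_itv_split T0 Tv); last exact: integrable_sub_itv (Ig j') (lexx _) vt.
  by rewrite -(DE j' T) ?T0// DT add0r.
have w0 u' : 0 <= lip_weight p.+1 q r.+1 (x u') by rewrite /lip_weight; case: ifP.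
have [c /andP[Tc cT1] Dc] := local_gronwall TT1 (fun j => integrable_sub_itv (Ig j) T0 T1t)
  (integrable_sub_itv Iw T0 T1t) w0 DE' gle.
suff : A c by move=> /(sup_upper_bound supA); rewrite leNgt Tc.
split; first by rewrite (le_trans T0 (ltW Tc)) (le_trans cT1 T1t).
move=> v' /andP[v0 vc] j'; case: (ltP v' T) => vT; first exact: Tlt.
by apply: Dc; rewrite vT.
Unshelve. all: by end_near. Qed.

End uniqueness.


(** * Time integrals as functions of the code *)

Section coded_paths.
Context {R : realType} {d : nat}.
Local Notation mu := (@lebesgue_measure R).

Definition coordinate : Type := (bool * nat * 'I_d)%type.
HB.instance Definition _ := Countable.on coordinate.

(* [(true, j, k)] is the [k]-th coordinate of X^j, [(false, j, k)] that of B^j. *)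
Definition coded (z : bool) (c : code coordinate) (u : R) : seqE R d :=
  fun j => \row_k decoded c u (z, j, k).

Lemma coded_entry z c u j k : coded z c u j 0 k = decoded c u (z, j, k).
Proof. by rewrite /coded mxE. Qed.

Lemma measurable_coded z : measurable_fun [set: R * code coordinate]
  (fun p => coded z p.2 p.1 : seqM R d).
Proof.
apply: measurable_fun_seqM => j k.
rewrite (_ : (fun _ => _) = (fun p : R * code coordinate => decoded p.2 p.1 (z, j, k))).
  exact: measurable_decoded.
by apply/funext => p; rewrite coded_entry.
Qed.

Lemma measurable_coded_at z (u : R) : measurable_fun [set: code coordinate]
  (fun c => coded z c u : seqM R d).
Proof.
apply: measurable_fun_seqM => j k.
have := measurable_decoded (R := R) (z, j, k); move=> h.
have : measurable_fun [set: code coordinate] (fun c => decoded (u, c).2 (u, c).1 (z, j, k) : R).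
  apply: (measurableT_comp h); exact: measurable_pair1.
by rewrite (_ : (fun c => coded z c u j 0 k) = (fun c => decoded (u, c).2 (u, c).1 (z, j, k)))//; apply/funext => c; rewrite coded_entry.
Qed.

(** Tonelli's theorem, applied to the joint measurability of [coded] in time and code. *)
Lemma measurable_time_integral (f : seqE R d -> \bar R) (t : R) :
  (forall x, 0 <= f x)%E -> measurable_fun [set: seqM R d] f ->
  measurable_fun [set: code coordinate] (fun c => \int[mu]_(u in `[0%R, t]) f (coded true c u))%E.
Proof.
move=> f0 mf.
pose g (p : R * code coordinate) := ((\1_(`[0%R, t]%classic) p.1)%:E * f (coded true p.2 p.1))%E.
have mg : measurable_fun [set: R * code coordinate] g.
  apply: emeasurable_funM.
    apply/measurable_EFinP; apply: (measurableT_comp _ measurable_fst).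
    exact: measurable_indic.
  exact: (measurableT_comp mf (measurable_coded true)).
have g0 p : (0 <= g p)%E by rewrite mule_ge0// lee_fin indicE.
rewrite (_ : (fun c => _) = fun c => \int[mu]_u g (u, c))%E.
  exact: measurable_fun_fubini_tonelli_G.
apply/funext => c; rewrite integral_mkcond; apply: eq_integral => u _.
rewrite /g /patch indicE /=; case: ifP => h; [by rewrite mul1e|by rewrite mul0e].
Qed.

Lemma measurable_time_Rintegral (f : seqE R d -> R) (t : R) :
  measurable_fun [set: seqM R d] f ->
  measurable_fun [set: code coordinate] (fun c => \int[mu]_(u in `[0%R, t]) f (coded true c u)).
Proof.
move=> mf; have fm : measurable_fun [set: \bar R] (fine : \bar R -> R) by exact: fine_measurable.
rewrite /Rintegral; apply: (measurableT_comp fm).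
have mE : measurable_fun [set: seqM R d] (fun x => (f x)%:E) by exact/measurable_EFinP.
rewrite (_ : (fun c => _) = (fun c => \int[mu]_(u in `[0%R, t]) maxe (f (coded true c u))%:E 0 -
   \int[mu]_(u in `[0%R, t]) maxe (- (f (coded true c u))%:E) 0))%E; last first.
  apply/funext => c; rewrite integralE; congr (_ - _)%E; apply: eq_integral => u _.
    by rewrite funeposE.
  by rewrite funenegE.
apply: emeasurable_funB.
  apply: (@measurable_time_integral (fun x => maxe (f x)%:E 0)).
    by move=> x; rewrite le_max lexx orbT.
  by apply: measurable_maxe => //; exact: measurable_cst.
apply: (@measurable_time_integral (fun x => maxe (- (f x)%:E) 0)%E).
  by move=> x; rewrite le_max lexx orbT.
apply: measurable_maxe => //; exact: measurableT_comp.
Qed.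

Lemma decode_agree (t : R) (c c' : code coordinate) (i : coordinate) :
  (forall n k r, dyad (n, k) <= t -> c (n, k, i, r) = c' (n, k, i, r)) ->
  forall n k, dyad (n, k) <= t -> decode c n k i = decode c' n k i :> \bar R.
Proof.
move=> cc' n k nk; rewrite /decode; congr (esups _ _); apply/funext => j.
by case: unpickle => // r; rewrite cc'.
Qed.

Lemma decoded_eq (c c' : code coordinate) (i : coordinate) (t u : R) : 0 <= u <= t ->
  (forall n k, dyad (n, k) <= t -> decode c n k i = decode c' n k i :> \bar R) ->
  decoded c u i = decoded c' u i.
Proof.
move=> /andP[u0 ut] cc'; rewrite /decoded; congr (fine (limn_esup _)); apply/funext => n.
apply: cc'; have /andP[_ h] := dyadic_le n u0; exact: le_trans ut.
Qed.

Lemma decoded_cvg (c : code coordinate) (i : coordinate) (u v : R) : 0 <= u ->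
  (fine (decode c n (Num.truncn (u * 2 ^+ n)) i : \bar R) @[n --> \oo] --> v) ->
  (forall n, (decode c n (Num.truncn (u * 2 ^+ n)) i : \bar R) \is a fin_num) ->
  decoded c u i = v.
Proof.
move=> u0 cv fin; rewrite /decoded.
have H : (decode c n (Num.truncn (u * 2 ^+ n)) i : \bar R) @[n --> \oo] --> v%:E.
  by apply/fine_cvgP; split => //; near=> n.
by rewrite (cvg_limn_einf_sup H).2.
Unshelve. all: by end_near. Qed.

End coded_paths.

(** * The measurable condition on codes that singles out the solution *)

Section gamma.
Context {R : realType} {d : nat}.
Local Notation mu := (@lebesgue_measure R).
Variable S : set 'rV[R]_d.
Hypothesis clS : closed S.
Variables (a : nat -> nat -> nat) (m : nat) (Ssde : set (cfg R d)).
Variables (b : 'rV[R]_d -> cfg R d -> 'rV[R]_d) (Ft : nat -> nat -> nat -> 'M[R]_(m, d) -> cfg R d -> R).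
Hypothesis mSsde : measurable (Ssde : set (cfgM S)).
Hypothesis mb : borel_coef S Ssde b.
Hypothesis hallS : forall xs : 'M[R]_(m, d) * cfg R d, Hall S a xs -> Ssde (cfg_add (unlabelm xs.1) xs.2).
Hypothesis mFt : forall p q r, (0 < p)%N -> (0 < q)%N -> (0 < r)%N -> measurable_fun
       [set xs : borel 'M[R]_(m, d) * cfgM S |
          (forall i, S (row i (xs.1 : 'M[R]_(m, d)))) /\ config S xs.2]
       (fun xs => Ft p q r xs.1 xs.2).
Variables (cc : 'I_m -> 'M[R]_d) (s : seqE R d).

(** Extended by 0 to be measurable on all sequences; a path with [is_tame] spends almost no time
    where this matters. *)
Definition tame_drift (i : 'I_m) (k : 'I_d) (x : seqE R d) : R :=
  if `[< hall S a m x >] then drift b x i k else 0.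

Lemma measurable_tame_drift i k : measurable_fun [set: seqM R d] (tame_drift i k).
Proof.
have mh := measurable_hall clS a m.
have := measurable_coefficient clS i k mSsde mb hallS.
move=> /(measurable_restrictT _ mh).1; apply: eq_measurable_fun => x _.
rewrite /patch /tame_drift; case: asboolP => h; first by rewrite mem_set.
by rewrite memNset.
Qed.

Lemma measurable_lip_weight p q r : (0 < p)%N -> (0 < q)%N -> (0 < r)%N ->
  measurable_fun [set: seqM R d] (lip_weight S a (Ft p q r) p q r).
Proof.
move=> p0 q0 r0; have mh := measurable_hop clS a m p q r.
have := measurable_bound clS (mFt p0 q0 r0) (p := p) (q := q) (r := r) (a := a).
move=> h; have {}h : measurable_fun (hop S a m p q r : set (seqM R d)) (fun x : seqM R d => `|Ft p q r (firstm m x) (unlabel (from m) x)|).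
  by apply: (measurableT_comp (f := fun x : R => `|x|)) h.
have := (measurable_restrictT _ mh).1 h; apply: eq_measurable_fun => x _.
rewrite /patch /lip_weight; case: asboolP => hx; first by rewrite mem_set.
by rewrite memNset.
Qed.

Lemma lip_weight_ge0 p q r f x : 0 <= lip_weight S a (m := m) f p q r x.
Proof. by rewrite /lip_weight; case: ifP. Qed.

(** Both analytic conditions are integrals over time, hence measurable in the code. The weight
    belongs to the next level, as in [pathwise_unique]. *)
Definition is_tame (t : R) (p q r : nat) (x : R -> seqE R d) : Prop :=
  [/\ (0 < p)%N, (0 < q)%N, (0 < r)%N,
      (\int[mu]_(u in `[0%R, t]) (\1_(~` hop S a m p q r) (x u))%:E = 0)%E &
      (\int[mu]_(u in `[0%R, t]) (lip_weight S a (Ft p.+1 q r.+1) p.+1 q r.+1 (x u))%:E < +oo)%E].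

(** Up to time [t] the coded path solves the equation started from [s], with the noise and
    environment contained in the same code. Imposing the equation at dyadic times keeps the
    condition measurable; integrability and tameness are what uniqueness uses. *)
Definition Gam (t : R) : set (code (coordinate (d := d))) :=
  [set c | [/\ forall e, dyad e <= t -> forall i : 'I_m, S (coded true c (dyad e) i),
     forall i k, (\int[mu]_(u in `[0%R, t]) (`|tame_drift i k (coded true c u)|)%:E < +oo)%E,
     exists p q r, is_tame t p q r (coded true c) &
     forall e, dyad e <= t -> forall (i : 'I_m) k, decode c e.1 e.2 (true, i : nat, k) =
       (s i 0 k + (coded false c (dyad e) i *m (cc i)^T) 0 k +
        \int[mu]_(u in `[0, dyad e]) tame_drift i k (coded true c u))%:E ]].

Let mlt (f : code (coordinate (d := d)) -> \bar R) : measurable_fun setT f -> measurable [set c | (f c < +oo)%E].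
Proof. by move=> mf; rewrite -[X in measurable X]setTI; exact: emeasurable_fun_lt. Qed.

Let meq (f g : code (coordinate (d := d)) -> \bar R) : measurable_fun setT f -> measurable_fun setT g -> measurable [set c | f c = g c].
Proof. by move=> mf mg; rewrite -[X in measurable X]setTI; exact: measurable_eqe. Qed.

Lemma measurable_is_tame t p q r : measurable [set c : code (coordinate (d := d)) | is_tame t p q r (coded true c)].
Proof.
case: p => [|p]; first by rewrite (_ : mkset _ = set0)//; apply/seteqP; split => c //= [].
case: q => [|q]; first by rewrite (_ : mkset _ = set0)//; apply/seteqP; split => c //= [].
case: r => [|r]; first by rewrite (_ : mkset _ = set0)//; apply/seteqP; split => c //= [].
have mh := measurable_hop clS a m p.+1 q.+1 r.+1.
rewrite (_ : mkset _ = [set c : code (coordinate (d := d)) | \int[mu]_(u in `[0%R, t]) (\1_(~` hop S a m p.+1 q.+1 r.+1) (coded true c u))%:E = cst 0 c]%E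
  `&` [set c : code (coordinate (d := d)) | \int[mu]_(u in `[0%R, t]) (lip_weight S a (Ft p.+2 q.+1 r.+2) p.+2 q.+1 r.+2 (coded true c u))%:E < +oo]%E); last first.
  by apply/seteqP; split => c /=; [case|case].
apply: measurableI.
  apply: meq => //; apply: (@measurable_time_integral _ _ (fun x => (\1_(~` hop S a m p.+1 q.+1 r.+1) x)%:E)).
    by move=> x; rewrite lee_fin indicE.
  by apply/measurable_EFinP; apply: measurable_indic; exact: measurableC.
apply: mlt; apply: (@measurable_time_integral _ _ (fun x => (lip_weight S a (Ft p.+2 q.+1 r.+2) p.+2 q.+1 r.+2 x)%:E)).
  by move=> x; rewrite lee_fin lip_weight_ge0.
by apply/measurable_EFinP; exact: measurable_lip_weight.
Qed.

Lemma measurable_Gam t : measurable (Gam t).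
Proof.
have -> : Gam t = ((\bigcap_(e in [set e | dyad e <= t]) \bigcap_(i in [set: 'I_m]) [set c : code (coordinate (d := d)) | S (coded true c (dyad e) i)]) `&`
   (\bigcap_(ik in [set: 'I_m * 'I_d]) [set c : code (coordinate (d := d)) | \int[mu]_(u in `[0%R, t]) (`|tame_drift ik.1 ik.2 (coded true c u)|)%:E < +oo]%E)) `&`
   ((\bigcup_p \bigcup_q \bigcup_r [set c : code (coordinate (d := d)) | is_tame t p q r (coded true c)]) `&`
    (\bigcap_(e in [set e | dyad e <= t]) \bigcap_(ik in [set: 'I_m * 'I_d]) [set c : code (coordinate (d := d)) |
        decode c e.1 e.2 (true, ik.1 : nat, ik.2) = (s ik.1 0 ik.2 + (coded false c (dyad e) ik.1 *m (cc ik.1)^T) 0 ik.2 +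
        \int[mu]_(u in `[0, dyad e]) tame_drift ik.1 ik.2 (coded true c u))%:E ])).
  apply/seteqP; split => c /=.
    move=> [h1 h2 [p [q [r h3]]] h4]; split; split => //.
    - by move=> e et i _; exact: h1.
    - by move=> [i k] _; exact: h2.
    - by exists p => //; exists q => //; exists r.
    - by move=> e et [i k] _; exact: h4.
  move=> [[h1 h2] [[p _ [q _ [r _ h3]]] h4]]; split.
  - by move=> e et i; exact: h1.
  - by move=> i k; exact: (h2 (i, k)).
  - by exists p, q, r.
  - by move=> e et i k; exact: (h4 e et (i, k)).
have mcap (I : countType) (P : set I) (F : I -> set (code (coordinate (d := d)))) :
   (forall i, P i -> measurable (F i)) -> measurable (\bigcap_(i in P) F i).
  move=> mF; rewrite -[X in measurable X]setCK setC_bigcap; apply: measurableC.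
  rewrite bigcup_mkcond; apply: countable_bigcupT_measurable => // i.
  by case: ifPn => // /set_mem /mF mFi; exact: measurableC.
apply: measurableI; apply: measurableI.
- apply: (@mcap _ _ _) => e _; apply: (@mcap _ _ _) => i _.
  have mS : measurable (S : set (borel 'rV[R]_d)) by exact: borel_closed.
  have mp : measurable_fun [set: seqM R d] (fun x : seqM R d => (x : seqE R d) i : borel 'rV[R]_d) by exact: measurable_proj.
  have := measurableT_comp mp (measurable_coded_at true (dyad e)) measurableT mS.
  by rewrite setTI.
- apply: (@mcap _ _ _) => -[i k] _; apply: mlt.
  apply: (@measurable_time_integral _ _ (fun x => (`|tame_drift i k x|)%:E)) => //.
  apply/measurable_EFinP; apply: measurableT_comp => //; exact: measurable_tame_drift.
- do 3![apply: bigcupT_measurable => ?]; exact: measurable_is_tame.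
- apply: (@mcap _ _ _) => e _; apply: (@mcap _ _ _) => -[i k] _ /=; apply: meq; first exact: measurable_decode.
  apply/measurable_EFinP; apply: measurable_funD; last exact: measurable_time_Rintegral (measurable_tame_drift i k).
  apply: measurable_funD; first exact: measurable_cst.
  rewrite (_ : (fun c => _) = (fun c => \sum_l (coded false c (dyad e) i 0 l * cc i k l))); last first.
    by apply/funext => c; rewrite mxE; apply: eq_bigr => l _; rewrite [(cc i)^T _ _]mxE.
  apply: measurable_sum => l; apply: measurable_funM; last exact: measurable_cst.
  exact: (measurableT_comp (measurable_coord (R := R) i l) (measurable_coded_at false (dyad e))).
Qed.

End gamma.


(** * Uniqueness for codes *)

Lemma within_continuous_cvg {R : realType} {V : topologicalType} (f : R -> V) (A : set R) (v : nat -> R) (u : R) :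
  {within A, continuous f} -> A u -> (forall n, A (v n)) -> v n @[n --> \oo] --> u ->
  f (v n) @[n --> \oo] --> f u.
Proof.
move=> cf Au Av vu; apply: (@cvg_comp _ _ _ v f _ (nbhs (u : subspace A))); last exact: cf.
move=> U HU; have : within A (nbhs u) U by rewrite (nbhs_subspace_in Au).
move=> h; have : \forall n \near \oo, A (v n) -> U (v n) := vu _ h.
move=> {}h; change (\forall n \near \oo, U (v n)); move: h; apply: filterS => n h'; exact: (h' (Av n)).
Qed.

Section gamma_paths.
Context {R : realType} {d : nat}.
Local Notation mu := (@lebesgue_measure R).
Variable S : set 'rV[R]_d.
Hypothesis clS : closed S.
Variables (a : nat -> nat -> nat) (m : nat) (Ssde : set (cfg R d)).
Variables (b : 'rV[R]_d -> cfg R d -> 'rV[R]_d) (Ft : nat -> nat -> nat -> 'M[R]_(m, d) -> cfg R d -> R).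
Hypothesis mSsde : measurable (Ssde : set (cfgM S)).
Hypothesis mb : borel_coef S Ssde b.
Hypothesis hallS : forall xs : 'M[R]_(m, d) * cfg R d, Hall S a xs -> Ssde (cfg_add (unlabelm xs.1) xs.2).
Hypothesis mFt : forall p q r, (0 < p)%N -> (0 < q)%N -> (0 < r)%N -> measurable_fun
       [set xs : borel 'M[R]_(m, d) * cfgM S |
          (forall i, S (row i (xs.1 : 'M[R]_(m, d)))) /\ config S xs.2]
       (fun xs => Ft p q r xs.1 xs.2).
Variables (cc : 'I_m -> 'M[R]_d) (s : seqE R d) (t : R) (bw : R -> seqE R d).
Hypothesis t0 : 0 <= t.
Hypothesis bw_cont : forall (i : 'I_m) k, {within `[0, t], continuous (fun u => bw u i 0 k)}.

Local Notation Gam := (Gam S a b Ft cc s t).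
Local Notation tame_drift := (tame_drift S a b).

Definition noise (u : R) (i : 'I_m) (k : 'I_d) : R := s i 0 k + (bw u i *m (cc i)^T) 0 k.

Lemma measurable_coded_time z (c : code (coordinate (d := d))) :
  measurable_fun [set: R] (fun u : R => coded z c u : seqM R d).
Proof.
apply: measurable_fun_seqM => j k.
have h := measurable_decoded (R := R) (z, j, k).
have : measurable_fun [set: R] (fun u : R => decoded (u, c).2 (u, c).1 (z, j, k) : R).
  apply: (measurableT_comp h); exact: measurable_pair2.
by rewrite (_ : (fun u => coded z c u j 0 k) = (fun u => decoded (u, c).2 (u, c).1 (z, j, k)))//; apply/funext => u; rewrite coded_entry.
Qed.

Lemma integrable_tame_drift (x : R -> seqE R d) (i : 'I_m) k :
  measurable_fun [set: R] (fun u : R => x u : seqM R d) ->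
  (\int[mu]_(u in `[0%R, t]) (`|tame_drift i k (x u)|)%:E < +oo)%E ->
  mu.-integrable `[0, t] (EFin \o (fun u => tame_drift i k (x u))).
Proof.
move=> mx fin; apply/integrableP; split => //.
apply/measurable_EFinP; apply: measurable_funTS.
exact: (measurableT_comp (measurable_tame_drift clS mSsde mb hallS i k) mx).
Qed.

Lemma noise_continuous i k : {within `[0, t], continuous (fun u => noise u i k)}.
Proof.
move=> u; apply: cvgD; first exact: cvg_cst.
rewrite (_ : (fun u => _) = fun u => \sum_l bw u i 0 l * cc i k l); last first.
  by apply/funext => v; rewrite mxE; apply: eq_bigr => l _; rewrite [(cc i)^T _ _]mxE.
have -> : (bw u i *m (cc i)^T) 0 k = \sum_l bw u i 0 l * cc i k l.
  by rewrite mxE; apply: eq_bigr => l _; rewrite [(cc i)^T _ _]mxE.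
apply: (@cvg_big _ _ _ _ _ add_continuous) => l _; apply: cvgM; last exact: cvg_cst.
exact: bw_cont.
Qed.

(** At dyadic times the code takes the values of the continuous function [phi], and decoding takes
    limits along dyadic times, so the decoded path is [phi] itself. *)
Lemma Gam_path c (i : 'I_m) k : Gam c ->
  (forall u (i : 'I_m), 0 <= u <= t -> coded false c u i = bw u i) ->
  let phi u := noise u i k + \int[mu]_(v in `[0, u]) tame_drift i k (coded true c v) in
  {within `[0, t], continuous phi} /\ forall u, 0 <= u <= t -> coded true c u i 0 k = phi u.
Proof.
move=> [h1 h2 h3 h4] cb phi.
have cphi : {within `[0, t], continuous phi}.
  move=> u; apply: cvgD; first exact: noise_continuous.
  apply: (parameterized_integral_continuous t0).
  by apply: integrable_tame_drift (h2 i k); exact: measurable_coded_time.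
split => // u /andP[u0 ut]; rewrite coded_entry.
have E n : decode c n (Num.truncn (u * 2 ^+ n)) (true, i : nat, k) = (phi (dyadic n u))%:E.
  have /andP[d0 du] := dyadic_le n u0.
  have dt : dyadic n u <= t by exact: le_trans ut.
  by rewrite (h4 (n, Num.truncn (u * 2 ^+ n)) dt i k) cb ?d0.
apply: decoded_cvg => //; last by move=> n; rewrite E.
rewrite (_ : (fun n => _) = (fun n => phi (dyadic n u))); last by apply/funext => n; rewrite E.
apply: within_continuous_cvg cphi _ _ (cvg_dyadic u0); first by rewrite /= in_itv /= u0.
move=> n; have /andP[d0 du] := dyadic_le n u0.
by rewrite /= in_itv /= d0 (le_trans du).
Qed.

Lemma closed_path (x : R -> 'rV[R]_d) (u : R) : 0 <= u <= t ->
  (forall k, {within `[0, t], continuous (fun u => x u 0 k)}) ->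
  (forall e, dyad e <= t -> S (x (dyad e))) -> S (x u).
Proof.
move=> /andP[u0 ut] cx Sx.
have : x (dyadic n u) @[n --> \oo] --> x u.
  apply: cvg_matrix => i k; rewrite (ord1 i).
  apply: within_continuous_cvg (cx k) _ _ (cvg_dyadic u0); first by rewrite /= in_itv /= u0.
  by move=> n; have /andP[d0 du] := dyadic_le n u0; rewrite /= in_itv /= d0 (le_trans du).
apply: (@closed_cvg _ _ _ eventually_filter _ S) => //.
near=> n; apply: (Sx (n, Num.truncn (u * 2 ^+ n))).
by have /andP[_ du] := dyadic_le n u0; exact: le_trans du ut.
Unshelve. all: by end_near. Qed.

(** [pathwise_unique] identifies the decoded paths; the coded dyadic values then agree, since the
    equation expresses them by the noise and the drift integral. *)
Lemma Gam_unique (c c' : code (coordinate (d := d))) (xw : R -> seqE R d) :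
  (forall p q r (u : R) y y', (0 < p)%N -> (0 < q)%N -> (0 < r)%N -> 0 <= u <= t ->
     Hopen S a p q r (y, unlabel (from m) (xw u)) ->
     Hopen S a p q r (y', unlabel (from m) (xw u)) ->
     simn S a p q r (unlabel (from m) (xw u)) y y' ->
     fam_norm (fun i : 'I_m => coefm b y (unlabel (from m) (xw u)) i - coefm b y' (unlabel (from m) (xw u)) i)
       <= enorm (y - y') * Ft p q r y (unlabel (from m) (xw u))) ->
  (forall c0 (u : R) j, c0 = c \/ c0 = c' -> 0 <= u <= t -> (m <= j)%N -> coded true c0 u j = xw u j) ->
  (forall c0 (u : R) (i : 'I_m), c0 = c \/ c0 = c' -> 0 <= u <= t -> coded false c0 u i = bw u i) ->
  Gam c -> Gam c' ->
  forall e (i : 'I_m) k, dyad e <= t -> decode c e.1 e.2 (true, i : nat, k) = decode c' e.1 e.2 (true, i : nat, k) :> \bar R.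
Proof.
move=> lip envE bE Gc Gc'.
have envc u : 0 <= u <= t -> unlabel (from m) (coded true c u) = unlabel (from m) (xw u).
  by move=> hu; apply: eq_unlabel => // j; apply: envE => //; left.
have GE c0 : c0 = c \/ c0 = c' -> Gam c0 -> forall (i : 'I_m) k,
    {within `[0, t], continuous (fun u => coded true c0 u i 0 k)} /\
    forall u, 0 <= u <= t -> coded true c0 u i 0 k = noise u i k + \int[mu]_(v in `[0, u]) tame_drift i k (coded true c0 v).
  move=> hc0 G0 i k; have [cphi E] := @Gam_path c0 i k G0 (fun u i => bE c0 u i hc0).
  split => //; apply: subspace_eq_continuous cphi.
  by move=> u; rewrite inE /= in_itv /= => hu; apply/esym; exact: E.
have [S1 I1 [p [q [r [p0 q0 r0 tame1 tame2]]]] D1] := Gc.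
have [S2 I2 _ D2] := Gc'.
have cl : c = c \/ c = c' by left. have cr : c' = c \/ c' = c' by right.
have eqpaths : forall u (i : 'I_m), 0 <= u <= t -> coded true c u i = coded true c' u i.
  apply: (@pathwise_unique _ _ S clS a m b (Ft p.+1 q r.+1) p q r t (coded true c) (coded true c') noise
     (fun u i k => tame_drift i k (coded true c u)) (fun u i k => tame_drift i k (coded true c' u)) q0).
  - by move=> u i k _ h; rewrite /tame_drift asboolT.
  - by move=> u i k _ h; rewrite /tame_drift asboolT.
  - have mI : measurable_fun (`[0, t]%classic : set (g_sigma_algebraType (@ocitv R))) (fun u => (\1_(~` hop S a m p q r) (coded true c u))%:E : \bar R).
      apply/measurable_EFinP; apply: measurable_funTS.
      apply: (measurableT_comp (f := \1_(~` hop S a m p q r) : seqM R d -> R)); last exact: measurable_coded_time.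
      by apply: measurable_indic; apply: measurableC; exact: measurable_hop.
    have tame1' : (\int[mu]_(u in `[0%R, t]) `|(\1_(~` hop S a m p q r) (coded true c u))%:E| = 0)%E.
      by rewrite -[RHS]tame1; apply: eq_integral => u _; rewrite gee0_abs// lee_fin indicE.
    have [N [mN N0 sub]] := (ae_eq_integral_abs mu (measurable_itv _) mI).1 tame1'.
    exists N; split => // u /= nu; apply: sub => /= hu; apply: nu => h.
    have := hu; rewrite in_itv /= => /(_ h) /eqP; rewrite eqe indicE; case: (boolP (_ \in _)) => //.
      by rewrite oner_eq0.
    by move=> /negP nh _; apply: contrapT => nh'; apply: nh; rewrite inE.
  - by move=> u j hu mj; rewrite (envE c') // (envE c).
  - move=> u i hu; split; apply: (closed_path (x := fun u => coded true _ u i)) => //.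
    + by move=> k; have [] := GE c cl Gc i k.
    + by move=> e et; exact: S1.
    + by move=> k; have [] := GE c' cr Gc' i k.
    + by move=> e et; exact: S2.
  - by move=> i k; have [] := GE c cl Gc i k.
  - by move=> i k; have [] := GE c' cr Gc' i k.
  - by move=> u y y' hu; rewrite envc//; exact: lip.
  - apply/integrableP; split.
      apply/measurable_EFinP; apply: measurable_funTS.
      apply: (measurableT_comp (f := lip_weight S a (Ft p.+1 q r.+1) p.+1 q r.+1 : seqM R d -> R)); last exact: measurable_coded_time.
      exact: (measurable_lip_weight clS a mFt).
    by apply: le_lt_trans tame2; under eq_integral do rewrite /= ger0_norm ?lip_weight_ge0//.
  - move=> i k; split.
      exact: (@integrable_tame_drift (coded true c) i k (measurable_coded_time _ _) (I1 i k)).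
    exact: (@integrable_tame_drift (coded true c') i k (measurable_coded_time _ _) (I2 i k)).
  - move=> u i k hu; have [_ e1] := GE c cl Gc i k; have [_ e2] := GE c' cr Gc' i k.
    by split; [exact: e1|exact: e2].
have eqall u : 0 <= u <= t -> coded true c u = coded true c' u.
  move=> hu; apply/funext => j; case: (ltnP j m) => jm; last by rewrite (envE c) // (envE c').
  exact: (eqpaths u (Ordinal jm)).
move=> e i k et; have he : 0 <= @dyad R e <= t by rewrite dyad_ge0 et.
have IE : \int[mu]_(v in `[0, dyad e]) tame_drift i k (coded true c v) =
          \int[mu]_(v in `[0, dyad e]) tame_drift i k (coded true c' v).
  apply: eq_Rintegral => u; rewrite inE /= in_itv /= => /andP[u0 ue].
  by rewrite eqall// u0 (le_trans ue).
by rewrite (D1 e et i k) (D2 e et i k) (bE c (dyad e) i cl he) (bE c' (dyad e) i cr he) IE.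
Qed.

End gamma_paths.


(** * Events of the output as events of the input *)

Section time_points.
Context {R : realType}.

Lemma time_subproof (u : R) : 0 <= u -> u \in (`[0, +oo[%classic : set R).
Proof. by move=> u0; rewrite inE /= in_itv /= andbT. Qed.

Definition time_of (u : R) (u0 : 0 <= u) : @time R := exist _ u (time_subproof u0).

Lemma time_ofE u u0 : set_val (@time_of u u0) = u.
Proof. by []. Qed.

Lemma time_ge0 (t : @time R) : 0 <= (set_val t : R).
Proof. by have := set_valP t; rewrite /= in_itv /= andbT. Qed.

Lemma set_val_inj (t t' : @time R) : set_val t = set_val t' :> R -> t = t'.
Proof. by move=> h; apply: val_inj. Qed.

Lemma cvg_time (v : nat -> @time R) (t : @time R) : (set_val (v n) : R) @[n --> \oo] --> (set_val t : R) ->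
  v n @[n --> \oo] --> t.
Proof.
move=> cv U [V [[W oW <-] Wt VU]].
have : \forall n \near \oo, W (set_val (v n) : R) by apply: cv; exact: open_nbhs_nbhs.
by move=> h; change (\forall n \near \oo, U (v n)); move: h; apply: filterS => n Wn; exact: VU.
Qed.

Lemma path_cvg {dO} {Omega : measurableType dO} {A : topologicalType} (Z : R -> Omega -> A) w (v : nat -> R) (u : R) :
  continuous_process Z -> 0 <= u -> (forall n, 0 <= v n) -> v n @[n --> \oo] --> u ->
  Z (v n) w @[n --> \oo] --> Z u w.
Proof.
move=> cZ u0 v0 vu.
have cv : time_of (v0 n) @[n --> \oo] --> time_of u0 by exact: cvg_time.
exact: (cvg_comp _ _ cv (cZ w (time_of u0))).
Qed.

Lemma path_within {dO} {Omega : measurableType dO} {A : topologicalType} (Z : R -> Omega -> A) w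
    (g : A -> R) (t : R) :
  continuous_process Z -> continuous g -> {within `[0, t], continuous (fun u => g (Z u w))}.
Proof.
move=> cZ cg.
(* Negative times are sent to 0, since continuity of paths is given on [time] only. *)
have u0 (u : R) : 0 <= Num.max u 0 by rewrite le_max lexx orbT.
apply: (@subspace_eq_continuous _ _ _ (fun u => g (path_of Z w (time_of (u0 u))))).
  move=> u; rewrite inE /= in_itv /= => /andP[h _]; rewrite /path_of time_ofE.
  by rewrite (max_idPl h).
apply: continuous_subspaceT => u.
have ct : continuous (fun u => time_of (u0 u)).
  apply: continuous_comp_initial => x; rewrite /comp /=.
  apply: (@continuous_max _ _ id (cst 0)); [exact: cvg_id|exact: cvg_cst].
exact: (cvg_comp _ _ (cvg_comp _ _ (ct u) (cZ w _)) (cg _)).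
Qed.

Definition dyad_time (e : nat * nat) : @time R := time_of (dyad_ge0 e).

End time_points.

Section events.
Context {R : realType} {d : nat} {dO : measure_display} {Omega : measurableType dO}.
Local Notation mu := (@lebesgue_measure R).
Variable S : set 'rV[R]_d.
Hypothesis clS : closed S.
Variables (a : nat -> nat -> nat) (m : nat) (Ssde : set (cfg R d)).
Variables (b : 'rV[R]_d -> cfg R d -> 'rV[R]_d) (Ft : nat -> nat -> nat -> nat -> 'M[R]_(m, d) -> cfg R d -> R).
Hypothesis mSsde : measurable (Ssde : set (cfgM S)).
Hypothesis mb : borel_coef S Ssde b.
Hypothesis hallS : forall xs : 'M[R]_(m, d) * cfg R d, Hall S a xs -> Ssde (cfg_add (unlabelm xs.1) xs.2).
Hypothesis mFt : forall p q r T, (0 < p)%N -> (0 < q)%N -> (0 < r)%N -> (0 < T)%N -> measurable_fun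
       [set xs : borel 'M[R]_(m, d) * cfgM S |
          (forall i, S (row i (xs.1 : 'M[R]_(m, d)))) /\ config S xs.2]
       (fun xs => Ft p q r T xs.1 xs.2).
Variables (cc : 'I_m -> 'M[R]_d) (s : seqE R d) (o : 'rV[R]_d).
Variables (Q : probability Omega R) (X B : R -> Omega -> seqE R d).
Hypothesis X_cont : continuous_process X.
Hypothesis B_cont : continuous_process B.
Hypothesis mX : forall u j k, 0 <= u -> measurable_fun setT (fun w => X u w j 0 k).
Hypothesis mB : forall u j k, 0 <= u -> measurable_fun setT (fun w => B u w j 0 k).

Lemma continuous_coord j k : continuous (fun x : seqE R d => x j 0 k).
Proof.
move=> x; apply: (@continuous_comp _ _ _ (fun x : seqE R d => x j) (fun y : 'rV[R]_d => y 0 k)).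
  exact: (@proj_continuous _ (fun=> 'rV[R]_d) j).
exact: coord_continuous.
Qed.

Lemma X_coord_cvg (Z : R -> Omega -> seqE R d) w (v : nat -> R) (u : R) j k : continuous_process Z ->
  0 <= u -> (forall n, 0 <= v n) ->
  v n @[n --> \oo] --> u -> Z (v n) w j 0 k @[n --> \oo] --> Z u w j 0 k.
Proof.
move=> cZ u0 v0 vu; have := path_cvg cZ u0 v0 vu; move=> /(_ w) cv.
exact: (cvg_comp _ _ cv (@continuous_coord j k _)).
Qed.

Definition values (w : Omega) (u : R) (i : coordinate (d := d)) : R :=
  let: (z, j, k) := i in if z then X u w j 0 k else B u w j 0 k.

Definition path_code (w : Omega) : code (coordinate (d := d)) := encode values w.

Lemma values_cvg w u i : 0 <= u -> values w (dyadic n u) i @[n --> \oo] --> values w u i.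
Proof.
case: i => -[[] j] k u0 /=; apply: X_coord_cvg => //; try exact: cvg_dyadic;
  by move=> n; have /andP[] := dyadic_le n u0.
Qed.

Lemma decoded_path_code w u i : 0 <= u -> decoded (path_code w) u i = values w u i.
Proof. by move=> u0; apply: decoded_encode => //; exact: values_cvg. Qed.

Lemma coded_path_code w u : 0 <= u -> coded true (path_code w) u = X u w /\ coded false (path_code w) u = B u w.
Proof.
by move=> u0; split; apply/funext => j; apply/rowP => k; rewrite coded_entry decoded_path_code.
Qed.

Lemma measurable_values u i : 0 <= u -> measurable_fun setT (fun w => values w u i).
Proof. by case: i => -[[] j] k u0; [exact: mX|exact: mB]. Qed.

Lemma measurable_path_code_bit e : measurable [set w | path_code w e].
Proof.
case: e => -[[n k] i] r; rewrite /path_code /encode /=.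
rewrite (_ : mkset _ = (fun w => values w (dyad (n, k)) i) @^-1` `]ratr r, +oo[); last first.
  by apply/seteqP; split => w /=; rewrite in_itv /= andbT.
rewrite -[X in measurable X]setTI; apply: measurable_values => //.
exact: (dyad_ge0 (n, k)).
Qed.

Lemma measurable_path_code : measurable_fun setT (path_code : Omega -> code (coordinate (d := d))).
Proof.
move=> mT; suff h : measurable_fun setT (path_code : Omega -> code (coordinate (d := d))) by exact: h.
apply: measurability; first by [].
move=> _ [_ [e _ <-] <-].
by rewrite setTI; exact: measurable_path_code_bit.
Qed.

Local Notation pathm := {compact-open, @time R -> 'M[R]_(m, d)}.
Local Notation paths := {compact-open, @time R -> seqE R d}.
Local Notation input := (input X B m o).

(** Coordinates of [X] and [B] that the input does not carry show an arbitrary constant instead;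
    [is_input] marks those that can be trusted. *)
Definition input_value (z : pathm * paths) (u : @time R) (i : coordinate (d := d)) : R :=
  let: (y, j, k) := i in
  if y then z.2 u j 0 k else (if insub j is Some j' then z.1 u (j' : 'I_m) k else 0).

Definition input_bit (z : pathm * paths) (e : event (I := coordinate (d := d))) : bool :=
  let: (n, k, i, r) := e in ratr r < input_value z (dyad_time (n, k)) i.

Definition is_input (i : coordinate (d := d)) : bool :=
  let: (y, j, k) := i in if y then (m <= j)%N else (j < m)%N.

Lemma input_valueE w u i : is_input i -> input_value (input w) u i = values w (set_val u) i.
Proof.
case: i => -[[] j] k /=; first by rewrite ltnNge => ->.
by move=> jm; rewrite insubT /= mxE.
Qed.

Lemma input_bitE w n k i r : is_input i -> input_bit (input w) (n, k, i, r) = path_code w (n, k, i, r).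
Proof. by move=> isi; rewrite /input_bit input_valueE. Qed.

Definition past_events (t : R) : set (event (I := coordinate (d := d))) :=
  [set e | let: (n, k, i, r) := e in is_input i /\ dyad (n, k) <= t].

Local Notation W0W := (@W0W R d m).
Local Notation past_W0W := (@past_W0W R d m).

(** The continuity clauses hold for every outcome, so only the start of the noise remains. *)
Lemma W0W_input w : W0W (input w) <-> forall i : 'I_m, B 0 w i = 0.
Proof.
split=> [[_ h _] i|h].
  have := h (time_of (lexx 0)) erefl; move=> /(congr1 (row i)); rewrite row_firstm => ->.
  by apply/rowP => k; rewrite !mxE.
split => /=.
- move=> t; have ft := nbhs_filter t; apply: (cvg_matrix (FF := ft)) => i k.
  rewrite [X in _ --> X]mxE (_ : (fun u => _) = (fun u : @time R => B (set_val u) w i 0 k)); last first.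
    by apply/funext => u; rewrite mxE.
  exact: (cvg_comp _ _ (@B_cont w t) (@continuous_coord i k _)).
- by move=> t t0; rewrite t0; apply/matrixP => i k; rewrite !mxE h mxE.
- move=> t; have ft := nbhs_filter t; apply/pointwise_cvgP => j.
  suff hh : (if (j < m)%N then o else X (set_val u) w j) @[u --> t] --> (if (j < m)%N then o else X (set_val t) w j) by exact: hh.
  case: ifP => jm; first exact: cvg_cst.
  exact: (cvg_comp _ _ (@X_cont w t) (@proj_continuous _ (fun=> 'rV[R]_d) j _)).
Qed.

Lemma measurable_input_W0W : measurable (input @^-1` W0W).
Proof.
have -> : input @^-1` W0W = \bigcap_(i in [set: 'I_m]) \bigcap_(k in [set: 'I_d]) [set w | B 0 w i 0 k = cst 0 w].
  apply/seteqP; split => w /=.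
    by move=> /W0W_input h i _ k _ /=; rewrite h mxE.
  by move=> h; apply/W0W_input => i; apply/rowP => k; rewrite mxE; exact: h.
apply: fin_bigcap_measurable => // i _; apply: fin_bigcap_measurable => // k _.
have := mB i k (lexx 0) measurableT (measurable_set1 (0 : R)); rewrite setTI.
by congr measurable; apply/seteqP; split => w.
Qed.

(** The first property gives adaptedness, the second Borel measurability on path space, the third a
    measurable preimage, so that the law of the input can be evaluated. *)
Definition observable (q : @time R) : set (set (pathm * paths)) :=
  [set C | [/\ past_W0W q C, borel_on W0W C & measurable (input @^-1` C)]].

Lemma observable_sigma q : sigma_algebra W0W (observable q).
Proof.
have [p1 p2 p3] := @smallest_sigma_algebra _ W0W
  [set A | exists (u : time) (U : set (borel 'M[R]_(m, d) * borel (seqE R d))),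
      [/\ (set_val u : R) <= set_val q, measurable U &
          A = W0W `&` [set vw : pathm * paths | U (vw.1 u, vw.2 u)]]].
have [b1 b2 b3] := @smallest_sigma_algebra _ W0W [set W0W `&` U | U in open].
split.
- by split => //; rewrite preimage_set0.
- move=> C [pC bC mC]; split; [exact: p2|exact: b2|].
  rewrite (_ : _ @^-1` _ = (input @^-1` W0W) `\` (input @^-1` C))//.
  by apply: measurableD => //; exact: measurable_input_W0W.
- move=> C HC; split; [by apply: p3 => n; case: (HC n)|by apply: b3 => n; case: (HC n)|].
  by rewrite preimage_bigcup; apply: bigcupT_measurable => n; case: (HC n).
Qed.

(** Singletons being compact, evaluation at one time is continuous for the compact-open topology; a
    bit is thus an open condition as well as an event of the past. *)
Lemma observable_bit (e : event (I := coordinate (d := d))) q : past_events (set_val q) e ->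
  observable q (W0W `&` [set z | input_bit z e]).
Proof.
case: e => -[[n k] [[zb j] l]] r [isi eq].
have mrow (j0 : nat) : measurable [set x : borel (seqE R d) | ratr r < (x : seqE R d) j0 0 l].
  have := @measurable_seq_coord R d j0 l measurableT _ (measurable_itv `]ratr r, +oo[).
  by rewrite setTI; congr measurable; apply/seteqP; split => x /=; rewrite in_itv /= andbT.
have orow (j0 : nat) : open [set x : seqE R d | ratr r < x j0 0 l].
  have := @continuous_coord j0 l; move=> /continuousP /(_ _ (@open_gt R (ratr r))).
  by congr open.
have single (T : topologicalType) (u : @time R) (U : set T) : [set g : {compact-open, @time R -> T} | g @` [set u] `<=` U] = [set g | U (g u)].
  apply/seteqP; split => g /=; first by move=> h; apply: h; exists u.
  by move=> h _ [_ -> <-].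
have op1 (U : set 'M[R]_(m, d)) (u : @time R) : open U -> open ([set z | U (z.1 u)] : set (pathm * paths)).
  move=> oU; have := @compact_open_open _ _ [set u] U (@compact_set1 _ u) oU.
  rewrite single => h; apply: open_comp h => z _; exact: cvg_fst.
have op2 (U : set (seqE R d)) (u : @time R) : open U -> open ([set z | U (z.2 u)] : set (pathm * paths)).
  move=> oU; have := @compact_open_open _ _ [set u] U (@compact_set1 _ u) oU.
  rewrite single => h; apply: open_comp h => z _; exact: cvg_snd.
have mI : measurable (input @^-1` (W0W `&` [set z | input_bit z (n, k, (zb, j, l), r)])).
  rewrite preimage_setI; apply: measurableI; first exact: measurable_input_W0W.
  rewrite (_ : _ @^-1` _ = [set w | path_code w (n, k, (zb, j, l), r)]); first exact: measurable_path_code_bit.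
  by apply/seteqP; split => w; rewrite /preimage /mkset input_bitE.
split => //; apply: sub_gen_smallest.
- exists (dyad_time (n, k)); case: zb isi {mI} => /= mj.
    exists (setT `*` [set x : borel (seqE R d) | ratr r < (x : seqE R d) j 0 l]); split => //.
      exact: measurableX.
    by congr (_ `&` _); apply/seteqP; split => z //= [].
  exists ([set x : borel 'M[R]_(m, d) | ratr r < (x : 'M[R]_(m, d)) (Ordinal mj) l] `*` setT); split => //.
    apply: measurableX => //.
    have := @measurable_entry R m d (Ordinal mj) l measurableT _ (measurable_itv `]ratr r, +oo[).
    by rewrite setTI; congr measurable; apply/seteqP; split => x /=; rewrite in_itv /= andbT.
  by congr (_ `&` _); apply/seteqP; split => z /=; rewrite insubT //= => -[].
- exists [set z0 | input_bit z0 (n, k, (zb, j, l), r)] => //.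
  case: zb isi {mI} => /= mj; first exact: (op2 _ _ (orow j)).
  rewrite insubT; apply: (op1 [set x : 'M[R]_(m, d) | ratr r < x (Ordinal mj) l]).
  have /continuousP := @coord_continuous R m d (Ordinal mj) l.
  by move=> /(_ _ (@open_gt R (ratr r))).
Qed.

Hypothesis B0 : {ae Q, forall w, forall i : nat, B 0 w i = 0}.
Hypothesis lip : {ae Q, forall w, forall p q r T : nat, (0 < p)%N -> (0 < q)%N -> (0 < r)%N -> (0 < T)%N ->
  forall (u : R) (x y : 'M[R]_(m, d)), 0 <= u <= T%:R ->
  Hopen S a p q r (x, unlabel (from m) (X u w)) -> Hopen S a p q r (y, unlabel (from m) (X u w)) ->
  simn S a p q r (unlabel (from m) (X u w)) x y ->
  fam_norm (fun i => coefm b x (unlabel (from m) (X u w)) i - coefm b y (unlabel (from m) (X u w)) i)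
  <= enorm (x - y) * Ft p q r T x (unlabel (from m) (X u w))}.
Hypothesis GamX : {ae Q, forall w, forall e,
  Gam S a b (fun p q r => Ft p q r (Num.truncn (dyad e : R)).+1) cc s (dyad e) (path_code w)}.

(** [factor_through], with the input bits up to time [dyad e] as the observed ones and [Gam] as the
    relation: by uniqueness these bits determine the solution at that time. *)
Lemma output_event (e : nat * nat) (i : 'I_m) (k : 'I_d) (r : rat) :
  exists2 C, observable (dyad_time e) C & {ae Q, forall w, C (input w) <-> ratr r < X (dyad e) w i 0 k}.
Proof.
(* The Lipschitz bounds are given on intervals of positive integer length. *)
pose T := (Num.truncn (dyad e : R)).+1.
have eT : dyad e <= T%:R :> R by apply/ltW; exact: truncnS_gt.
pose E : set (code (coordinate (d := d))) := [set c | ((ratr r)%:E < (decode c e.1 e.2 (true, i : nat, k) : \bar R))%E].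
have mE : measurable E.
  by rewrite -[X in measurable X]setTI; apply: emeasurable_fun_lt => //; exact: measurable_decode.
have mG : measurable (Gam S a b (fun p q r => Ft p q r T) cc s (dyad e)).
  by apply: (measurable_Gam clS mSsde) => // p q r' p0 q0 r0; exact: mFt.
pose L : set Omega := [set w | [/\ forall i : nat, B 0 w i = 0,
  forall p q r T : nat, (0 < p)%N -> (0 < q)%N -> (0 < r)%N -> (0 < T)%N ->
  forall (u : R) (x y : 'M[R]_(m, d)), 0 <= u <= T%:R ->
  Hopen S a p q r (x, unlabel (from m) (X u w)) -> Hopen S a p q r (y, unlabel (from m) (X u w)) ->
  simn S a p q r (unlabel (from m) (X u w)) x y ->
  fam_norm (fun i => coefm b x (unlabel (from m) (X u w)) i - coefm b y (unlabel (from m) (X u w)) i)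
  <= enorm (x - y) * Ft p q r T x (unlabel (from m) (X u w)) &
  Gam S a b (fun p q r => Ft p q r T) cc s (dyad e) (path_code w)]].
have Lae : {ae Q, forall w, L w}.
  by apply: filterS3 B0 lip GamX => w h1 h2 h3; split => //; exact: h3.
have LP w : L w -> [/\ W0W (input w), Gam S a b (fun p q r => Ft p q r T) cc s (dyad e) (path_code w) &
   forall e', past_events (dyad e) e' -> input_bit (input w) e' = path_code w e'].
  move=> [h1 h2 h3]; split => //; first exact/W0W_input.
  by move=> [[[n' k'] i'] r'] [isi _]; exact: input_bitE.
have uniq w : L w -> forall c c', Gam S a b (fun p q r => Ft p q r T) cc s (dyad e) c ->
    Gam S a b (fun p q r => Ft p q r T) cc s (dyad e) c' ->
  (forall e', past_events (dyad e) e' -> c e' = path_code w e') ->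
  (forall e', past_events (dyad e) e' -> c' e' = path_code w e') -> E c -> E c'.
  move=> [h1 h2 h3] c c' Gc Gc' Hc Hc'.
  have agree c0 : c0 = c \/ c0 = c' -> forall (u : R) i', is_input i' -> 0 <= u <= dyad e -> decoded c0 u i' = values w u i'.
    move=> hc0 u i' isi hu; have /andP[u0 _] := hu; rewrite -decoded_path_code//.
    apply: (decoded_eq hu); apply: decode_agree => n' k' r' nk.
    by case: hc0 => ->; [apply: Hc|apply: Hc'].
  suff DE : decode c e.1 e.2 (true, i : nat, k) = decode c' e.1 e.2 (true, i : nat, k) :> \bar R by rewrite /E /= DE.
  apply: (@Gam_unique R d S clS a m Ssde b (fun p q r => Ft p q r T) mSsde mb hallS _ cc s (dyad e) (fun u => B u w) (dyad_ge0 e) _ c c' (fun u => X u w)) => //.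
  - by move=> p q r' p0 q0 r0; exact: mFt.
  - move=> i' k'; apply: (@path_within R dO Omega (seqE R d) B w (fun x : seqE R d => x i' 0 k') (dyad e) B_cont).
    exact: continuous_coord.
  - move=> p q r' u y y' p0 q0 r0 /andP[u0 ue]; apply: h2 => //.
    by rewrite u0 (le_trans ue).
  - move=> c0 u j hc0 hu mj; apply/rowP => l; rewrite coded_entry (agree c0 hc0)//.
  - move=> c0 u j hc0 hu; apply/rowP => l; rewrite coded_entry (agree c0 hc0)//=.
have [C GC CE] := factor_through measurable_path_code_bit (observable_sigma (dyad_time e))
  (Z := input) (@observable_bit ^~ (dyad_time e)) mG mE Lae LP uniq.
exists C => //; apply: filterS CE => w ->; rewrite /E /= decode_encode lte_fin.
by []. Qed.


End events.


(** * Continuous paths recovered from codes *)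

Lemma uniform_modulus {R : realType} (f : R -> R) (N : R) : {within `[0, N], continuous f} ->
  forall e, 0 < e -> exists2 delta, 0 < delta &
  forall u v, 0 <= u <= N -> 0 <= v <= N -> `|u - v| <= delta -> `|f u - f v| <= e.
Proof.
move=> cf e e0; have e2 : 0 < e / 2 by rewrite divr_gt0.
have loc x : 0 <= x <= N -> exists2 rho, 0 < rho & forall u, 0 <= u <= N -> `|x - u| < rho -> `|f x - f u| < e / 2.
  move=> hx; have Ax : `[0, N]%classic x by rewrite /= in_itv.
  have /cvgrPdist_lt/(_ _ e2) := cf x; rewrite /= => h.
  have : within `[0, N]%classic (nbhs x) [set u | `|f x - f u| < e / 2] by rewrite (nbhs_subspace_in Ax).
  move=> [rho /= rho0 H]; exists rho => // u hu xu.
  by apply: H => //; rewrite /= in_itv.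
have := @segment_compact R 0 N => /compact_near_coveringP cov.
pose P delta u := 0 <= u <= N -> forall v, 0 <= v <= N -> `|u - v| <= delta -> `|f u - f v| <= e.
have [] := cov R (0^'+) P _.
  move=> x; rewrite /= in_itv /= => hx; have [rho rho0 H] := loc x hx.
  have r2 : 0 < rho / 2 by rewrite divr_gt0.
  exists ([set u | `|x - u| < rho / 2], [set delta | 0 < delta < rho / 2]).
    split; first by exists (rho / 2).
    exists (rho / 2) => // y; rewrite /ball_ /= sub0r normrN => h y0.
    by rewrite y0 /= (le_lt_trans (ler_norm y)).
  move=> [u delta] /= [h1 /andP[d0 d1]] hu v hv uv.
  have Hu := H u hu; have Hv := H v hv.
  have xu : `|x - u| < rho by apply: lt_trans h1 _; rewrite ltr_pdivrMr// ltr_pMr// ltr1n.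
  have xv : `|x - v| < rho.
    rewrite (_ : x - v = (x - u) + (u - v)); last by ring.
    rewrite (le_lt_trans (ler_normD _ _))// [rho]splitr ltrD//.
    exact: le_lt_trans uv _.
  rewrite (_ : f u - f v = (f x - f v) - (f x - f u)); last by ring.
  rewrite (le_trans (ler_normB _ _))// [e]splitr lerD// ltW//; [exact: Hv|exact: Hu].
move=> delta delta0 H; exists (delta / 2); first by rewrite divr_gt0.
move=> u v hu hv; apply: (H (delta / 2)) => //=.
by rewrite sub0r normrN ger0_norm ?ltW ?divr_gt0// ltr_pdivrMr// ltr_pMr// ltr1n.
by rewrite divr_gt0.
Qed.

Section coded_output.
Context {R : realType} {d m : nat}.
Local Notation I := (coordinate (d := d)).
Local Notation pathm := {compact-open, @time R -> 'M[R]_(m, d)}.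

Definition grid_value (c : code I) (e : nat * nat) (i : 'I_m) (k : 'I_d) : R :=
  fine (decode c e.1 e.2 (true, i : nat, k)).

(** Uniform continuity of the dyadic values on bounded intervals, by countably many conditions: a
    measurable description of the codes of continuous paths. *)
Definition uniform_code : set (code I) :=
  [set c | (forall e (i : 'I_m) k, (decode c e.1 e.2 (true, i : nat, k) : \bar R) \is a fin_num) /\
    forall N j, exists l, forall e e', dyad e <= (N%:R : R) -> dyad e' <= (N%:R : R) ->
     `|dyad e - dyad e'| <= (l.+1%:R^-1 : R) -> forall i k, `|grid_value c e i k - grid_value c e' i k| <= j.+1%:R^-1].

Lemma measurable_grid_value e i k : measurable_fun setT (fun c : code I => grid_value c e i k).
Proof.
have fm : measurable_fun [set: \bar R] (fine : \bar R -> R) by exact: fine_measurable.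
exact: (measurableT_comp fm (measurable_decode (R := R) _ _ _)).
Qed.

Lemma measurable_bigcap_count {dT} {T : measurableType dT} (J : countType) (P : set J) (F : J -> set T) :
  (forall i, P i -> measurable (F i)) -> measurable (\bigcap_(i in P) F i).
Proof.
move=> mF; rewrite -[X in measurable X]setCK setC_bigcap; apply: measurableC.
rewrite bigcup_mkcond; apply: countable_bigcupT_measurable => // i.
by case: ifPn => // /set_mem /mF mFi; exact: measurableC.
Qed.

Lemma measurable_uniform_code : measurable uniform_code.
Proof.
have -> : uniform_code = (\bigcap_(eik in [set: (nat * nat) * 'I_m * 'I_d])
     ((fun c : code I => decode c eik.1.1.1 eik.1.1.2 (true, eik.1.2 : nat, eik.2) : \bar R) @^-1` [set x | x \is a fin_num])) `&`
  (\bigcap_(Nj in [set: nat * nat]) \bigcup_l \bigcap_(p in [set p : (nat * nat) * (nat * nat) |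
     [/\ dyad p.1 <= (Nj.1%:R : R), dyad p.2 <= (Nj.1%:R : R) & `|dyad p.1 - dyad p.2| <= (l.+1%:R^-1 : R)]])
     \bigcap_(ik in [set: 'I_m * 'I_d]) [set c : code I | (`|grid_value c p.1 ik.1 ik.2 - grid_value c p.2 ik.1 ik.2| <= Nj.2.+1%:R^-1)]).
  apply/seteqP; split => c /=.
    move=> [h1 h2]; split; first by move=> [[e i] k] _; exact: h1.
    move=> [N j] _; have [l H] := h2 N j; exists l => // -[e e'] [p1 p2 p3] [i k] _; exact: H.
  move=> [h1 h2]; split; first by move=> e i k; exact: (h1 (e, i, k) Logic.I).
  move=> N j; have [l _ H] := h2 (N, j) Logic.I; exists l => e e' p1 p2 p3 i k.
  exact: (H (e, e') (And3 p1 p2 p3) (i, k) Logic.I).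
apply: measurableI.
  apply: measurable_bigcap_count => -[[e i] k] _ /=.
  have mf : measurable [set x : \bar R | x \is a fin_num].
    rewrite (_ : mkset _ = ~` ([set +oo%E] `|` [set -oo%E])).
      by apply: measurableC; apply: measurableU; exact: emeasurable_set1.
    by apply/seteqP; split => -[x| |] //=; rewrite ?fin_numE//; [move=> _ []|move=> []; left|move=> []; right].
  by have := measurable_decode (R := R) e.1 e.2 (true, i : nat, k) measurableT mf; rewrite setTI.
apply: measurable_bigcap_count => Nj _; apply: bigcupT_measurable => l.
apply: measurable_bigcap_count => p _; apply: measurable_bigcap_count => ik _.
have mg : measurable_fun setT (fun c : code I => `|grid_value c p.1 ik.1 ik.2 - grid_value c p.2 ik.1 ik.2|).
  by apply: measurableT_comp => //; apply: measurable_funB; exact: measurable_grid_value.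
have := mg measurableT _ (measurable_itv `]-oo, Nj.2.+1%:R^-1]).
by rewrite setTI; congr measurable; apply/seteqP; split => c /=; rewrite in_itv.
Qed.

Definition coded_matrix (c : code I) (u : R) : 'M[R]_(m, d) := \matrix_(i, k) decoded c u (true, i : nat, k).

Definition coded_output (c : code I) : pathm := fun t : @time R => coded_matrix c (set_val t).

Lemma coded_output_cvg c u (i : 'I_m) k : uniform_code c -> 0 <= u ->
  grid_value c (n, Num.truncn (u * 2 ^+ n)) i k @[n --> \oo] --> coded_matrix c u i k.
Proof.
move=> [fin unif] u0; have uN : u <= (Num.truncn u).+1%:R by apply/ltW; exact: truncnS_gt.
have cv : cvgn (fun n => grid_value c (n, Num.truncn (u * 2 ^+ n)) i k).
  apply/cauchy_cvgP; apply: cauchy_exP => e e0.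
  have [j _ /(_ j (leqnn j)) /= je] := near_infty_natSinv_lt (PosNum e0).
  have [l H] := unif (Num.truncn u).+1 j.
  have l2 : 0 < l.+1%:R^-1 / 2 :> R by rewrite divr_gt0// invr_gt0.
  have /cvgrPdist_lt/(_ _ l2) near_u := cvg_dyadic u0.
  have [n0 hn0] := filter_ex near_u.
  exists (grid_value c (n0, Num.truncn (u * 2 ^+ n0)) i k).
  suff : \forall n \near \oo, `|grid_value c (n0, Num.truncn (u * 2 ^+ n0)) i k - grid_value c (n, Num.truncn (u * 2 ^+ n)) i k| < e by [].
  apply: filterS near_u => n hn; apply: le_lt_trans je; apply: H.
  - have /andP[_ h] := dyadic_le n0 u0; exact: le_trans uN.
  - have /andP[_ h] := dyadic_le n u0; exact: le_trans uN.
  - change (`|dyadic n0 u - dyadic n u| <= l.+1%:R^-1).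
    rewrite (_ : dyadic n0 u - dyadic n u = (u - dyadic n u) - (u - dyadic n0 u)); last by ring.
    rewrite (le_trans (ler_normB _ _))// [leRHS]splitr lerD// ltW//.
rewrite mxE (_ : decoded c u _ = limn (fun n => grid_value c (n, Num.truncn (u * 2 ^+ n)) i k)); first exact: cv.
have finn n : (decode c n (Num.truncn (u * 2 ^+ n)) (true, i : nat, k) : \bar R) \is a fin_num by exact: (fin (n, _)).
exact: (@decoded_cvg R d c (true, i : nat, k) u _ u0 cv finn).
Qed.

Lemma coded_output_modulus c N j : uniform_code c -> exists l, forall u v : R, 0 <= u <= N%:R -> 0 <= v <= N%:R ->
  `|u - v| < l.+1%:R^-1 -> forall i k, `|coded_matrix c u i k - coded_matrix c v i k| <= j.+1%:R^-1.
Proof.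
move=> cu; have [fin unif] := cu; have [l H] := unif N j; exists l => u v /andP[u0 uN] /andP[v0 vN] uv i k.
have cvd : `|grid_value c (n, Num.truncn (u * 2 ^+ n)) i k - grid_value c (n, Num.truncn (v * 2 ^+ n)) i k| @[n --> \oo] -->
   `|coded_matrix c u i k - coded_matrix c v i k|.
  by apply: cvg_norm; apply: cvgB; exact: coded_output_cvg.
apply: (@closed_cvg _ _ _ eventually_filter _ _ (@closed_le R j.+1%:R^-1)) cvd.
have cvt : `|dyadic n u - dyadic n v| @[n --> \oo] --> `|u - v|.
  by apply: cvg_norm; apply: cvgB; exact: cvg_dyadic.
have : \forall n \near \oo, `|dyadic n u - dyadic n v| < l.+1%:R^-1 by apply: cvgr_lt cvt _ uv.
apply: filterS => n h; apply: H.
- have /andP[_ h'] := dyadic_le n u0; exact: le_trans uN.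
- have /andP[_ h'] := dyadic_le n v0; exact: le_trans vN.
- exact: ltW.
Qed.

Lemma coded_output_continuous c : uniform_code c -> continuous (coded_output c : @time R -> 'M[R]_(m, d)).
Proof.
move=> cu t; have ft := nbhs_filter t; apply: (cvg_matrix (FF := ft)) => i k.
apply/cvgrPdist_le => e e0.
have [j _ /(_ j (leqnn j)) /= je] := near_infty_natSinv_lt (PosNum e0).
pose N := (Num.truncn (set_val t + 1 : R)).+1.
have [l H] := @coded_output_modulus c N j cu.
have tN : set_val t + 1 <= N%:R :> R by apply/ltW; exact: truncnS_gt.
pose r : R := Num.min 1 l.+1%:R^-1.
have r0 : 0 < r by rewrite lt_min ltr01 invr_gt0/=.
have : nbhs t [set u : @time R | `|set_val t - set_val u| < r].
  have cs : (set_val u : R) @[u --> t] --> (set_val t : R) by exact: (@initial_continuous _ _ set_val).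
  by have /cvgrPdist_lt/(_ _ r0) := cs.
apply: filterS => u /= hu; apply: (le_trans _ (ltW je)); apply: H.
- rewrite time_ge0 /= (le_trans _ tN)//; lra.
- rewrite time_ge0 /=; have : set_val u - set_val t <= `|set_val t - set_val u| :> R by rewrite distrC ler_norm.
  have : r <= 1 by rewrite ge_min lexx.
  by move: hu tN; lra.
- by apply: lt_le_trans hu _; rewrite ge_min lexx orbT.
Qed.

Lemma coded_output_grid c N j : uniform_code c -> \forall n \near \oo, forall u : R, 0 <= u <= N%:R ->
  forall i k, `|coded_matrix c u i k - grid_value c (n, Num.truncn (u * 2 ^+ n)) i k| <= j.+1%:R^-1.
Proof.
move=> cu; have [fin unif] := cu; have [l H] := unif N j.
have /cvgrPdist_lt/(_ l.+1%:R^-1) := @cvg_half R.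
have l0 : 0 < l.+1%:R^-1 :> R by rewrite invr_gt0.
move=> /(_ l0); apply: filterS => n hn u /andP[u0 uN] i k.
have cvd : `|grid_value c (n', Num.truncn (u * 2 ^+ n')) i k - grid_value c (n, Num.truncn (u * 2 ^+ n)) i k| @[n' --> \oo] -->
   `|coded_matrix c u i k - grid_value c (n, Num.truncn (u * 2 ^+ n)) i k|.
  by apply: cvg_norm; apply: cvgB; [exact: coded_output_cvg|exact: cvg_cst].
apply: (@closed_cvg _ _ _ eventually_filter _ _ (@closed_le R j.+1%:R^-1)) cvd.
have /andP[_ du] := dyadic_le n u0; have dg := dyadic_gt n u0.
have hn' : `|u - dyadic n u| < l.+1%:R^-1.
  move: hn; rewrite sub0r normrN ger0_norm ?exprn_ge0// => hn.
  by rewrite ger0_norm ?subr_ge0//; apply: le_lt_trans hn; lra.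
have cvt : `|dyadic n' u - dyadic n u| @[n' --> \oo] --> `|u - dyadic n u|.
  by apply: cvg_norm; apply: cvgB; [exact: cvg_dyadic|exact: cvg_cst].
have : \forall n' \near \oo, `|dyadic n' u - dyadic n u| < l.+1%:R^-1 by apply: cvgr_lt cvt _ hn'.
apply: filterS => n' h; apply: H.
- have /andP[_ h'] := dyadic_le n' u0; exact: le_trans uN.
- exact: le_trans uN.
- exact: ltW.
Qed.

End coded_output.


(** * Borel sets of the compact-open topology in terms of codes *)

Section compact_open_borel.
Context {R : realType} {d m : nat}.
Local Notation I := (coordinate (d := d)).
Local Notation pathm := {compact-open, @time R -> 'M[R]_(m, d)}.

(* The paths of which a tube of width 1/(j+1) over [0, j] lies in O. *)
Definition tube_inside (O : set pathm) (j : nat) : set pathm :=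
  [set v : pathm | forall v' : pathm, (forall t : @time R, (set_val t : R) <= j%:R -> forall i k,
     `|(v' t : 'M[R]_(m, d)) i k - (v t : 'M[R]_(m, d)) i k| < j.+1%:R^-1) -> O v'].

(** Otherwise there are paths outside [O] in tubes of vanishing width over growing intervals; they
    converge to [v] uniformly on compact sets, that is in the compact-open topology, and must enter
    [O]. *)
Lemma compact_open_tube (O : set pathm) (v : pathm) : open O ->
  continuous (v : @time R -> 'M[R]_(m, d)) -> O v -> exists j, tube_inside O j v.
Proof.
move=> oO cv Ov; apply: contrapT => nj.
have /choice[w Hw] : forall j : nat, exists v' : pathm, (forall t : @time R, (set_val t : R) <= j%:R -> forall i k,
     `|(v' t : 'M[R]_(m, d)) i k - (v t : 'M[R]_(m, d)) i k| < j.+1%:R^-1) /\ ~ O v'.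
  move=> j; apply: contrapT => nv; apply: nj; exists j => v' h; apply: contrapT => nO.
  by apply: nv; exists v'.
have Fw : Filter ((fun j => w j : @time R -> 'M[R]_(m, d)) @ \oo) by exact: fmap_filter.
have : {compact-open, (fun j => w j : @time R -> 'M[R]_(m, d)) @ \oo --> v}.
  apply: (@compact_open_fam_compactP _ _ (v : @time R -> 'M[R]_(m, d)) _ cv Fw).2.
  apply/fam_cvgP => A cA P /uniform_nbhs[E [entE sub]].
  have [e e0 be] : exists2 e : R, 0 < e & [set xy : 'M[R]_(m, d) * 'M[R]_(m, d) | ball xy.1 e xy.2] `<=` E.
    by move: entE; rewrite -entourage_ballE => -[e e0 be]; exists e.
  have [N HN] : exists N : nat, forall t, A t -> (set_val t : R) <= N%:R.
    have : compact ((set_val : @time R -> R) @` A).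
      by apply: continuous_compact => //; apply: continuous_subspaceT; exact: initial_continuous.
    move=> /compact_bounded[M [_ HM]].
    exists (Num.truncn (M + 1)).+1 => t At.
    apply: (@le_trans _ _ (M + 1)); last by apply/ltW; exact: truncnS_gt.
    apply: le_trans (ler_norm _) _; apply: (HM (M + 1)); first by rewrite ltrDl.
    by exists t.
  have : \forall j \near \oo, P (w j).
    have := near_infty_natSinv_lt (PosNum e0) => h1.
    have h2 : \forall j \near \oo, (N <= j)%N by exists N.
    apply: filterS2 h1 h2 => j /= je Nj; apply: sub => t At; apply: be => /=.
    rewrite -ball_normE /= [ltLHS]mx_normrE; apply: bigmax_lt => // p _.
    rewrite !mxE distrC; apply: lt_trans je; apply: (Hw j).1.
    by rewrite (le_trans (HN t At))// ler_nat.
  by [].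
move=> /(_ O (open_nbhs_nbhs (conj oO Ov))) h.
have : \forall j \near \oo, O (w j) by exact: h.
by move=> /filter_ex[j]; exact: (Hw j).2.
Qed.

(** Values at the grid times up to [j], rounded to multiples of [2^-n]: there are countably many
    outcomes, so any condition on them is measurable in the code. *)
Definition rounding (j n : nat) (c : code I) : {ffun 'I_(j * 2 ^ n).+1 -> 'M[int]_(m, d)} :=
  [ffun q => \matrix_(i, k) Num.floor (grid_value c (n, nat_of_ord q) i k * 2 ^+ n : R)].

Definition step_path (j n : nat) (tau : {ffun 'I_(j * 2 ^ n).+1 -> 'M[int]_(m, d)}) : pathm :=
  fun t : @time R => \matrix_(i, k) ((tau (inord (Num.truncn (set_val t * 2 ^+ n : R))) i k)%:~R / 2 ^+ n).

Lemma floor_eqP (x : R) (z : int) : Num.floor x = z <-> z%:~R <= x < (z + 1)%:~R.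
Proof.
split=> [<-|h]; last exact: floor_def.
by apply: floor_itv; exact: num_real.
Qed.

Lemma measurable_rounding j n tau : measurable [set c : code I | rounding j n c = tau].
Proof.
have -> : [set c : code I | rounding j n c = tau] = \bigcap_(q in [set: 'I_(j * 2 ^ n).+1 * 'I_m * 'I_d])
   [set c : code I | Num.floor (grid_value c (n, nat_of_ord q.1.1) q.1.2 q.2 * 2 ^+ n : R) = tau q.1.1 q.1.2 q.2].
  apply/seteqP; split => c /=.
    by move=> <- [[q i] k] _ /=; rewrite /rounding ffunE mxE.
  move=> h; apply/ffunP => q; rewrite ffunE; apply/matrixP => i k; rewrite mxE.
  exact: (h (q, i, k) Logic.I).
apply: measurable_bigcap_count => -[[q i] k] _ /=; set z := tau q i k.
have mg : measurable_fun setT (fun c : code I => grid_value c (n, nat_of_ord q) i k * 2 ^+ n : R).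
  by apply: measurable_funM; [exact: measurable_grid_value|exact: measurable_cst].
have := mg measurableT _ (measurable_itv `[z%:~R, (z + 1)%:~R[).
rewrite setTI; congr measurable; apply/seteqP; split => c /=.
  by rewrite in_itv /= => /floor_eqP.
by move=> h; rewrite in_itv /=; exact/floor_eqP.
Qed.

(** Half of the error comes from freezing the path between grid times, half from rounding; the index
    [2 * i0 + 1] is used because its successor is twice [i0.+1]. *)
Lemma step_path_close (c : code I) (j i0 : nat) : uniform_code (R := R) (m := m) c -> \forall n \near \oo,
  forall t : @time R, (set_val t : R) <= j%:R -> forall i k,
  `|(step_path (rounding j n c) t : 'M[R]_(m, d)) i k - (coded_output c t : 'M[R]_(m, d)) i k| < i0.+1%:R^-1.
Proof.
move=> cu; have h1 := coded_output_grid j (2 * i0 + 1) cu.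
have e0 : 0 < (2 * i0.+1%:R)^-1 :> R by rewrite invr_gt0 mulr_gt0.
have /cvgrPdist_lt/(_ _ e0) h2 := @cvg_half R.
apply: filterS2 h1 h2 => n h1 h2 t tj i k.
have t0 := time_ge0 t.
have p2 : 0 < 2 ^+ n :> R by rewrite exprn_gt0.
have tr : (Num.truncn (set_val t * 2 ^+ n : R) < (j * 2 ^ n).+1)%N.
  rewrite ltnS truncn_le_nat; apply: (@le_lt_trans _ _ (j * 2 ^ n)%:R); last by rewrite ltr_nat.
  by rewrite natrM natrX ler_pM2r.
have ht : 0 <= (set_val t : R) <= j%:R by rewrite t0 tj.
have := h1 (set_val t) ht i k; rewrite /coded_output /step_path mxE ffunE inordK// !mxE.
set x := grid_value _ _ _ _ => hx.
have /andP[f1 f2] := (floor_eqP (x * 2 ^+ n) _).1 erefl.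
set f := (Num.floor _)%:~R in f1 *.
have f3 : x * 2 ^+ n < f + 1 by move: f2; rewrite intrD.
have fx : `|f / 2 ^+ n - x| <= 2^-1 ^+ n.
  have -> : f / 2 ^+ n - x = (f - x * 2 ^+ n) / 2 ^+ n by field; rewrite gt_eqF.
  rewrite normrM (gtr0_norm (_ : 0 < (2 ^+ n)^-1)) ?invr_gt0// exprVn.
  apply: ler_piMl; first by rewrite invr_ge0 ltW.
  by rewrite ler_norml; lra.
move: h2; rewrite sub0r normrN ger0_norm ?exprn_ge0// => h2.
have e1 : (2 * i0 + 1).+1%:R^-1 = (2 * i0.+1%:R)^-1 :> R by rewrite -natrM; congr (_%:R^-1); rewrite mulnS addn1 add2n.
rewrite e1 in hx.
have e2 : i0.+1%:R^-1 = (2 * i0.+1%:R)^-1 + (2 * i0.+1%:R)^-1 :> R.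
  by rewrite invfM; set y := i0.+1%:R^-1; lra.
rewrite e2; move: hx; set y := decoded _ _ _ => hx.
have -> : f / 2 ^+ n - y = (f / 2 ^+ n - x) - (y - x) by rewrite opprB addrA subrK.
rewrite (le_lt_trans (ler_normB _ _))// ltr_leD//.
exact: le_lt_trans h2.
Qed.

(** Membership of the path in an arbitrary open set, tested on its roundings: [tube_inside O j]
    enters only through countably many step paths. *)
Definition open_code (O : set pathm) : set (code I) :=
  [set c | exists j N, forall n, (N <= n)%N -> tube_inside O j (step_path (rounding j n c))].

Lemma measurable_open_code O : measurable (open_code O).
Proof.
have -> : open_code O = \bigcup_j \bigcup_N \bigcap_(n in [set n | (N <= n)%N])
   \bigcup_(tau in [set tau | tube_inside O j (step_path (j := j) (n := n) tau)]) [set c : code I | rounding j n c = tau].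
  apply/seteqP; split => c /=.
    by move=> [j [N H]]; exists j => //; exists N => // n Nn; exists (rounding j n c) => //; exact: H.
  by move=> [j _ [N _ H]]; exists j, N => n Nn; have [tau h e] := H n Nn; rewrite e.
apply: bigcupT_measurable => j; apply: bigcupT_measurable => N; apply: measurable_bigcap_count => n _.
rewrite bigcup_mkcond; apply: countable_bigcupT_measurable => // tau.
by case: ifP => // _; exact: measurable_rounding.
Qed.

Lemma open_codeP (O : set pathm) c : open O -> uniform_code (R := R) (m := m) c ->
  open_code O c <-> O (coded_output c).
Proof.
move=> oO cu; split.
  move=> [j [N H]]; have close := step_path_close j j cu.
  have hN : \forall n \near \oo, (N <= n)%N by exists N.
  have [n [h1 h2]] := filter_ex (filterI close hN).
  by apply: (H n h2) => t tj i k; rewrite distrC; exact: h1.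
move=> Oc; have [j0 Hj0] := compact_open_tube oO (coded_output_continuous cu) Oc.
(* Half the width of the given tube, so that a tube about the step path fits into the one about the
   path. *)
pose j := (2 * j0 + 1)%N; have := step_path_close j j cu.
move=> [N _ HN]; exists j, N => n Nn v' hv'; apply: Hj0 => t tj i k.
have tj' : (set_val t : R) <= j%:R by rewrite (le_trans tj)// ler_nat /j mul2n -addnn -addnA leq_addr.
have := HN n Nn t tj' i k; have := hv' t tj' i k => h1 h2.
have e1 : j.+1%:R^-1 = (2 * j0.+1%:R)^-1 :> R by rewrite -natrM; congr (_%:R^-1); rewrite /j mulnS addn1 add2n.
have e2 : j0.+1%:R^-1 = (2 * j0.+1%:R)^-1 + (2 * j0.+1%:R)^-1 :> R.
  by rewrite invfM; set y := j0.+1%:R^-1; lra.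
rewrite e1 in h1 h2; rewrite e2; set z := (step_path _ t : 'M[R]_(m, d)) i k in h1 h2.
have -> : (v' t : 'M[R]_(m, d)) i k - (coded_output c t : 'M[R]_(m, d)) i k = ((v' t : 'M[R]_(m, d)) i k - z) + (z - (coded_output c t : 'M[R]_(m, d)) i k) by rewrite addrA subrK.
by rewrite (le_lt_trans (ler_normD _ _))// ltrD.
Qed.

End compact_open_borel.


(** * The strong functional *)

Section functional.
Context {R : realType} {d m : nat} {dO : measure_display} {Omega : measurableType dO}.
Variables (Q : probability Omega R) (X B : R -> Omega -> seqE R d) (o : 'rV[R]_d).
Local Notation I := (coordinate (d := d)).
Local Notation pathm := {compact-open, @time R -> 'M[R]_(m, d)}.
Local Notation paths := {compact-open, @time R -> seqE R d}.
Local Notation input := (input X B m o).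
Local Notation W0W := (@W0W R d m).
Local Notation past_W0W := (@past_W0W R d m).
Local Notation Wm := (@Wm R d m).
Hypothesis X_cont : continuous_process X.
Hypothesis B_cont : continuous_process B.
Hypothesis mB : forall (u : R) j k, 0 <= u -> measurable_fun setT (fun w => B u w j 0 k).
Variable C : (nat * nat) * 'I_m * 'I_d * rat -> set (pathm * paths).
Hypothesis C_obs : forall e, observable o X B (dyad_time e.1.1.1) (C e).
Hypothesis C_ae : {ae Q, forall w, forall e : (nat * nat) * 'I_m * 'I_d * rat,
  C e (input w) <-> ratr e.2 < X (dyad e.1.1.1) w e.1.1.2 0 e.1.2}.

(** The bits of the first [m] particles as the sets [C] read them off the input; all other bits are
    filled with false. *)
Definition output_code (z : pathm * paths) : code I :=
  fun ev : event (I := I) => let: (n, k, (y, j, l), r) := ev in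
    if y then (if insub j is Some i then `[< C ((n, k), i, l, r) z >] else false) else false.

(** Decodes to the same path up to time [t], while all its bits are events of the past of [t]. *)
Definition stopped_code (t : R) (z : pathm * paths) : code I :=
  fun ev : event (I := I) => (dyad ev.1.1 <= t) && output_code z ev.

Definition strong_map (z : pathm * paths) : pathm :=
  if `[< uniform_code (R := R) (m := m) (output_code z) >] then coded_output (output_code z) else (fun=> 0).

Lemma strong_map_continuous z : Wm (strong_map z).
Proof.
rewrite /Wm /= /strong_map; case: asboolP => h; first exact: coded_output_continuous.
suff hc : continuous (fun _ : @time R => (0 : 'M[R]_(m, d))) by exact: hc.
exact: cst_continuous.
Qed.

(** Inputs that receive the default path. The condition involves the whole input; it is absorbed by
    the completion, which admits null sets of the full Borel field. *)
Definition exceptional : set (pathm * paths) := W0W `&` [set z | ~ uniform_code (R := R) (m := m) (output_code z)].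

Lemma C_sub e : C e `<=` W0W.
Proof.
have [pC _ _] := C_obs e.
suff h : past_W0W (dyad_time e.1.1.1) `<=` [set A | A `<=` W0W] by exact: h.
apply: smallest_sub.
  by split => //; [move=> A _ z []|move=> A HA z [n _ /HA]].
by move=> _ [u [U [_ _ ->]]] z [].
Qed.

Lemma output_bit_in (G : set (set (pathm * paths))) ev : sigma_algebra W0W G ->
  (forall e, e.1.1.1 = ev.1.1 -> G (C e)) -> G (W0W `&` [set z | output_code z ev]).
Proof.
case: ev => -[[n k] [[y j] l]] r /= [g1 g2 g3] GC.
have Gf : G (W0W `&` [set z | false]).
  by rewrite (_ : _ `&` _ = set0)//; apply/seteqP; split => z //= [].
case: y => //; case: insubP => [i _ _|_] //.
rewrite (_ : _ `&` _ = C ((n, k), i, l, r)); first exact: GC.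
by apply/seteqP; split => z; [case=> _ /asboolP|move=> h; split; [exact: C_sub h|exact/asboolP]].
Qed.

Lemma output_event_in (G : set (set (pathm * paths))) (E : set (code I)) : sigma_algebra W0W G ->
  (forall e, G (C e)) -> measurable E -> G (W0W `&` [set z | E (output_code z)]).
Proof.
move=> sG GC mE; apply: (code_sigma_preimage sG _ mE) => ev; exact: output_bit_in.
Qed.

Lemma stopped_event_in (t : @time R) (E : set (code I)) : measurable E ->
  past_W0W t (W0W `&` [set z | E (stopped_code (set_val t) z)]).
Proof.
have sG : sigma_algebra W0W (past_W0W t) by exact: smallest_sigma_algebra.
move=> mE; apply: (code_sigma_preimage sG _ mE) => ev; have [g1 g2 g3] := sG.
rewrite /stopped_code; case: (boolP (dyad ev.1.1 <= set_val t)) => h /=; last first.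
  by rewrite (_ : _ `&` _ = set0)//; apply/seteqP; split => z //= [].
apply: output_bit_in => // e ee; have [pC _ _] := C_obs e.
suff hs : past_W0W (dyad_time e.1.1.1) `<=` past_W0W t by exact: hs.
apply: smallest_sub => // A [u [U [h1 h2 ->]]]; apply: sub_gen_smallest; exists u, U; split => //.
by apply: le_trans h1 _; rewrite ee.
Qed.

Lemma exceptional_borel : borel_on W0W exceptional.
Proof.
apply: (@output_event_in _ (~` uniform_code (R := R) (m := m))).
- exact: smallest_sigma_algebra.
- by move=> e; case: (C_obs e).
- by apply: measurableC; exact: measurable_uniform_code.
Qed.

(** Almost surely all bits are those of [X], whose paths are uniformly continuous on bounded
    intervals. *)
Lemma output_code_path : {ae Q, forall w, uniform_code (R := R) (m := m) (output_code (input w)) /\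
  forall u : R, 0 <= u -> coded_matrix (output_code (input w)) u = firstm m (X u w)}.
Proof.
apply: filterS C_ae => w Cw.
have dec e (i : 'I_m) k : decode (output_code (input w)) e.1 e.2 (true, i : nat, k) = (X (dyad e) w i 0 k)%:E.
  have <- := @decode_encode _ _ _ (values X B) w e.1 e.2 (true, i : nat, k).
  congr (esups _ _); apply/funext => j; case: unpickle => // r.
  rewrite /output_code valK /encode /=.
  have := Cw ((e.1, e.2), i, k, r); rewrite /= -/(dyad e) => h.
  have -> : `[< C ((e.1, e.2), i, k, r) (input w) >] = (ratr r < X (dyad e) w i 0 k) by apply/asboolP/idP => /h.
  by [].
have gv e (i : 'I_m) k : grid_value (output_code (input w)) e i k = X (dyad e) w i 0 k by rewrite /grid_value dec.
split.
  split; first by move=> e i k; rewrite dec.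
  move=> N j.
  have /choice[dl Hdl] : forall ik : 'I_m * 'I_d, exists delta : R, 0 < delta /\
     forall u v, 0 <= u <= N%:R -> 0 <= v <= N%:R -> `|u - v| <= delta ->
      `|X u w ik.1 0 ik.2 - X v w ik.1 0 ik.2| <= j.+1%:R^-1.
    move=> [i k]; have cX := @path_within R dO Omega (seqE R d) X w (fun x : seqE R d => x i 0 k) N%:R X_cont (@continuous_coord R d i k).
    have j0 : 0 < j.+1%:R^-1 :> R by rewrite invr_gt0.
    by have [delta d0 H] := uniform_modulus cX j0; exists delta.
  have : \forall l \near \oo, forall ik : 'I_m * 'I_d, l.+1%:R^-1 < dl ik.
    by apply: filter_forall => ik; have := near_infty_natSinv_lt (PosNum (Hdl ik).1).
  move=> /filter_ex[l Hl]; exists l => e e' eN eN' ee i k.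
  rewrite !gv; apply: (Hdl (i, k)).2; first by rewrite dyad_ge0.
    by rewrite dyad_ge0.
  by rewrite (le_trans ee)// ltW//; exact: (Hl (i, k)).
move=> u u0; apply/matrixP => i k; rewrite !mxE.
transitivity (decoded (path_code X B w) u (true, i : nat, k)); last exact: (decoded_path_code X_cont B_cont w (true, i : nat, k) u0).
apply: (@decoded_eq _ _ _ _ _ u); first by rewrite u0 lexx.
move=> n k' _; rewrite (dec (n, k') i k) /path_code.
by rewrite decode_encode.
Qed.

Lemma exceptional_null : input_law Q X B o exceptional = 0%E.
Proof.
rewrite /input_law; apply/negligibleP.
  have sG : sigma_algebra W0W [set A | A `<=` W0W /\ measurable (input @^-1` A)].
    split.
    - by split => //; rewrite preimage_set0.
    - move=> A [AW mA]; split; first by move=> z [].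
      rewrite (_ : _ @^-1` _ = (input @^-1` W0W) `\` (input @^-1` A))//.
      by apply: measurableD => //; exact: measurable_input_W0W.
    - move=> A HA; split; first by move=> z [n _ /(HA n).1].
      by rewrite preimage_bigcup; apply: bigcupT_measurable => n; case: (HA n).
  have [] := @output_event_in _ (~` uniform_code (R := R) (m := m)) sG.
  - by move=> e; split; [exact: C_sub|case: (C_obs e)].
  - by apply: measurableC; exact: measurable_uniform_code.
  - by [].
have [N [mN N0 sub]] := output_code_path; exists N; split => // w [_ /= nu].
by apply: sub => -[].
Qed.

(** Agreement with a set of [G] off [exceptional] is stable under complements and countable unions,
    so generators suffice. *)
Lemma completed_strong_map (G : set (set (pathm * paths))) (GW : set (set pathm)) : sigma_algebra W0W G ->
  (forall U, GW U -> exists2 V, G V & forall z, W0W z -> uniform_code (R := R) (m := m) (output_code z) ->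
     V z <-> U (strong_map z)) ->
  forall U, <<s Wm, GW >> U -> completed Q X B o G (W0W `&` strong_map @^-1` U).
Proof.
move=> sG HG; have [g1 g2 g3] := sG.
suff H : <<s Wm, GW >> `<=` [set U | exists2 V, G V & forall z, W0W z -> uniform_code (R := R) (m := m) (output_code z) ->
     V z <-> U (strong_map z)].
  move=> U /H[V GV HV]; split; first by move=> z [].
  exists (W0W `&` V), exceptional; split.
  - have -> : W0W `&` V = W0W `\` (W0W `\` V) by rewrite setDD.
    exact: (g2 _ (g2 _ GV)).
  - exact: exceptional_borel.
  - exact: exceptional_null.
  - move=> z [] [h1 h2].
      case: h1 => Wz Uz; split => // cu; apply: h2; split => //.
      exact/HV.
    case: h1 => Wz Vz; split => // cu; apply: h2; split => //.
    exact/(HV z Wz cu).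
apply: smallest_sub => //; split.
- by exists set0.
- move=> U [V GV HV]; exists (W0W `\` V); first exact: g2.
  move=> z Wz cu; split.
    by move=> [_ nV]; split; [exact: strong_map_continuous|move=> /(HV z Wz cu)].
  by move=> [_ nU]; split => // /(HV z Wz cu).
- move=> U /(_ _)/cid2-/all_sig2[V GV HV]; exists (\bigcup_n V n); first exact: g3.
  by move=> z Wz cu; split => -[n _ h]; exists n => //; exact/(HV n z Wz cu).
Qed.

Lemma strong_map_functional : strong_functional Q X B o strong_map.
Proof.
split.
- by move=> z _; exact: strong_map_continuous.
- apply: completed_strong_map; first exact: smallest_sigma_algebra.
  move=> _ [U0 oU <-]; exists (W0W `&` [set z | open_code U0 (output_code z)]).
    apply: output_event_in; first exact: smallest_sigma_algebra.
      by move=> e; case: (C_obs e).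
    exact: measurable_open_code.
  move=> z Wz cu; have E : strong_map z = coded_output (output_code z) by rewrite /strong_map asboolT.
  rewrite E; split; first by move=> [_ /(open_codeP oU cu) h]; split => //; rewrite -E; exact: strong_map_continuous.
  by move=> [_ h]; split => //; exact/open_codeP.
- move=> t; apply: completed_strong_map; first exact: smallest_sigma_algebra.
  move=> _ [u [U [ut mU ->]]].
  exists (W0W `&` [set z | [set c : code I | U (coded_matrix c (set_val u))] (stopped_code (set_val t) z)]).
    apply: stopped_event_in; rewrite -[X in measurable X]setTI.
    have mM : measurable_fun [set: code I] (fun c : code I => coded_matrix c (set_val u) : borel 'M[R]_(m, d)).
      apply: measurable_fun_borel_matrix => i k.
      have := measurableT_comp (measurable_coord (R := R) i k) (measurable_coded_at true (set_val u : R)).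
      by apply: eq_measurable_fun => c _ /=; rewrite coded_entry mxE.
    exact: mM.
  move=> z Wz cu; have E : strong_map z = coded_output (output_code z) by rewrite /strong_map asboolT.
  have E2 : coded_matrix (stopped_code (set_val t) z) (set_val u) = coded_matrix (output_code z) (set_val u) :> 'M[R]_(m, d).
    apply/matrixP => i k; rewrite !mxE; apply: (@decoded_eq _ _ _ _ _ (set_val t)); first by rewrite time_ge0.
    by apply: decode_agree => n l r nt; rewrite /stopped_code /= nt.
  rewrite /= E2 E; split; first by move=> [_ h]; split => //; rewrite -E; exact: strong_map_continuous.
  by move=> [_ h].
Qed.

Lemma strong_map_represents : represents Q X B o strong_map (fun t w => firstm m (X t w)).
Proof.
apply: filterS output_code_path => w [cu Hw]; rewrite /strong_map asboolT//.
by apply/funext => t; rewrite /path_of /coded_output Hw// time_ge0.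
Qed.

End functional.


(** * Exit times, dyadic equalities and single Brownian coordinates *)

Lemma ae_all {R : realType} {dT} {T : measurableType dT} (Q : probability T R) {J : countType} (L : J -> T -> Prop) :
  (forall i, {ae Q, forall w, L i w}) -> {ae Q, forall w, forall i, L i w}.
Proof.
move=> H; have HN n : Q.-negligible (if @unpickle J n is Some i then ~` [set w | L i w] else set0).
  by case: unpickle => [i|]; [exact: H|exact: negligible_set0].
apply: negligibleS (negligible_bigcup HN) => w /= /existsNP[i nL].
by exists (pickle i) => //; rewrite pickleK.
Qed.

(** A divergent sequence has limit 0 by convention, which the hypothesis [0 <= T] covers. *)
Lemma limn_le {R : realType} (u : nat -> \bar R) (T : \bar R) : (0 <= T)%E ->
  (forall n, (0 < n)%N -> (u n <= T)%E) -> (limn u <= T)%E.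
Proof.
move=> T0 H; have [cv|/dvgP ->//] := pselect (cvgn u).
by apply: lime_le => //; exists 1%N.
Qed.

(** If every exit time were at most [T], so would be each iterated limit. Time 0 is left out because
    exit times look at positive times only. *)
Lemma lim_exit_timeP {R : realType} {d m : nat} (S : set 'rV[R]_d) a (w : R -> 'M[R]_(m, d) * cfg R d) (T : R) :
  0 <= T -> lim_exit_time S a w = +oo%E ->
  exists p q r, [/\ (0 < p)%N, (0 < q)%N, (0 < r)%N & forall u, 0 < u <= T -> Hopen S a p q r (w u)].
Proof.
move=> T0 lim; apply: contrapT => nH.
suff : (lim_exit_time S a w <= T%:E)%E by rewrite lim.
apply: limn_le => [|r r0]; first by rewrite lee_fin.
apply: limn_le => [|q q0]; first by rewrite lee_fin.
apply: limn_le => [|p p0]; first by rewrite lee_fin.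
rewrite leNgt; apply/negP => lt; apply: nH; exists p, q, r; split => // u /andP[u0 uT].
apply: contrapT => nu; have : (exit_time S a p q r w <= u%:E)%E.
  by apply: ereal_inf_lbound; exists u.
by rewrite leNgt (le_lt_trans _ lt)// lee_fin.
Qed.

Lemma eq_on_dyadics {R : realType} (f g : R -> R) (t : R) :
  {within `[0, t], continuous f} -> {within `[0, t], continuous g} ->
  (forall e, dyad e <= t -> f (dyad e) = g (dyad e)) -> forall u, 0 <= u <= t -> f u = g u.
Proof.
move=> cf cg fg u /andP[u0 ut].
have du n : dyadic n u <= t by have /andP[_ h] := dyadic_le n u0; exact: le_trans ut.
have Au : `[0, t]%classic u by rewrite /= in_itv /= u0.
have Ad n : `[0, t]%classic (dyadic n u).
  by rewrite /= in_itv /= du andbT; have /andP[] := dyadic_le n u0.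
have l1 := within_continuous_cvg cf Au Ad (cvg_dyadic u0).
have l2 := within_continuous_cvg cg Au Ad (cvg_dyadic u0).
have E : (fun n => f (dyadic n u)) = (fun n => g (dyadic n u)).
  by apply/funext => n; exact: (fg (n, Num.truncn (u * 2 ^+ n)) (du n)).
by rewrite E in l1; exact: (cvg_unique _ l1 l2).
Qed.

Section adapted_processes.
Context {R : realType} {d : nat} {dO : measure_display} {Omega : measurableType dO}.
Variables (P : probability Omega R) (F : R -> set (set Omega)).
Hypothesis FF : is_filtration F.

Lemma adapted_wrt (Z : R -> Omega -> seqE R d) t i k : adapted F Z -> 0 <= t -> measurable_wrt (F t) (fun w => Z t w i 0 k).
Proof.
move=> aZ t0; apply/(measurable_wrtP _ (FF.1 t t0).1) => D mD.
have := @measurable_seq_coord R d i k measurableT D mD; rewrite setTI => mU.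
exact: (aZ t t0 _ mU).
Qed.

Lemma adapted_measurable (Z : R -> Omega -> seqE R d) t i k : adapted F Z -> 0 <= t ->
  measurable_fun setT (fun w => Z t w i 0 k).
Proof. by move=> aZ t0; apply: measurable_wrtW (adapted_wrt i k aZ t0); exact: (FF.1 t t0).2. Qed.

Variables (B : R -> Omega -> seqE R d).
Hypothesis BB : brownian P F B.

Lemma brownian_coord (s t : R) (i : nat) (k : 'I_d) A D : 0 <= s -> s < t -> F s A -> measurable D ->
  P (A `&` (fun w => B t w i 0 k - B s w i 0 k) @^-1` D) = (P A * normal_prob 0 (Num.sqrt (t - s)) D)%E.
Proof.
move=> s0 st FA mD; have [_ _ _ H] := BB.
(* One coordinate of particle [i] is constrained to [D], all others to the whole line, of normal
   probability 1. *)
pose C (i' : 'I_i.+1) (k' : 'I_d) : set R := if (i' == ord_max) && (k' == k) then D else setT.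
have mC i' k' : measurable (C i' k') by rewrite /C; case: ifP.
have := H s t s0 st A FA i.+1 C mC.
have n1 : normal_prob 0 (Num.sqrt (t - s)) (setT : set R) = 1%E by exact: probability_setT.
rewrite (bigD1 ord_max)//= [X in (_ * (_ * X))%E]big1 ?mule1; last first.
  by move=> i' /negPf ni; rewrite big1// => k' _; rewrite /C ni.
rewrite (bigD1 k)//= [X in (_ * (_ * X))%E]big1 ?mule1; last first.
  by move=> k' /negPf nk; rewrite /C nk andbF.
rewrite {2}/C !eqxx /= => <-; congr (P (_ `&` _)).
apply/seteqP; split => w /=.
  move=> h i' k'; rewrite /C; case: eqP => //= ->; case: eqP => //= ->.
  by move: h; rewrite !mxE.
move=> /(_ ord_max k); rewrite /C !eqxx /= !mxE.
by [].
Qed.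

End adapted_processes.

(** * Equations with constant diffusion coefficient *)

Section constant_coefficient.
Context {R : realType} {d : nat} {dO : measure_display} {Omega : measurableType dO}.
Variables (Q : probability Omega R) (B : R -> Omega -> seqE R d) (i : nat).
Hypothesis B_cont : continuous_process B.
Hypothesis mB : forall (v : R) k, 0 <= v -> measurable_fun setT (fun w => B v w i 0 k).
Let W (t : R) (w : Omega) := B t w i.
Hypothesis B_indep : forall e e' k L q, dyad e < dyad e' :> R ->
    Q (past_cyl W L (dyad e) `&` (fun w => W (dyad e') w 0 k - W (dyad e) w 0 k) @^-1` `]ratr q, +oo[) =
    (Q (past_cyl W L (dyad e)) * normal_prob 0 (Num.sqrt (dyad e' - dyad e)) `]ratr q, +oo[%classic)%E.

Let W_cont : forall w (v : nat -> R) (u : R) k, 0 <= u -> (forall n, 0 <= v n) ->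
  v n @[n --> \oo] --> u -> W (v n) w 0 k @[n --> \oo] --> W u w 0 k.
Proof. by move=> w v u k u0 v0 vu; exact: X_coord_cvg. Qed.

(** [ito_constant] gives one null set for each time, hence an almost sure identity at all dyadic
    times at once. *)
Lemma ito_equation_constant (Z : R -> Omega -> 'rV[R]_d) (H : R -> Omega -> 'M[R]_d) (K : R -> Omega -> 'rV[R]_d) (c : 'M[R]_d) :
  {ae Q, forall w, forall t : R, 0 <= t -> H t w = c} ->
  ito_equation Q Z (fun t w => B t w i) H K ->
  {ae Q, forall w, forall e, Z (dyad e) w - Z 0 w = (B (dyad e) w i - B 0 w i) *m c^T +
     \row_k (\int[lebesgue_measure]_(u in `[0, dyad e]) K u w 0 k)%R}.
Proof.
move=> [N [mN N0 sub]] [_ [J [itoJ eqJ]]].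
have HN w t : ~ N w -> 0 <= t -> H t w = c.
  by move=> nN t0; apply: contrapT => nH; apply: nN; apply: sub => /= h; apply: nH; exact: h.
have G0M t : 0 <= t -> sigma_algebra setT (past W t) /\ past W t `<=` measurable.
  by move=> t0; split; [exact: past_sigma|apply: past_measurable => // v k; exact: mB].
have := @ito_constant R d dO Omega Q W (past W) G0M (past_mono W_cont)
  (fun t t0 k => past_W W_cont t0 k) (past_indep mB B_indep) W_cont H c N mN N0 HN J itoJ => key.
have : {ae Q, forall w, forall e, J (dyad e) w = (B (dyad e) w i - B 0 w i) *m c^T}.
  by apply: ae_all => e; exact: (key (dyad e) (dyad_ge0 e)).
by apply: filterS2 eqJ => w h1 h2 e; rewrite (h1 (dyad e) (dyad_ge0 e)) h2.
Qed.

(** The simple process equal to [c] on []0, n]] approximates [H]: for [n >= T] it differs from [H]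
    on [[0, T]], off a null set of outcomes, at time 0 at most. *)
Lemma ito_integral_constant (H : R -> Omega -> 'M[R]_d) (c : 'M[R]_d) :
  {ae Q, forall w, forall t : R, 0 <= t -> H t w = c} ->
  ito_integral Q (fun t w => B t w i) H (fun t w => (B t w i - B 0 w i) *m c^T).
Proof.
move=> [N [mN N0 sub]].
have HN w t : ~ N w -> 0 <= t -> H t w = c.
  by move=> nN t0; apply: contrapT => nH; apply: nN; apply: sub => /= h; apply: nH; exact: h.
have ext0 A : A `<=` N -> mu_ext Q A = 0%E.
  move=> AN; apply/eqP; rewrite eq_le; apply/andP; split; last exact: mu_ext_ge0.
  apply: le_trans (le_mu_ext Q AN) _.
  by rewrite measurable_mu_extE// [X in (X <= _)%E]N0.
have cvg0 (Z : nat -> Omega -> \bar R) (n0 : nat) :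
  (forall n w, (n0 <= n)%N -> ~ N w -> Z n w = 0%E) -> cvg0_in_prob Q Z.
  move=> HZ e e0; apply: cvg_near_cst; exists n0 => // n /= n0n; apply: ext0 => w /= h.
  by apply: contrapT => nN; move: h; rewrite HZ// lee_fin leNgt e0.
have enorm0 a b : enorm (0 : 'M[R]_(a, b)) = 0.
  by rewrite enorm_pair big1 ?sqrtr0// => q _; rewrite mxE expr0n.
exists (fun n => SimpleProcess 1 (fun j => if j is 0 then 0 else n%:R) (fun _ _ => c)); split.
  move=> n; split => //=.
  - by move=> [].
  - by move=> j _; exists (enorm c).
  - move=> j _ U mU; have [s1 s2 _] := @smallest_sigma_algebra _ setT [set A | exists2 s, 0 <= s <= (if j is 0 then 0 else n%:R) &
         (exists2 U : set (borel 'M[R]_d), measurable U & A = H s @^-1` U) \/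
         (exists2 U : set (borel 'rV[R]_d), measurable U & A = (fun w => B s w i) @^-1` U)].
    case: (pselect (U c)) => Uc.
      rewrite (_ : _ @^-1` _ = setT `\` set0); first exact: (s2 _ s1).
      by rewrite setD0; apply/seteqP; split.
    by rewrite (_ : _ @^-1` _ = set0)//; apply/seteqP; split.
move=> T T0; have Tn n : ((Num.truncn T).+1 <= n)%N -> T <= n%:R.
  by move=> h; apply/ltW/(lt_le_trans (truncnS_gt T)); rewrite ler_nat.
split; apply: (cvg0 _ (Num.truncn T).+1) => n w /Tn Tn' nN.
  transitivity (\int[lebesgue_measure]_(t in `[0%R, T]) (if (t : R) == 0%R then ((enorm c ^+ 2)%R)%:E else 0%E))%E.
    apply: eq_integral => t; rewrite inE /= in_itv /= => /andP[t0 tT]; rewrite HN// /sp_eval big_mkcond big_ord1 /=.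
    have tn : t <= n%:R by exact: le_trans Tn'.
    rewrite tn andbT; case: eqVneq => [->|tn0].
      by rewrite ltxx sub0r enormN.
    by rewrite lt_def tn0 t0 subrr enorm0 expr0n.
  transitivity (\int[lebesgue_measure]_(t in [set (0%R : R)]) ((enorm c ^+ 2)%R)%:E)%E; last first.
    exact: integral_set1.
  rewrite [RHS]integral_mkcond [LHS]integral_mkcond; apply: eq_integral => t _.
  rewrite /patch; case: (boolP (t \in [set 0])) => [/set_mem /= ->|/negP nt].
    by rewrite mem_set ?eqxx//= in_itv /= lexx T0.
  case: ifP => // _; case: eqP => // t0; exfalso; apply: nt; by rewrite t0 inE.
apply/eqP; rewrite eq_le; apply/andP; split.
  apply: ge_ereal_sup => x [t ti <-]; move: ti; rewrite /= in_itv /= => /andP[t0 tT].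
  rewrite /sp_int big_ord1 /= (min_idPl (le_trans tT Tn')) (min_idPr t0) subrr.
  by rewrite enorm0.
apply: ereal_sup_ubound; exists 0; first by rewrite /= in_itv /= lexx T0.
rewrite /sp_int big_ord1 /= (min_idPl (_ : 0 <= n%:R))// minxx !subrr.
by rewrite enorm0.
Qed.

End constant_coefficient.


(** * Deterministic properties of the paths of the solution *)

Lemma row_shift {R : realType} {d : nat} (x s y : 'rV[R]_d) (f : 'I_d -> R) k :
  x - s = y + \row_k f k -> x 0 k = s 0 k + (y 0 k + f k).
Proof. by move/(canRL (subrK _)) => ->; rewrite !mxE addrC. Qed.

Lemma row_unshift {R : realType} {d : nat} (x s y : 'rV[R]_d) (f : 'I_d -> R) :
  (forall k, x 0 k = s 0 k + (y 0 k + f k)) -> x - s = y + \row_k f k.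
Proof. by move=> H; apply/rowP => k; rewrite !mxE H addrAC subrr add0r. Qed.

Section good_paths.
Context {R : realType} {d : nat} {dO : measure_display} {Omega : measurableType dO}.
Local Notation mu := (@lebesgue_measure R).
Variable S : set 'rV[R]_d.
Hypothesis clS : closed S.
Variables (a : nat -> nat -> nat) (m : nat) (Ssde : set (cfg R d)).
Variables (b : 'rV[R]_d -> cfg R d -> 'rV[R]_d) (Ft : nat -> nat -> nat -> nat -> 'M[R]_(m, d) -> cfg R d -> R).
Hypothesis mSsde : measurable (Ssde : set (cfgM S)).
Hypothesis Ssde_sub : Ssde `<=` config_infinite S.
Hypothesis mb : borel_coef S Ssde b.
Hypothesis hallS : forall xs : 'M[R]_(m, d) * cfg R d, Hall S a xs -> Ssde (cfg_add (unlabelm xs.1) xs.2).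
Hypothesis mFt : forall p q r T, (0 < p)%N -> (0 < q)%N -> (0 < r)%N -> (0 < T)%N -> measurable_fun
       [set xs : borel 'M[R]_(m, d) * cfgM S |
          (forall i, S (row i (xs.1 : 'M[R]_(m, d)))) /\ config S xs.2]
       (fun xs => Ft p q r T xs.1 xs.2).
Variables (cc : 'I_m -> 'M[R]_d) (X B : R -> Omega -> seqE R d).
Hypothesis X_cont : continuous_process X.
Hypothesis B_cont : continuous_process B.

Lemma Ssde_good (x : seqE R d) : Ssde (unlabel predT x) -> goodcfg S predT x.
Proof. by move=> /Ssde_sub[/(config_unlabel clS)]. Qed.

Lemma Ssde_extend (x : seqE R d) : Ssde (unlabel predT x) -> extend S Ssde (firstm m x, unlabel (from m) x).
Proof.
move=> Sx; have gx := Ssde_good Sx; split => /=.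
- by move=> i; rewrite row_firstm; case: gx => + _; exact.
- by apply/config_unlabel => //; apply: goodcfg_sub gx.
- by rewrite cfg_add_env.
Qed.

(** The properties of a single path on which the comparison with other solutions rests; they hold
    almost surely under [P], hence under almost every conditional law. *)
Definition good_path (w : Omega) : Prop :=
  [/\ forall t : R, 0 <= t -> Ssde (unlabel predT (X t w)),
      forall (i : 'I_m) e, X (dyad e) w i - X 0 w i = (B (dyad e) w i - B 0 w i) *m (cc i)^T +
        \row_k (\int[mu]_(u in `[0, dyad e]) drift b (X u w) i k)%R,
      forall (i : 'I_m) k (T : R), 0 <= T -> mu.-integrable `[0, T] (fun u => (drift b (X u w) i k)%:E),
      forall T : R, 0 <= T -> exists p q r, [/\ (0 < p)%N, (0 < q)%N, (0 < r)%N &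
        forall u : R, 0 < u <= T -> hop S a m p q r (X u w)] &
      forall p q r T, (0 < p)%N -> (0 < q)%N -> (0 < r)%N -> (0 < T)%N ->
        (\int[mu]_(u in `[0%R, T%:R]) (lip_weight S a (Ft p q r T) p q r (X u w))%:E < +oo)%E].

(** Nothing is known of [X] at negative times; the decoded path is measurable on the whole line. *)
Lemma measurable_path w : exists2 x : R -> seqE R d, measurable_fun [set: R] (fun u : R => x u : seqM R d) &
  forall u, 0 <= u -> x u = X u w.
Proof.
exists (coded true (path_code X B w)); first exact: measurable_coded_time.
by move=> u u0; have [-> _] := coded_path_code X_cont B_cont w u0.
Qed.

(** On the interval, true and tame drift agree except possibly at time 0, about which exit times say
    nothing; a single time does not change the integrals. *)
Lemma good_Gam w (s : seqE R d) : good_path w -> (forall i : nat, B 0 w i = 0) ->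
  (forall i : 'I_m, X 0 w i = s i) ->
  forall e, Gam S a b (fun p q r => Ft p q r (Num.truncn (dyad e : R)).+1) cc s (dyad e) (path_code X B w).
Proof.
move=> [h1 h2 h3 h4 h5] B0 X0 e; set t : R := dyad e.
have t0 : 0 <= t by exact: dyad_ge0.
have xE u : 0 <= u -> coded true (path_code X B w) u = X u w.
  by move=> u0; have [-> _] := coded_path_code X_cont B_cont w u0.
have bE u : 0 <= u -> coded false (path_code X B w) u = B u w.
  by move=> u0; have [_ ->] := coded_path_code X_cont B_cont w u0.
have [p [q [r [p0 q0 r0 Hhop]]]] := h4 t t0.
have mc := measurable_coded_time (R := R) true (path_code X B w).
have mtd (i : 'I_m) k (A : set R) : measurable A -> measurable_fun A (fun u : R => tame_drift S a b i k (coded true (path_code X B w) u)).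
  move=> mA; apply: measurable_funTS.
  exact: (measurableT_comp (measurable_tame_drift clS mSsde mb hallS i k) mc).
have tT : t <= (Num.truncn t).+1%:R by apply/ltW; exact: truncnS_gt.
split.
- move=> e' _ i; rewrite xE ?dyad_ge0//.
  by have [+ _] := Ssde_good (h1 (dyad e') (dyad_ge0 e')); exact.
- move=> i k; have /integrableP[mI fin] := h3 i k t t0.
  apply: le_lt_trans fin; apply: ge0_le_integral => //.
  + by apply/measurable_EFinP; apply: measurableT_comp => //; exact: mtd.
  + exact: measurableT_comp.
  + move=> u /=; rewrite in_itv /= => /andP[u0 _]; rewrite xE// lee_fin /tame_drift.
    by case: ifP => // _; rewrite normr0.
- exists p, q, r; split => //.
    transitivity (\int[mu]_(u in [set (0%R : R)]) ((\1_(~` hop S a m p q r) (coded true (path_code X B w) 0%R))%:E))%E; last exact: integral_set1.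
    rewrite [RHS]integral_mkcond [LHS]integral_mkcond; apply: eq_integral => u _.
    rewrite /patch; case: (boolP (u \in [set 0])) => [/set_mem /= ->|/negP nu].
      by rewrite mem_set//= in_itv /= lexx t0.
    case: ifP => // /set_mem /=; rewrite in_itv /= => /andP[u0 ut].
    rewrite xE// indicE memNset//= => nh; apply: nh; apply: Hhop.
    rewrite ut andbT lt_def u0 andbT; apply/eqP => u00; apply: nu; by rewrite u00 inE.
  have := h5 p.+1 q r.+1 (Num.truncn t).+1 isT q0 isT isT; apply: le_lt_trans.
  have mlw (A : set R) : measurable A -> measurable_fun A (fun u : R => lip_weight S a (Ft p.+1 q r.+1 (Num.truncn t).+1) p.+1 q r.+1 (coded true (path_code X B w) u)).
    move=> mA; apply: measurable_funTS.
    apply: (measurableT_comp (f := lip_weight S a (Ft p.+1 q r.+1 (Num.truncn t).+1) p.+1 q r.+1 : seqM R d -> R)); last exact: measurable_coded_time.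
    by apply: (measurable_lip_weight (Ft := fun p q r => Ft p q r (Num.truncn t).+1) clS a) => // p' q' r' p'0 q'0 r'0; exact: mFt.
  rewrite [leRHS](_ : _ = \int[mu]_(u in `[0%R, (Num.truncn t).+1%:R]) (lip_weight S a (Ft p.+1 q r.+1 (Num.truncn t).+1) p.+1 q r.+1 (coded true (path_code X B w) u))%:E)%E; last first.
    by apply: eq_integral => u; rewrite inE /= in_itv /= => /andP[u0 _]; rewrite xE.
  apply: ge0_subset_integral => //.
  + by apply/measurable_EFinP; exact: mlw.
  + by move=> u _; rewrite lee_fin lip_weight_ge0.
  + by apply: subset_itv; rewrite bnd_simp.
- move=> e' e't i k; have e'0 : 0 <= (dyad e' : R) by exact: dyad_ge0.
  have -> : decode (path_code X B w) e'.1 e'.2 (true, i : nat, k) = (X (dyad e') w i 0 k)%:E.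
    exact: (@decode_encode _ _ _ (values X B) w e'.1 e'.2 (true, i : nat, k)).
  rewrite (bE _ e'0); congr (EFin _).
  have := h2 i e'; rewrite B0 subr0 X0 => /(@row_shift _ _ _ _ _ _ k) E.
  rewrite E addrA; congr (_ + _); rewrite /Rintegral; congr fine.
  have /integrableP[mI _] := h3 i k (dyad e') e'0.
  apply: ae_eq_integral => //.
    by apply/measurable_EFinP; exact: mtd.
  exists [set 0]; split => //; first exact: lebesgue_measure_set1.
  move=> u /= nu; apply: contrapT => nu0; apply: nu; rewrite in_itv /= => /andP[u0 ue].
  rewrite xE// /tame_drift asboolT//; exists p, q, r; split => //; apply: Hhop.
  by rewrite lt_def u0 andbT (le_trans ue e't) andbT; apply/eqP.
Qed.

(** The competitor [y] is completed by the environment of [X] to a full sequence [x'], and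
    [pathwise_unique] compares it with the tame path of [X]. *)
Lemma good_unique w (s : seqE R d) (y : R -> 'M[R]_(m, d)) : good_path w ->
  (forall p q r T : nat, (0 < p)%N -> (0 < q)%N -> (0 < r)%N -> (0 < T)%N ->
    forall (u : R) (x x' : 'M[R]_(m, d)), 0 <= u <= T%:R ->
    Hopen S a p q r (x, unlabel (from m) (X u w)) -> Hopen S a p q r (x', unlabel (from m) (X u w)) ->
    simn S a p q r (unlabel (from m) (X u w)) x x' ->
    fam_norm (fun i => coefm b x (unlabel (from m) (X u w)) i - coefm b x' (unlabel (from m) (X u w)) i)
    <= enorm (x - x') * Ft p q r T x (unlabel (from m) (X u w))) ->
  (forall i : 'I_m, X 0 w i = s i) -> y 0 = firstm m s ->
  (forall i k (T : R), {within `[0, T], continuous (fun u => y u i k)}) ->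
  (forall u : R, 0 <= u -> Ssde (cfg_add (unlabelm (y u)) (unlabel (from m) (X u w)))) ->
  (forall (i : 'I_m) k (T : R), 0 <= T -> mu.-integrable `[0, T] (fun u => (coefm b (y u) (unlabel (from m) (X u w)) i 0 k)%:E)) ->
  (forall (i : 'I_m) e, row i (y (dyad e)) - row i (y 0) = (B (dyad e) w i - B 0 w i) *m (cc i)^T +
        \row_k (\int[mu]_(u in `[0, dyad e]) coefm b (y u) (unlabel (from m) (X u w)) i 0 k)%R) ->
  forall u : R, 0 <= u -> y u = firstm m (X u w).
Proof.
move=> [h1 h2 h3 h4 h5] lip X0 y0 cy Sy Iy eqy t t0.
have [p [q [r [p0 q0 r0 Hhop]]]] := h4 t t0.
pose x' u : seqE R d := fun j => if insub j is Some i then row (i : 'I_m) (y u) else X u w j.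
have x'i u (i : 'I_m) : x' u i = row i (y u) by rewrite /x' valK.
have x'f u : firstm m (x' u) = y u.
  by apply/matrixP => i k; rewrite mxE x'i mxE.
have x'e u : unlabel (from m) (x' u) = unlabel (from m) (X u w).
  by apply: eq_unlabel => // j mj; rewrite /x' insubF// ltnNge [(m <= j)%N]mj.
have x'd u (i : 'I_m) k : coefm b (y u) (unlabel (from m) (X u w)) i 0 k = drift b (x' u) i k.
  by rewrite -x'f -x'e /coefm cfg_add_env_but row_firstm.
pose bw u : seqE R d := fun j => B u w j - B 0 w j.
have cbw T (i : 'I_m) k : {within `[0, T], continuous (fun u => bw u i 0 k)}.
  rewrite (_ : (fun u => _) = (fun u => B u w i 0 k - B 0 w i 0 k)); last by apply/funext => u; rewrite !mxE.
  move=> u; apply: cvgB; last exact: cvg_cst.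
  exact: (@path_within R dO Omega (seqE R d) B w (fun x : seqE R d => x i 0 k) T B_cont (@continuous_coord R d i k)).
have cX T (i : 'I_m) k : {within `[0, T], continuous (fun u => X u w i 0 k)}.
  exact: (@path_within R dO Omega (seqE R d) X w (fun x : seqE R d => x i 0 k) T X_cont (@continuous_coord R d i k)).
have cx' T (i : 'I_m) k : {within `[0, T], continuous (fun u => x' u i 0 k)}.
  by rewrite (_ : (fun u => _) = (fun u => y u i k)); [exact: cy|apply/funext => u; rewrite x'i mxE].
have eqall (z : R -> seqE R d) (i : 'I_m) k : {within `[0, t], continuous (fun u => z u i 0 k)} ->
  mu.-integrable `[0, t] (fun u => (drift b (z u) i k)%:E) ->
  (forall e, z (dyad e) i - s i = (B (dyad e) w i - B 0 w i) *m (cc i)^T + \row_k (\int[mu]_(u in `[0, dyad e]) drift b (z u) i k)%R) ->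
  forall u, 0 <= u <= t -> z u i 0 k = noise cc s bw u i k + \int[mu]_(v in `[0, u]) drift b (z v) i k.
  move=> cz Iz Ez; apply: eq_on_dyadics => //.
    move=> u; apply: cvgD; first exact: noise_continuous.
    exact: (parameterized_integral_continuous t0 Iz).
  by move=> e et; have := Ez e => /(@row_shift _ _ _ _ _ _ k) ->; rewrite addrA.
have Ix (i : 'I_m) k : mu.-integrable `[0, t] (fun u => (drift b (X u w) i k)%:E) by exact: h3.
have Ix' (i : 'I_m) k : mu.-integrable `[0, t] (fun u => (drift b (x' u) i k)%:E).
  by have := Iy i k t t0; rewrite (_ : (fun u => _) = (fun u => (drift b (x' u) i k)%:E))//; apply/funext => u; rewrite x'd.
have Sx' u : 0 <= u -> goodcfg S predT (x' u).
  by move=> u0; apply: Ssde_good; rewrite -(cfg_add_env m) x'f x'e; exact: Sy.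
apply/matrixP => i k; rewrite mxE; have -> : y t i k = x' t i 0 k by rewrite x'i mxE.
suff -> : X t w i = x' t i by [].
pose T := (Num.truncn t).+1.
have tT : t <= T%:R by apply/ltW; exact: truncnS_gt.
apply: (@pathwise_unique _ _ S clS a m b (Ft p.+1 q r.+1 T) p q r t (fun u => X u w) x' (noise cc s bw)
  (fun u i k => drift b (X u w) i k) (fun u i k => drift b (x' u) i k) q0) => //.
- exists [set 0]; split => //; first exact: lebesgue_measure_set1.
  move=> u /= nu; apply: contrapT => nu0; apply: nu => /andP[u0 ut]; apply: Hhop.
  by rewrite ut andbT lt_def u0 andbT; apply/eqP.
- by move=> u j _ mj; rewrite /x' insubF// ltnNge mj.
- move=> u j /andP[u0 _]; split; first by have [+ _] := Ssde_good (h1 u u0); exact.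
  by have [+ _] := Sx' u u0; exact.
- by move=> u z z' /andP[u0 ut]; apply: lip => //; rewrite u0 (le_trans ut).
- have [xm mx xmE] := measurable_path w.
  have mlw : measurable_fun [set: R] (fun u : R => lip_weight S a (Ft p.+1 q r.+1 T) p.+1 q r.+1 (xm u)).
    apply: (measurableT_comp (f := lip_weight S a (Ft p.+1 q r.+1 T) p.+1 q r.+1 : seqM R d -> R)) => //.
    by apply: (measurable_lip_weight (Ft := fun p q r => Ft p q r T) clS a) => // p' q' r' p'0 q'0 r'0; exact: mFt.
  have IT : mu.-integrable `[0, T%:R] (EFin \o (fun u => lip_weight S a (Ft p.+1 q r.+1 T) p.+1 q r.+1 (X u w))).
    apply: (@eq_integrable _ _ _ mu _ _ (EFin \o (fun u => lip_weight S a (Ft p.+1 q r.+1 T) p.+1 q r.+1 (xm u)))) => //.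
      by move=> u; rewrite inE /= in_itv /= => /andP[u0 _]; rewrite xmE.
    apply/integrableP; split; first by apply/measurable_EFinP; exact: measurable_funTS.
    have := h5 p.+1 q r.+1 T isT q0 isT isT; apply: le_lt_trans.
    rewrite (_ : (\int[mu]_(x in _) _)%E = \int[mu]_(u in `[0%R, T%:R]) (lip_weight S a (Ft p.+1 q r.+1 T) p.+1 q r.+1 (X u w))%:E)%E//.
    apply: eq_integral => u; rewrite inE /= in_itv /= => /andP[u0 _].
    by rewrite /= xmE// ger0_norm ?lip_weight_ge0.
  exact: integrable_sub_itv IT (lexx _) tT.
- by move=> j l; split; [exact: Ix|exact: Ix'].
- move=> u j l hu; split; apply: eqall => //.
    by move=> e; rewrite -X0; exact: h2.
  move=> e; rewrite x'i; have := eqy j e; rewrite y0 row_firstm => ->.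
  congr (_ + _); apply/rowP => l'; rewrite !mxE.
  by congr (Rintegral _ _ _); apply/funext => v; rewrite x'd.
- by rewrite t0 lexx.
Qed.

Lemma good_equation w : good_path w -> forall (t : R) (i : 'I_m), 0 <= t ->
  X t w i - X 0 w i = (B t w i - B 0 w i) *m (cc i)^T + \row_k (\int[mu]_(u in `[0, t]) drift b (X u w) i k)%R.
Proof.
move=> [h1 h2 h3 h4 h5] t i t0; apply: row_unshift => k.
pose bw u : seqE R d := fun j => B u w j - B 0 w j.
have cbw (j : 'I_m) l : {within `[0, t], continuous (fun u => bw u j 0 l)}.
  rewrite (_ : (fun u => _) = (fun u => B u w j 0 l - B 0 w j 0 l)); last by apply/funext => u; rewrite !mxE.
  move=> u; apply: cvgB; last exact: cvg_cst.
  exact: (@path_within R dO Omega (seqE R d) B w (fun x : seqE R d => x j 0 l) t B_cont (@continuous_coord R d j l)).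
have cX : {within `[0, t], continuous (fun u => X u w i 0 k)}.
  exact: (@path_within R dO Omega (seqE R d) X w (fun x : seqE R d => x i 0 k) t X_cont (@continuous_coord R d i k)).
have cg : {within `[0, t], continuous (fun u => noise cc (X 0 w) bw u i k + \int[mu]_(v in `[0, u]) drift b (X v w) i k)}.
  move=> u; apply: cvgD; first exact: noise_continuous.
  exact: (parameterized_integral_continuous t0 (h3 i k t t0)).
have Ed e : dyad e <= t -> X (dyad e) w i 0 k = noise cc (X 0 w) bw (dyad e) i k + \int[mu]_(v in `[0, dyad e]) drift b (X v w) i k.
  by move=> et; have := h2 i e => /(@row_shift _ _ _ _ _ _ k) ->; rewrite addrA.
have tt : 0 <= t <= t by rewrite t0 lexx.
have E := eq_on_dyadics cX cg Ed tt.
by rewrite E /noise -addrA.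
Qed.

Lemma glue_path (y : 'M[R]_(m, d)) (x : seqE R d) :
  exists x', firstm m x' = y /\ unlabel (from m) x' = unlabel (from m) x.
Proof.
exists (fun j => if insub j is Some i then row (i : 'I_m) y else x j); split.
  by apply/matrixP => i k; rewrite !mxE valK mxE.
by apply: eq_unlabel => // j mj; rewrite insubF// ltnNge [(m <= j)%N]mj.
Qed.

(** A finite expectation makes the time integral of the power finite almost surely, and
    [z <= 1 + z^gamma] passes to the weight itself. *)
Lemma moment_finite (P : probability Omega R) p q r T (gamma : R) :
  (0 < p)%N -> (0 < q)%N -> (0 < r)%N -> (0 < T)%N -> 1 < gamma ->
  (forall (u : R) j k, 0 <= u -> measurable_fun setT (fun w => X u w j 0 k)) ->
  (forall (u : R) j k, 0 <= u -> measurable_fun setT (fun w => B u w j 0 k)) ->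
  (\int[P]_w \int[mu]_(t in `[0%R, T%:R])
          (\1_(Hopen S a p q r) (firstm m (X t w), env X m t w) *
           `|Ft p q r T (firstm m (X t w)) (env X m t w)| `^ gamma)%R%:E < +oo)%E ->
  {ae P, forall w, (\int[mu]_(u in `[0%R, T%:R]) (lip_weight S a (Ft p q r T) p q r (X u w))%:E < +oo)%E}.
Proof.
move=> p0 q0 r0 T0 g1 mX mB fin.
pose lw := lip_weight S a (Ft p q r T) p q r : seqM R d -> R.
have mlw : measurable_fun [set: seqM R d] lw.
  by apply: (measurable_lip_weight (Ft := fun p q r => Ft p q r T) clS a) => // p' q' r' p'0 q'0 r'0; exact: mFt.
pose f (x : seqE R d) : \bar R := (lw x `^ gamma)%:E.
have mf : measurable_fun [set: seqM R d] f.
  by apply/measurable_EFinP; exact: (measurableT_comp (measurable_powR gamma) mlw).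
have f0 x : (0 <= f x)%E by rewrite lee_fin powR_ge0.
(* The time integral is written through the code in order to be a measurable function of the
   outcome. *)
pose Phi c := (\int[mu]_(u in `[0%R, T%:R]) f (coded true c u))%E.
have mPhi : measurable_fun setT (fun w => Phi (path_code X B w)).
  have mP : measurable_fun [set: Omega] (path_code X B : Omega -> code (coordinate (d := d))).
    by apply: measurable_path_code.
  have mI := @measurable_time_integral R d f T%:R f0 mf.
  exact: (measurableT_comp mI mP).
have E w : Phi (path_code X B w) = (\int[mu]_(t in `[0%R, T%:R])
          (\1_(Hopen S a p q r) (firstm m (X t w), env X m t w) *
           `|Ft p q r T (firstm m (X t w)) (env X m t w)| `^ gamma)%R%:E)%E.
  apply: eq_integral => u; rewrite inE /= in_itv /= => /andP[u0 _].
  have [-> _] := coded_path_code X_cont B_cont w u0.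
  rewrite /f /lw /lip_weight /env; congr EFin; case: asboolP => h.
    by rewrite indicE mem_set// mul1r.
  by rewrite indicE memNset// mul0r powR0// gt_eqF// (lt_trans ltr01).
have Phi0 w : (0 <= Phi (path_code X B w))%E by apply: integral_ge0.
have IP : P.-integrable setT (fun w => Phi (path_code X B w)).
  apply/integrableP; split => //; apply: le_lt_trans fin.
  rewrite le_eqVlt; apply/orP; left; apply/eqP.
  by apply: eq_integral => w _; rewrite gee0_abs// E.
have [N [mN N0 sub]] := integrable_ae measurableT IP.
exists N; split => // w /= nw; apply: sub => /= fw; apply: nw.
have {fw} fw := fw Logic.I.
rewrite (_ : (\int[mu]_(u in _) _)%E = \int[mu]_(u in `[0%R, T%:R]) (lw (coded true (path_code X B w) u))%:E)%E; last first.
  apply: eq_integral => u; rewrite inE /= in_itv /= => /andP[u0 _].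
  by have [-> _] := coded_path_code X_cont B_cont w u0.
have mc := measurable_coded_time (R := R) true (path_code X B w).
apply: (@le_lt_trans _ _ (\int[mu]_(u in `[0%R, T%:R]) (cst 1%E u + f (coded true (path_code X B w) u)))%E).
  have mg : measurable_fun (`[0, T%:R]%classic : set R) (fun u : R => (cst 1%E u + f (coded true (path_code X B w) u))%E).
    by apply: emeasurable_funD => //; apply: measurable_funTS; exact: (measurableT_comp mf mc).
  have ml : measurable_fun (`[0, T%:R]%classic : set R) (fun u : R => (lw (coded true (path_code X B w) u))%:E).
    by apply/measurable_EFinP; apply: measurable_funTS; exact: (measurableT_comp mlw mc).
  have g0 (u : R) : (0 <= cst 1%E u + f (coded true (path_code X B w) u))%E by rewrite adde_ge0.
  have l0 (u : R) : (0 <= (lw (coded true (path_code X B w) u))%:E)%E by rewrite lee_fin lip_weight_ge0.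
  apply: ge0_le_integral => // u _; rewrite /f /= -EFinD lee_fin; set z := lw _.
  have z0 : 0 <= z by exact: lip_weight_ge0.
  case: (leP z 1) => z1; first by rewrite (le_trans z1)// lerDl powR_ge0.
  rewrite (@le_trans _ _ (z `^ gamma))//; last by rewrite lerDr.
  by rewrite -{1}(powRr1 z0) ler_powR// ltW.
rewrite ge0_integralD//; last by apply: measurable_funTS; exact: (measurableT_comp mf mc).
rewrite integral_cst// lte_add_pinfty//.
  rewrite mul1e; have E1 := lebesgue_measure_itv `[0%R, (T%:R : R)].
  refine (@eq_ind_r _ _ (fun z => (z < +oo)%E) _ _ E1).
  by rewrite /=; case: ifP => _; rewrite ?sube0 ltry.
by move: fw; rewrite fin_numElt => /andP[].
Qed.

End good_paths.


(** * Conditional laws and the assembly of the proof *)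

Section kernel_value.
Context {R : realType} {d1 d2} {A : measurableType d1} {T : measurableType d2}.
Variables (k : R.-pker A ~> T) (s : A).

(** A name for the measure [k s], to which the structure of a probability can be attached. *)
Definition kernel_value : set T -> \bar R := k s.
HB.instance Definition _ := Measure.on kernel_value.
HB.instance Definition _ := Measure_isProbability.Build _ _ _ kernel_value (@prob_kernel _ _ _ _ _ k s).

End kernel_value.

Theorem theorem3p2 (R : realType) (d : nat) (d_gt0 : (0 < d)%N)
  (S : set 'rV[R]_d) (S_dom : admissible_domain S)
  (o : 'rV[R]_d) (o_S : S o)
  (l : cfg R d -> seqE R d) (l_label : label S l)
  (H Ssde : set (cfg R d))
  (H_borel : measurable (H : set (cfgM S)))
  (Ssde_borel : measurable (Ssde : set (cfgM S)))
  (H_sub : H `<=` Ssde) (Ssde_sub : Ssde `<=` config_infinite S)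
  (sigma : 'rV[R]_d -> cfg R d -> 'M[R]_d)
  (b : 'rV[R]_d -> cfg R d -> 'rV[R]_d)
  (sigma_borel : borel_coef S Ssde sigma) (b_borel : borel_coef S Ssde b)
  (a : nat -> nat -> nat) (a_tame : tame_seq a)
  (dO : measure_display) (Omega : measurableType dO) (P : probability Omega R)
  (F : R -> set (set Omega)) (F_filtration : is_filtration F)
  (X B : R -> Omega -> seqE R d)
  (XB_solution : isde_weak_solution sigma b Ssde S l H P F X B)
  (Ps : R.-pker (borel (seqE R d)) ~> Omega)
  (Ps_cond : regular_conditional P (X 0 : Omega -> borel (seqE R d)) Ps)
  (Ft : forall m p q r T : nat, 'M[R]_(m, d) -> cfg R d -> R)
  (Ft_borel : forall m p q r T : nat, (0 < m)%N ->
     (0 < p)%N -> (0 < q)%N -> (0 < r)%N -> (0 < T)%N ->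
     measurable_fun
       [set xs : borel 'M[R]_(m, d) * cfgM S |
          (forall i, S (row i (xs.1 : 'M[R]_(m, d)))) /\ config S xs.2]
       (fun xs => Ft m p q r T xs.1 xs.2))
  (non_exit : forall m : nat, (0 < m)%N ->
     {ae P, forall w,
        lim_exit_time S a (fun t => (firstm m (X t w), env X m t w)) = +oo%E})
  (Hall_sde : forall m : nat, (0 < m)%N ->
     forall xs : 'M[R]_(m, d) * cfg R d, Hall S a xs ->
       Ssde (cfg_add (unlabelm xs.1) xs.2))
  (lipschitz : forall m p q r T : nat, (0 < m)%N ->
     (0 < p)%N -> (0 < q)%N -> (0 < r)%N -> (0 < T)%N ->
     {ae P, forall w, forall (t : R) (x y : 'M[R]_(m, d)), 0 <= t <= T%:R ->
        Hopen S a p q r (x, env X m t w) -> Hopen S a p q r (y, env X m t w) ->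
        simn S a p q r (env X m t w) x y ->
        fam_norm (fun i =>
            coefm sigma x (env X m t w) i - coefm sigma y (env X m t w) i)
          <= enorm (x - y) * Ft m p q r T x (env X m t w)} /\
     {ae P, forall w, forall (t : R) (x y : 'M[R]_(m, d)), 0 <= t <= T%:R ->
        Hopen S a p q r (x, env X m t w) -> Hopen S a p q r (y, env X m t w) ->
        simn S a p q r (env X m t w) x y ->
        fam_norm (fun i =>
            coefm b x (env X m t w) i - coefm b y (env X m t w) i)
          <= enorm (x - y) * Ft m p q r T x (env X m t w)})
  (sigma_constant : forall m : nat, (0 < m)%N ->
     exists c : 'I_m -> 'M[R]_d,
       forall (y : 'M[R]_(m, d)) (s : cfg R d), extend S Ssde (y, s) ->
         coefm sigma y s = c)
  (moment : forall m p q r T : nat, (0 < m)%N ->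
     (0 < p)%N -> (0 < q)%N -> (0 < r)%N -> (0 < T)%N ->
     exists2 gamma : R, 1 < gamma &
       (\int[P]_w \int[lebesgue_measure]_(t in `[0%R, T%:R])
          (\1_(Hopen S a p q r) (firstm m (X t w), env X m t w) *
           `|Ft m p q r T (firstm m (X t w)) (env X m t w)| `^ gamma)%R%:E
         < +oo)%E) :
  IFC sigma b Ssde P F X B o Ps.
Proof.
have clS : closed S by case: S_dom.
have [aX cX BB mom stateX _ eqX] := XB_solution.
have [aB cB B00 _] := BB.
have mX u j k : 0 <= u -> measurable_fun setT (fun w => X u w j 0 k) by exact: adapted_measurable F_filtration X u j k aX.
have mB u j k : 0 <= u -> measurable_fun setT (fun w => B u w j 0 k) by exact: adapted_measurable F_filtration B u j k aB.
have mX0 : measurable_fun setT (X 0 : Omega -> borel (seqE R d)).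
  by move=> _ U mU; rewrite setTI; apply: (F_filtration.1 0 (lexx 0)).2; exact: (aX 0 (lexx 0) U mU).
have cylF (i : nat) L e : F (dyad e) (past_cyl (fun t w => B t w i) L (dyad e)).
  apply: past_cyl_in; first by case: (F_filtration.1 _ (dyad_ge0 e)).
  move=> v k v0 ve; apply: measurable_wrtS (adapted_wrt F_filtration i k aB v0).
  exact: F_filtration.2.
have mray (q : rat) : measurable (`]ratr q, +oo[%classic : set R) by exact: measurable_itv.
have indepP (i : nat) e e' k L q : dyad e < dyad e' :> R ->
    P (past_cyl (fun t w => B t w i) L (dyad e) `&` (fun w => B (dyad e') w i 0 k - B (dyad e) w i 0 k) @^-1` `]ratr q, +oo[) =
    (P (past_cyl (fun t w => B t w i) L (dyad e)) * normal_prob 0 (Num.sqrt (dyad e' - dyad e)) `]ratr q, +oo[%classic)%E.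
  by move=> ee; exact: (brownian_coord BB i k (dyad_ge0 e) ee (cylF i L e) (mray q)).
have Hstate : {ae P, forall w, forall t : R, 0 <= t -> Ssde (unlabel predT (X t w))}.
  by apply: filterS stateX => w h t t0; case: (h t t0).
apply: (@law_aeP _ _ _ _ _ P (X 0 : Omega -> borel (seqE R d))).
apply: (law_ae_forall mX0) => m.
case: (posnP m) => [->|m0]; first exact: law_aeT.
have [c Hc] := sigma_constant m m0.
have hS := Hall_sde m m0.
pose Ftm p q r T := Ft m p q r T.
have mFtm p q r T : (0 < p)%N -> (0 < q)%N -> (0 < r)%N -> (0 < T)%N -> measurable_fun
       [set xs : borel 'M[R]_(m, d) * cfgM S |
          (forall i, S (row i (xs.1 : 'M[R]_(m, d)))) /\ config S xs.2]
       (fun xs => Ftm p q r T xs.1 xs.2) by move=> p0 q0 r0 T0; exact: Ft_borel.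
have sigX (x : seqE R d) (i : 'I_m) : Ssde (unlabel predT x) -> sigma (x i) (unlabel (but i) x) = c i.
  move=> Sx; have := Hc _ _ (Ssde_extend clS m Ssde_sub Sx) => /(congr1 (fun f => f i)) <-.
  by rewrite /coefm cfg_add_env_but row_firstm.
(* Proved under [P], where [B] is a Brownian motion for [F], and transferred to the conditional laws
   as an almost sure event. *)
have Hgood : {ae P, forall w, good_path S a Ssde b Ftm c X B w}.
  have H2 : {ae P, forall w, forall (i : 'I_m) e, X (dyad e) w i - X 0 w i = (B (dyad e) w i - B 0 w i) *m (c i)^T +
        \row_k (\int[lebesgue_measure]_(u in `[0, dyad e]) drift b (X u w) i k)%R}.
    apply: ae_all => i.
    have mBi (v : R) k : 0 <= v -> measurable_fun setT (fun w => B v w i 0 k) by exact: mB.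
    apply: (ito_equation_constant cB mBi (indepP i) _ (eqX i)).
    by apply: filterS Hstate => w h t t0; exact: sigX (h t t0).
  have H3 : {ae P, forall w, forall (i : 'I_m) k (T : R), 0 <= T -> lebesgue_measure.-integrable `[0, T] (fun u => (drift b (X u w) i k)%:E)}.
    by apply: ae_all => i; have [h _] := eqX i; apply: filterS h => w h k T T0; have [_] := h T T0; exact.
  have H5 : {ae P, forall w, forall pqrT : nat * nat * nat * nat, (0 < pqrT.1.1.1)%N -> (0 < pqrT.1.1.2)%N -> (0 < pqrT.1.2)%N -> (0 < pqrT.2)%N ->
     (\int[lebesgue_measure]_(u in `[0%R, pqrT.2%:R]) (lip_weight S a (Ftm pqrT.1.1.1 pqrT.1.1.2 pqrT.1.2 pqrT.2) pqrT.1.1.1 pqrT.1.1.2 pqrT.1.2 (X u w))%:E < +oo)%E}.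
    apply: ae_all => -[[[p q] r] T] /=.
    have [p0|p0] := posnP p; first by apply: aeW => w; rewrite p0.
    have [q0|q0] := posnP q; first by apply: aeW => w; rewrite q0.
    have [r0|r0] := posnP r; first by apply: aeW => w; rewrite r0.
    have [T0|T0] := posnP T; first by apply: aeW => w; rewrite T0.
    have [gamma g1 fin] := moment m p q r T m0 p0 q0 r0 T0.
    by apply: filterS (moment_finite clS mFtm cX cB p0 q0 r0 T0 g1 mX mB fin) => w h _ _ _ _.
  apply: filterS3 Hstate H2 (filterI H3 (filterI (non_exit m m0) H5)) => w h1 h2 [h3 [h4 h5]].
  split => //.
    by move=> T T0; exact: lim_exit_timeP T0 h4.
  by move=> p q r T; exact: (h5 (p, q, r, T)).
have Hlip : {ae P, forall w, forall pqrT : nat * nat * nat * nat, (0 < pqrT.1.1.1)%N -> (0 < pqrT.1.1.2)%N -> (0 < pqrT.1.2)%N -> (0 < pqrT.2)%N ->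
  forall (u : R) (x y : 'M[R]_(m, d)), 0 <= u <= pqrT.2%:R ->
  Hopen S a pqrT.1.1.1 pqrT.1.1.2 pqrT.1.2 (x, unlabel (from m) (X u w)) -> Hopen S a pqrT.1.1.1 pqrT.1.1.2 pqrT.1.2 (y, unlabel (from m) (X u w)) ->
  simn S a pqrT.1.1.1 pqrT.1.1.2 pqrT.1.2 (unlabel (from m) (X u w)) x y ->
  fam_norm (fun i => coefm b x (unlabel (from m) (X u w)) i - coefm b y (unlabel (from m) (X u w)) i)
  <= enorm (x - y) * Ftm pqrT.1.1.1 pqrT.1.1.2 pqrT.1.2 pqrT.2 x (unlabel (from m) (X u w))}.
  apply: ae_all => -[[[p q] r] T] /=.
  have [p0|p0] := posnP p; first by apply: aeW => w; rewrite p0.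
  have [q0|q0] := posnP q; first by apply: aeW => w; rewrite q0.
  have [r0|r0] := posnP r; first by apply: aeW => w; rewrite r0.
  have [T0|T0] := posnP T; first by apply: aeW => w; rewrite T0.
  by have [_ h] := lipschitz m p q r T m0 p0 q0 r0 T0; apply: filterS h => w h _ _ _ _.
have Hsig : {ae P, forall w, forall (i : 'I_m) (T : R), 0 <= T ->
   (\int[lebesgue_measure]_(t in `[0%R, T]) ((enorm (sigma (X t w i) (unlabel (but i) (X t w))) ^+ 2)%R)%:E < +oo)%E}.
  by apply: ae_all => i; have [h _] := eqX i; apply: filterS h => w h T T0; have [] := h T T0.
pose All w := [/\ good_path S a Ssde b Ftm c X B w, (forall i : nat, B 0 w i = 0),
  (forall pqrT : nat * nat * nat * nat, (0 < pqrT.1.1.1)%N -> (0 < pqrT.1.1.2)%N -> (0 < pqrT.1.2)%N -> (0 < pqrT.2)%N ->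
  forall (u : R) (x y : 'M[R]_(m, d)), 0 <= u <= pqrT.2%:R ->
  Hopen S a pqrT.1.1.1 pqrT.1.1.2 pqrT.1.2 (x, unlabel (from m) (X u w)) -> Hopen S a pqrT.1.1.1 pqrT.1.1.2 pqrT.1.2 (y, unlabel (from m) (X u w)) ->
  simn S a pqrT.1.1.1 pqrT.1.1.2 pqrT.1.2 (unlabel (from m) (X u w)) x y ->
  fam_norm (fun i => coefm b x (unlabel (from m) (X u w)) i - coefm b y (unlabel (from m) (X u w)) i)
  <= enorm (x - y) * Ftm pqrT.1.1.1 pqrT.1.1.2 pqrT.1.2 pqrT.2 x (unlabel (from m) (X u w))) &
  forall (i : 'I_m) (T : R), 0 <= T ->
   (\int[lebesgue_measure]_(t in `[0%R, T]) ((enorm (sigma (X t w i) (unlabel (but i) (X t w))) ^+ 2)%R)%:E < +oo)%E].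
have HAll : {ae P, forall w, All w}.
  by apply: filterS3 Hgood B00 (filterI Hlip Hsig) => w h1 h2 [h3 h4]; split.
have mA0 : forall C : set (borel (seqE R d)), measurable C -> measurable (X 0 @^-1` C : set Omega).
  by move=> C mC; have := mX0 measurableT C mC; rewrite setTI.
(* All data are countable: particle, two dyadic times, coordinate, list of a cylinder and rational
   ray. *)
have L2 : law_ae P (X 0 : Omega -> borel (seqE R d)) (fun s => forall ix : nat * (nat * nat) * (nat * nat) * 'I_d * seq (nat * nat * 'I_d * rat) * rat,
    let: (i, e, e', k, L, q) := ix in dyad e < dyad e' :> R ->
    Ps s (past_cyl (fun t w => B t w i) L (dyad e) `&` (fun w => B (dyad e') w i 0 k - B (dyad e) w i 0 k) @^-1` `]ratr q, +oo[) =
    (Ps s (past_cyl (fun t w => B t w i) L (dyad e)) * normal_prob 0 (Num.sqrt (dyad e' - dyad e)) `]ratr q, +oo[%classic)%E).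
  apply: (law_ae_forall mX0) => -[[[[[i e] e'] k] L] q].
  case: (ltP (dyad e : R) (dyad e')) => ee; last by apply: law_aeT.
  set nq := normal_prob _ _ _.
  have nq01 : (0 <= nq <= 1)%E by rewrite measure_ge0 probability_le1.
  have nqf : nq \is a fin_num by exact: fin_num_measure.
  have mcyl : measurable (past_cyl (fun t w => B t w i) L (dyad e)) by apply: (F_filtration.1 _ (dyad_ge0 e)).2.
  have minc : measurable ((fun w => B (dyad e') w i 0 k - B (dyad e) w i 0 k) @^-1` `]ratr q, +oo[).
    rewrite -[X in measurable X]setTI.
    have mD : measurable_fun setT (fun w => B (dyad e') w i 0 k - B (dyad e) w i 0 k).
      by apply: measurable_funB; apply: mB; exact: dyad_ge0.
    exact: mD.
  have fq : (fine nq)%:E = nq by rewrite fineK.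
  have h0 : law_ae P (X 0 : Omega -> borel (seqE R d)) (fun s => Ps s (past_cyl (fun t w => B t w i) L (dyad e) `&` (fun w => B (dyad e') w i 0 k - B (dyad e) w i 0 k) @^-1` `]ratr q, +oo[) =
      (Ps s (past_cyl (fun t w => B t w i) L (dyad e)) * (fine nq)%:E)%E).
    apply: (law_ae_indep mX0 Ps_cond mcyl minc) => [|C mC]; first by rewrite -!lee_fin fq.
    (* The event on [X 0] belongs to [F 0], so it joins the cylinder in the past of the
       increment. *)
    rewrite fq setIAC; apply: (brownian_coord BB i k (dyad_ge0 e) ee _ (mray q)).
    have [s1 s2 s3] := (F_filtration.1 _ (dyad_ge0 e)).1.
    have FI U V : F (dyad e) U -> F (dyad e) V -> F (dyad e) (U `&` V).
      move=> FU FV; have -> : U `&` V = setT `\` \bigcup_n (if n is 0%N then setT `\` U else setT `\` V).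
        apply/seteqP; split => x; first by move=> [xU xV]; split => // -[[|n] _ [_ h]]; exact: h.
        move=> [_ h]; split; apply: contrapT => h'; apply: h; [exists 0%N|exists 1%N] => //; by split.
      by apply: (s2); apply: (s3) => -[|n]; apply: (s2).
    apply: FI; first exact: cylF.
    have F0C := aX 0 (lexx 0) C mC.
    exact: (F_filtration.2 0 (dyad e) (lexx 0) (dyad_ge0 e) _ F0C).
  by apply: law_aeS h0 => s + _; rewrite fq.
(* Rational half-spaces and their complements: countably many conditions that pin [X 0] to [s]. *)
have L3 : law_ae P (X 0 : Omega -> borel (seqE R d)) (fun s => forall ix : nat * 'I_d * rat * bool,
    let C := (if ix.2 then [set x : borel (seqE R d) | ratr ix.1.2 < (x : seqE R d) ix.1.1.1 0 ix.1.1.2]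
       else ~` [set x : borel (seqE R d) | ratr ix.1.2 < (x : seqE R d) ix.1.1.1 0 ix.1.1.2]) in
    C s -> Ps s (X 0 @^-1` (~` C)) = 0%E).
  apply: (law_ae_forall mX0) => -[[[i k] q] z] /=.
  have mC : measurable [set x : borel (seqE R d) | ratr q < (x : seqE R d) i 0 k].
    have := @measurable_seq_coord R d i k measurableT _ (mray q).
    by rewrite setTI; congr measurable; apply/seteqP; split => x /=; rewrite in_itv /= andbT.
  by apply: (law_ae_start mX0 Ps_cond); case: z => //; exact: measurableC.
apply: law_aeS (law_ae_and mX0 (law_ae_ae mX0 Ps_cond HAll) (law_ae_and mX0 L2 L3)) => s [sAll [sind sstart]] _.
pose Q : probability Omega R := kernel_value Ps s.
change (unique_strong_solution sigma b Ssde Q F X B m s o).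
have {}sAll : {ae Q, forall w, All w} by exact: sAll.
have X0s : {ae Q, forall w, X 0 w = s}.
  have hX : {ae Q, forall w, forall ix : nat * 'I_d * rat, (ratr ix.2 < X 0 w ix.1.1 0 ix.1.2) = (ratr ix.2 < s ix.1.1 0 ix.1.2)}.
    apply: ae_all => -[[i k] q] /=.
    have mC : measurable [set x : borel (seqE R d) | ratr q < (x : seqE R d) i 0 k].
      have := @measurable_seq_coord R d i k measurableT _ (mray q).
      by rewrite setTI; congr measurable; apply/seteqP; split => x /=; rewrite in_itv /= andbT.
    case: (boolP (ratr q < s i 0 k)) => h.
      exists (X 0 @^-1` (~` [set x : borel (seqE R d) | ratr q < (x : seqE R d) i 0 k])); split.
      - by apply: mA0; exact: measurableC.
      - exact: (sstart (i, k, q, true) h).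
      - by move=> w /= nw h'; apply: nw.
    exists (X 0 @^-1` (~` ~` [set x : borel (seqE R d) | ratr q < (x : seqE R d) i 0 k])); split.
    - by apply: mA0; rewrite setCK.
    - by apply: (sstart (i, k, q, false)) => h'; move/negP: h; apply.
    - by move=> w /= nw nh; apply: nw; apply/negbTE/negP.
  apply: filterS hX => w h; apply/funext => i; apply/rowP => k; apply/eqP; rewrite eq_le !leNgt.
  apply/andP; split; apply/negP => /rat_in_itvoo[q]; rewrite in_itv /= => /andP[h1 h2].
    by have := h (i, k, q); rewrite /= h2 => /esym; rewrite ltNge (ltW h1).
  by have := h (i, k, q); rewrite /= h2 ltNge (ltW h1).
have indepQ (i : nat) e e' k L q : dyad e < dyad e' :> R ->
    Q (past_cyl (fun t w => B t w i) L (dyad e) `&` (fun w => B (dyad e') w i 0 k - B (dyad e) w i 0 k) @^-1` `]ratr q, +oo[) =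
    (Q (past_cyl (fun t w => B t w i) L (dyad e)) * normal_prob 0 (Num.sqrt (dyad e' - dyad e)) `]ratr q, +oo[%classic)%E.
  exact: (sind (i, e, e', k, L, q)).
have B0Q : {ae Q, forall w, forall i : nat, B 0 w i = 0} by apply: filterS sAll => w [].
have lipQ : {ae Q, forall w, forall p q r T : nat, (0 < p)%N -> (0 < q)%N -> (0 < r)%N -> (0 < T)%N ->
  forall (u : R) (x y : 'M[R]_(m, d)), 0 <= u <= T%:R ->
  Hopen S a p q r (x, unlabel (from m) (X u w)) -> Hopen S a p q r (y, unlabel (from m) (X u w)) ->
  simn S a p q r (unlabel (from m) (X u w)) x y ->
  fam_norm (fun i => coefm b x (unlabel (from m) (X u w)) i - coefm b y (unlabel (from m) (X u w)) i)
  <= enorm (x - y) * Ftm p q r T x (unlabel (from m) (X u w))}.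
  by apply: filterS sAll => w [_ _ h _] p q r T; exact: (h (p, q, r, T)).
have GamQ : {ae Q, forall w, forall e,
  Gam S a b (fun p q r => Ftm p q r (Num.truncn (dyad e : R)).+1) c s (dyad e) (path_code X B w)}.
  apply: filterS2 sAll X0s => w [gw B0w _ _] X0w.
  by apply: (good_Gam clS Ssde_borel Ssde_sub b_borel hS mFtm cX cB gw B0w) => i; rewrite X0w.
have /choice[C HC] : forall e : (nat * nat) * 'I_m * 'I_d * rat, exists C : set ({compact-open, @time R -> 'M[R]_(m, d)} * {compact-open, @time R -> seqE R d}),
   observable o X B (dyad_time e.1.1.1) C /\ {ae Q, forall w, C (input X B m o w) <-> ratr e.2 < X (dyad e.1.1.1) w e.1.1.2 0 e.1.2}.
  move=> [[[e i] k] r] /=.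
  by have [C C1 C2] := output_event clS Ssde_borel b_borel hS mFtm o cX cB mX mB B0Q lipQ GamQ e i k r; exists C.
have Cobs e : observable o X B (dyad_time e.1.1.1) (C e) by case: (HC e).
have Cae : {ae Q, forall w, forall e, C e (input X B m o w) <-> ratr e.2 < X (dyad e.1.1.1) w e.1.1.2 0 e.1.2}.
  by apply: ae_all => e; case: (HC e).
have rep := strong_map_represents cX cB Cae.
have func := strong_map_functional cX cB mB Cobs Cae.
exists (strong_map C); split; last first.
  (* Any weak solution coincides with the first [m] particles of [X] by [good_unique], and these are
     represented by the functional. *)
  move=> Y [aY cY eqY SY Y0].
  have extY w t : Ssde (cfg_add (unlabelm (Y t w)) (env X m t w)) -> extend S Ssde (Y t w, env X m t w).
    rewrite /env; have [x' [<- <-]] := glue_path (Y t w) (X t w); rewrite cfg_add_env.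
    exact: (Ssde_extend clS m Ssde_sub).
  have eqYd : {ae Q, forall w, forall (i : 'I_m) e, row i (Y (dyad e) w) - row i (Y 0 w) = (B (dyad e) w i - B 0 w i) *m (c i)^T +
        \row_k (\int[lebesgue_measure]_(u in `[0, dyad e]) coefm b (Y u w) (unlabel (from m) (X u w)) i 0 k)%R}.
    apply: ae_all => i.
    have mBi (v : R) k : 0 <= v -> measurable_fun setT (fun w => B v w i 0 k) by exact: mB.
    apply: (ito_equation_constant cB mBi (indepQ i) _ (eqY i)).
    by apply: filterS SY => w h t t0; rewrite (Hc _ _ (extY w t (h t t0))).
  have IY : {ae Q, forall w, forall (i : 'I_m) k (T : R), 0 <= T -> lebesgue_measure.-integrable `[0, T] (fun u => (coefm b (Y u w) (unlabel (from m) (X u w)) i 0 k)%:E)}.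
    by apply: ae_all => i; have [h _] := eqY i; apply: filterS h => w h k T T0; have [_] := h T T0; exact.
  have YX : {ae Q, forall w, forall u : R, 0 <= u -> Y u w = firstm m (X u w)}.
    apply: filterS3 (filterI sAll X0s) (filterI lipQ Y0) (filterI SY (filterI eqYd IY)) => w [[gw _ _ _] X0w] [lw Y0w] [Sw [ew Iw]].
    apply: (good_unique clS Ssde_sub mFtm cX cB gw lw _ Y0w _ Sw Iw ew); first by move=> i; rewrite X0w.
    move=> i k T; apply: (@path_within R dO Omega _ Y w (fun y : 'M[R]_(m, d) => y i k) T cY).
    exact: coord_continuous.
  apply: filterS2 YX rep => w h <-; apply/funext => t; rewrite /path_of h//; exact: time_ge0.
(* The first [m] particles of [X] are the required weak solution; [ito_integral_constant] supplies
   its stochastic integral under the conditional law. *)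
exists (fun t w => firstm m (X t w)); split => //.
have HcX (i : 'I_m) : {ae Q, forall w, forall t : R, 0 <= t -> coefm sigma (firstm m (X t w)) (env X m t w) i = c i}.
  by apply: filterS sAll => w [[h _ _ _ _] _ _ _] t t0; rewrite (Hc _ _ (Ssde_extend clS m Ssde_sub (h t t0))).
have cbE w (u : R) (i : 'I_m) k : coefm b (firstm m (X u w)) (env X m u w) i 0 k = drift b (X u w) i k.
  by rewrite /coefm /env cfg_add_env_but row_firstm.
split.
- move=> t t0 U mU; have mf : measurable_fun [set: borel (seqE R d)] (fun x : borel (seqE R d) => firstm m (x : seqE R d) : borel 'M[R]_(m, d)).
    apply: measurable_fun_borel_matrix => i k.
    by have := @measurable_seq_coord R d i k; apply: eq_measurable_fun => x _; rewrite mxE.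
  have := mf measurableT U mU; rewrite setTI => mpre; exact: (aX t t0 _ mpre).
- move=> w t; have ft := nbhs_filter t; apply: (cvg_matrix (FF := ft)) => i k.
  rewrite [X in _ --> X]mxE (_ : (fun u => _) = (fun u : @time R => X (set_val u) w i 0 k)); last first.
    by apply/funext => u; rewrite mxE.
  exact: (cvg_comp _ _ (cX w t) (@continuous_coord R d i k _)).
- move=> i; split.
    apply: filterS sAll => w [[_ _ h3 _ _] _ _ h] T T0; split.
      have := h i T T0; apply: le_lt_trans; rewrite le_eqVlt; apply/orP; left; apply/eqP.
      by apply: eq_integral => u _; rewrite /coefm /env cfg_add_env_but row_firstm.
    move=> k; have := h3 i k T T0; rewrite (_ : (fun u => _) = (fun u => (coefm b (firstm m (X u w)) (env X m u w) i 0 k)%:E))//.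
    by apply/funext => u; rewrite cbE.
  exists (fun t w => (B t w i - B 0 w i) *m (c i)^T); split; first exact: ito_integral_constant (HcX i).
  apply: filterS sAll => w [gw _ _ _] t t0; rewrite !row_firstm (good_equation cX cB gw i t0).
  congr (_ + _); apply/rowP => k; rewrite !mxE; congr (Rintegral _ _ _).
  by apply/funext => u; rewrite cbE.
- by apply: filterS sAll => w [[h _ _ _ _] _ _ _] t t0; rewrite /env cfg_add_env; exact: h.
- by apply: filterS X0s => w ->.
Qed.
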